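(* Let $\beta\in(-1,1)\setminus\{0\}$. There is $\eta_0>0$ such that for every $0<\eta<\eta_0$ and all real-valued data $(\phi_0,\phi_1)$ with $$\Vert(\phi_0,\phi_1)-(B,B_t)(\cdot\,;\beta,0,0)\Vert_{H^1\times L^2}<\eta,$$ the following holds. Let $x_1,x_2$ be the initial modulation shifts of $(\phi_0,\phi_1)$ and $(z_0,w_0):=(\phi_0,\phi_1)-(B,B_t)(\cdot\,;\beta,x_1,x_2)$. Then there are $(u_0,s_0,\delta)$ and $(y_0,v_0,\tilde\delta)$, small and each unique in a neighborhood of the origin in $H^1(\mathbb R;\mathbb C)\times L^2(\mathbb R;\mathbb C)\times\mathbb C$, such that $$\mathcal F(B+z_0,\,B_t+w_0,\,K+u_0,\,K_t+s_0,\,\beta+i\alpha+\delta)=(0,0),$$ $$\mathcal F(K+u_0,\,K_t+s_0,\,y_0,\,v_0,\,\beta-i\alpha+\tilde\delta)=(0,0),$$ where $B,B_t,K,K_t$ are evaluated at $(\cdot\,;\beta,x_1,x_2)$, and the functions $(y_0,v_0)\in H^1\times L^2$ so obtained are necessarily real-valued, even if $(u_0,s_0)$ are not.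
   Context: $\alpha:=\sqrt{1-\beta^2}$. Breather profile: $$B(x;\beta,x_1,x_2)=4\arctan\Big(\frac{\beta}{\alpha}\frac{\sin(\alpha x_1)}{\cosh(\beta(x+x_2))}\Big),\qquad B_t(x;\beta,x_1,x_2)=\frac{4\alpha^2\beta\cos(\alpha x_1)\cosh(\beta(x+x_2))}{\alpha^2\cosh^2(\beta(x+x_2))+\beta^2\sin^2(\alpha x_1)}.$$ Complex-valued kink profile (defined for $x_1\notin\frac{\pi}{\alpha}(\frac12+\mathbb Z)$): $$K(x;\beta,x_1,x_2)=4\arctan\big(e^{\beta(x+x_2)+i\alpha x_1}\big),\qquad K_t(x;\beta,x_1,x_2)=\frac{4i\alpha e^{\beta(x+x_2)+i\alpha x_1}}{1+e^{2(\beta(x+x_2)+i\alpha x_1)}},$$ where $\arctan$ is analytic on $\mathbb C\setminus((-i\infty,-i]\cup[i,i\infty))$. The subscript $t$ in $B_t,K_t$ is part of the name. Bäcklund functional: $\mathcal F=(\mathcal F_1,\mathcal F_2)$ with $$\mathcal F_1(\varphi_0,\varphi_1,\phi_0,\phi_1,a)=\varphi_{0,x}-\phi_1-\tfrac1a\sin\big(\tfrac{\varphi_0+\phi_0}{2}\big)-a\sin\big(\tfrac{\varphi_0-\phi_0}{2}\big),$$ $$\mathcal F_2(\varphi_0,\varphi_1,\phi_0,\phi_1,a)=\varphi_1-\phi_{0,x}-\tfrac1a\sin\big(\tfrac{\varphi_0+\phi_0}{2}\big)+a\sin\big(\tfrac{\varphi_0-\phi_0}{2}\big).$$ Initial modulation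 shifts: for $\eta_0$ small, these are the unique $(x_1,x_2)$ near $(0,0)$, of size $O(\eta)$, such that $(z_0,w_0)=(\phi_0,\phi_1)-(B,B_t)(\cdot\,;\beta,x_1,x_2)$ satisfies $$\int_{\mathbb R}\big(z_0\,\partial_{x_j}B+w_0\,\partial_{x_j}B_t\big)\,dx=0,\qquad j=1,2$$ (with $B,B_t$ evaluated at $(x;\beta,x_1,x_2)$); in particular $\Vert(z_0,w_0)\Vert_{H^1\times L^2}\lesssim\eta$ and $x_1\notin\frac{\pi}{\alpha}(\frac12+\mathbb Z)$ for $\eta_0$ small. *)

(* Defs.v *)
From HB Require Import structures.
From mathcomp Require Import all_boot all_order all_algebra.
From mathcomp Require Import all_classical all_reals all_analysis.

Set Implicit Arguments.
Unset Strict Implicit.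
Unset Printing Implicit Defensive.

Import Order.TTheory GRing.Theory Num.Theory.
Import numFieldNormedType.Exports.
From mathcomp Require Import complex.

Local Open Scope classical_set_scope.
Local Open Scope ring_scope.
Local Open Scope complex_scope.

Section ComplexFunctions.
Variable R : realType.
Local Notation I := ((0 : R) +i* 1).
Local Notation normc := (@Normc.normc R).

Definition cexp (z : R[i]) : R[i] :=
  (expR (Re z) * cos (Im z)) +i* (expR (Re z) * sin (Im z)).

Definition csin (z : R[i]) : R[i] :=
  (cexp (I * z) - cexp (- (I * z))) / (2%:R * I).

(* Principal branches, meaningful for z outside ]-oo, 0]; the half-angle
   formula gives arg z in ]-pi, pi[. *)
Definition carg (z : R[i]) : R := 2 * atan (Im z / (normc z + Re z)).

Definition clog (z : R[i]) : R[i] := ln (normc z) +i* carg z.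

(* For z off ]-i oo, -i] and [i, i oo[, both 1 + i z and 1 - i z avoid
   ]-oo, 0], so this is the analytic branch of arctan there with
   arctan 0 = 0; only such values of z are relevant. *)
Definition carctan (z : R[i]) : R[i] :=
  (clog (1 + I * z) - clog (1 - I * z)) / (2%:R * I).

Definition toC (f : R -> R) : R -> R[i] := fun x => (f x)%:C.

End ComplexFunctions.

Section SobolevSpaces.
Variable R : realType.
Local Notation normc := (@Normc.normc R).
Local Notation mu := (@lebesgue_measure R).
Implicit Types (u v g : R -> R[i]).

(* Elements of L^2 and H^1 are represented by functions, to be identified when
   equal almost everywhere. *)
Definition aeq u v : Prop := {ae mu, forall x, u x = v x}.

Definition inL2 u : Prop :=
  [/\ measurable_fun [set: R] (fun x => Re (u x)),
      measurable_fun [set: R] (fun x => Im (u x)) &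
      ('N[mu]_2%:E [EFin \o (normc \o u)] < +oo)%E].

(* Finite part of the extended-real norm: only meaningful under [inL2 u]. *)
Definition L2norm u : R := fine 'N[mu]_2%:E [EFin \o (normc \o u)]%E.

Definition test_function (psi : R -> R) : Prop :=
  [/\ forall x, derivable psi x 1,
      continuous (derive1 psi) &
      exists M : R, forall x, M < `|x| -> psi x = 0].

(* Weak derivatives on the line are tested against C^1 functions with compact
   support, as in Brezis's definition of W^{1,p}(I). *)
Definition has_wderivR (f g : R -> R) : Prop :=
  [/\ locally_integrable [set: R] f,
      locally_integrable [set: R] g &
      forall psi, test_function psi ->
        \int[mu]_x (f x * derive1 psi x) = - \int[mu]_x (g x * psi x)].

Definition has_wderiv u g : Prop :=
  has_wderivR (fun x => Re (u x)) (fun x => Re (g x)) /\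
  has_wderivR (fun x => Im (u x)) (fun x => Im (g x)).

(* A chosen weak derivative (unique up to a.e. equality when it exists). *)
Definition wderiv u : R -> R[i] :=
  xget (fun=> 0) [set g | has_wderiv u g].

Definition inH1 u : Prop :=
  inL2 u /\ exists g, has_wderiv u g /\ inL2 g.

Definition inH1L2 u v : Prop := inH1 u /\ inL2 v.

Definition H1L2norm u v : R :=
  Num.sqrt (L2norm u ^+ 2 + L2norm (wderiv u) ^+ 2 + L2norm v ^+ 2).

(* Norm of H^1(R;C) x L^2(R;C) x C. *)
Definition H1L2Cnorm u v (d : R[i]) : R := H1L2norm u v + normc d.

(* (u, v, d) solves [eqn], has norm at most e, and is the only solution in the
   open ball of radius r of H^1(R;C) x L^2(R;C) x C. *)
Definition small_unique_solution
    (eqn : (R -> R[i]) -> (R -> R[i]) -> R[i] -> Prop) (e r : R)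
    u v (d : R[i]) : Prop :=
  [/\ inH1L2 u v, H1L2Cnorm u v d <= e, H1L2Cnorm u v d < r, eqn u v d &
      forall u' v' d', inH1L2 u' v' -> H1L2Cnorm u' v' d' < r ->
        eqn u' v' d' -> [/\ aeq u' u, aeq v' v & d' = d]].

End SobolevSpaces.

Section SineGordon.
Variable R : realType.
Local Notation I := ((0 : R) +i* 1).
Local Notation mu := (@lebesgue_measure R).
Implicit Types beta x : R.

Definition alpha beta : R := Num.sqrt (1 - beta ^+ 2).

Definition cosh (y : R) : R := (expR y + expR (- y)) / 2.

Definition breather beta (x1 x2 : R) x : R :=
  4 * atan (beta / alpha beta *
            (sin (alpha beta * x1) / cosh (beta * (x + x2)))).

Definition breather_t beta (x1 x2 : R) x : R :=
  4 * alpha beta ^+ 2 * beta * cos (alpha beta * x1) * cosh (beta * (x + x2)) /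
  (alpha beta ^+ 2 * cosh (beta * (x + x2)) ^+ 2 +
   beta ^+ 2 * sin (alpha beta * x1) ^+ 2).

Definition kink_phase beta (x1 x2 : R) x : R[i] :=
  (beta * (x + x2)) +i* (alpha beta * x1).

Definition kink beta (x1 x2 : R) x : R[i] :=
  4%:R * carctan (cexp (kink_phase beta x1 x2 x)).

Definition kink_t beta (x1 x2 : R) x : R[i] :=
  4%:R * I * (alpha beta)%:C * cexp (kink_phase beta x1 x2 x) /
  (1 + cexp (2%:R * kink_phase beta x1 x2 x)).

(* The values of x1 for which the kink profile avoids the cuts of arctan. *)
Definition kink_admissible beta (x1 : R) : Prop :=
  forall k : int, x1 <> pi / alpha beta * (1 / 2 + k%:~R).

Definition backlund1 (phi0 phi1 psi0 psi1 : R -> R[i]) (a : R[i])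
    : R -> R[i] := fun x =>
  wderiv phi0 x - psi1 x
  - a^-1 * csin ((phi0 x + psi0 x) / 2%:R)
  - a * csin ((phi0 x - psi0 x) / 2%:R).

Definition backlund2 (phi0 phi1 psi0 psi1 : R -> R[i]) (a : R[i])
    : R -> R[i] := fun x =>
  phi1 x - wderiv psi0 x
  - a^-1 * csin ((phi0 x + psi0 x) / 2%:R)
  + a * csin ((phi0 x - psi0 x) / 2%:R).

(* The Backlund functional takes the value (0, 0) in L^2 x L^2. *)
Definition backlund_zero (phi0 phi1 psi0 psi1 : R -> R[i]) (a : R[i]) : Prop :=
  aeq (backlund1 phi0 phi1 psi0 psi1 a) (fun=> 0) /\
  aeq (backlund2 phi0 phi1 psi0 psi1 a) (fun=> 0).

(* rem0 and rem1 are z_0 and w_0; at x1 = x2 = 0 they are the components of the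
   initial perturbation of the breather. *)
Definition rem0 beta (phi0 : R -> R) (x1 x2 : R) : R -> R :=
  fun x => phi0 x - breather beta x1 x2 x.

Definition rem1 beta (phi1 : R -> R) (x1 x2 : R) : R -> R :=
  fun x => phi1 x - breather_t beta x1 x2 x.

(* (x1, x2) lies in the open square of half-side rho and satisfies the two
   orthogonality conditions; the derivatives are in the first, respectively the
   second, shift. *)
Definition modulation_shift beta (phi0 phi1 : R -> R) (rho x1 x2 : R) : Prop :=
  [/\ `|x1| < rho, `|x2| < rho,
      \int[mu]_x
        (rem0 beta phi0 x1 x2 x
           * derive1 (fun s => breather beta s x2 x) x1 +
         rem1 beta phi1 x1 x2 x
           * derive1 (fun s => breather_t beta s x2 x) x1) = 0 &
      \int[mu]_x
        (rem0 beta phi0 x1 x2 x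
           * derive1 (fun s => breather beta x1 s x) x2 +
         rem1 beta phi1 x1 x2 x
           * derive1 (fun s => breather_t beta x1 s x) x2) = 0].

End SineGordon.

(* Main.v *)
Require Import Defs.
From HB Require Import structures.
From mathcomp Require Import all_boot all_order all_algebra.
From mathcomp Require Import all_classical all_reals all_analysis.
From mathcomp Require Import measurable_realfun ring lra.

Import Order.TTheory GRing.Theory Num.Theory.
Import numFieldNormedType.Exports.
From mathcomp Require Import complex.

Local Open Scope classical_set_scope.
Local Open Scope ring_scope.
Local Open Scope complex_scope.

Set Implicit Arguments.
Unset Strict Implicit.
Unset Printing Implicit Defensive.

(** Write [S x = sech (beta x)]. At zero shifts the breather vanishes, its time
    derivative is [4 beta S], and the kink is real: half of it is an angle with
    sine [S] and cosine [- tanh (beta x)] ([kink0]). The data, the shifted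
    breather and the shifted kink are all perturbations of this single explicit
    configuration, because changing the shifts moves the kink profiles by at
    most a constant times [S] times the size of the shifts
    ([kink_shift_bound]). Hence it is enough to linearize at zero shifts.

    Modulation. Once the remainders are expanded, the two orthogonality
    conditions are two equations in the shifts whose linear part at the origin
    is minus the Gram matrix of the derivatives of the breather pair in the
    shifts, namely [(4 beta S, 0)] and [(0, - 4 beta^2 S tanh)]. This matrix is
    diagonal and positive, and a quantitative inverse function theorem in two
    variables gives existence and uniqueness ([modulation]).

    One Backlund step. The first component of the functional gives the unknown
    time derivative algebraically, so a step amounts to its second component: an
    ordinary differential equation for the unknown field, with the parameter as
    an additional unknown. Its linearization is
    [q' = beta tanh (beta x) q + kappa d S + f], where the slope [kappa] in the
    parameter is [a^-2 - 1] in the first step and [a^-2 + 1] in the second, both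
    nonzero. The homogeneous solutions are multiples of [cosh (beta x)]; thus a
    bounded solution exists only if [kappa d S + f] integrates to zero against
    [S], which fixes the parameter [d], and the solution is then given by
    variation of constants and bounded in the sup norm by [f]
    ([bounded_solution_exists], [bounded_solution_bound]). The nonlinear
    remainder has a small Lipschitz constant ([bk_rem_lipschitz]), which yields
    uniqueness among small bounded solutions ([bk_unique]) and, by a
    contraction, existence ([bk_exists]); square integrability follows from an
    energy identity, since the coefficient [tanh] points away from the origin
    ([energy_estimate]). Passing between this equation and the weak formulation
    uses that a function with a weak derivative is almost everywhere a primitive
    of it ([has_wderivR_primitive]), and that its supremum is controlled by the
    Sobolev norm ([sup_le_n2]). The result is [backlund_step].

    The second step is solved explicitly. Let [psi] be the field obtained in the
    first step, with parameter [a = beta + i alpha + delta]. Permutability of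
    the transformations with parameters [a] and [conj a] suggests the field
    [phi0 - 4 arctan ((Re a / Im a) tanh (Im psi / 2))] with parameter [conj a].
    The identities [superposition_plus] and [superposition_minus] show that it
    solves the second equation and that the corresponding time derivative is
    real. It is small, so by uniqueness it is the solution of the second step,
    and this is why that solution is real although [psi] is not. *)

(** * Integrals over segments and primitives *)

Section IntervalIntegrals.
Context {R : realType}.
Local Notation mu := (@lebesgue_measure R).
Implicit Types (f g h u v : R -> R) (a b c x y : R).

Definition loc_int g :=
  measurable_fun [set: R] g /\
  forall a b, mu.-integrable `[a, b] (EFin \o g).

Definition iint a b g : R := \int[mu]_(x in `[a, b]) g x.

Lemma loc_int_le f g : measurable_fun [set: R] f ->
  (forall x, `|f x| <= `|g x|) -> loc_int g -> loc_int f.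
Proof.
move=> mf fg [mg ig]; split => // a b.
apply: (le_integrable _ _ _ (ig a b)) => //.
  by apply/measurable_EFinP; exact: measurable_funS mf.
by move=> x _ /=; rewrite lee_fin.
Qed.

Lemma loc_intD f g : loc_int f -> loc_int g -> loc_int (fun x => f x + g x).
Proof.
move=> [mf fi] [mg gi]; split; first exact: measurable_funD.
by move=> a b; apply: (integrableD _ (fi a b) (gi a b)).
Qed.

Lemma loc_intZ (k : R) f : loc_int f -> loc_int (fun x => k * f x).
Proof.
move=> [mf fi]; split; first exact: measurable_funM.
by move=> a b; apply: (integrableZl _ k (fi a b)).
Qed.

Lemma loc_intN f : loc_int f -> loc_int (fun x => - f x).
Proof.
move=> /(loc_intZ (-1)) fi; apply: loc_int_le (fi).
  by have := fi.1; under eq_fun do rewrite mulN1r.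
by move=> x; rewrite mulN1r.
Qed.

Lemma loc_intB f g : loc_int f -> loc_int g -> loc_int (fun x => f x - g x).
Proof. by move=> fi gi; apply: loc_intD => //; exact: loc_intN. Qed.

Lemma loc_int_norm f : loc_int f -> loc_int (fun x => `|f x|).
Proof.
move=> fi; apply: loc_int_le (fi); last by move=> x; rewrite normr_id.
by apply: measurableT_comp => //; exact: fi.1.
Qed.

Lemma continuous_bounded_itv f a b : continuous f ->
  exists M, forall x, a <= x <= b -> `|f x| <= M.
Proof.
move=> cf.
have /compact_bounded[M [Mr HM]] : compact (f @` `[a, b]).
  apply: continuous_compact; last exact: segment_compact.
  by apply: continuous_subspaceT.
exists (M + 1) => x xab; apply: HM; first by rewrite ltrDl.
by exists x => //; rewrite /= in_itv.
Qed.

Lemma loc_intMc f g : continuous f -> loc_int g -> loc_int (fun x => f x * g x).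
Proof.
move=> cf [mg gi]; split.
  by apply: measurable_funM => //; exact: continuous_measurable_fun.
move=> a b; apply: (integrableMr _ _ _ (gi a b)) => //.
  by apply: measurable_funS (continuous_measurable_fun cf).
have [M HM] := continuous_bounded_itv a b cf.
exists M; split; first exact: num_real.
by move=> N MN x /=; rewrite in_itv /= => /HM /le_trans; apply; exact: ltW.
Qed.

Lemma loc_int_cst (k : R) : loc_int (fun=> k).
Proof.
split=> // a b; apply: continuous_compact_integrable; first exact: segment_compact.
by apply: continuous_subspaceT => ?; exact: cst_continuous.
Qed.

Lemma loc_int_cont f : continuous f -> loc_int f.
Proof.
move=> cf; have := loc_intMc cf (loc_int_cst 1).
by under eq_fun do rewrite mulr1.
Qed.

Lemma eq_iint a b f g : (forall x, a <= x <= b -> f x = g x) ->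
  iint a b f = iint a b g.
Proof.
by move=> fg; apply: eq_Rintegral => x; rewrite inE /= in_itv /=; exact: fg.
Qed.

Lemma iintD a b f g : loc_int f -> loc_int g ->
  iint a b (fun x => f x + g x) = iint a b f + iint a b g.
Proof. by move=> [_ fi] [_ gi]; rewrite /iint RintegralD. Qed.

Lemma iintZ a b (k : R) f : loc_int f ->
  iint a b (fun x => k * f x) = k * iint a b f.
Proof. by move=> [_ fi]; rewrite /iint RintegralZl. Qed.

Lemma iintB a b f g : loc_int f -> loc_int g ->
  iint a b (fun x => f x - g x) = iint a b f - iint a b g.
Proof. by move=> [_ fi] [_ gi]; rewrite /iint RintegralB. Qed.

Lemma le_iint a b f g : loc_int f -> loc_int g ->
  (forall x, a <= x <= b -> f x <= g x) -> iint a b f <= iint a b g.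
Proof.
by move=> [_ fi] [_ gi] fg; apply: le_Rintegral => // x; rewrite /= in_itv; exact: fg.
Qed.

Lemma iint_ge0 a b f : (forall x, a <= x <= b -> 0 <= f x) -> 0 <= iint a b f.
Proof. by move=> f0; apply: Rintegral_ge0 => x; rewrite /= in_itv; exact: f0. Qed.

Lemma le_norm_iint a b f : loc_int f -> `|iint a b f| <= iint a b (fun x => `|f x|).
Proof. by move=> [_ fi]; exact: le_normr_Rintegral. Qed.

Lemma iint_xx a f : iint a a f = 0.
Proof. by rewrite /iint set_itv1 Rintegral_set1. Qed.

Lemma iint_chasles a b c f : a <= b -> b <= c -> loc_int f ->
  iint a c f = iint a b f + iint b c f.
Proof.
move=> ab bc [_ fi]; rewrite /iint.
have := @Rintegral_itvB R f (BLeft a) (BRight c) b (fi a c).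
rewrite !bnd_simp => /(_ ab bc) /eqP; rewrite subr_eq => /eqP ->.
rewrite Rintegral_itv_obnd_cbnd 1?addrC //.
by apply: integrableS (fi b c) => //; apply: subset_itvr; rewrite bnd_simp.
Qed.

Lemma iint_cst a b (k : R) : a <= b -> iint a b (fun=> k) = k * (b - a).
Proof.
move=> ab; rewrite /iint Rintegral_cst //=.
rewrite lebesgue_measure_itv /= lte_fin.
move: ab; rewrite le_eqVlt => /predU1P[->|ab]; last by rewrite ab.
by rewrite ltxx subrr.
Qed.

(** Absolute continuity, with the derivative as part of the data. *)
Definition primitive u g :=
  loc_int g /\ forall a b, a <= b -> u b - u a = iint a b g.

Lemma primitiveD u v g h : primitive u g -> primitive v h ->
  primitive (fun x => u x + v x) (fun x => g x + h x).
Proof.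
move=> [lg ug] [lh vh]; split; first exact: loc_intD.
by move=> a b ab; rewrite iintD // -ug // -vh //; ring.
Qed.

Lemma primitiveZ (k : R) u g : primitive u g ->
  primitive (fun x => k * u x) (fun x => k * g x).
Proof.
move=> [lg ug]; split; first exact: loc_intZ.
by move=> a b ab; rewrite iintZ // -ug // -mulrBr.
Qed.

Lemma primitiveB u v g h : primitive u g -> primitive v h ->
  primitive (fun x => u x - v x) (fun x => g x - h x).
Proof.
move=> [lg ug] [lh vh]; split; first exact: loc_intB.
by move=> a b ab; rewrite iintB // -ug // -vh //; ring.
Qed.

Lemma eq_primitive u v g h : u =1 v -> g =1 h -> primitive u g -> primitive v h.
Proof. by move=> /funext -> /funext ->. Qed.

Lemma primitive_incr u g a b : primitive u g -> a <= b ->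
  `|u b - u a| <= iint a b (fun x => `|g x|).
Proof. by move=> [lg ug] ab; rewrite ug //; exact: le_norm_iint. Qed.

Lemma le_iint_itv a b c d f : loc_int f -> (forall x, 0 <= f x) ->
  c <= a -> a <= b -> b <= d -> iint a b f <= iint c d f.
Proof.
move=> lf f0 ca ab bd; rewrite (iint_chasles (b := a) ca) ?(le_trans ab) //.
rewrite (iint_chasles ab bd) //.
have := @iint_ge0 c a f (fun x _ => f0 x).
have := @iint_ge0 b d f (fun x _ => f0 x).
lra.
Qed.

Lemma ex_primitive g : loc_int g -> exists u, primitive u g.
Proof.
move=> lg; pose c : R := 0.
exists (fun x => if c <= x then iint c x g else - iint x c g).
split=> // a b ab.
case: (leP c b) => cb; case: (leP c a) => ca.
- by rewrite (iint_chasles ca ab) //; ring.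
- by rewrite opprK addrC (iint_chasles (ltW ca) cb).
- by have := lt_le_trans cb (le_trans ca ab); rewrite ltxx.
- by rewrite (iint_chasles ab (ltW cb)) //; ring.
Qed.

Lemma primitive_continuous u g : primitive u g -> continuous u.
Proof.
move=> [lg ug] x.
have x1 : x - 1 <= x + 1 by lra.
have := @parameterized_integral_continuous R _ _ g x1 (lg.2 _ _).
move=> /continuous_within_itvP.
have x11 : x - 1 < x + 1 by lra.
have xx1 : x - 1 < x by lra.
case/(_ x11) => /(_ x) + _ _.
rewrite in_itv /= => /(_ _) H.
have {}H := H ltac:(lra).
have E : {near nbhs x, (fun y => parameterized_integral mu (x - 1) y g + u (x - 1)) =1 u}.
  near=> y; have yx : x - 1 <= y by near: y; apply: filterS (lt_nbhsr xx1) => ? /ltW.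
  by rewrite /parameterized_integral -/(iint _ _ _) -ug // subrK.
rewrite /continuous_at -(nbhs_singleton E).
apply: cvg_trans; first exact: near_eq_cvg E.
by apply: cvgD => //; exact: cvg_cst.
Unshelve. all: by end_near. Qed.

Lemma le_geometric (a b k : R) : (forall n : nat, a <= b + k / 2 ^+ n) -> a <= b.
Proof.
move=> H; apply/ler_addgt0Pr => eps eps0; have [k0|k0] := leP k 0.
  by have := H 0%N; rewrite expr0 divr1; lra.
have [n Hn] : exists n : nat, k / eps < n%:R.
  by exists (Num.bound (k / eps)); apply: archi_boundP; rewrite divr_ge0 // ltW.
apply: (le_trans (H n)); rewrite lerD2l.
rewrite ltr_pdivrMr // in Hn; rewrite ler_pdivrMr ?exprn_gt0 //.
apply: (le_trans (ltW Hn)); rewrite mulrC ler_wpM2l ?(ltW eps0) //.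
by rewrite -natrX ler_nat ltnW // ltn_expl.
Qed.

(** Bisecting an interval at the midpoint of the gauge [m] halves the bound, so
    the increment is below every [C (m b - m a)^2 / 2^n]. *)
Lemma quadratic_increment_const (e m : R -> R) (C : R) :
  continuous m -> {homo m : x y / x <= y} ->
  (forall a b, a <= b -> `|e b - e a| <= C * (m b - m a) ^+ 2) ->
  forall a b, e a = e b.
Proof.
move=> cm mm H.
have K (n : nat) : forall a b, a <= b ->
    `|e b - e a| <= C * (m b - m a) ^+ 2 / 2 ^+ n.
  elim: n => [|n IH] a b ab; first by rewrite expr0 divr1; exact: H.
  have mab := mm _ _ ab.
  have [c cab mc] : exists2 c, c \in `[a, b] & m c = (m a + m b) / 2.
    apply: IVT => //; first exact: continuous_subspaceT.
    by rewrite min_l // max_r //; lra.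
  move: cab; rewrite in_itv /= => /andP[ac cb].
  have /ler_normlP[A1 A2] := IH _ _ ac.
  have /ler_normlP[B1 B2] := IH _ _ cb.
  move: A1 A2 B1 B2; rewrite mc (exprS 2 n) invfM.
  rewrite (_ : (m a + m b) / 2 - m a = (m b - m a) / 2); last by field.
  rewrite (_ : m b - (m a + m b) / 2 = (m b - m a) / 2); last by field.
  rewrite (_ : C * ((m b - m a) / 2) ^+ 2 / 2 ^+ n =
    C * (m b - m a) ^+ 2 * (2^-1 / 2 ^+ n) / 2); last by field; exact: expf_neq0.
  set Z := C * _ * _; move=> A1 A2 B1 B2.
  by apply/ler_normlP; split; lra.
suff K2 a b : a <= b -> e a = e b.
  by move=> a b; case: (leP a b) => [|/ltW] ab; [exact: K2|exact/esym/K2].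
move=> ab; apply/esym/eqP; rewrite -subr_eq0 -normr_le0.
by apply: (@le_geometric _ _ (C * (m b - m a) ^+ 2)) => n; rewrite add0r; exact: K.
Qed.

End IntervalIntegrals.

(** * Derivatives and the chain rule for primitives *)

Section Continuity.
Context {R : realType}.
Implicit Types (f g : R -> R) (k : R).

Lemma c_cst k : continuous (fun _ : R => k).
Proof. by move=> ?; exact: cst_continuous. Qed.

Lemma c_id : continuous (fun x : R => x).
Proof. by move=> ?; exact: cvg_id. Qed.

Lemma c_D f g : continuous f -> continuous g -> continuous (fun x => f x + g x).
Proof. by move=> cf cg x; apply: cvgD; [exact: cf|exact: cg]. Qed.

Lemma c_N f : continuous f -> continuous (fun x => - f x).
Proof. by move=> cf x; apply: cvgN; exact: cf. Qed.

Lemma c_B f g : continuous f -> continuous g -> continuous (fun x => f x - g x).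
Proof. by move=> cf cg; apply: c_D => //; exact: c_N. Qed.

Lemma c_M f g : continuous f -> continuous g -> continuous (fun x => f x * g x).
Proof. by move=> cf cg x; apply: cvgM; [exact: cf|exact: cg]. Qed.

Lemma c_V f : (forall x, f x != 0) -> continuous f -> continuous (fun x => (f x)^-1).
Proof. by move=> f0 cf x; apply: cvgV; [exact: f0|exact: cf]. Qed.

Lemma c_comp f g : continuous f -> continuous g -> continuous (fun x => g (f x)).
Proof. by move=> cf cg x; apply: continuous_comp; [exact: cf|exact: cg]. Qed.

End Continuity.
Arguments c_cst {R} k [x t] _.

Section Derivatives.
Context {R : realType}.
Implicit Types (f g : R -> R) (x y k l m : R).

Lemma d_eq f x l m : is_derive x 1 f l -> l = m -> is_derive x (1 : R) f m.
Proof. by move=> H <-. Qed.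

Lemma d_cst k x : is_derive x 1 (fun _ : R => k) (0 : R).
Proof. exact: is_derive_cst. Qed.

Lemma d_id x : is_derive x 1 (fun s : R => s) (1 : R).
Proof. exact: is_derive_id. Qed.

Lemma d_D f g x l m : is_derive x 1 f l -> is_derive x 1 g m ->
  is_derive x 1 (fun s => f s + g s) (l + m).
Proof. by move=> F G; exact: is_deriveD. Qed.

Lemma d_N f x l : is_derive x 1 f l -> is_derive x 1 (fun s => - f s) (- l).
Proof. by move=> F; exact: is_deriveN. Qed.

Lemma d_B f g x l m : is_derive x 1 f l -> is_derive x 1 g m ->
  is_derive x 1 (fun s => f s - g s) (l - m).
Proof. by move=> F G; exact: is_deriveB. Qed.

Lemma d_M f g x l m : is_derive x 1 f l -> is_derive x 1 g m ->
  is_derive x 1 (fun s => f s * g s) (l * g x + f x * m).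
Proof.
move=> F G; apply: (@d_eq _ _ _ _ (is_deriveM F G)).
by rewrite /GRing.scale /=; ring.
Qed.

Lemma d_Z f k x l : is_derive x 1 f l -> is_derive x 1 (fun s => k * f s) (k * l).
Proof. by move=> F; apply: d_eq (d_M (d_cst k x) F) _; ring. Qed.

Lemma d_V f x l : f x != 0 -> is_derive x 1 f l ->
  is_derive x 1 (fun s => (f s)^-1) (- l / f x ^+ 2).
Proof.
move=> fx F; apply: (@d_eq _ _ _ _ (is_deriveV fx F)).
by rewrite /GRing.scale /=; field.
Qed.

Lemma d_comp f g x l m : is_derive x 1 f l -> is_derive (f x) 1 g m ->
  is_derive x 1 (fun s => g (f s)) (m * l).
Proof. by move=> F G; exact: (@is_derive1_comp _ g f x _ _ G F). Qed.

Lemma d_ext f g x l : f =1 g -> is_derive x 1 f l -> is_derive x (1 : R) g l.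
Proof. by move=> /funext ->. Qed.

End Derivatives.

Section ChainRule.
Context {R : realType}.
Implicit Types (f g h u v F dF : R -> R) (a b c x y z : R).

Lemma is_derive_continuous F dF x : is_derive x 1 F (dF x) -> {for x, continuous F}.
Proof. by move=> dx; apply: differentiable_continuous; apply/derivable1_diffP. Qed.

(** The endpoints come in either order, whence the sign condition. *)
Lemma MVT_between F dF x y :
  (forall z, (z - x) * (z - y) <= 0 -> is_derive z 1 F (dF z)) ->
  exists2 z, (z - x) * (z - y) <= 0 & F y - F x = dF z * (y - x).
Proof.
wlog xy : x y / x <= y.
  move=> H; case: (leP x y) => [|/ltW] xy D; first exact: H.
  have [|z zyx zE] := H _ _ xy; first by move=> z; rewrite mulrC; exact: D.
  by exists z; [rewrite mulrC|rewrite -opprB zE -mulrN opprB].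
move=> D; have D' z : x <= z <= y -> is_derive z 1 F (dF z).
  by move=> /andP[xz zy]; apply: D; rewrite mulr_ge0_le0 // ?subr_ge0 // subr_le0.
have [||z zxy zE] := @MVT_segment R F dF x y xy.
- move=> z; rewrite in_itv /= => /andP[/ltW xz /ltW zy].
  by apply: D'; rewrite xz.
- apply: continuous_in_subspaceT => z; rewrite inE /= in_itv /= => /D'.
  exact: is_derive_continuous.
exists z => //; move: zxy; rewrite in_itv /= => /andP[xz zy].
by rewrite mulr_ge0_le0 // ?subr_ge0 // subr_le0.
Qed.

Lemma between_norm x y z : (z - x) * (z - y) <= 0 -> `|z - x| <= `|y - x|.
Proof.
move=> H; case: (ger0P (z - x)) => h1; case: (ger0P (y - x)) => h2.
- case: (leP z y) => zy; first by lra.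
  have : 0 <= (z - x) * (z - y) by apply: mulr_ge0 => //; lra.
  nra.
- have : 0 <= (z - x) * (z - y) by apply: mulr_ge0 => //; lra.
  nra.
- have : 0 <= (x - z) * (y - z) by apply: mulr_ge0; lra.
  nra.
- case: (leP y z) => zy; first by lra.
  have : 0 < (x - z) * (y - z) by apply: mulr_gt0; lra.
  nra.
Qed.

Lemma lipschitz_continuous F (C : R) :
  (forall x y, `|F x - F y| <= C * `|x - y|) -> continuous F.
Proof.
move=> LF x; apply/cvgrPdist_lt => /= e e0.
have C0 : 0 <= C.
  have := LF 1 0; rewrite subr0 normr1 mulr1; exact: le_trans.
near=> y; apply: (le_lt_trans (LF _ _)).
have : `|x - y| < e / (C + 1).
  by near: y; apply: cvgr_dist_lt; rewrite ?divr_gt0 //; lra.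
rewrite ltr_pdivlMr; last lra.
by have := normr_ge0 (x - y); nra.
Unshelve. all: by end_near. Qed.

(** The increments of [F (u x)] and of a primitive of [dF (u x) * g x] differ by
    a quantity quadratic in the increments of a primitive of [|g|]; hence their
    difference is constant. *)
Lemma primitive_comp F dF (C : R) u g :
  (forall x, is_derive x 1 F (dF x)) ->
  (forall x y, `|dF x - dF y| <= C * `|x - y|) ->
  primitive u g -> primitive (fun x => F (u x)) (fun x => dF (u x) * g x).
Proof.
move=> dFP LdF ug.
have C0 : 0 <= C.
  have := LdF 1 0; rewrite subr0 normr1 mulr1; exact: le_trans.
have cu := primitive_continuous ug.
have cdF := lipschitz_continuous LdF.
have lg := ug.1; have lng := loc_int_norm lg.
have cdFu : continuous (fun x => dF (u x)).
  by move=> x; apply: continuous_comp; [exact: cu|exact: cdF].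
have lh : loc_int (fun x => dF (u x) * g x) by exact: loc_intMc.
split=> // a b ab.
have [m [mp mP]] := ex_primitive lng.
have [G [Gp GP]] := ex_primitive lh.
have E : F (u a) - G a = F (u b) - G b.
  apply: (@quadratic_increment_const R (fun x => F (u x) - G x) m (2 * C)).
  - by apply: primitive_continuous; split; [exact: mp|exact: mP].
  - by move=> x y xy; rewrite -subr_ge0 mP // iint_ge0.
  move=> {}a {}b {}ab.
  have {1}-> : F (u b) - G b - (F (u a) - G a) =
    F (u b) - F (u a) - (G b - G a) by ring.
  rewrite mP // GP //.
  have [xi xiP ->] : exists2 z, (z - u a) * (z - u b) <= 0 &
    F (u b) - F (u a) = dF z * (u b - u a) by apply: MVT_between.
  rewrite ug.2 // -iintZ // -iintB //; last exact: loc_intZ.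
  apply: (le_trans (le_norm_iint _ _ _)).
    by apply: loc_intB => //; exact: loc_intZ.
  set I := iint a b (fun x => `|g x|).
  rewrite expr2 mulrA -iintZ //; apply: le_iint.
  - by apply: loc_int_norm; apply: loc_intB => //; exact: loc_intZ.
  - exact: loc_intZ.
  move=> t /andP[at_ tb]; rewrite -mulrBl normrM ler_wpM2r //.
  apply: (le_trans (LdF _ _)).
  have I1 : `|xi - u a| <= I.
    by apply: (le_trans (between_norm xiP)); exact: primitive_incr.
  have I2 : `|u t - u a| <= I.
    by apply: (le_trans (primitive_incr ug at_)); apply: le_iint_itv.
  have : `|xi - u t| <= `|xi - u a| + `|u t - u a|.
    by rewrite (_ : xi - u t = (xi - u a) - (u t - u a)) ?ler_normB //; ring.
  by nra.
by rewrite -GP //; lra.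
Qed.

Lemma primitive_sqr u g : primitive u g ->
  primitive (fun x => u x ^+ 2) (fun x => 2 * u x * g x).
Proof.
move=> ug; apply: (@primitive_comp (fun x => x ^+ 2) (fun x => 2 * x) 2 _ _ _ _ ug).
  move=> x; apply: is_derive_eq.
  by rewrite /GRing.scale /=; ring.
by move=> x y; rewrite -mulrBr normrM (@ger0_norm _ 2).
Qed.

(** By polarization of the case of squares. *)
Lemma primitiveM u v g h : primitive u g -> primitive v h ->
  primitive (fun x => u x * v x) (fun x => g x * v x + u x * h x).
Proof.
move=> ug vh.
have := primitiveZ 4^-1 (primitiveB (primitive_sqr (primitiveD ug vh))
                                     (primitive_sqr (primitiveB ug vh))).
by apply: eq_primitive => x /=; field.
Qed.

Lemma primitive_C1 F dF : (forall x, is_derive x 1 F (dF x)) -> continuous dF ->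
  primitive F dF.
Proof.
move=> D cdF; split; first exact: loc_int_cont.
move=> a b; rewrite le_eqVlt => /predU1P[<-|ab]; first by rewrite iint_xx subrr.
rewrite /iint /Rintegral (@continuous_FTC2 _ dF F) //.
- exact: continuous_subspaceT.
- have cF x : {for x, continuous F} by apply: is_derive_continuous.
  split.
  + by move=> x _; have := D x; case.
  + by apply: cvg_at_right_filter; exact: cF.
  + by apply: cvg_at_left_filter; exact: cF.
- by move=> x _; rewrite derive1E; have := D x => -[_ ->].
Qed.

End ChainRule.

(** * Square-integrable functions *)

Section SquareIntegrable.
Context {R : realType}.
Local Notation mu := (@lebesgue_measure R).
Local Notation msb D := (@measurable _ (measurableTypeR R) D).
Implicit Types (f g h : R -> R) (D E : set R) (a b c x y k A : R).

Definition integrable_on D f := mu.-integrable D (EFin \o f).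

Lemma integrable_on_le D f g : msb D -> measurable_fun [set: R] f ->
  (forall x, D x -> `|f x| <= `|g x|) -> integrable_on D g -> integrable_on D f.
Proof.
rewrite /integrable_on => mD mf fg ig; apply: le_integrable ig.
  exact: mD.
  by apply/measurable_EFinP; exact: measurable_funS mf.
by move=> x Dx /=; rewrite lee_fin; exact: fg.
Qed.

Lemma integrable_onD D f g : msb D ->
  integrable_on D f -> integrable_on D g -> integrable_on D (fun x => f x + g x).
Proof. by move=> mD fi gi; apply: (integrableD _ fi gi). Qed.

Lemma integrable_onB D f g : msb D ->
  integrable_on D f -> integrable_on D g -> integrable_on D (fun x => f x - g x).
Proof. by move=> mD fi gi; apply: (integrableB _ fi gi). Qed.

Lemma integrable_onZ D k f : msb D ->
  integrable_on D f -> integrable_on D (fun x => k * f x).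
Proof. by move=> mD fi; apply: (integrableZl _ k fi). Qed.

Lemma integrable_on_norm D f : msb D ->
  integrable_on D f -> integrable_on D (fun x => `|f x|).
Proof. by move=> mD fi; exact: (integrable_abse fi). Qed.

Lemma integrable_onS D E f : msb D -> msb E -> D `<=` E ->
  integrable_on E f -> integrable_on D f.
Proof. by move=> mD mE DE; exact: integrableS. Qed.

Lemma loc_int_on f a b : loc_int f -> integrable_on `[a, b] f.
Proof. by move=> [_]; apply. Qed.

Lemma integrable_loc_int f : measurable_fun [set: R] f ->
  integrable_on [set: R] f -> loc_int f.
Proof. by move=> mf fi; split => // a b; exact: integrableS fi. Qed.

(** Monotone convergence: for a nonnegative function, a common bound on the
    pieces of an exhaustion is enough. *)
Lemma integrable_exhaustion D (F : nat -> set R) h A :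
  {homo F : n m / (n <= m)%N >-> (n <= m)%O} ->
  (forall n, msb (F n)) -> \bigcup_n F n = D ->
  measurable_fun [set: R] h -> (forall x, 0 <= h x) ->
  (forall n, integrable_on (F n) h) ->
  (forall n, \int[mu]_(x in F n) h x <= A) ->
  integrable_on D h /\ \int[mu]_(x in D) h x <= A.
Proof.
move=> Fh mF FD mh h0 ih hA.
have mD : msb D by rewrite -FD; exact: bigcup_measurable.
have mEh E : measurable_fun E (EFin \o h).
  by apply/measurable_EFinP; exact: measurable_funS mh.
have K : (\int[mu]_(x in D) (h x)%:E <= A%:E)%E.
  have cv : (\int[mu]_(x in F i) (EFin \o h) x)%E @[i --> \oo] -->
      (\int[mu]_(x in D) (EFin \o h) x)%E.
    rewrite -FD.
    apply: (@ge0_nondecreasing_set_cvg_integral _ (measurableTypeR R)) => //.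
      by move=> n; exact: mEh.
    by move=> n x _; rewrite lee_fin.
  rewrite -(cvg_lim _ cv) //; apply: lime_le; first by apply/cvg_ex; eexists; exact: cv.
  apply: nearW => n; have := hA n; rewrite -lee_fin /Rintegral fineK //.
  by apply: (integrable_fin_num _ (ih n)).
have ihD : integrable_on D h.
  apply/integrableP; split; first exact: mEh.
  apply: le_lt_trans (ltry A); apply: le_trans K.
  rewrite le_eqVlt; apply/orP; left; apply/eqP; apply: eq_integral => x _ /=.
  by rewrite ger0_norm.
split => //; rewrite -lee_fin /Rintegral fineK //; by apply: (integrable_fin_num _ ihD).
Qed.

Lemma bigcup_itvNn : \bigcup_n (`[- n%:R, n%:R]%classic : set R) = [set: R].
Proof.
apply/seteqP; split=> // x _.
exists (Num.bound `|x|) => //; rewrite /= in_itv /= -ler_norml.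
exact/ltW/archi_boundP.
Qed.

Lemma integrable_line h A : loc_int h -> (forall x, 0 <= h x) ->
  (forall n : nat, iint (- n%:R) n%:R h <= A) ->
  integrable_on [set: R] h /\ \int[mu]_x h x <= A.
Proof.
move=> [mh ih] h0 hA; apply: (integrable_exhaustion _ _ bigcup_itvNn) => //.
- move=> n m nm; apply/subsetPset => x; rewrite /= !in_itv /= => /andP[nx xn].
  have : (n%:R : R) <= m%:R by rewrite ler_nat.
  by move=> ?; apply/andP; split; lra.
- by move=> n; exact: ih.
Qed.

Lemma integrable_left x h A : loc_int h -> (forall x, 0 <= h x) ->
  (forall y, y <= x -> iint y x h <= A) ->
  integrable_on `]-oo, x] h /\ \int[mu]_(y in `]-oo, x]) h y <= A.
Proof.
move=> [mh ih] h0 hA.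
apply: (@integrable_exhaustion _ (fun n => `[x - n%:R, x]%classic)) => //.
- move=> n m nm; apply/subsetPset => y; rewrite /= !in_itv /= => /andP[nx xn].
  have : (n%:R : R) <= m%:R by rewrite ler_nat.
  by move=> ?; apply/andP; split; lra.
- apply/seteqP; split=> y; rewrite /= in_itv /=.
    by move=> [n _]; rewrite /= in_itv /= => /andP[_ ->].
  move=> yx; exists (Num.bound (x - y)) => //; rewrite /= in_itv /= yx andbT.
  have := @archi_boundP _ (x - y); rewrite subr_ge0 => /(_ yx); lra.
- by move=> n; exact: ih.
- by move=> n; apply: hA; rewrite lerBlDr lerDl.
Qed.

Lemma integrable_right x h A : loc_int h -> (forall x, 0 <= h x) ->
  (forall y, x <= y -> iint x y h <= A) ->
  integrable_on `[x, +oo[ h /\ \int[mu]_(y in `[x, +oo[) h y <= A.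
Proof.
move=> [mh ih] h0 hA.
apply: (@integrable_exhaustion _ (fun n => `[x, x + n%:R]%classic)) => //.
- move=> n m nm; apply/subsetPset => y; rewrite /= !in_itv /= => /andP[nx xn].
  have : (n%:R : R) <= m%:R by rewrite ler_nat.
  by move=> ?; apply/andP; split; lra.
- apply/seteqP; split=> y; rewrite /= in_itv /=.
    by move=> [n _]; rewrite /= in_itv /= => /andP[-> _].
  rewrite andbT => yx; exists (Num.bound (y - x)) => //; rewrite /= in_itv /= yx /=.
  have := @archi_boundP _ (y - x); rewrite subr_ge0 => /(_ yx); lra.
- by move=> n; exact: ih.
- by move=> n; apply: hA; rewrite lerDl.
Qed.

(** Measurability is asked on the whole line so that the class is stable under
    restriction of the domain. *)
Definition sq D f :=
  [/\ msb D, measurable_fun [set: R] f & integrable_on D (fun x => f x ^+ 2)].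

Definition n2 D f : R := Num.sqrt (\int[mu]_(x in D) (f x ^+ 2)).

Lemma n2_ge0 D f : 0 <= n2 D f. Proof. exact: sqrtr_ge0. Qed.

Lemma n2_sqr D f : n2 D f ^+ 2 = \int[mu]_(x in D) (f x ^+ 2).
Proof. by rewrite sqr_sqrtr // Rintegral_ge0 // => x _; rewrite sqr_ge0. Qed.

Lemma n2_le D f A : 0 <= A -> \int[mu]_(x in D) (f x ^+ 2) <= A ^+ 2 -> n2 D f <= A.
Proof. by move=> A0 H; rewrite -(ger0_norm A0) -sqrtr_sqr ler_wsqrtr. Qed.

Lemma le_Rint D f g : msb D -> integrable_on D f -> integrable_on D g ->
  (forall x, D x -> f x <= g x) -> \int[mu]_(x in D) f x <= \int[mu]_(x in D) g x.
Proof. by move=> *; exact: le_Rintegral. Qed.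

Lemma sq_le D f g : measurable_fun [set: R] f -> (forall x, D x -> `|f x| <= `|g x|) ->
  sq D g -> sq D f /\ n2 D f <= n2 D g.
Proof.
move=> mf fg [mD mg ig].
have fg2 x : D x -> f x ^+ 2 <= g x ^+ 2.
  by move=> Dx; rewrite -[leLHS]real_normK ?num_real // -[leRHS]real_normK ?num_real //
    lerXn2r ?nnegrE // fg.
have mf2 : measurable_fun [set: R] (fun x => f x ^+ 2) by exact: measurable_funX.
have iff : integrable_on D (fun x => f x ^+ 2).
  apply: integrable_on_le ig => // x Dx.
  by rewrite !ger0_norm ?sqr_ge0 // fg2.
split => //; apply: n2_le; rewrite ?n2_ge0 // n2_sqr.
exact: le_Rint.
Qed.

Lemma sqS D E f : msb D -> D `<=` E -> sq E f -> sq D f /\ n2 D f <= n2 E f.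
Proof.
move=> mD DE [mE mf fi]; split.
  by split => //; exact: integrable_onS fi.
apply: n2_le; rewrite ?n2_ge0 // n2_sqr /Rintegral fine_le //.
- by apply: (integrable_fin_num _ (integrable_onS mD mE DE fi)).
- by apply: (integrable_fin_num _ fi).
- apply: ge0_subset_integral => //.
    by apply/measurable_EFinP; apply: measurable_funX; exact: measurable_funS mf.
  by move=> x _; rewrite lee_fin sqr_ge0.
Qed.

(** Optimization over [t], separating the degenerate case [a = 0]. *)
Lemma quadratic_form_bound (a b c : R) : 0 <= a -> 0 <= c ->
  (forall t, 0 <= a * t ^+ 2 - 2 * b * t + c) -> b <= Num.sqrt a * Num.sqrt c.
Proof.
move=> a0 c0 H; rewrite -sqrtrM //.
have [b0|b0] := leP b 0; first by apply: le_trans b0 (sqrtr_ge0 _).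
rewrite -(ger0_norm (ltW b0)) -sqrtr_sqr ler_wsqrtr //.
have [aE|an] := eqVneq a 0.
  have := H ((c + 1) / (2 * b)); rewrite aE mul0r add0r.
  by rewrite (_ : - (2 * b * _) = - (c + 1)); [lra | field; exact: lt0r_neq0].
have ap : 0 < a by rewrite lt0r an.
have := H (b / a).
rewrite (_ : a * (b / a) ^+ 2 - 2 * b * (b / a) + c = c - b ^+ 2 / a); last first.
  by field.
by rewrite subr_ge0 ler_pdivrMr // mulrC.
Qed.

Lemma cauchy_schwarz D f g : sq D f -> sq D g ->
  integrable_on D (fun x => f x * g x) /\
  \int[mu]_(x in D) `|f x * g x| <= n2 D f * n2 D g.
Proof.
move=> [mD mf fi] [_ mg gi].
have mfg : measurable_fun [set: R] (fun x => f x * g x) by exact: measurable_funM.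
have ifg : integrable_on D (fun x => f x * g x).
  apply: (integrable_on_le mD mfg _ (integrable_onD mD fi gi)) => x _.
  rewrite (ger0_norm (addr_ge0 (sqr_ge0 _) (sqr_ge0 _))) normrM.
  have := sqr_ge0 (`|f x| - `|g x|).
  rewrite -(real_normK (num_real (f x))) -(real_normK (num_real (g x))).
  have := normr_ge0 (f x); have := normr_ge0 (g x); nra.
split => //; apply: quadratic_form_bound.
- by apply: Rintegral_ge0 => x _; rewrite sqr_ge0.
- by apply: Rintegral_ge0 => x _; rewrite sqr_ge0.
move=> t; have ing := integrable_on_norm mD ifg.
have -> : \int[mu]_(x in D) f x ^+ 2 * t ^+ 2 - 2 * \int[mu]_(x in D) `|f x * g x| * t
   + \int[mu]_(x in D) g x ^+ 2 =
  \int[mu]_(x in D) (t ^+ 2 * f x ^+ 2 - (2 * t) * `|f x * g x| + g x ^+ 2).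
  rewrite RintegralD // ?RintegralB // ?RintegralZl //; first by ring.
  - exact: (integrable_onZ _ mD).
  - exact: (integrable_onZ _ mD).
  - apply: (integrable_onB mD); exact: (integrable_onZ _ mD).
apply: Rintegral_ge0 => x _; rewrite normrM.
rewrite -(real_normK (num_real (f x))) -(real_normK (num_real (g x))).
have -> : t ^+ 2 * `|f x| ^+ 2 - 2 * t * (`|f x| * `|g x|) + `|g x| ^+ 2 =
  (t * `|f x| - `|g x|) ^+ 2 by ring.
exact: sqr_ge0.
Qed.

Lemma sq_eq D f g : f =1 g -> sq D f -> sq D g.
Proof. by move=> /funext ->. Qed.

Lemma sqD D f g : sq D f -> sq D g ->
  sq D (fun x => f x + g x) /\ n2 D (fun x => f x + g x) <= n2 D f + n2 D g.
Proof.
move=> sf sg; have [ifg cs] := cauchy_schwarz sf sg.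
move: sf sg => [mD mf fi] [_ mg gi].
have i2 := integrable_onZ 2 mD ifg.
have i3 := integrable_onD mD (integrable_onD mD fi i2) gi.
have E : (fun x => f x ^+ 2 + 2 * (f x * g x) + g x ^+ 2) = (fun x => (f x + g x) ^+ 2).
  by apply/funext => x; ring.
split; first by split => //; [exact: measurable_funD|rewrite -E].
apply: n2_le; first by rewrite addr_ge0 ?n2_ge0.
rewrite -E RintegralD //; last exact: (integrable_onD mD).
rewrite RintegralD // RintegralZl // -!n2_sqr.
have : \int[mu]_(x in D) (f x * g x) <= \int[mu]_(x in D) `|f x * g x|.
  apply: le_Rint => //; first exact: integrable_on_norm.
  by move=> x _; exact: ler_norm.
by nra.
Qed.

Lemma sqZ D k f : sq D f ->
  sq D (fun x => k * f x) /\ n2 D (fun x => k * f x) = `|k| * n2 D f.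
Proof.
move=> [mD mf fi].
have E : (fun x => (k * f x) ^+ 2) = (fun x => k ^+ 2 * f x ^+ 2).
  by apply/funext => x; rewrite exprMn.
split; first by split => //; [exact: measurable_funM|rewrite E; exact: integrable_onZ].
by rewrite /n2 E RintegralZl // sqrtrM ?sqr_ge0 // sqrtr_sqr.
Qed.

Lemma sq_norm D f : sq D f -> sq D (fun x => `|f x|) /\ n2 D (fun x => `|f x|) = n2 D f.
Proof.
move=> [mD mf fi].
have E : (fun x => `|f x| ^+ 2) = (fun x => f x ^+ 2).
  by apply/funext => x; rewrite real_normK ?num_real.
split; last by rewrite /n2 E.
by split => //; [exact: measurableT_comp|rewrite E].
Qed.

Lemma sq_bound D f g A : measurable_fun [set: R] f -> sq D g -> n2 D g <= A ->
  (forall x, D x -> `|f x| <= g x) -> sq D f /\ n2 D f <= A.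
Proof.
move=> mf sg gA fg; have [|sf fle] := @sq_le D f g mf _ sg.
  by move=> x Dx; apply: le_trans (fg x Dx) (ler_norm _).
by split => //; exact: le_trans fle gA.
Qed.

End SquareIntegrable.

(** * Weak derivatives are almost everywhere derivatives of primitives *)

Section WeakDerivatives.
Context {R : realType}.
Local Notation mu := (@lebesgue_measure R).
Implicit Types (f g h u v psi : R -> R) (a b c e x y t : R).

Lemma ae_imply (P Q : R -> Prop) : (forall x, P x -> Q x) ->
  {ae mu, forall x, P x} -> {ae mu, forall x, Q x}.
Proof. by move=> PQ; apply: filterS => //; exact: (ae_filter_ringOfSetsType mu). Qed.

Lemma ae_imply2 (P Q S : R -> Prop) : (forall x, P x -> Q x -> S x) ->
  {ae mu, forall x, P x} -> {ae mu, forall x, Q x} -> {ae mu, forall x, S x}.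
Proof. by move=> PQ; apply: filterS2 => //; exact: (ae_filter_ringOfSetsType mu). Qed.

Lemma ae_all (P : R -> Prop) : (forall x, P x) -> {ae mu, forall x, P x}.
Proof.
by move=> H; apply: aeW.
Qed.

Lemma locally_integrable_loc_int f : locally_integrable [set: R] f -> loc_int f.
Proof.
move=> [mf _ fi]; split => // a b; apply/integrableP; split.
  by apply/measurable_EFinP; exact: measurable_funS mf.
by apply: fi => //; exact: segment_compact.
Qed.

Lemma loc_int_locally_integrable f : loc_int f -> locally_integrable [set: R] f.
Proof.
move=> [mf fi]; split => //; first exact: openT.
move=> K _ cK; have [M [_ HM]] := compact_bounded cK.
have /integrableP[_] := fi (- (M + 1)) (M + 1).
apply: le_lt_trans; apply: ge0_subset_integral => //.
- exact: compact_measurable.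
- by apply/measurable_EFinP; apply: measurableT_comp => //; exact: measurable_funS mf.
- move=> x Kx; rewrite /= in_itv /= -ler_norml; apply: HM => //.
  by rewrite ltrDl.
Qed.

Lemma Rint_support a b h : (forall x, ~~ (a <= x <= b) -> h x = 0) ->
  \int[mu]_x h x = iint a b h.
Proof.
move=> h0; rewrite /iint [RHS]Rintegral_mkcond; congr Rintegral.
apply/funext => x; rewrite patchE; case: ifPn => //.
by rewrite notin_setE /= in_itv /= => /negP /h0.
Qed.

Lemma derive1_out psi (M : R) x : (forall y, M < `|y| -> psi y = 0) -> M < `|x| ->
  derive1 psi x = 0.
Proof.
move=> p0 Mx; rewrite derive1E.
have E : {near x, psi =1 cst 0}.
  near=> y; apply: p0; near: y.
  exact: (cvgr_gt _ (@norm_continuous _ R x)).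
by rewrite (near_eq_derive _ E) ?derive_cst // oner_neq0.
Unshelve. all: by end_near. Qed.

Lemma test_is_derive psi x : test_function psi -> is_derive x 1 psi (derive1 psi x).
Proof. by move=> [dpsi _ _]; rewrite derive1E; apply/derivableP; exact: dpsi. Qed.

Lemma test_primitive psi : test_function psi -> primitive psi (derive1 psi).
Proof.
move=> tpsi; have [_ cpsi _] := tpsi.
by apply: primitive_C1 => // x; exact: test_is_derive.
Qed.

(** The product with a test function is a primitive vanishing at both ends of
    the support. *)
Lemma primitive_has_wderivR u g : primitive u g -> has_wderivR u g.
Proof.
move=> ug; have lu := loc_int_cont (primitive_continuous ug).
split; [exact: loc_int_locally_integrable..|exact: loc_int_locally_integrable ug.1|].
move=> psi tpsi; have [dpsi cpsi [M0 HM0]] := tpsi.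
pose M := `|M0| + 1.
have HM y : M <= `|y| -> psi y = 0.
  by move=> My; apply: HM0; have := ler_norm M0; rewrite /M in My; lra.
have M0' : 0 < M by rewrite /M; have := normr_ge0 M0; lra.
have HN y : ~~ (- M <= y <= M) -> psi y = 0.
  by rewrite -ler_norml -ltNge => /ltW; exact: HM.
have HdN y : ~~ (- M <= y <= M) -> derive1 psi y = 0.
  rewrite -ler_norml -ltNge => My; apply: (@derive1_out _ M) => //.
  by move=> z /ltW; exact: HM.
have pp := test_primitive tpsi.
have := (primitiveM ug pp).2 (- M) M.
rewrite (HM M) ?(HM (- M)) ?normrN ?ger0_norm ?(ltW M0') // !mulr0 subrr.
have l1 : loc_int (fun x => g x * psi x).
  under eq_fun do rewrite mulrC.
  by apply: loc_intMc ug.1; exact: primitive_continuous pp.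
have l2 : loc_int (fun x => u x * derive1 psi x).
  by apply: loc_intMc pp.1; exact: primitive_continuous ug.
rewrite iintD // => /(_ ltac:(lra)) E.
rewrite (@Rint_support (- M) M) ?(@Rint_support (- M) M); first by lra.
- by move=> x /HN ->; rewrite mulr0.
- by move=> x /HdN ->; rewrite mulr0.
Qed.

Lemma has_wderivRD u v g h : has_wderivR u g -> primitive v h ->
  has_wderivR (fun x => u x + v x) (fun x => g x + h x).
Proof.
move=> [lu lg ug] vh; have [lv lh vh'] := primitive_has_wderivR vh.
split.
- apply: loc_int_locally_integrable.
  by apply: loc_intD; exact: locally_integrable_loc_int.
- apply: loc_int_locally_integrable.
  by apply: loc_intD; exact: locally_integrable_loc_int.
move=> psi tpsi; have [dpsi cpsi [M0 HM0]] := tpsi.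
have HN y : ~~ (- M0 <= y <= M0) -> psi y = 0.
  by rewrite -ler_norml -ltNge; exact: HM0.
have HdN y : ~~ (- M0 <= y <= M0) -> derive1 psi y = 0.
  by rewrite -ler_norml -ltNge => My; exact: (@derive1_out _ M0).
have cp := primitive_continuous (test_primitive tpsi).
have := ug _ tpsi; have := vh' _ tpsi.
rewrite !(@Rint_support (- M0) M0); try by
  move=> x xM; rewrite ?(HN _ xM) ?(HdN _ xM) mulr0.
move=> E1 E2.
have LL w : locally_integrable [set: R] w -> forall p, continuous p ->
    loc_int (fun x => w x * p x).
  move=> lw p cp'; under eq_fun do rewrite mulrC.
  by apply: loc_intMc => //; exact: locally_integrable_loc_int.
under eq_iint do rewrite mulrDl.
rewrite iintD; [|exact: LL..].
rewrite E1 E2.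
have -> : iint (- M0) M0 (fun x => (g x + h x) * psi x) =
  iint (- M0) M0 (fun x => g x * psi x + h x * psi x).
  by apply: eq_iint => x _; rewrite mulrDl.
by rewrite iintD; [ring|exact: LL..].
Qed.

Lemma lebesgue_ptP f a : loc_int f -> lebesgue_pt f a ->
  forall e, 0 < e -> \forall r \near 0^'+,
    iint (a - r) (a + r) (fun x => `|f x - f a|) <= e * r.
Proof.
move=> lf fa e e0.
have lfa : loc_int (fun x => `|f x - f a|).
  by apply: loc_int_norm; apply: loc_intB => //; exact: loc_int_cst.
have e20 : 0 < e / 2 by rewrite divr_gt0.
have cv : fine (davg f a r) @[r --> 0^'+] --> (0 : R) by exact: fine_cvg.
move: cv => /cvgrPdist_lt /(_ _ e20) H.
have r0 : \forall r \near 0^'+, (0 : R) < r by exact: nbhs_right_gt.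
apply: filterS2 r0 H => r r0.
rewrite /= /davg /iavg lebesgue_measure_ball ?(ltW r0) //.
have -> : (\int[mu]_(y in ball a r) `|((center (f a) \o f) y)%:E| =
    (iint (a - r) (a + r) (fun x => `|f x - f a|))%:E)%E.
  rewrite ball_itv /iint /Rintegral fineK; last first.
    by apply: (integrable_fin_num _ (lfa.2 _ _)).
  rewrite -integral_itv_bndo_bndc; last first.
    by apply/measurable_EFinP; exact: measurable_funS lfa.1.
  rewrite -[RHS]integral_itv_obnd_cbnd //.
  by apply/measurable_EFinP; exact: measurable_funS lfa.1.
rewrite inver mulrn_eq0 /= gt_eqF // -EFinM /= sub0r normrN => H.
have {}H := le_lt_trans (ler_norm _) H.
move: H; rewrite mulrC ltr_pdivrMr; last by rewrite mulrn_wgt0.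
rewrite (_ : e / 2 * (r *+ 2) = e * r); last by rewrite mulr2n; field.
exact: ltW.
Qed.

Definition pos t : R := (t + `|t|) / 2.

Lemma pos_le0 t : t <= 0 -> pos t = 0.
Proof. by move=> t0; rewrite /pos ler0_norm // subrr mul0r. Qed.

Lemma pos_ge0E t : 0 <= t -> pos t = t.
Proof. by move=> t0; rewrite /pos ger0_norm //; field. Qed.

Lemma pos_continuous : continuous pos.
Proof.
move=> t; apply: cvgM; last exact: cvg_cst.
by apply: cvgD; [exact: cvg_id|exact: norm_continuous].
Qed.

Lemma is_derive_quadratic_bound (F : R -> R) (l C : R) x :
  (forall h : R, `|F (x + h) - F x - l * h| <= C * h ^+ 2) -> is_derive x 1 F l.
Proof.
move=> H.
have C0 : 0 <= C by have := le_trans (normr_ge0 _) (H 1); rewrite expr1n mulr1.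
have cv : (fun k : R => k^-1 *: ((F \o shift x) (k *: (1 : R)) - F x)) @ 0^' --> l.
  apply/cvgrPdist_lt => e e0; near=> h.
  have h0 : h != 0 by near: h; exact: nbhs_dnbhs_neq.
  have : `|h| < e / (C + 1).
    near: h; apply: dnbhs0_lt; rewrite divr_gt0 //; lra.
  rewrite ltr_pdivlMr ?(ltr_pwDr ltr01 C0) // => hC.
  rewrite /= [h *: 1]mulr1 (addrC h).
  have -> : l - h^-1 *: (F (x + h) - F x) = - (h^-1 * (F (x + h) - F x - l * h)).
    by rewrite /GRing.scale /=; field.
  rewrite normrN normrM normfV.
  apply: (@le_lt_trans _ _ (C * `|h|)); last first.
    by have := normr_ge0 h; nra.
  rewrite mulrC ler_pdivrMr ?normr_gt0 //.
  apply: (le_trans (H h)); rewrite -(real_normK (num_real h)) expr2; lra.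
split; first by apply/cvg_ex; exists l.
exact/cvg_lim.
Unshelve. all: by end_near. Qed.

Lemma is_derive_pos_sqr t : is_derive t 1 (fun s => pos s ^+ 2) (2 * pos t).
Proof.
apply: (@is_derive_quadratic_bound _ _ 1) => h.
rewrite mul1r.
case: (leP 0 t) => t0; case: (leP 0 (t + h)) => h0;
  rewrite ?(pos_ge0E t0) ?(pos_ge0E h0) ?(pos_le0 (ltW t0)) ?(pos_le0 (ltW h0));
  apply/ler_normlP; split; nra.
Qed.

(** The second difference of [pos ^ 2] rises from 0 to 1 across [-1, 1] and is
    continuously differentiable with derivative the tent function, so that a
    difference of two rescaled steps is a test function. *)
Definition step t : R :=
  (pos (t + 1) ^+ 2 - 2 * pos t ^+ 2 + pos (t - 1) ^+ 2) / 2.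
Definition tent t : R := pos (t + 1) - 2 * pos t + pos (t - 1).

Lemma tent_out t : 1 <= `|t| -> tent t = 0.
Proof.
rewrite ler_normr /tent => /orP[t1|t1].
  by rewrite !pos_ge0E //; lra.
by rewrite !pos_le0 //; lra.
Qed.

Lemma tent_ge0_le1 t : 0 <= tent t <= 1.
Proof.
have [t1|t1] := leP 1 `|t|; first by rewrite tent_out // lexx ler01.
move: t1; rewrite ltr_norml /tent => /andP[t1 t2].
rewrite (@pos_ge0E (t + 1)) ?(@pos_le0 (t - 1)); try lra.
by case: (leP 0 t) => t0; [rewrite pos_ge0E //|rewrite (pos_le0 (ltW t0))]; apply/andP; split; lra.
Qed.

Lemma step_ge1 t : 1 <= t -> step t = 1.
Proof. by move=> t1; rewrite /step !pos_ge0E; first field; lra. Qed.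

Lemma step_leN1 t : t <= -1 -> step t = 0.
Proof. by move=> t1; rewrite /step !pos_le0; first field; lra. Qed.

Lemma is_derive_step_scale a r t : is_derive t 1 (fun s => step (r * (s - a)))
  (r * tent (r * (t - a))).
Proof.
have L k : is_derive t 1 (fun s => r * (s - a) + k) r.
  apply: d_eq (d_D (d_Z r (d_B (d_id t) (d_cst a t))) (d_cst k t)) _; ring.
have D k := d_comp (L k) (is_derive_pos_sqr (r * (t - a) + k)).
have E := d_Z 2^-1 (d_D (d_B (D 1) (d_Z 2 (D 0))) (D (-1))).
apply: d_ext (d_eq E _).
  by move=> s; rewrite /step addr0 mulrC.
by rewrite /tent addr0; field.
Qed.

Lemma tent_continuous : continuous tent.
Proof.
have C k : continuous (fun t => pos (t + k)).
  exact: (c_comp (c_D c_id (c_cst k)) pos_continuous).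
exact: (c_D (c_B (C 1) (c_M (c_cst 2) pos_continuous)) (C (-1))).
Qed.

Lemma tent_scale_continuous a r : continuous (fun t => r * tent (r * (t - a))).
Proof.
have L := c_M (c_cst r) (c_B c_id (c_cst a)).
exact: (c_M (c_cst r) (c_comp L tent_continuous)).
Qed.

Lemma step_scale_primitive a r :
  primitive (fun t => step (r * (t - a))) (fun t => r * tent (r * (t - a))).
Proof.
apply: primitive_C1; first by move=> x; exact: is_derive_step_scale.
exact: tent_scale_continuous.
Qed.

Lemma tent_average v a r : loc_int v -> 0 < r ->
  `|\int[mu]_x (v x * (r^-1 * tent (r^-1 * (x - a)))) - v a| <=
  r^-1 * iint (a - r) (a + r) (fun x => `|v x - v a|).
Proof.
move=> lv r0.
have ri0 : 0 < r^-1 by rewrite invr_gt0.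
have lvt : loc_int (fun x => v x * (r^-1 * tent (r^-1 * (x - a)))).
  under eq_fun do rewrite mulrC.
  by apply: loc_intMc => //; exact: tent_scale_continuous.
have lt_ : loc_int (fun x => r^-1 * tent (r^-1 * (x - a))).
  by apply: loc_int_cont; exact: tent_scale_continuous.
have lva : loc_int (fun x => v x - v a) by apply: loc_intB => //; exact: loc_int_cst.
have arr : a - r <= a + r by lra.
rewrite (@Rint_support (a - r) (a + r)); last first.
  move=> x xn; rewrite tent_out ?mulr0 // normrM gtr0_norm // mulrC ler_pdivlMr //.
  rewrite mul1r leNgt; apply/negP => H; move/negP: xn; apply.
  by move: H; rewrite ltr_distl => /andP[h1 h2]; apply/andP; split; lra.
have E1 : iint (a - r) (a + r) (fun x => r^-1 * tent (r^-1 * (x - a))) = 1.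
  rewrite -(step_scale_primitive a r^-1).2 //.
  rewrite step_ge1 ?step_leN1 ?subr0 //.
    by rewrite addrAC subrr sub0r mulrN mulVf // gt_eqF.
  by rewrite addrAC subrr add0r mulVf // gt_eqF.
rewrite -{1}(mulr1 (v a)) -E1 -iintZ // -iintB //; last exact: loc_intZ.
apply: (le_trans (le_norm_iint _ _ _)).
  by apply: loc_intB => //; exact: loc_intZ.
rewrite -iintZ; last exact: loc_int_norm.
apply: le_iint.
- by apply: loc_int_norm; apply: loc_intB => //; exact: loc_intZ.
- by apply: loc_intZ; exact: loc_int_norm.
move=> x _; rewrite -mulrBl normrM mulrC normrM gtr0_norm // -mulrA ler_pM2l //.
have /andP[t0 t1] := tent_ge0_le1 (r^-1 * (x - a)).
by rewrite ger0_norm // ler_piMl.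
Qed.

Lemma test_step_difference a b r : 0 < r ->
  test_function (fun t => step (r^-1 * (t - a)) - step (r^-1 * (t - b))).
Proof.
move=> r0.
have ri0 : 0 < r^-1 by rewrite invr_gt0.
have D t := d_B (is_derive_step_scale a r^-1 t) (is_derive_step_scale b r^-1 t).
split.
- by move=> x; have := D x => -[].
- have -> : derive1 (fun t => step (r^-1 * (t - a)) - step (r^-1 * (t - b))) =
    (fun t => r^-1 * tent (r^-1 * (t - a)) - r^-1 * tent (r^-1 * (t - b))).
    by apply/funext => t; rewrite derive1E; have := D t => -[_ ->].
  by move=> t; apply: cvgB; exact: tent_scale_continuous.
exists (`|a| + `|b| + r) => x; rewrite ltr_normr.
have [Ha Ha'] : `|a| = `|a| /\ - `|a| <= a <= `|a| by rewrite -ler_norml.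
have [Hb Hb'] : `|b| = `|b| /\ - `|b| <= b <= `|b| by rewrite -ler_norml.
move: Ha' Hb' => /andP[a1 a2] /andP[b1 b2].
have na := normr_ge0 a; have nb := normr_ge0 b.
case/orP => H.
  rewrite !step_ge1 ?subrr // mulrC ler_pdivlMr // mul1r; lra.
rewrite !step_leN1 ?subrr // mulrC ler_pdivrMr // mulN1r; lra.
Qed.

(** Testing against the difference of two steps compares the averages of [v]
    near [a] and near [b] for narrow tents of mass 1; at Lebesgue points these
    averages converge to the values of [v]. *)
Lemma du_bois_reymond v : loc_int v ->
  (forall psi, test_function psi -> \int[mu]_x (v x * derive1 psi x) = 0) ->
  forall a b, lebesgue_pt v a -> lebesgue_pt v b -> v a = v b.
Proof.
move=> lv Hv a b la lb.
apply/eqP; rewrite -subr_eq0 -normr_le0; apply/ler_addgt0Pl => e e0; rewrite addr0.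
have e20 : 0 < e / 2 by rewrite divr_gt0.
near (0 : R)^'+ => r.
have r0 : 0 < r by [].
have ri0 : 0 < r^-1 by rewrite invr_gt0.
have A1 : iint (a - r) (a + r) (fun x => `|v x - v a|) <= e / 2 * r.
  by near: r; exact: lebesgue_ptP.
have B1 : iint (b - r) (b + r) (fun x => `|v x - v b|) <= e / 2 * r.
  by near: r; exact: lebesgue_ptP.
have A2 := tent_average a lv r0; have B2 := tent_average b lv r0.
have A3 := le_trans A2 (ler_wpM2l (ltW ri0) A1).
have B3 := le_trans B2 (ler_wpM2l (ltW ri0) B1).
move: A3 B3; rewrite (_ : r^-1 * (e / 2 * r) = e / 2); last by field; rewrite gt_eqF.
set Ia := Rintegral _ _ _; set Ib := Rintegral _ _ _ => A3 B3.
suff E : Ia = Ib.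
  move: A3 B3; rewrite E => /ler_normlP[? ?] /ler_normlP[? ?].
  by apply/ler_normlP; split; lra.
have := Hv _ (test_step_difference a b r0).
set D := derive1 _.
have DE x : D x = r^-1 * tent (r^-1 * (x - a)) - r^-1 * tent (r^-1 * (x - b)).
  rewrite /D derive1E.
  by have := d_B (is_derive_step_scale a r^-1 x) (is_derive_step_scale b r^-1 x) => -[_ ->].
have supp c : forall x, ~~ (c - r <= x <= c + r) ->
    v x * (r^-1 * tent (r^-1 * (x - c))) = 0.
  move=> x xn; rewrite tent_out ?mulr0 // normrM gtr0_norm // mulrC ler_pdivlMr //.
  rewrite mul1r leNgt; apply/negP => H; move/negP: xn; apply.
  by move: H; rewrite ltr_distl => /andP[h1 h2]; apply/andP; split; lra.
pose M := `|a| + `|b| + r.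
have nM c x : `|c| <= `|a| + `|b| -> ~~ (- M <= x <= M) -> ~~ (c - r <= x <= c + r).
  move=> cab; apply: contra => /andP[h1 h2].
  have := ler_norm c; have := ler_norm (- c); rewrite normrN /M => ? ?.
  by apply/andP; split; lra.
have [na nb] : `|a| <= `|a| + `|b| /\ `|b| <= `|a| + `|b|.
  by rewrite lerDl lerDr.
have lt_ c : loc_int (fun x => v x * (r^-1 * tent (r^-1 * (x - c)))).
  under eq_fun do rewrite mulrC.
  by apply: loc_intMc => //; exact: tent_scale_continuous.
rewrite /Ia /Ib !(@Rint_support (- M) M); last 3 first.
- by move=> x /(nM b x nb); exact: supp.
- by move=> x /(nM a x na); exact: supp.
- move=> x xM; rewrite DE mulrBr.
  by rewrite (supp a) ?(supp b) ?subrr //; exact: nM.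
under eq_iint do rewrite DE mulrBr.
by rewrite iintB //; lra.
Unshelve. all: by end_near. Qed.

Lemma ex_lebesgue_pt v : loc_int v -> exists a, lebesgue_pt v a.
Proof.
move=> lv; have := lebesgue_differentiation (loc_int_locally_integrable lv).
have mu0 : (0 < mu [set: R])%E.
  have := @lebesgue_measure_itv R `[0, 1].
  rewrite /= lte_fin ltr01 oppr0 adde0 => E.
  apply: (@lt_le_trans _ _ 1%E); first exact: lte01.
  by rewrite -E; apply: le_measure; rewrite ?inE.
have := ae_properfilter_algebraOfSetsType mu0 => PF.
by move=> /filter_ex.
Qed.

(** The difference between the function and a primitive of its weak derivative
    has weak derivative zero; subtracting its value at one Lebesgue point, the
    lemma of du Bois-Reymond applies at almost every point. *)
Lemma has_wderivR_primitive f g : has_wderivR f g ->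
  exists2 u, primitive u g & {ae mu, forall x, f x = u x}.
Proof.
move=> [lf lg fg]; have lf' := locally_integrable_loc_int lf.
have [G Gg] := ex_primitive (locally_integrable_loc_int lg).
have lG := loc_int_cont (primitive_continuous Gg).
pose v := fun x => f x - G x.
have lv : loc_int v by exact: loc_intB.
have Hv psi : test_function psi -> \int[mu]_x (v x * derive1 psi x) = 0.
  move=> tpsi; have [_ _] := has_wderivRD (And3 lf lg fg) (primitiveZ (-1) Gg).
  move=> /(_ _ tpsi).
  have E1 : (fun x => (f x + -1 * G x) * derive1 psi x) = (fun x => v x * derive1 psi x).
    by apply/funext => x; rewrite mulN1r.
  have E2 : (fun x => (g x + -1 * g x) * psi x) = (fun=> 0).
    by apply/funext => x; rewrite mulN1r subrr mul0r.
  by rewrite E1 E2 Rintegral_cst // mul0r oppr0.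
have [a0 la0] := ex_lebesgue_pt lv.
exists (fun x => v a0 + G x).
  split; first exact: Gg.1.
  by move=> a b ab; rewrite -Gg.2 //; ring.
have := lebesgue_differentiation (loc_int_locally_integrable lv).
apply: ae_imply => x /(du_bois_reymond lv Hv la0) ->.
by rewrite /v subrK.
Qed.

Lemma iint0_ae h : loc_int h -> (forall a b, a <= b -> iint a b h = 0) ->
  {ae mu, forall x, h x = 0}.
Proof.
move=> lh h0.
have := lebesgue_differentiation (loc_int_locally_integrable lh).
apply: ae_imply => a la.
apply/eqP; rewrite -normr_le0; apply/ler_addgt0Pl => e e0; rewrite addr0.
near (0 : R)^'+ => r.
have r0 : 0 < r by [].
have A1 : iint (a - r) (a + r) (fun x => `|h x - h a|) <= e * r.
  by near: r; exact: lebesgue_ptP.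
have lc := @loc_int_cst R (h a).
have arr : a - r <= a + r by lra.
have := le_norm_iint (a - r) (a + r) (loc_intB lh lc).
rewrite iintB // h0 // iint_cst // sub0r normrN normrM.
rewrite (_ : a + r - (a - r) = 2 * r); last by ring.
rewrite (@ger0_norm _ (2 * r)); last by lra.
by move=> /le_trans/(_ A1); have := normr_ge0 (h a); nra.
Unshelve. all: by end_near. Qed.

Lemma has_wderivR_unique f g h : has_wderivR f g -> has_wderivR f h ->
  {ae mu, forall x, g x = h x}.
Proof.
move=> fg fh; have [_ lg _] := fg; have [_ lh _] := fh.
have lgh := loc_intB (locally_integrable_loc_int lg) (locally_integrable_loc_int lh).
have [H Hgh] := ex_primitive lgh.
have cH := primitive_continuous Hgh.
have lH := loc_int_cont cH.
have H0 psi : test_function psi -> \int[mu]_x (H x * derive1 psi x) = 0.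
  move=> tpsi; have [_ _ ->] // := primitive_has_wderivR Hgh.
  have := fg; have := fh; move=> [_ _ /(_ _ tpsi) E1] [_ _ /(_ _ tpsi) E2].
  have [dpsi cpsi [M HM]] := tpsi.
  have HN y : ~~ (- M <= y <= M) -> psi y = 0.
    by rewrite -ler_norml -ltNge; exact: HM.
  have cp := primitive_continuous (test_primitive tpsi).
  have LL w : loc_int w -> loc_int (fun x => w x * psi x).
    by move=> lw; under eq_fun do rewrite mulrC; exact: loc_intMc.
  move: E1 E2; set J := Rintegral _ _ _ => ->.
  rewrite !(@Rint_support (- M) M); try by move=> x /HN ->; rewrite mulr0.
  under [in iint _ _ (fun x => (_ - _) * _)]eq_iint do rewrite mulrBl.
  rewrite iintB; [|by apply: LL; exact: locally_integrable_loc_int..].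
  lra.
have HL a : lebesgue_pt H a.
  apply: (@continuous_lebesgue_pt _ _ _ setT) => //; last exact: cH.
    by split => //; exact: openT.
  exact: lH.1.
have Hc a b : H a = H b by exact: (du_bois_reymond lH H0).
have Z a b : a <= b -> iint a b (fun x => g x - h x) = 0.
  by move=> ab; rewrite -Hgh.2 // (Hc b a) subrr.
have := iint0_ae lgh Z; apply: ae_imply => x /eqP; rewrite subr_eq0 => /eqP; exact.
Qed.

End WeakDerivatives.

(** * Complex exponential and sine *)

Section ComplexNumbers.
Context {R : realType}.
Local Notation I := ((0 : R) +i* 1).
Local Notation nc := (@Normc.normc R).
Implicit Types (z w v : R[i]) (x y t k : R).

Lemma nc_ge0 z : 0 <= nc z.
Proof. by case: z => a b; exact: sqrtr_ge0. Qed.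

Lemma ncD z w : nc (z + w) <= nc z + nc w.
Proof. exact: (@le_normcD R z w). Qed.

Lemma ncN z : nc (- z) = nc z.
Proof. exact: (@normcN R z). Qed.

Lemma ncB z w : nc (z - w) <= nc z + nc w.
Proof. by rewrite -(ncN w); exact: ncD. Qed.

Lemma ncM z w : nc (z * w) = nc z * nc w.
Proof. exact: Normc.normcM. Qed.

Lemma ncV z : nc z^-1 = (nc z)^-1.
Proof. exact: Normc.normcV. Qed.

Lemma nc0 : nc 0 = 0. Proof. exact: Normc.normc0. Qed.

Lemma nc1 : nc 1 = 1. Proof. exact: Normc.normc1. Qed.

Lemma nc_real x : nc x%:C = `|x|.
Proof. by rewrite /= expr0n addr0 sqrtr_sqr. Qed.

Lemma ncE z : nc z ^+ 2 = Re z ^+ 2 + Im z ^+ 2.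
Proof. by case: z => a b; rewrite sqr_sqrtr // addr_ge0 ?sqr_ge0. Qed.

Lemma nc_eq0 z : nc z = 0 -> z = 0.
Proof. exact: Normc.eq0_normc. Qed.

Lemma nc_Re z : `|Re z| <= nc z.
Proof.
case: z => a b /=; rewrite -sqrtr_sqr ler_wsqrtr // lerDl; exact: sqr_ge0.
Qed.

Lemma nc_Im z : `|Im z| <= nc z.
Proof.
case: z => a b /=; rewrite -sqrtr_sqr ler_wsqrtr // lerDr; exact: sqr_ge0.
Qed.

Lemma nc_le_ReIm z : nc z <= `|Re z| + `|Im z|.
Proof.
have nb := normr_ge0 (Re z); have ni := normr_ge0 (Im z).
rewrite -[leRHS]ger0_norm ?addr_ge0 // -[leLHS]ger0_norm ?nc_ge0 //.
rewrite -ler_sqr ?nnegrE // !real_normK ?num_real // ncE.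
rewrite -(real_normK (num_real (Re z))) -(real_normK (num_real (Im z))); nra.
Qed.

Lemma nc_conj z : nc z^* = nc z.
Proof. by case: z => a b; rewrite /= sqrrN. Qed.

Lemma ncI : nc I = 1.
Proof. by rewrite /= expr0n expr1n add0r sqrtr1. Qed.

Lemma I_neq0 : I != 0 :> R[i].
Proof. by rewrite eq_complex /= negb_and oner_neq0 orbT. Qed.

Lemma ReD z w : Re (z + w) = Re z + Re w. Proof. by case: z w => ? ? []. Qed.
Lemma ImD z w : Im (z + w) = Im z + Im w. Proof. by case: z w => ? ? []. Qed.
Lemma ReN z : Re (- z) = - Re z. Proof. by case: z. Qed.
Lemma ImN z : Im (- z) = - Im z. Proof. by case: z. Qed.
Lemma ReB z w : Re (z - w) = Re z - Re w. Proof. by rewrite ReD ReN. Qed.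
Lemma ImB z w : Im (z - w) = Im z - Im w. Proof. by rewrite ImD ImN. Qed.
Lemma ReM z w : Re (z * w) = Re z * Re w - Im z * Im w.
Proof. by case: z w => ? ? []. Qed.
Lemma ImM z w : Im (z * w) = Re z * Im w + Im z * Re w.
Proof. by case: z w => ? ? []. Qed.
Lemma complex_ext z w : Re z = Re w -> Im z = Im w -> z = w.
Proof. by case: z w => a b [c d] /= -> ->. Qed.

Lemma cexpD z w : cexp (z + w) = cexp z * cexp w.
Proof.
rewrite /cexp ReD ImD expRD cosD sinD; apply: complex_ext; rewrite ?ReM ?ImM /=; ring.
Qed.

Lemma cexp0 : cexp (0 : R[i]) = 1.
Proof. by rewrite /cexp /= expR0 cos0 sin0 mulr1 mulr0. Qed.

Lemma nc_cexp z : nc (cexp z) = expR (Re z).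
Proof.
apply/eqP; rewrite -(eqrXn2 (n := 2)) ?nc_ge0 ?expR_ge0 // ncE /= !exprMn.
by rewrite -mulrDr cos2Dsin2 mulr1.
Qed.

Lemma cexp_neq0 z : cexp z != 0.
Proof.
apply/eqP => /(congr1 nc); rewrite nc_cexp nc0 => E.
by have := expR_gt0 (Re z); rewrite E ltxx.
Qed.

Definition ccos z : R[i] := (cexp (I * z) + cexp (- (I * z))) / 2%:R.

Lemma two_neq0 : (2%:R : R[i]) != 0.
Proof. by rewrite pnatr_eq0. Qed.

Lemma csinD z w : csin (z + w) = csin z * ccos w + ccos z * csin w.
Proof.
rewrite /csin /ccos mulrDr opprD !cexpD; field.
exact: I_neq0.
Qed.

Lemma csinN z : csin (- z) = - csin z.
Proof. by rewrite /csin mulrN opprK -opprB mulNr. Qed.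

Lemma csin_real x : csin x%:C = (sin x)%:C.
Proof.
rewrite /csin.
have -> : I * x%:C = 0 +i* x by apply: complex_ext; rewrite ?ReM ?ImM /=; ring.
rewrite /cexp /= oppr0 expR0 cosN sinN !mul1r.
have -> : (cos x +i* sin x) - (cos x +i* - sin x) = (2%:R * I) * (sin x)%:C :> R[i].
  have -> : (2%:R : R[i]) = 2%:R%:C by rewrite rmorph_nat.
  by apply: complex_ext; rewrite ?ReM ?ImM /= ?ReM ?ImM /=; ring.
rewrite mulrC mulrA mulVf ?mul1r // mulf_neq0 ?I_neq0 ?two_neq0 //.
Qed.

Lemma ccos_real x : ccos x%:C = (cos x)%:C.
Proof.
rewrite /ccos.
have -> : I * x%:C = 0 +i* x by apply: complex_ext; rewrite ?ReM ?ImM /=; ring.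
rewrite /cexp /= oppr0 expR0 cosN sinN !mul1r.
have -> : (cos x +i* sin x) + (cos x +i* - sin x) = 2%:R * (cos x)%:C :> R[i].
  have -> : (2%:R : R[i]) = 2%:R%:C by rewrite rmorph_nat.
  by apply: complex_ext; rewrite ?ReM ?ImM /=; ring.
by rewrite mulrC mulrA mulVf ?mul1r ?two_neq0.
Qed.

(** The mean value theorem, applied to each component along the segment. *)
Lemma complex_increment (F dF : R -> R[i]) (B : R) :
  (forall t, 0 <= t <= 1 -> is_derive t 1 (fun s => Re (F s)) (Re (dF t))) ->
  (forall t, 0 <= t <= 1 -> is_derive t 1 (fun s => Im (F s)) (Im (dF t))) ->
  (forall t, 0 <= t <= 1 -> nc (dF t) <= B) ->
  nc (F 1 - F 0) <= 2 * B.
Proof.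
move=> DR DI HB.
have bt t : (t - 0) * (t - 1) <= 0 -> 0 <= t <= 1.
  rewrite subr0 => H; apply/andP; split; nra.
have [t1 /bt h1 E1] := @MVT_between R _ _ 0 1 (fun t ht => DR t (bt _ ht)).
have [t2 /bt h2 E2] := @MVT_between R _ _ 0 1 (fun t ht => DI t (bt _ ht)).
apply: (le_trans (nc_le_ReIm _)).
rewrite ReB ImB E1 E2 subr0 !mulr1.
have := le_trans (nc_Re _) (HB _ h1); have := le_trans (nc_Im _) (HB _ h2).
lra.
Qed.

Lemma cexp_line_derive z v t :
  is_derive t 1 (fun s => Re (cexp (z + s%:C * v))) (Re (cexp (z + t%:C * v) * v)) /\
  is_derive t 1 (fun s => Im (cexp (z + s%:C * v))) (Im (cexp (z + t%:C * v) * v)).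
Proof.
have DR : is_derive t 1 (fun s => Re z + s * Re v) (Re v).
  by apply: d_eq (d_D (d_cst _ _) (d_M (d_id _) (d_cst _ _))) _; ring.
have DI : is_derive t 1 (fun s => Im z + s * Im v) (Im v).
  by apply: d_eq (d_D (d_cst _ _) (d_M (d_id _) (d_cst _ _))) _; ring.
have ER s : Re (z + s%:C * v) = Re z + s * Re v by rewrite ReD ReM /=; ring.
have EI s : Im (z + s%:C * v) = Im z + s * Im v by rewrite ImD ImM /=; ring.
have De := d_comp DR (is_derive_expR (Re z + t * Re v)).
have Dc := d_comp DI (is_derive_cos (Im z + t * Im v)).
have Ds := d_comp DI (is_derive_sin (Im z + t * Im v)).
split.
  apply: d_ext (d_eq (d_M De Dc) _) => [s|]; rewrite /cexp /= ?ReM /= ?ER ?EI //; ring.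
apply: d_ext (d_eq (d_M De Ds) _) => [s|]; rewrite /cexp /= ?ImM /= ?ER ?EI //; ring.
Qed.

Lemma expR1_le4 : expR 1 <= 4 :> R.
Proof.
have H : 2^-1 <= expR (- 2^-1) :> R by have := expR_ge1Dx (- 2^-1 : R); lra.
have E : expR (2^-1) <= 2 :> R.
  have E1 : expR 2^-1 * expR (- 2^-1) = 1 :> R by rewrite -expRD subrr expR0.
  by have := expR_gt0 (2^-1 : R); nra.
have -> : expR 1 = expR 2^-1 * expR 2^-1 :> R by rewrite -expRD; congr expR; field.
by have := expR_gt0 (2^-1 : R); nra.
Qed.

Lemma nc_cexp_le4 z : nc z <= 1 -> nc (cexp z) <= 4.
Proof.
move=> z1; rewrite nc_cexp; apply: le_trans expR1_le4; rewrite ler_expR.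
by apply: le_trans (ler_norm _) _; exact: le_trans (nc_Re z) z1.
Qed.

Lemma cexp_sub1 z : nc z <= 1 -> nc (cexp z - 1) <= 8 * nc z.
Proof.
move=> z1.
have := @complex_increment (fun t => cexp (0 + t%:C * z))
  (fun t => cexp (0 + t%:C * z) * z) (4 * nc z).
rewrite mul1r mul0r !add0r cexp0 mulrA (_ : 2 * 4 = 8); last by ring.
apply.
- by move=> t _; case: (cexp_line_derive 0 z t).
- by move=> t _; case: (cexp_line_derive 0 z t).
move=> t /andP[t0 t1]; rewrite ncM add0r ler_wpM2r ?nc_ge0 //.
apply: nc_cexp_le4; rewrite ncM nc_real ger0_norm //.
by have := nc_ge0 z; nra.
Qed.

(** Second-order remainder in difference form: the derivative of
    [cexp z - z] is [cexp z - 1], of size at most [8 |z|] on the segment. *)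
Lemma cexp_linearization z w : nc z <= 1 -> nc w <= 1 ->
  nc (cexp z - cexp w - (z - w)) <= 16 * (nc z + nc w) * nc (z - w).
Proof.
move=> z1 w1; have [v vE] : exists v, v = z - w by exists (z - w).
rewrite -vE.
have := @complex_increment (fun t => cexp (w + t%:C * v) - t%:C * v)
  (fun t => cexp (w + t%:C * v) * v - v) (8 * (nc z + nc w) * nc v).
rewrite mul1r mul0r !addr0 subr0 (_ : w + v = z); last by rewrite vE addrC subrK.
rewrite (_ : cexp z - v - cexp w = cexp z - cexp w - v); last by rewrite addrAC.
rewrite !mulrA (_ : 2 * 8 = 16); last by ring.
apply.
- move=> t _; have [D _] := cexp_line_derive w v t.
  apply: d_ext (d_eq (d_B D (d_M (d_id t) (d_cst (Re v) t))) _) => [s|].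
    by rewrite ReB [X in _ = _ - X]ReM /= mul0r subr0.
  by rewrite ReB; ring.
- move=> t _; have [_ D] := cexp_line_derive w v t.
  apply: d_ext (d_eq (d_B D (d_M (d_id t) (d_cst (Im v) t))) _) => [s|].
    by rewrite ImB [X in _ = _ - X]ImM /= mul0r addr0.
  by rewrite ImB; ring.
move=> t /andP[t0 t1].
have -> : cexp (w + t%:C * v) * v - v = (cexp (w + t%:C * v) - 1) * v.
  by rewrite mulrBl mul1r.
rewrite ncM ler_wpM2r ?nc_ge0 //.
have E : w + t%:C * v = (1 - t)%:C * w + t%:C * z.
  by apply: complex_ext; rewrite vE ?ReD ?ImD ?ReM ?ImM ?ReB ?ImB /=; ring.
have H : nc (w + t%:C * v) <= (1 - t) * nc w + t * nc z.
  by rewrite E; apply: (le_trans (ncD _ _)); rewrite !ncM !nc_real !ger0_norm // subr_ge0.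
have h0 := nc_ge0 z; have h1 := nc_ge0 w.
apply: le_trans (cexp_sub1 _) _; first by nra.
by rewrite ler_pM2l //; nra.
Qed.

Lemma nc2 : nc 2%:R = 2.
Proof. by rewrite -(rmorph_nat (real_complex R)) nc_real ger0_norm. Qed.

Lemma csin_linearization z w : nc z <= 1 -> nc w <= 1 ->
  nc (csin z - csin w - (z - w)) <= 16 * (nc z + nc w) * nc (z - w).
Proof.
move=> z1 w1.
have N1 u : nc (I * u) = nc u by rewrite ncM ncI mul1r.
have N2 u : nc (- (I * u)) = nc u by rewrite ncN N1.
have A := @cexp_linearization (I * z) (I * w); rewrite !N1 -mulrBr N1 in A.
have B := @cexp_linearization (- (I * z)) (- (I * w)).
have EB : - (I * z) - - (I * w) = I * (w - z) by ring.
rewrite EB !N2 N1 -(opprB z w) ncN (opprB z w) in B.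
have -> : csin z - csin w - (z - w) =
  ((cexp (I * z) - cexp (I * w) - I * (z - w)) -
   (cexp (- (I * z)) - cexp (- (I * w)) - I * (w - z))) / (2%:R * I).
  by rewrite /csin; field; exact: I_neq0.
rewrite ncM ncV ncM ncI nc2 mulr1 ler_pdivrMr //.
apply: (le_trans (ncB _ _)); have := A z1 w1; have := B z1 w1.
lra.
Qed.

Lemma ccos_lipschitz z w : nc z <= 1 -> nc w <= 1 ->
  nc (ccos z - ccos w) <= 16 * (nc z + nc w) * nc (z - w).
Proof.
move=> z1 w1.
have N1 u : nc (I * u) = nc u by rewrite ncM ncI mul1r.
have N2 u : nc (- (I * u)) = nc u by rewrite ncN N1.
have A := @cexp_linearization (I * z) (I * w); rewrite !N1 -mulrBr N1 in A.
have B := @cexp_linearization (- (I * z)) (- (I * w)).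
have EB : - (I * z) - - (I * w) = I * (w - z) by ring.
rewrite EB !N2 N1 -(opprB z w) ncN (opprB z w) in B.
have -> : ccos z - ccos w =
  ((cexp (I * z) - cexp (I * w) - I * (z - w)) +
   (cexp (- (I * z)) - cexp (- (I * w)) - I * (w - z))) / 2%:R.
  by rewrite /ccos; field.
rewrite ncM ncV nc2 ler_pdivrMr //.
apply: (le_trans (ncD _ _)); have := A z1 w1; have := B z1 w1.
lra.
Qed.

End ComplexNumbers.

(** * Complex square-integrable and Sobolev functions *)

Section ComplexL2.
Context {R : realType}.
Local Notation mu := (@lebesgue_measure R).
Local Notation nc := (@Normc.normc R).
Implicit Types (u v g h : R -> R[i]) (f : R -> R) (x y A : R).

Definition cmeasurable u :=
  measurable_fun [set: R] (fun x => Re (u x)) /\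
  measurable_fun [set: R] (fun x => Im (u x)).

Definition csq u := cmeasurable u /\ sq [set: R] (fun x => nc (u x)).
Definition cn2 u : R := n2 [set: R] (fun x => nc (u x)).

Lemma measurable_nc u : cmeasurable u -> measurable_fun [set: R] (fun x => nc (u x)).
Proof.
move=> [mr mi].
have -> : (fun x => nc (u x)) = (fun x => Num.sqrt (Re (u x) ^+ 2 + Im (u x) ^+ 2)).
  by apply/funext => x; case: (u x).
apply: measurableT_comp; first exact: (continuous_measurable_fun (@sqrt_continuous R)).
by apply: measurable_funD; exact: measurable_funX.
Qed.

Lemma cmeasurableD u v : cmeasurable u -> cmeasurable v -> cmeasurable (fun x => u x + v x).
Proof.
move=> [a b] [c d]; split.
  by under eq_fun do rewrite ReD; exact: measurable_funD.
by under eq_fun do rewrite ImD; exact: measurable_funD.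
Qed.

Lemma cmeasurableN u : cmeasurable u -> cmeasurable (fun x => - u x).
Proof.
move=> [a b]; split.
  by under eq_fun do rewrite ReN; exact: measurable_funN.
by under eq_fun do rewrite ImN; exact: measurable_funN.
Qed.

Lemma cmeasurableB u v : cmeasurable u -> cmeasurable v -> cmeasurable (fun x => u x - v x).
Proof. by move=> mu_ mv; apply: cmeasurableD => //; exact: cmeasurableN. Qed.

Lemma cmeasurableM u v : cmeasurable u -> cmeasurable v -> cmeasurable (fun x => u x * v x).
Proof.
move=> [a b] [c d]; split.
  by under eq_fun do rewrite ReM; apply: measurable_funB; exact: measurable_funM.
by under eq_fun do rewrite ImM; apply: measurable_funD; exact: measurable_funM.
Qed.

Lemma cmeasurable_cst (z : R[i]) : cmeasurable (fun=> z).
Proof. by split. Qed.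

Lemma cmeasurable_real f : measurable_fun [set: R] f -> cmeasurable (toC f).
Proof. by move=> mf; split => //=; exact: measurable_cst. Qed.

Lemma cmeasurable_cexp u : cmeasurable u -> cmeasurable (fun x => cexp (u x)).
Proof.
move=> [a b]; split => /=; apply: measurable_funM.
- by apply: measurableT_comp => //; exact: measurable_expR.
- by apply: measurableT_comp => //; apply: continuous_measurable_fun; exact: continuous_cos.
- by apply: measurableT_comp => //; exact: measurable_expR.
- by apply: measurableT_comp => //; apply: continuous_measurable_fun; exact: continuous_sin.
Qed.

Lemma cmeasurable_csin u : cmeasurable u -> cmeasurable (fun x => csin (u x)).
Proof.
move=> m; apply: cmeasurableM; last exact: cmeasurable_cst.
have mi : cmeasurable (fun x => (0 +i* 1) * u x).
  by apply: cmeasurableM => //; exact: cmeasurable_cst.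
by apply: cmeasurableB; apply: cmeasurable_cexp => //; exact: cmeasurableN.
Qed.

Lemma csq_bound u f A : cmeasurable u -> sq [set: R] f -> n2 [set: R] f <= A ->
  (forall x, nc (u x) <= f x) -> csq u /\ cn2 u <= A.
Proof.
move=> mu_ sf fA uf.
have [|s n] := sq_bound (measurable_nc mu_) sf fA.
  by move=> x _; rewrite ger0_norm ?nc_ge0.
by split => //; split.
Qed.

Lemma csqD u v : csq u -> csq v ->
  csq (fun x => u x + v x) /\ cn2 (fun x => u x + v x) <= cn2 u + cn2 v.
Proof.
move=> [mu_ su] [mv sv]; have [s n] := sqD su sv.
apply: (csq_bound _ s n); first exact: cmeasurableD.
by move=> x; exact: ncD.
Qed.

Lemma csqN u : csq u -> csq (fun x => - u x) /\ cn2 (fun x => - u x) = cn2 u.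
Proof.
move=> [mu_ su]; have E : (fun x => nc (- u x)) = (fun x => nc (u x)).
  by apply/funext => x; rewrite ncN.
by split; [split; [exact: cmeasurableN|rewrite E]|rewrite /cn2 E].
Qed.

Lemma csqB u v : csq u -> csq v ->
  csq (fun x => u x - v x) /\ cn2 (fun x => u x - v x) <= cn2 u + cn2 v.
Proof. by move=> su /csqN[sv <-]; exact: csqD. Qed.

Lemma csq_real f : csq (toC f) <-> sq [set: R] f.
Proof.
have E : (fun x => nc (toC f x)) = (fun x => `|f x|).
  by apply/funext => x; rewrite /toC nc_real.
split=> [[[mf _] [mD _ i]]|sf].
  split; [exact: mD|exact: mf|].
  move: i; congr (integrable_on _ _).
  by apply/funext => x; rewrite /toC nc_real real_normK ?num_real.
split; last by rewrite E; case: (sq_norm sf).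
by apply: cmeasurable_real; case: sf.
Qed.

Lemma cn2_real f : cn2 (toC f) = n2 [set: R] f.
Proof.
rewrite /cn2 /n2; congr Num.sqrt; congr Rintegral.
by apply/funext => x; rewrite /toC nc_real real_normK ?num_real.
Qed.

Lemma sq_ReIm u : csq u ->
  [/\ sq [set: R] (fun x => Re (u x)), sq [set: R] (fun x => Im (u x)),
      n2 [set: R] (fun x => Re (u x)) <= cn2 u & n2 [set: R] (fun x => Im (u x)) <= cn2 u].
Proof.
move=> [[mr mi] s].
have [sr nr] : sq [set: R] (fun x => Re (u x)) /\ n2 [set: R] (fun x => Re (u x)) <= cn2 u.
  by apply: (sq_bound mr s) => // x _; exact: nc_Re.
have [si ni] : sq [set: R] (fun x => Im (u x)) /\ n2 [set: R] (fun x => Im (u x)) <= cn2 u.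
  by apply: (sq_bound mi s) => // x _; exact: nc_Im.
by [].
Qed.

Lemma Lnorm2E f : ('N[mu]_2%:E [EFin \o f] = (\int[mu]_x (f x ^+ 2)%:E) `^ 2^-1)%E.
Proof.
rewrite unlock; congr poweR; apply: eq_integral => x _ /=.
by rewrite powR_mulrn // real_normK ?num_real.
Qed.

Lemma integral_abse_sqr f :
  (\int[mu]_x `|(EFin \o (fun y => f y ^+ 2)%R) x| = \int[mu]_x (f x ^+ 2)%:E)%E.
Proof. by apply: eq_integral => x _ /=; rewrite ger0_norm ?sqr_ge0. Qed.

Lemma inL2_csq u : inL2 u <-> csq u.
Proof.
have P0 : (0 <= \int[mu]_x (nc (u x) ^+ 2)%:E)%E.
  by apply: integral_ge0 => x _; rewrite lee_fin sqr_ge0.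
split.
  move=> [mr mi]; rewrite Lnorm2E => H.
  have m : cmeasurable u by [].
  have mn := measurable_nc m.
  split => //; split => //.
  apply/integrableP; split; first by apply/measurable_EFinP; exact: measurable_funX.
  rewrite integral_abse_sqr ltey; apply/eqP => E; move: H.
  rewrite (_ : (\int[mu]_x ((nc \o u) x ^+ 2)%:E = +oo)%E) //.
  by rewrite poweRyr ?invr_eq0 ?pnatr_eq0.
move=> [[mr mi] [_ mn i]]; split => //; rewrite Lnorm2E.
apply: poweR_lty; have /integrableP[_] := i.
by rewrite integral_abse_sqr.
Qed.

Lemma L2normE u : csq u -> L2norm u = cn2 u.
Proof.
move=> [_ [_ mn i]]; rewrite /L2norm Lnorm2E /cn2 /n2 /Rintegral.
have f := integrable_fin_num measurableT i.
rewrite -[X in fine (X `^ _)]fineK // /= -/(Num.sqrt _).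
rewrite powR12_sqrt // fine_ge0 //.
by apply: integral_ge0 => x _; rewrite lee_fin sqr_ge0.
Qed.

Lemma sq_ae (f f' : R -> R) : measurable_fun [set: R] f' -> {ae mu, forall x, f x = f' x} ->
  sq [set: R] f -> sq [set: R] f' /\ n2 [set: R] f' = n2 [set: R] f.
Proof.
move=> mf' ff' [mD mf i].
have E : ae_eq mu setT (fun x => (f x ^+ 2)%:E) (fun x => (f' x ^+ 2)%:E).
  by apply: ae_imply ff' => x -> _.
have M : measurable_fun [set: R] (fun x => (f x ^+ 2)%:E).
  by apply/measurable_EFinP; exact: measurable_funX.
have M' : measurable_fun [set: R] (fun x => (f' x ^+ 2)%:E).
  by apply/measurable_EFinP; exact: measurable_funX.
have EI : (\int[mu]_x (f x ^+ 2)%:E = \int[mu]_x (f' x ^+ 2)%:E)%E.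
  by apply: ae_eq_integral.
split; last by rewrite /n2 /Rintegral EI.
split => //; apply/integrableP; split; first exact: M'.
move/integrableP: i => [_]; rewrite !integral_abse_sqr.
by rewrite EI.
Qed.

Lemma csq_ae u v : cmeasurable v -> aeq u v -> csq u -> csq v /\ cn2 v = cn2 u.
Proof.
move=> mv uv [mu_ su].
have [|s n] := sq_ae (measurable_nc mv) _ su; last by split => //; split.
by apply: ae_imply uv => x ->.
Qed.

Lemma aeq_sym u v : aeq u v -> aeq v u.
Proof. by apply: ae_imply => x ->. Qed.

Definition cprimitive u g :=
  primitive (fun x => Re (u x)) (fun x => Re (g x)) /\
  primitive (fun x => Im (u x)) (fun x => Im (g x)).

Lemma cprimitive_measurable u g : cprimitive u g -> cmeasurable u.
Proof.
by move=> [a b]; split; apply: continuous_measurable_fun;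
   [exact: primitive_continuous a|exact: primitive_continuous b].
Qed.

Lemma cprimitive_measurable_deriv u g : cprimitive u g -> cmeasurable g.
Proof. by move=> [[[a _] _] [[b _] _]]. Qed.

Lemma cprimitiveD u v g h : cprimitive u g -> cprimitive v h ->
  cprimitive (fun x => u x + v x) (fun x => g x + h x).
Proof.
move=> [a b] [c d]; split.
  by apply: eq_primitive (primitiveD a c) => x; rewrite ReD.
by apply: eq_primitive (primitiveD b d) => x; rewrite ImD.
Qed.

Lemma cprimitiveB u v g h : cprimitive u g -> cprimitive v h ->
  cprimitive (fun x => u x - v x) (fun x => g x - h x).
Proof.
move=> [a b] [c d]; split.
  by apply: eq_primitive (primitiveB a c) => x; rewrite ReB.
by apply: eq_primitive (primitiveB b d) => x; rewrite ImB.
Qed.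

Lemma cprimitive_real (f g : R -> R) : primitive f g -> cprimitive (toC f) (toC g).
Proof.
move=> fg; split => //=; split; first exact: loc_int_cst.
by move=> a b ab; rewrite iint_cst // mul0r subrr.
Qed.

Lemma iint_ae (f f' : R -> R) a b : loc_int f -> loc_int f' ->
  {ae mu, forall x, f x = f' x} -> iint a b f = iint a b f'.
Proof.
move=> [mf _] [mf' _] E; rewrite /iint /Rintegral; congr fine.
apply: ae_eq_integral => //.
- by apply/measurable_EFinP; exact: measurable_funS mf.
- by apply/measurable_EFinP; exact: measurable_funS mf'.
- by apply: ae_imply E => x -> _.
Qed.

Lemma loc_int_ae (f f' : R -> R) : loc_int f -> measurable_fun [set: R] f' ->
  {ae mu, forall x, f x = f' x} -> loc_int f'.
Proof.
move=> [mf fi] mf' E; split => // a b; apply/integrableP; split.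
  by apply/measurable_EFinP; exact: measurable_funS mf'.
have /integrableP[_] := fi a b.
congr (_ < _)%E; apply: ae_eq_integral => //.
- apply: measurableT_comp => //; apply/measurable_EFinP; exact: measurable_funS mf.
- apply: measurableT_comp => //; apply/measurable_EFinP; exact: measurable_funS mf'.
- by apply: ae_imply E => x /= -> _.
Qed.

Lemma cprimitive_ae u g h : cprimitive u g -> cmeasurable h -> aeq g h -> cprimitive u h.
Proof.
move=> [[la ea] [lb eb]] [mr mi] gh.
have ghr : {ae mu, forall x, Re (g x) = Re (h x)} by apply: ae_imply gh => x ->.
have ghi : {ae mu, forall x, Im (g x) = Im (h x)} by apply: ae_imply gh => x ->.
have lr := loc_int_ae la mr ghr; have li := loc_int_ae lb mi ghi.
split; split => // a b ab; first by rewrite ea //; exact: iint_ae.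
by rewrite eb //; exact: iint_ae.
Qed.

Lemma cprimitive_has_wderiv u g : cprimitive u g -> has_wderiv u g.
Proof. by move=> [a b]; split; exact: primitive_has_wderivR. Qed.

Lemma has_wderiv_measurable u g : has_wderiv u g -> cmeasurable g.
Proof. by move=> [[_ [a _ _] _] [_ [b _ _] _]]. Qed.

Lemma has_wderiv_wderiv u g : has_wderiv u g -> has_wderiv u (wderiv u).
Proof.
move=> ug; have : [set h | has_wderiv u h] (wderiv u) by apply: xgetI ug.
by [].
Qed.

Lemma has_wderiv_unique u g h : has_wderiv u g -> has_wderiv u h -> aeq g h.
Proof.
move=> [a b] [c d]; have A := has_wderivR_unique a c; have B := has_wderivR_unique b d.
by apply: ae_imply2 A B => x; exact: complex_ext.
Qed.

Lemma wderiv_aeq u g : has_wderiv u g -> aeq (wderiv u) g.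
Proof. by move=> ug; apply: has_wderiv_unique (ug); exact: has_wderiv_wderiv ug. Qed.

Lemma has_wderiv_primitive u g : has_wderiv u g ->
  exists2 v, cprimitive v g & aeq u v.
Proof.
move=> [/has_wderivR_primitive[a ag ua] /has_wderivR_primitive[b bg ub]].
exists (fun x => a x +i* b x) => //.
by apply: ae_imply2 ua ub => x ? ?; exact: complex_ext.
Qed.

Lemma has_wderivD u v g h : has_wderiv u g -> cprimitive v h ->
  has_wderiv (fun x => u x + v x) (fun x => g x + h x).
Proof.
move=> [a b] [c d]; split.
  have := has_wderivRD a c.
  by congr has_wderivR; apply/funext => x; rewrite ReD.
have := has_wderivRD b d.
by congr has_wderivR; apply/funext => x; rewrite ImD.
Qed.

Lemma inH1_csq u : inH1 u ->
  [/\ csq u, csq (wderiv u), L2norm u = cn2 u, L2norm (wderiv u) = cn2 (wderiv u) &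
      has_wderiv u (wderiv u)].
Proof.
move=> [/inL2_csq su [g [ug /inL2_csq sg]]].
have W := has_wderiv_wderiv ug.
have [sw _] := csq_ae (has_wderiv_measurable W) (aeq_sym (wderiv_aeq ug)) sg.
by split => //; exact: L2normE.
Qed.

Lemma cprimitive_inH1 u g : cprimitive u g -> csq u -> csq g ->
  inH1 u /\ L2norm (wderiv u) = cn2 g.
Proof.
move=> ug su sg; have W := cprimitive_has_wderiv ug; split.
  by split; [exact/inL2_csq|exists g; split => //; exact/inL2_csq].
have W' := has_wderiv_wderiv W.
have [sw n] := csq_ae (has_wderiv_measurable W') (aeq_sym (wderiv_aeq W)) sg.
by rewrite L2normE.
Qed.

Lemma H1L2norm_ge u v : [/\ L2norm u <= H1L2norm u v, L2norm (wderiv u) <= H1L2norm u v &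
  L2norm v <= H1L2norm u v].
Proof.
have L (a : R) : a <= Num.sqrt (a ^+ 2) by rewrite sqrtr_sqr ler_norm.
have a0 := sqr_ge0 (L2norm u); have b0 := sqr_ge0 (L2norm (wderiv u)).
have c0 := sqr_ge0 (L2norm v).
by split; apply: (le_trans (L _)); rewrite /H1L2norm ler_wsqrtr //; lra.
Qed.

Lemma L2norm_ge0 u : 0 <= L2norm u.
Proof. by rewrite fine_ge0 // Lnorm_ge0. Qed.

Lemma H1L2norm_le u v : H1L2norm u v <= L2norm u + L2norm (wderiv u) + L2norm v.
Proof.
have a0 := L2norm_ge0 u; have b0 := L2norm_ge0 (wderiv u); have c0 := L2norm_ge0 v.
rewrite /H1L2norm -[leRHS]ger0_norm ?addr_ge0 // -sqrtr_sqr ler_wsqrtr //.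
by nra.
Qed.

(** The value at [x] differs from the average over [x, x + 1] by at most the
    integral of the derivative over that interval. *)
Lemma sup_le_n2 (f g : R -> R) x : primitive f g -> sq [set: R] f -> sq [set: R] g ->
  `|f x| <= n2 [set: R] f + n2 [set: R] g.
Proof.
move=> fg sf sg.
have x1 : x <= x + 1 by lra.
have lf := loc_int_cont (primitive_continuous fg).
have B (h : R -> R) : sq [set: R] h -> loc_int h -> iint x (x + 1) (fun y => `|h y|) <= n2 [set: R] h.
  move=> sh lh; have [s n] := @sqS R `[x, x + 1] setT h (measurable_itv _) (@subsetT _ _) sh.
  have s1 : sq `[x, x + 1] (fun=> 1 : R).
    split => //; have -> : (fun _ : R => (1 : R) ^+ 2) = (fun=> 1).
      by apply/funext => y; rewrite expr1n.
    exact: (loc_int_on x (x + 1) (loc_int_cst 1)).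
  have n1 : n2 `[x, x + 1] (fun=> 1 : R) = 1.
    rewrite /n2 -/(iint _ _ _) (@eq_iint _ _ _ _ (fun=> 1)) => [|y _]; last by rewrite expr1n.
    by rewrite iint_cst // mul1r (addrC x) addrK sqrtr1.
  have [_] := cauchy_schwarz s s1.
  rewrite n1 mulr1 => H; apply: le_trans n; apply: le_trans H.
  rewrite le_eqVlt; apply/orP; left; apply/eqP; apply: eq_iint => y _.
  by rewrite mulr1.
have lg := fg.1; have lng := loc_int_norm lg.
have -> : `|f x| = iint x (x + 1) (fun=> `|f x|).
  by rewrite iint_cst // (addrC x) addrK mulr1.
apply: (@le_trans _ _ (iint x (x + 1) (fun y => `|f y| + iint x (x + 1) (fun t => `|g t|)))).
  apply: le_iint; [exact: loc_int_cst| |].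
    by apply: loc_intD; [exact: loc_int_norm|exact: loc_int_cst].
  move=> y /andP[xy yx].
  have : `|f y - f x| <= iint x (x + 1) (fun t => `|g t|).
    by apply: (le_trans (primitive_incr fg xy)); apply: le_iint_itv.
  have := ler_normB (f y) (f y - f x).
  rewrite opprB addrC subrK; lra.
rewrite iintD; [|exact: loc_int_norm|exact: loc_int_cst].
rewrite iint_cst // (addrC x) addrK mulr1 (addrC 1).
by apply: lerD; exact: B.
Qed.

Lemma csup_le_cn2 u g x : cprimitive u g -> csq u -> csq g ->
  nc (u x) <= 2 * (cn2 u + cn2 g).
Proof.
move=> [a b] su sg; have [s1 s2 n1 n2_] := sq_ReIm su; have [t1 t2 m1 m2] := sq_ReIm sg.
have := sup_le_n2 x a s1 t1; have := sup_le_n2 x b s2 t2.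
have := nc_le_ReIm (u x); lra.
Qed.

End ComplexL2.

(** * Hyperbolic functions *)

Section Hyperbolic.
Context {R : realType}.
Implicit Types (x y : R).

Definition sinh y : R := (expR y - expR (- y)) / 2.
Definition sech y : R := (cosh y)^-1.
Definition tanh y : R := sinh y / cosh y.

Lemma cosh_gt0 y : 0 < cosh y.
Proof. by rewrite divr_gt0 ?addr_gt0 ?expR_gt0. Qed.

Lemma cosh_neq0 y : cosh y != 0. Proof. by rewrite gt_eqF ?cosh_gt0. Qed.

Lemma expRNM y : expR y * expR (- y) = 1.
Proof. by rewrite -expRD subrr expR0. Qed.

Lemma cosh2Bsinh2 y : cosh y ^+ 2 - sinh y ^+ 2 = 1.
Proof. by rewrite /cosh /sinh -[RHS](expRNM y); field. Qed.

Lemma cosh_ge1 y : 1 <= cosh y.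
Proof. have := cosh2Bsinh2 y; have := cosh_gt0 y; nra. Qed.

Lemma sech_gt0 y : 0 < sech y. Proof. by rewrite invr_gt0 cosh_gt0. Qed.

Lemma sech_le1 y : sech y <= 1.
Proof. by rewrite invf_le1 ?cosh_gt0 // cosh_ge1. Qed.

Lemma sech0 : sech 0 = 1.
Proof. by rewrite /sech /cosh oppr0 expR0; field. Qed.

Lemma coshN y : cosh (- y) = cosh y.
Proof. by rewrite /cosh opprK addrC. Qed.

Lemma sechN y : sech (- y) = sech y. Proof. by rewrite /sech coshN. Qed.

Lemma sinhN y : sinh (- y) = - sinh y.
Proof. by rewrite /sinh opprK -mulNr opprB. Qed.

Lemma tanhN y : tanh (- y) = - tanh y.
Proof. by rewrite /tanh coshN sinhN mulNr. Qed.

Lemma sech2Dtanh2 y : sech y ^+ 2 + tanh y ^+ 2 = 1.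
Proof.
have E : 1 + sinh y ^+ 2 = cosh y ^+ 2 by rewrite -(cosh2Bsinh2 y) subrK.
rewrite /sech /tanh exprMn exprVn -[X in X + _]mul1r -mulrDl E divff //.
by rewrite expf_neq0 // cosh_neq0.
Qed.

Lemma tanh_le1 y : `|tanh y| <= 1.
Proof.
rewrite -(@expr_le1 _ 2) // real_normK ?num_real //.
have := sech2Dtanh2 y; have := sqr_ge0 (sech y); lra.
Qed.

Lemma d_expRN y : is_derive y 1 (fun s => expR (- s)) (- expR (- y)).
Proof. by apply: d_eq (d_comp (d_N (d_id y)) (is_derive_expR _)) _; ring. Qed.

Lemma d_cosh y : is_derive y 1 (@cosh R) (sinh y).
Proof.
apply: d_ext (d_eq (d_Z 2^-1 (d_D (is_derive_expR y) (d_expRN y))) _).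
  by move=> s; rewrite mulrC.
by rewrite /sinh mulrC.
Qed.

Lemma d_sinh y : is_derive y 1 sinh (cosh y).
Proof.
apply: d_ext (d_eq (d_Z 2^-1 (d_B (is_derive_expR y) (d_expRN y))) _).
  by move=> s; rewrite mulrC.
by rewrite /cosh opprK mulrC.
Qed.

Lemma d_sech y : is_derive y 1 sech (- (tanh y * sech y)).
Proof.
apply: d_eq (d_V (cosh_neq0 y) (d_cosh y)) _.
by rewrite /tanh /sech; field; exact: cosh_neq0.
Qed.

Lemma d_tanh y : is_derive y 1 tanh (sech y ^+ 2).
Proof.
apply: d_eq (d_M (d_sinh y) (d_V (cosh_neq0 y) (d_cosh y))) _.
have -> : sech y ^+ 2 = (cosh y ^+ 2 - sinh y ^+ 2) / cosh y ^+ 2.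
  by rewrite cosh2Bsinh2 mul1r /sech exprVn.
by field; exact: cosh_neq0.
Qed.

Lemma derivable_continuous (F dF : R -> R) : (forall x, is_derive x 1 F (dF x)) -> continuous F.
Proof. by move=> D x; apply: is_derive_continuous (D x). Qed.

Lemma continuous_sinh : continuous sinh.
Proof. exact: derivable_continuous d_sinh. Qed.
Lemma continuous_sech : continuous sech.
Proof. exact: derivable_continuous d_sech. Qed.
Lemma continuous_tanh : continuous tanh.
Proof. exact: derivable_continuous d_tanh. Qed.

Lemma tanh_homo x y : x <= y -> tanh x <= tanh y.
Proof.
move=> xy; have [z _ E] := @MVT_between R tanh _ x y (fun z _ => d_tanh z).
by rewrite -subr_ge0 E mulr_ge0 ?sqr_ge0 ?subr_ge0.
Qed.

Lemma tanh0 : tanh 0 = 0.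
Proof. by rewrite /tanh /sinh oppr0 subrr mul0r mul0r. Qed.

Lemma tanh_gt0 y : 0 < y -> 0 < tanh y.
Proof.
by move=> y0; rewrite divr_gt0 ?cosh_gt0 // divr_gt0 // subr_gt0 ltr_expR; lra.
Qed.

Lemma tanh_ge0 y : 0 <= y -> 0 <= tanh y.
Proof. by move=> y0; rewrite -[leLHS]tanh0; exact: tanh_homo. Qed.

Lemma tanh_norm y : `|tanh y| = tanh `|y|.
Proof.
have [y0|y0] := leP 0 y; first by rewrite !ger0_norm // tanh_ge0.
have t0 : 0 <= tanh (- y) by rewrite tanh_ge0 // oppr_ge0 ltW.
by rewrite (ltr0_norm y0) -(ger0_norm t0) tanhN normrN.
Qed.

Lemma sech_le_expR y : sech y <= 2 * expR y.
Proof.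
rewrite /sech -div1r ler_pdivrMr ?cosh_gt0 // /cosh.
by have := expRNM y; have := expR_gt0 y; nra.
Qed.

Lemma expR_le_sech y : y <= 0 -> expR y <= sech y.
Proof.
move=> y0; rewrite /sech -[leRHS]div1r ler_pdivlMr ?cosh_gt0 // /cosh.
have := expRNM y; have := expR_gt0 y.
have : expR y <= 1 by rewrite -[leRHS]expR0 ler_expR.
nra.
Qed.

Lemma sech_homo x y : `|x| <= `|y| -> sech y <= sech x.
Proof.
move=> xy; rewrite lef_pV2 ?posrE ?cosh_gt0 //.
have E (z : R) : cosh z = cosh `|z| by have [z0|z0] := leP 0 z; [rewrite ger0_norm|rewrite ltr0_norm // coshN].
rewrite (E x) (E y).
have [z zP Eq] := @MVT_between R (@cosh R) _ `|x| `|y| (fun z _ => d_cosh z).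
have z0 : 0 <= z by have := normr_ge0 x; nra.
rewrite -subr_ge0 Eq mulr_ge0 ?subr_ge0 //.
by rewrite divr_ge0 // subr_ge0 ler_expR; lra.
Qed.

Lemma sech_small (e : R) : 0 < e -> exists M, forall x, M <= `|x| -> sech x <= e.
Proof.
move=> e0; exists (2 / e) => x Hx.
apply: (@le_trans _ _ (sech (- (2 / e)))).
  by apply: sech_homo; rewrite normrN (le_trans _ Hx) // ger0_norm // divr_ge0 // ltW.
apply: (le_trans (sech_le_expR _)).
rewrite expRN ler_pdivrMr ?expR_gt0 //.
have := expR_ge1Dx (2 / e).
have : e * (2 / e) = 2 by field; rewrite gt_eqF.
nra.
Qed.

End Hyperbolic.

(** * The linearized Backlund equation *)

Section LinearizedEquation.
Context {R : realType}.
Local Notation mu := (@lebesgue_measure R).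
Context (beta : R) (beta_neq0 : beta != 0).
Implicit Types (q f g : R -> R) (x y c m A B : R).

Local Notation b := (`|beta|).
Let b_gt0 : 0 < b. Proof. by rewrite normr_gt0. Qed.

Definition wsech x : R := sech (beta * x).
Definition wtanh x : R := beta * tanh (beta * x).
Local Notation S := wsech.
Local Notation T := wtanh.

Lemma wsechE x : S x = sech (b * x).
Proof. by rewrite /S; case: (ger0P beta) => // _; rewrite mulNr sechN. Qed.

Lemma wtanhE x : T x = b * tanh (b * x).
Proof. by rewrite /T; case: (ger0P beta) => // _; rewrite !mulNr tanhN mulrN opprK. Qed.

Lemma wsech_gt0 x : 0 < S x. Proof. exact: sech_gt0. Qed.
Lemma wsech_ge0 x : 0 <= S x. Proof. exact/ltW/wsech_gt0. Qed.
Lemma wsech_le1 x : S x <= 1. Proof. exact: sech_le1. Qed.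
Lemma wsech0 : S 0 = 1. Proof. by rewrite /S mulr0 sech0. Qed.

Lemma wsech_homo x y : `|x| <= `|y| -> S y <= S x.
Proof. by move=> xy; apply: sech_homo; rewrite !normrM ler_wpM2l. Qed.

Lemma d_lin x : is_derive x 1 (fun s => beta * s) beta.
Proof. by apply: d_eq (d_Z beta (d_id x)) _; rewrite mulr1. Qed.

Lemma d_wsech x : is_derive x 1 S (- (T x * S x)).
Proof. by apply: d_eq (d_comp (d_lin x) (d_sech _)) _; rewrite /T /S; ring. Qed.

Lemma continuous_wsech : continuous S.
Proof. exact: derivable_continuous d_wsech. Qed.

Lemma continuous_wtanh : continuous T.
Proof.
exact: (c_M (c_cst beta) (c_comp (c_M (c_cst beta) c_id) continuous_tanh)).
Qed.

Lemma wsech_primitive : primitive S (fun x => - (T x * S x)).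
Proof.
apply: primitive_C1; first exact: d_wsech.
exact: c_N (c_M continuous_wtanh continuous_wsech).
Qed.

Lemma loc_wsech : loc_int S. Proof. exact: loc_int_cont continuous_wsech. Qed.

Lemma wsech_small e : 0 < e -> exists M, forall x, M <= `|x| -> S x <= e.
Proof.
move=> /sech_small[M HM]; exists (M / b) => x; rewrite ler_pdivrMr // => Hx.
by apply: HM; rewrite normrM mulrC.
Qed.

Lemma iint_wsech_left y x : y <= x -> x <= 0 -> iint y x S <= 2 / b * S x.
Proof.
move=> yx x0.
have P : primitive (fun s => 2 / b * expR (b * s)) (fun s => 2 * expR (b * s)).
  apply: primitive_C1.
    move=> s; apply: d_eq (d_Z (2 / b) (d_comp (d_Z b (d_id s)) (is_derive_expR _))) _.
    by field; rewrite gt_eqF.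
  exact: (c_M (c_cst 2) (c_comp (c_M (c_cst b) c_id) (@continuous_expR R))).
apply: (@le_trans _ _ (iint y x (fun s => 2 * expR (b * s)))).
  apply: le_iint; [exact: loc_wsech|exact: P.1|] => s _.
  by rewrite wsechE; exact: sech_le_expR.
rewrite -P.2 // wsechE.
have b2 : 0 < 2 / b by rewrite divr_gt0.
apply: (@le_trans _ _ (2 / b * expR (b * x))).
  by rewrite gerBl mulr_ge0 ?expR_ge0 ?(ltW b2).
by rewrite ler_pM2l //; apply: expR_le_sech; rewrite mulr_ge0_le0.
Qed.

Lemma iint_wsech_right x y : x <= y -> 0 <= x -> iint x y S <= 2 / b * S x.
Proof.
move=> yx x0.
have P : primitive (fun s => - (2 / b) * expR (- (b * s))) (fun s => 2 * expR (- (b * s))).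
  apply: primitive_C1.
    move=> s; apply: d_eq (d_Z (- (2 / b)) (d_comp (d_N (d_Z b (d_id s))) (is_derive_expR _))) _.
    by field; rewrite gt_eqF.
  exact: (c_M (c_cst 2) (c_comp (c_N (c_M (c_cst b) c_id)) (@continuous_expR R))).
apply: (@le_trans _ _ (iint x y (fun s => 2 * expR (- (b * s))))).
  apply: le_iint; [exact: loc_wsech|exact: P.1|] => s _.
  by rewrite wsechE -sechN; exact: sech_le_expR.
rewrite -P.2 // wsechE -sechN.
have b2 : 0 < 2 / b by rewrite divr_gt0.
apply: (@le_trans _ _ (2 / b * expR (- (b * x)))).
  rewrite !mulNr opprK addrC gerBl mulr_ge0 ?expR_ge0 ?(ltW b2) //.
by rewrite ler_pM2l //; apply: expR_le_sech; rewrite oppr_le0 mulr_ge0 // ltW.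
Qed.

Lemma wsech_line : integrable_on [set: R] S /\ \int[mu]_x S x <= 4 / b.
Proof.
apply: integrable_line; [exact: loc_wsech|exact: wsech_ge0|] => n.
have n0 : (0 : R) <= n%:R by [].
rewrite (@iint_chasles _ _ 0) ?oppr_le0 //; last exact: loc_wsech.
have A := @iint_wsech_left (- n%:R) 0 ltac:(by rewrite oppr_le0) (lexx _).
have B := @iint_wsech_right 0 n%:R n0 (lexx _).
move: A B; rewrite wsech0 mulr1 => A B; apply: (le_trans (lerD A B)).
by lra.
Qed.

Lemma sq_wsech : sq [set: R] S.
Proof.
split => //; first exact: continuous_measurable_fun continuous_wsech.
apply: integrable_on_le wsech_line.1 => //.
  by apply: continuous_measurable_fun; exact: (c_M continuous_wsech continuous_wsech).
move=> x _; rewrite !ger0_norm ?sqr_ge0 ?wsech_ge0 //.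
by rewrite expr2 ler_piMl ?wsech_ge0 // wsech_le1.
Qed.

(** The class of source terms: an L2 function plus a constant, [A] recording the
    sum of the two sizes. Both kinds of terms occur in the nonlinear equation. *)
Definition dominated f A :=
  measurable_fun [set: R] f /\
  exists (f1 : R -> R) m, [/\ sq [set: R] f1, n2 [set: R] f1 + m <= A, 0 <= m &
    forall x, `|f x| <= `|f1 x| + m].

Lemma dominated_ge0 f A : dominated f A -> 0 <= A.
Proof. by move=> [_ [f1 [m [_ H m0 _]]]]; have := n2_ge0 setT f1; lra. Qed.

Lemma dominated_loc f A : dominated f A -> loc_int (fun x => f x * S x).
Proof.
move=> [mf [f1 [m [sf1 _ m0 ff]]]].
have [i _] := cauchy_schwarz sf1 sq_wsech.
have mf1 : measurable_fun [set: R] f1 by case: sf1.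
have mS : measurable_fun [set: R] S by exact: continuous_measurable_fun continuous_wsech.
have l1 : loc_int (fun x => `|f1 x * S x| + m * S x).
  apply: loc_intD; last exact: loc_intZ loc_wsech.
  by apply: loc_int_norm; apply: integrable_loc_int i; exact: measurable_funM.
apply: loc_int_le l1; first exact: measurable_funM.
move=> x; rewrite !normrM (ger0_norm (wsech_ge0 x)) -mulrDl.
rewrite [leRHS]ger0_norm; first by rewrite ler_wpM2r ?wsech_ge0.
by rewrite mulr_ge0 ?wsech_ge0 // addr_ge0.
Qed.

Let c0 : R := 2 / b + Num.sqrt (2 / b).
Let c0_gt0 : 0 < c0.
Proof. by rewrite ltr_pwDl ?divr_gt0 ?sqrtr_ge0. Qed.

Let dominated_interval f A x y z :
  dominated f A -> x <= y -> (forall s, x <= s <= y -> S s <= S z) ->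
  iint x y S <= 2 / b * S z ->
  iint x y (fun s => `|f s| * S s) <= c0 * A * S z.
Proof.
move=> df xy Sz HS; have A0 := dominated_ge0 df.
have lfS := dominated_loc df; case: df => [mf [f1 [m [sf1 nA m0 ff]]]].
have mS : measurable_fun [set: R] S by exact: continuous_measurable_fun continuous_wsech.
have [sf1' n1] := @sqS R `[x, y] setT f1 (measurable_itv _) (@subsetT _ _) sf1.
have [sS _] := @sqS R `[x, y] setT S (measurable_itv _) (@subsetT _ _) sq_wsech.
have [_ cs] := cauchy_schwarz sf1' sS.
have mf1 : measurable_fun [set: R] f1 by case: sf1.
have l1 : loc_int (fun x => f1 x * S x).
  have [i _] := cauchy_schwarz sf1 sq_wsech.
  by apply: integrable_loc_int i; exact: measurable_funM.
have b20 : 0 <= 2 / b by rewrite divr_ge0 // ltW.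
have nS : n2 `[x, y] S <= Num.sqrt (2 / b) * S z.
  have -> : Num.sqrt (2 / b) * S z = Num.sqrt (2 / b * S z ^+ 2).
    by rewrite [RHS]sqrtrM // sqrtr_sqr (ger0_norm (wsech_ge0 z)).
  apply: ler_wsqrtr; rewrite -/(iint _ _ _).
  apply: (@le_trans _ _ (iint x y (fun s => S z * S s))).
    apply: le_iint.
    - exact: loc_int_cont (c_M continuous_wsech continuous_wsech).
    - exact: loc_intZ loc_wsech.
    - by move=> s /Sz H; rewrite expr2 ler_wpM2r // wsech_ge0.
  rewrite iintZ; last exact: loc_wsech.
  rewrite (_ : 2 / b * S z ^+ 2 = S z * (2 / b * S z)); last by ring.
  by rewrite ler_wpM2l ?wsech_ge0.
apply: (@le_trans _ _ (iint x y (fun s => `|f1 s * S s| + m * S s))).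
  apply: le_iint.
  - apply: loc_int_le lfS; first by apply: measurable_funM => //; exact: measurableT_comp.
    by move=> s; rewrite !normrM normr_id.
  - by apply: loc_intD; [exact: loc_int_norm|exact: loc_intZ loc_wsech].
  - move=> s _; rewrite normrM (ger0_norm (wsech_ge0 s)) -mulrDl ler_wpM2r ?wsech_ge0 //.
rewrite iintD; [|exact: loc_int_norm|exact: loc_intZ loc_wsech].
rewrite iintZ; last exact: loc_wsech.
have z0 := wsech_ge0 z; have n10 := n2_ge0 setT f1.
have nS0 := n2_ge0 `[x, y] S; have n10' := n2_ge0 `[x, y] f1.
have s0 := sqrtr_ge0 (2 / b).
apply: (@le_trans _ _ (n2 setT f1 * (Num.sqrt (2 / b) * S z) + m * (2 / b * S z))).
  apply: lerD; last by rewrite ler_wpM2l.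
  apply: (le_trans cs); apply: ler_pM => //.
apply: (@le_trans _ _ (c0 * (n2 setT f1 + m) * S z)).
  rewrite !mulrA -mulrDl ler_wpM2r // /c0.
  have := mulr_ge0 n10 b20; have := mulr_ge0 m0 s0; nra.
by rewrite ler_wpM2r // ler_wpM2l // ltW.
Qed.

Lemma dominated_left f A y x : dominated f A -> y <= x -> x <= 0 ->
  iint y x (fun s => `|f s| * S s) <= c0 * A * S x.
Proof.
move=> df yx x0; apply: dominated_interval => //; last exact: iint_wsech_left.
by move=> s /andP[_ sx]; apply: wsech_homo; rewrite !ler0_norm //; lra.
Qed.

Lemma dominated_right f A x y : dominated f A -> x <= y -> 0 <= x ->
  iint x y (fun s => `|f s| * S s) <= c0 * A * S x.
Proof.
move=> df yx x0; apply: dominated_interval => //; last exact: iint_wsech_right.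
by move=> s /andP[sx _]; apply: wsech_homo; rewrite !ger0_norm //; lra.
Qed.

Lemma dominatedD_wsech f A c : dominated f A -> dominated (fun x => c * S x + f x) (A + `|c|).
Proof.
have mS : measurable_fun [set: R] S by exact: continuous_measurable_fun continuous_wsech.
move=> [mf [f1 [m [sf1 nA m0 ff]]]]; split.
  by apply: measurable_funD => //; exact: measurable_funM.
exists f1, (m + `|c|); split => //; [by rewrite addrA lerD2r|by rewrite addr_ge0|].
move=> x; apply: (le_trans (ler_normD _ _)); rewrite normrM (ger0_norm (wsech_ge0 x)).
by have := ff x; have := ler_piMr (normr_ge0 c) (wsech_le1 x); lra.
Qed.

Lemma primitive_wsechM q c f :
  primitive q (fun x => T x * q x + (c * S x + f x)) ->
  primitive (fun x => q x * S x) (fun x => (c * S x + f x) * S x).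
Proof.
move=> qp; apply: eq_primitive (primitiveM qp wsech_primitive) => x //; ring.
Qed.

(** Since [q S] tends to zero at both ends, it is the integral of its derivative
    from the nearer end, where the integral of [S] is comparable to [S]. *)
Let decayed_bound q g A B : dominated g A ->
  primitive (fun x => q x * S x) (fun x => g x * S x) ->
  (forall x, `|q x| <= B) -> forall x, `|q x| <= c0 * A.
Proof.
move=> dg qS qB x.
have B0 : 0 <= B by apply: le_trans (qB 0).
have E y : `|q y * S y| <= B * S y.
  by rewrite normrM (ger0_norm (wsech_ge0 y)) ler_wpM2r ?wsech_ge0.
have N y z : iint y z (fun s => `|g s * S s|) = iint y z (fun s => `|g s| * S s).
  by apply: eq_iint => s _; rewrite normrM (ger0_norm (wsech_ge0 s)).
have K e : 0 < e -> `|q x * S x| <= B * e + c0 * A * S x.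
  move=> e0; have [M HM] := wsech_small e0.
  have M0 := ler_norm M; have Mn := normr_ge0 M; have xn := ler_norm x.
  have xn' := ler_norm (- x); rewrite normrN in xn'.
  case: (leP x 0) => x0.
    pose y := x - `|M|; have yx : y <= x by rewrite /y; lra.
    have yM : M <= `|y| by rewrite /y ler0_norm; lra.
    have := primitive_incr qS yx; rewrite N => /le_trans/(_ (dominated_left dg yx x0)).
    have := le_trans (E y) (ler_wpM2l B0 (HM _ yM)).
    by have := ler_normD (q y * S y) (q x * S x - q y * S y); rewrite addrC subrK; lra.
  pose y := x + `|M|; have yx : x <= y by rewrite /y; lra.
  have yM : M <= `|y| by rewrite /y ger0_norm; lra.
  have := primitive_incr qS yx; rewrite N => /le_trans/(_ (dominated_right dg yx (ltW x0))).
  have := le_trans (E y) (ler_wpM2l B0 (HM _ yM)).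
  by have := ler_normB (q y * S y) (q y * S y - q x * S x); rewrite opprB addrC subrK; lra.
rewrite -(ler_pM2r (wsech_gt0 x)) -{1}(ger0_norm (wsech_ge0 x)) -normrM.
apply/ler_addgt0Pr => e e0.
apply: (le_trans (K (e / (B + 1)) _)); first by rewrite divr_gt0 //; lra.
rewrite addrC lerD2l mulrA ler_pdivrMr; nra.
Qed.

Let c1 : R := 2 * S 1 ^+ 2.
Let c1_gt0 : 0 < c1.
Proof. by rewrite mulr_gt0 // exprn_gt0 // wsech_gt0. Qed.

Let iint_wsech2 M : 1 <= M -> c1 <= iint (- M) M (fun x => S x ^+ 2).
Proof.
move=> M1; apply: (@le_trans _ _ (iint (-1) 1 (fun x => S x ^+ 2))).
  have -> : c1 = iint (-1) 1 (fun=> S 1 ^+ 2).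
    by rewrite iint_cst; [rewrite /c1; ring|lra].
  apply: le_iint; [exact: loc_int_cst| |].
    exact: loc_int_cont (c_M continuous_wsech continuous_wsech).
  move=> x /andP[x1 x2]; rewrite lerXn2r ?nnegrE ?wsech_ge0 //.
  by apply: wsech_homo; rewrite normr1 ler_norml x1 x2.
apply: le_iint_itv; [|by move=> x; exact: sqr_ge0|lra|lra|lra].
exact: loc_int_cont (c_M continuous_wsech continuous_wsech).
Qed.

(** A bounded solution decays against the weight, so that integrating the
    weighted equation over the line determines the parameter and then
    integrating from the nearer infinity controls the solution. *)
Lemma bounded_solution_bound : exists2 C, 0 < C & forall q c f A B,
  dominated f A -> primitive q (fun x => T x * q x + (c * S x + f x)) ->
  (forall x, `|q x| <= B) -> `|c| <= C * A /\ forall x, `|q x| <= C * A.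
Proof.
pose k := 2 * c0 / c1.
have k0 : 0 < k by rewrite divr_gt0 // mulr_gt0.
exists (k + c0 * (1 + k)); first by rewrite addr_gt0 // mulr_gt0 //; lra.
move=> q c f A B df qp qB; have A0 := dominated_ge0 df.
have B0 : 0 <= B by apply: le_trans (qB 0).
have qS := primitive_wsechM qp.
have dl := dominated_loc df.
have cA : `|c| <= k * A.
  rewrite /k mulrAC ler_pdivlMr //; apply/ler_addgt0Pr => e e0.
  have e1 : 0 < e / (2 * B + 1) by rewrite divr_gt0 //; lra.
  have [M HM] := wsech_small e1.
  pose N := `|M| + 1; have M0 := ler_norm M; have Mn := normr_ge0 M.
  have N1 : 1 <= N by rewrite /N; lra.
  have NN : - N <= N by lra.
  have lSS : loc_int (fun x => S x ^+ 2).
    exact: loc_int_cont (c_M continuous_wsech continuous_wsech).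
  have E : q N * S N - q (- N) * S (- N) =
    c * iint (- N) N (fun x => S x ^+ 2) + iint (- N) N (fun x => f x * S x).
    rewrite qS.2 // -iintZ // -iintD //; last exact: loc_intZ.
    by apply: eq_iint => x _; ring.
  have F1 : `|iint (- N) N (fun x => f x * S x)| <= 2 * c0 * A.
    apply: (le_trans (le_norm_iint _ _ dl)).
    rewrite (@eq_iint _ _ _ _ (fun x => `|f x| * S x)) => [|x _]; last first.
      by rewrite normrM (ger0_norm (wsech_ge0 x)).
    rewrite (@iint_chasles _ _ 0); [|lra|lra|]; last first.
      apply: loc_int_le dl; last by move=> x; rewrite !normrM normr_id.
      apply: measurable_funM; first by apply: measurableT_comp => //; case: df.
      exact: continuous_measurable_fun continuous_wsech.
    have := @dominated_left f A (- N) 0 df ltac:(lra) (lexx _).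
    have := @dominated_right f A 0 N df ltac:(lra) (lexx _).
    by rewrite wsech0; lra.
  have F2 y : `|y| = N -> `|q y * S y| <= B * (e / (2 * B + 1)).
    move=> yN; rewrite normrM (ger0_norm (wsech_ge0 y)); apply: ler_pM => //.
      exact: wsech_ge0.
    by apply: HM; rewrite yN /N; lra.
  have G1 := F2 N ltac:(by rewrite ger0_norm //; lra).
  have G2 := F2 (- N) ltac:(by rewrite normrN ger0_norm //; lra).
  have I1 := iint_wsech2 N1.
  have H3 : B * (e / (2 * B + 1)) * 2 <= e.
    by rewrite mulrA mulrAC ler_pdivrMr; [nra|lra].
  apply: (le_trans (ler_wpM2l (normr_ge0 c) I1)).
  rewrite -[X in _ * X]ger0_norm; last by apply: iint_ge0 => x _; exact: sqr_ge0.
  rewrite -normrM.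
  have -> : c * iint (- N) N (fun x => S x ^+ 2) =
    q N * S N - q (- N) * S (- N) - iint (- N) N (fun x => f x * S x) by rewrite E; ring.
  have := ler_normB (q N * S N - q (- N) * S (- N)) (iint (- N) N (fun x => f x * S x)).
  have := ler_normB (q N * S N) (q (- N) * S (- N)).
  lra.
split.
  by apply: (le_trans cA); rewrite ler_wpM2r // lerDl mulr_ge0 // ?(ltW c0_gt0) //; lra.
move=> x; apply: (le_trans (decayed_bound (dominatedD_wsech c df) qS qB x)).
have := ler_wpM2l (ltW c0_gt0) cA; have := mulr_ge0 (ltW k0) A0; lra.
Qed.

Let le_norm_half (D : set R) h A : @measurable _ (measurableTypeR R) D ->
  integrable_on D h -> \int[mu]_(x in D) `|h x| <= A -> `|\int[mu]_(x in D) h x| <= A.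
Proof. by move=> mD ih; apply: le_trans; apply: le_normr_Rintegral. Qed.

(** Variation of constants. The parameter is chosen so that the source has mean
    zero against the weight; then integrating from the left and from the right
    give the same function, and each point is reached from its nearer end. *)
Lemma bounded_solution_exists f A : dominated f A ->
  exists q c B, primitive q (fun x => T x * q x + (c * S x + f x)) /\
                (forall x, `|q x| <= B).
Proof.
move=> df.
have mS : measurable_fun [set: R] S by exact: continuous_measurable_fun continuous_wsech.
have wint g A' : dominated g A' -> integrable_on [set: R] (fun x => g x * S x).
  move=> dg; have lg := dominated_loc dg.
  have mg : measurable_fun [set: R] (fun x => g x * S x) := lg.1.
  have Hn (n : nat) : iint (- n%:R) n%:R (fun x => `|g x * S x|) <= c0 * A' + c0 * A'.
    have n0 : (0 : R) <= n%:R by [].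
    rewrite (@eq_iint _ _ _ _ (fun x => `|g x| * S x)) => [|x _]; last first.
      by rewrite normrM (ger0_norm (wsech_ge0 x)).
    rewrite (@iint_chasles _ _ 0) ?oppr_le0 //; last first.
      apply: loc_int_le lg; last by move=> x; rewrite !normrM normr_id.
      by apply: measurable_funM => //; apply: measurableT_comp => //; case: dg.
    have L := @dominated_left g A' (- n%:R) 0 dg ltac:(by rewrite oppr_le0) (lexx _).
    have P := @dominated_right g A' 0 n%:R dg n0 (lexx _).
    by move: L P; rewrite wsech0 mulr1 => L P; exact: lerD.
  have [i _] := integrable_line (loc_int_norm lg) (fun x => normr_ge0 _) Hn.
  by apply: integrable_on_le i => // x _; rewrite normr_id.
have [_ _ iSS] := sq_wsech.
pose I2 := \int[mu]_x (S x ^+ 2).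
have I2_gt0 : 0 < I2.
  apply: lt_le_trans c1_gt0 _; apply: (le_trans (iint_wsech2 (lexx 1))).
  have [_ H] := @sqS R `[-1, 1] setT S (measurable_itv _) (@subsetT _ _) sq_wsech.
  by rewrite /I2 /iint -!n2_sqr lerXn2r ?nnegrE ?n2_ge0.
pose c := - (\int[mu]_x (f x * S x)) / I2.
pose g := fun x => c * S x + f x.
have dg : dominated g (A + `|c|) by exact: dominatedD_wsech.
pose h := fun x => g x * S x.
have ih : integrable_on [set: R] h by exact: wint dg.
have lh : loc_int h := dominated_loc dg.
have h0 : \int[mu]_x h x = 0.
  have -> : \int[mu]_x h x = \int[mu]_x (c * S x ^+ 2 + f x * S x).
    by congr Rintegral; apply/funext => x; rewrite /h /g; ring.
  rewrite RintegralD // ?RintegralZl //.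
  - by rewrite -/I2 /c divfK ?gt_eqF // addrC subrr.
  - exact: (integrable_onZ _ _ iSS).
  - exact: wint df.
pose W x := \int[mu]_(y in `]-oo, x]) h y.
have ihD (D : set R) : @measurable _ (measurableTypeR R) D -> integrable_on D h.
  by move=> mD; exact: integrable_onS ih.
have WP : primitive W h.
  split => // a b' ab; rewrite /W /iint.
  have := @Rintegral_itvB R h -oo%O (BRight b') a (ihD _ (measurable_itv _)).
  rewrite !bnd_simp => /(_ isT ab) ->.
  by rewrite Rintegral_itv_obnd_cbnd //; exact: ihD (measurable_itv _).
have N : (fun x => `|h x|) = (fun x => `|g x| * S x).
  by apply/funext => x; rewrite normrM (ger0_norm (wsech_ge0 x)).
pose B := c0 * (A + `|c|).
have WB x : `|W x| <= B * S x.
  case: (leP x 0) => x0.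
    apply: le_norm_half; [exact: measurable_itv|exact: ihD (measurable_itv _)|].
    have H y : y <= x -> iint y x (fun s => `|h s|) <= B * S x.
      by move=> yx; rewrite N; exact: dominated_left.
    exact: (integrable_left (loc_int_norm lh) (fun x => normr_ge0 _) H).2.
  have E : W x = - \int[mu]_(y in `[x, +oo[) h y.
    have := @Rintegral_itvB R h -oo%O +oo%O x (ihD _ (measurable_itv _)).
    rewrite !bnd_simp => /(_ isT isT).
    rewrite set_itvNyy -/(W x) h0 sub0r => /(congr1 -%R); rewrite opprK => ->.
    by rewrite Rintegral_itv_obnd_cbnd //; exact: ihD (measurable_itv _).
  rewrite E normrN.
  apply: le_norm_half; [exact: measurable_itv|exact: ihD (measurable_itv _)|].
  have H y : x <= y -> iint x y (fun s => `|h s|) <= B * S x.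
    by move=> yx; rewrite N; apply: dominated_right => //; exact: ltW.
  exact: (integrable_right (loc_int_norm lh) (fun x => normr_ge0 _) H).2.
have cP : primitive (fun x => cosh (beta * x)) (fun x => sinh (beta * x) * beta).
  apply: primitive_C1; first by move=> x; exact: (d_comp (d_lin x) (d_cosh _)).
  have L := c_M (c_cst beta) (@c_id R).
  exact: (c_M (c_comp L continuous_sinh) (c_cst beta)).
have SC x : S x * cosh (beta * x) = 1 by rewrite /S /sech mulVf // cosh_neq0.
exists (fun x => W x * cosh (beta * x)), c, B; split.
  apply: eq_primitive (primitiveM WP cP) => x //.
  rewrite /h -mulrA SC mulr1 addrC /T /tanh /g; congr (_ + _).
  by field; exact: cosh_neq0.
move=> x; rewrite normrM (ger0_norm (ltW (cosh_gt0 _))).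
apply: (le_trans (ler_wpM2r (ltW (cosh_gt0 _)) (WB x))).
by rewrite -mulrA SC mulr1.
Qed.

(** Multiply the equation by [q] and integrate over each half-line: [T] has the
    sign of [x], and [|T|] is bounded below outside [-1, 1], while on [-1, 1]
    the sup bound suffices. *)
Lemma energy_estimate : exists2 C, 0 < C & forall q g B,
  primitive q (fun x => T x * q x + g x) -> (forall x, `|q x| <= B) -> loc_int g ->
  forall n : nat, iint (- n%:R) n%:R (fun x => q x ^+ 2) <=
    C * (B ^+ 2 + iint (- n%:R) n%:R (fun x => `|q x| * `|g x|)).
Proof.
pose t1 := b * tanh b.
have t10 : 0 < t1 by rewrite mulr_gt0 // tanh_gt0.
have T1 x : 1 <= `|x| -> t1 <= `|T x|.
  move=> x1; rewrite wtanhE normrM normr_id ler_pM2l //.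
  rewrite tanh_norm normrM normr_id.
  by apply: tanh_homo; rewrite -[leLHS]mulr1 ler_pM2l.
have S1 := wsech_gt0 1.
pose C := 4 / b / S 1 + t1^-1 * 2.
have k1 : 0 < 4 / b / S 1 by rewrite divr_gt0 // divr_gt0.
have k2 : 0 < t1^-1 by rewrite invr_gt0.
have C0 : 0 < C by rewrite addr_gt0 // mulr_gt0.
exists C => // q g B qp qB lg n.
have B0 : 0 <= B by apply: le_trans (qB 0).
have n0 : (0 : R) <= n%:R by []. have nN : - n%:R <= (0 : R) by rewrite oppr_le0.
have nn : - n%:R <= n%:R :> R by lra.
have cq := primitive_continuous qp.
have q2 := c_M cq cq.
have q2B y : q y ^+ 2 <= B ^+ 2.
  by rewrite -[leLHS]real_normK ?num_real // lerXn2r ?nnegrE // qB.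
have lqg : loc_int (fun x => q x * g x) by exact: loc_intMc.
have lnqg : loc_int (fun x => `|q x| * `|g x|).
  apply: loc_int_le (loc_int_norm lqg); last by move=> x; rewrite !normrM !normr_id.
  have [m1 _] := loc_int_norm lg; apply: measurable_funM => //.
  by apply: measurableT_comp => //; exact: continuous_measurable_fun.
have lTq : loc_int (fun x => T x * q x ^+ 2).
  exact: loc_int_cont (c_M continuous_wtanh q2).
have cnT : continuous (fun x => `|T x|).
  by move=> x; apply: cvg_norm; exact: continuous_wtanh.
have lnTq : loc_int (fun x => `|T x| * q x ^+ 2).
  exact: loc_int_cont (c_M cnT q2).
have H := primitiveZ 2^-1 (primitive_sqr qp).
have HE a b' : a <= b' -> q b' ^+ 2 / 2 - q a ^+ 2 / 2 =
    iint a b' (fun x => T x * q x ^+ 2) + iint a b' (fun x => q x * g x).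
  move=> ab; have := H.2 _ _ ab; rewrite -iintD // ![2^-1 * _]mulrC => ->.
  by apply: eq_iint => x _; field.
have qgB a b' : `|iint a b' (fun x => q x * g x)| <= iint a b' (fun x => `|q x| * `|g x|).
  apply: (le_trans (le_norm_iint _ _ lqg)); apply: le_iint => //.
    exact: loc_int_norm.
  by move=> x _; rewrite normrM.
have Tpos x : 0 <= x -> 0 <= T x.
  move=> x0; rewrite wtanhE mulr_ge0 ?(ltW b_gt0) // tanh_ge0 //.
  by rewrite mulr_ge0 // ltW.
have Tneg x : x <= 0 -> T x <= 0.
  move=> x0; rewrite -oppr_ge0 -[x]opprK wtanhE mulrN tanhN mulrN opprK.
  by rewrite mulr_ge0 ?(ltW b_gt0) // tanh_ge0 // mulr_ge0 ?oppr_ge0 // ltW.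
have E1 : iint 0 n%:R (fun x => `|T x| * q x ^+ 2) <=
    B ^+ 2 / 2 + iint 0 n%:R (fun x => `|q x| * `|g x|).
  rewrite (@eq_iint _ _ _ _ (fun x => T x * q x ^+ 2)) => [|x /andP[x0 _]]; last first.
    by rewrite ger0_norm // Tpos.
  have /ler_normlP[] := qgB 0 n%:R; have := HE _ _ n0; have := q2B n%:R.
  have := sqr_ge0 (q 0); lra.
have E2 : iint (- n%:R) 0 (fun x => `|T x| * q x ^+ 2) <=
    B ^+ 2 / 2 + iint (- n%:R) 0 (fun x => `|q x| * `|g x|).
  rewrite (@eq_iint _ _ _ _ (fun x => -1 * (T x * q x ^+ 2))) => [|x /andP[_ x0]]; last first.
    by rewrite ler0_norm ?Tneg // mulN1r mulNr.
  rewrite iintZ //.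
  have /ler_normlP[] := qgB (- n%:R) 0; have := HE _ _ nN; have := q2B (- n%:R).
  have := sqr_ge0 (q 0); lra.
have E3 : iint (- n%:R) n%:R (fun x => `|T x| * q x ^+ 2) <=
    B ^+ 2 + iint (- n%:R) n%:R (fun x => `|q x| * `|g x|).
  rewrite (iint_chasles nN n0) // (iint_chasles nN n0 lnqg); lra.
have PW x : q x ^+ 2 <= B ^+ 2 / S 1 * S x + t1^-1 * (`|T x| * q x ^+ 2).
  have qx0 := sqr_ge0 (q x); have sx := wsech_ge0 x; have tx := normr_ge0 (T x).
  have BS : 0 <= B ^+ 2 / S 1 * S x by rewrite mulr_ge0 // divr_ge0 ?sqr_ge0 ?wsech_ge0.
  have tq : 0 <= t1^-1 * (`|T x| * q x ^+ 2).
    by rewrite (mulr_ge0 (ltW k2)) // mulr_ge0.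
  have [x1|x1] := leP `|x| 1.
    apply: (@le_trans _ _ (B ^+ 2 / S 1 * S x)); last by rewrite lerDl.
    apply: (le_trans (q2B x)); rewrite mulrAC ler_pdivlMr // ler_wpM2l ?sqr_ge0 //.
    by apply: wsech_homo; rewrite normr1.
  apply: (@le_trans _ _ (t1^-1 * (`|T x| * q x ^+ 2))); last by rewrite lerDr.
  rewrite mulrC ler_pdivlMr // mulrC ler_wpM2r // T1 //.
  exact: ltW.
have lSc : loc_int (fun x => B ^+ 2 / S 1 * S x) by exact: loc_intZ loc_wsech.
have lTc : loc_int (fun x => t1^-1 * (`|T x| * q x ^+ 2)) by exact: loc_intZ.
apply: (@le_trans _ _ (iint (- n%:R) n%:R
    (fun x => B ^+ 2 / S 1 * S x + t1^-1 * (`|T x| * q x ^+ 2)))).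
  apply: le_iint => //; first exact: loc_int_cont.
  exact: loc_intD.
rewrite iintD // !iintZ //; last exact: loc_wsech.
have IS : iint (- n%:R) n%:R S <= 4 / b.
  rewrite (iint_chasles nN n0); last exact: loc_wsech.
  have := @iint_wsech_left (- n%:R) 0 nN (lexx _).
  have := @iint_wsech_right 0 n%:R n0 (lexx _).
  by rewrite wsech0; lra.
set J := iint _ _ (fun x => `|q x| * `|g x|) in E3 *.
have J0 : 0 <= J by apply: iint_ge0 => x _; rewrite mulr_ge0.
have B20 := sqr_ge0 B.
have h1 : B ^+ 2 / S 1 * iint (- n%:R) n%:R S <= B ^+ 2 / S 1 * (4 / b).
  by rewrite ler_wpM2l // divr_ge0 // wsech_ge0.
have h2 : t1^-1 * iint (- n%:R) n%:R (fun x => `|T x| * q x ^+ 2) <= t1^-1 * (B ^+ 2 + J).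
  by rewrite ler_pM2l // invr_gt0.
apply: (le_trans (lerD h1 h2)).
rewrite (_ : B ^+ 2 / S 1 * (4 / b) = 4 / b / S 1 * B ^+ 2); last by ring.
rewrite /C [leRHS]mulrDl; apply: lerD.
  by rewrite ler_wpM2l ?(ltW k1) // lerDl.
by rewrite -mulrA ler_wpM2l ?(ltW k2) // ler_peMl ?addr_ge0 // ler1n.
Qed.

End LinearizedEquation.

(** * The nonlinear term of the Backlund equation *)

Section NonlinearTerm.
Context {R : realType}.
Local Notation nc := (@Normc.normc R).
Implicit Types (a d p q sg z w : R[i]) (s c : R).

(** Right-hand side of the second Backlund equation, after the sine of a sum
    has been expanded around half a kink whose sine and cosine are [s] and
    [c]; [sg] is the sign with which the kink enters the difference. *)
Definition bk_rhs sg a s c p q : R[i] :=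
  - a^-1 * (s%:C * ccos ((p + q) / 2%:R) + c%:C * csin ((p + q) / 2%:R)) +
  a * (sg * s%:C * ccos ((p - q) / 2%:R) + c%:C * csin ((p - q) / 2%:R)).

Definition bk_slope sg a : R[i] := a^-1 ^+ 2 + sg.

(** What remains of the right-hand side once its value at the base point and
    its linear part in [q] and in the parameter are removed. *)
Definition bk_rem sg a s c p q d : R[i] :=
  bk_rhs sg (a + d) s c p q - bk_rhs sg a s c 0 0
  + (a + a^-1) / 2%:R * c%:C * q - bk_slope sg a * d * s%:C.

Lemma csin0 : csin (0 : R[i]) = 0.
Proof. by rewrite /csin mulr0 oppr0 subrr mul0r. Qed.

Lemma ccos0 : ccos (0 : R[i]) = 1.
Proof. by rewrite /ccos mulr0 oppr0 cexp0 -mulr2n divff // pnatr_eq0. Qed.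

Lemma csin_bound z : nc z <= 1 -> nc (csin z) <= 17 * nc z.
Proof.
move=> z1; have := @csin_linearization R z 0 z1; rewrite nc0 csin0 !subr0 addr0.
move=> /(_ ler01) H; have := ncD (csin z - z) z; rewrite subrK.
by have := nc_ge0 z; nra.
Qed.

Lemma ccos_bound z : nc z <= 1 -> nc (ccos z - 1) <= 16 * nc z.
Proof.
move=> z1; have := @ccos_lipschitz R z 0 z1; rewrite nc0 ccos0 !subr0 addr0.
move=> /(_ ler01) H; by have := nc_ge0 z; nra.
Qed.

Lemma nc_half z : nc (z / 2%:R) = nc z / 2.
Proof. by rewrite ncM ncV nc2. Qed.

Lemma nc_sum2 z w : nc ((z + w) / 2%:R) <= (nc z + nc w) / 2.
Proof. by rewrite nc_half ler_pM2r // ncD. Qed.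

Lemma nc_dif2 z w : nc ((z - w) / 2%:R) <= (nc z + nc w) / 2.
Proof. by rewrite nc_half ler_pM2r // ncB. Qed.

Lemma nc_invD a d : nc a = 1 -> nc d <= 4^-1 -> a + d != 0 /\ nc (a + d)^-1 <= 2.
Proof.
move=> a1 d4; have H : 2^-1 <= nc (a + d).
  by have := ncB (a + d) d; rewrite addrK a1; lra.
split; first by apply/eqP => E; move: H; rewrite E nc0; lra.
by rewrite ncV -[leRHS]invrK lef_pV2 ?posrE //; lra.
Qed.

Lemma ccos_diff_bound z w (A B H : R) : nc z <= A -> nc w <= B -> nc (z - w) <= H ->
  A <= 1 -> B <= 1 -> nc (ccos z - ccos w) <= 16 * (A + B) * H.
Proof.
move=> zA wB zwH A1 B1.
apply: (le_trans (ccos_lipschitz (le_trans zA A1) (le_trans wB B1))).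
apply: ler_pM => //; rewrite ?nc_ge0 // ?mulr_ge0 ?addr_ge0 ?nc_ge0 //.
by rewrite ler_wpM2l // lerD.
Qed.

Lemma csin_diff_bound z w (A B H : R) : nc z <= A -> nc w <= B -> nc (z - w) <= H ->
  A <= 1 -> B <= 1 -> nc (csin z - csin w - (z - w)) <= 16 * (A + B) * H.
Proof.
move=> zA wB zwH A1 B1.
apply: (le_trans (csin_linearization (le_trans zA A1) (le_trans wB B1))).
apply: ler_pM => //; rewrite ?nc_ge0 // ?mulr_ge0 ?addr_ge0 ?nc_ge0 //.
by rewrite ler_wpM2l // lerD.
Qed.

Lemma ncM_le z w (k l : R) : nc z <= k -> nc w <= l -> nc (z * w) <= k * l.
Proof. by move=> zk wl; rewrite ncM; apply: ler_pM => //; exact: nc_ge0. Qed.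

Lemma ncD_le z w (k l : R) : nc z <= k -> nc w <= l -> nc (z + w) <= k + l.
Proof. by move=> zk wl; apply: (le_trans (ncD _ _)); exact: lerD. Qed.

Lemma ncB_le z w (k l : R) : nc z <= k -> nc w <= l -> nc (z - w) <= k + l.
Proof. by move=> zk wl; apply: (le_trans (ncB _ _)); exact: lerD. Qed.

Let rem_arith (s c P Q Q' D D' X Y : R) : 0 <= s <= 1 -> 0 <= c <= 1 ->
  0 <= P -> 0 <= Q -> 0 <= Q' -> 0 <= D -> 0 <= D' -> 0 <= X -> 0 <= Y ->
  s * (4 * Y * (16 * ((P + Q) / 2)) + Y * (1 * (2 * D) + 2 * (2 * D'))
     + 2 * (16 * ((P + Q) / 2 + (P + Q') / 2) * (X / 2))
     + 1 * (Y * (16 * ((P + Q) / 2)) + 2 * (16 * ((P + Q) / 2 + (P + Q') / 2) * (X / 2))))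
  + c * (4 * Y * (17 * ((P + Q) / 2)) + Y * (17 * ((P + Q) / 2))
     + 2 * (16 * ((P + Q) / 2 + (P + Q') / 2) * (X / 2))
     + 2 * (16 * ((P + Q) / 2 + (P + Q') / 2) * (X / 2))
     + 2 * D' * (X / 2) + D' * (X / 2))
  <= 100 * ((P + Q + Q' + D + D') * X + ((D + D') * s + P + Q) * Y).
Proof.
move=> /andP[s0 s1] /andP[c0 c1] P0 Q0 Q0' D0 D0' X0 Y0.
have XP := mulr_ge0 X0 P0. have XQ := mulr_ge0 X0 Q0. have XQ' := mulr_ge0 X0 Q0'.
have XD := mulr_ge0 X0 D0. have XD' := mulr_ge0 X0 D0'.
have YP := mulr_ge0 Y0 P0. have YQ := mulr_ge0 Y0 Q0.
have YD := mulr_ge0 (mulr_ge0 Y0 D0) s0. have YD' := mulr_ge0 (mulr_ge0 Y0 D0') s0.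
pose Z1 := 40 * (Y * P + Y * Q) + 16 * (2 * (X * P) + X * Q + X * Q').
pose Z2 := 43 * (Y * P + Y * Q) + 16 * (2 * (X * P) + X * Q + X * Q') + 2 * (X * D').
have Z10 : 0 <= Z1 by rewrite /Z1; lra.
have Z20 : 0 <= Z2 by rewrite /Z2; lra.
have sZ := ler_piMl Z10 s1. have cZ := ler_piMl Z20 c1.
have cP := mulr_ge0 (addr_ge0 YP YQ) c0. have cD := mulr_ge0 XD' c0.
rewrite /Z1 in sZ; rewrite /Z2 in cZ.
lra.
Qed.

(** All first-order terms in [q] and [d] cancel except those carrying a factor
    [p], [q], [q'], [d] or [d']. Terms in [d] alone keep the factor [s], which
    makes their contribution to the equation square integrable. *)
Lemma bk_rem_lipschitz sg a s c p q q' d d' :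
  nc sg = 1 -> nc a = 1 -> 0 <= s <= 1 -> `|c| <= 1 ->
  nc p <= 4^-1 -> nc q <= 4^-1 -> nc q' <= 4^-1 -> nc d <= 4^-1 -> nc d' <= 4^-1 ->
  nc (bk_rem sg a s c p q d - bk_rem sg a s c p q' d') <=
  100 * ((nc p + nc q + nc q' + nc d + nc d') * nc (q - q') +
         ((nc d + nc d') * s + nc p + nc q) * nc (d - d')).
Proof.
move=> sg1 a1 /andP[s0 s1] c1 p4 q4 q4' d4 d4'.
have [an bn] := nc_invD a1 d4; have [an' bn'] := nc_invD a1 d4'.
have a0 : a != 0 by apply/eqP => E; move: a1; rewrite E nc0; lra.
have b1 : nc a^-1 = 1 by rewrite ncV a1 invr1.
set b := (a + d)^-1 in bn *; set b' := (a + d')^-1 in bn' *.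
pose dl := d - d'; pose h := (q - q') / 2%:R.
pose zp := (p + q) / 2%:R; pose zp' := (p + q') / 2%:R.
pose zm := (p - q) / 2%:R; pose zm' := (p - q') / 2%:R.
pose ep := csin zp - csin zp' - (zp - zp').
pose em := csin zm - csin zm' - (zm - zm').
have hp : zp - zp' = h by rewrite /zp /zp' /h; field.
have hm : zm - zm' = - h by rewrite /zm /zm' /h; field.
have bE : b - b' = - (dl * b * b') by rewrite /b /b' /dl; field; rewrite an an'.
have bE0 : a^-1 - b = d * a^-1 * b by rewrite /b; field; rewrite an a0.
have bE0' : a^-1 - b' = d' * a^-1 * b' by rewrite /b'; field; rewrite an' a0.
have E : bk_rem sg a s c p q d - bk_rem sg a s c p q' d' =
  s%:C * (- ((b - b') * (ccos zp - 1)) + dl * (a^-1 * (a^-1 - b) + b * (a^-1 - b')) * -1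
    - b' * (ccos zp - ccos zp') + sg * (dl * (ccos zm - 1) + (a + d') * (ccos zm - ccos zm')))
  + c%:C * (- ((b - b') * csin zp) + dl * csin zm - b' * ep + (a + d') * em
    + (a^-1 - b') * h - d' * h).
  rewrite /bk_rem /bk_rhs /bk_slope -/b -/b' -/zp -/zp' -/zm -/zm' /ep /em hp hm.
  have -> : q = q' + 2%:R * h by rewrite /h; field.
  have -> : dl * (a^-1 * (a^-1 - b) + b * (a^-1 - b')) * -1 = - (a^-1 ^+ 2 * dl) - (b - b').
    by rewrite bE; ring.
  rewrite (_ : d = d' + dl); last by rewrite /dl addrC subrK.
  by field; rewrite a0.
rewrite E.
set P := nc p in p4 *; set Q := nc q in q4 *; set Q' := nc q' in q4' *.
set D := nc d in d4 *; set D' := nc d' in d4' *.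
have P0 : 0 <= P := nc_ge0 _. have Q0 : 0 <= Q := nc_ge0 _.
have Q0' : 0 <= Q' := nc_ge0 _. have D0 : 0 <= D := nc_ge0 _.
have D0' : 0 <= D' := nc_ge0 _.
have hN : nc h = nc (q - q') / 2 by exact: nc_half.
set X := nc (q - q') in hN *. set Y := nc (d - d').
have X0 : 0 <= X := nc_ge0 _. have Y0 : 0 <= Y := nc_ge0 _.
have zpN : nc zp <= (P + Q) / 2 := nc_sum2 _ _.
have zpN' : nc zp' <= (P + Q') / 2 := nc_sum2 _ _.
have zmN : nc zm <= (P + Q) / 2 := nc_dif2 _ _.
have zmN' : nc zm' <= (P + Q') / 2 := nc_dif2 _ _.
have PQ : (P + Q) / 2 <= 1 by clear - p4 q4; lra.
have PQ' : (P + Q') / 2 <= 1 by clear - p4 q4'; lra.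
have zp1 := le_trans zpN PQ; have zp1' := le_trans zpN' PQ'.
have zm1 := le_trans zmN PQ; have zm1' := le_trans zmN' PQ'.
have b0 := nc_ge0 b. have b0' := nc_ge0 b'.
have bb : nc (b - b') <= 4 * Y.
  rewrite bE ncN !ncM -/Y -mulrA mulrC; apply: ler_wpM2r => //.
  by apply: le_trans (ler_pM b0 b0' bn bn') _; clear; lra.
have b01 : nc (a^-1 - b) <= 2 * D by rewrite bE0 !ncM b1 mulr1 mulrC ler_wpM2r.
have b01' : nc (a^-1 - b') <= 2 * D' by rewrite bE0' !ncM b1 mulr1 mulrC ler_wpM2r.
have ad' : nc (a + d') <= 2 by have v := ncD a d'; rewrite a1 -/D' in v; clear - v d4'; lra.
have h2 : nc h <= X / 2 by rewrite hN.
have hm2 : nc (zm - zm') <= X / 2 by rewrite hm ncN.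
have hp2 : nc (zp - zp') <= X / 2 by rewrite hp.
have cp1 := le_trans (ccos_bound zp1) (ler_wpM2l (ler0n _ 16) zpN).
have cm1 := le_trans (ccos_bound zm1) (ler_wpM2l (ler0n _ 16) zmN).
have sp1 := le_trans (csin_bound zp1) (ler_wpM2l (ler0n _ 17) zpN).
have sm1 := le_trans (csin_bound zm1) (ler_wpM2l (ler0n _ 17) zmN).
have cpp := ccos_diff_bound zpN zpN' hp2 PQ PQ'.
have cmm := ccos_diff_bound zmN zmN' hm2 PQ PQ'.
have epN := csin_diff_bound zpN zpN' hp2 PQ PQ'.
have emN := csin_diff_bound zmN zmN' hm2 PQ PQ'.
have t2 : nc (dl * (a^-1 * (a^-1 - b) + b * (a^-1 - b')) * -1) <= Y * (1 * (2 * D) + 2 * (2 * D')).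
  rewrite mulrN1 ncN; apply: ncM_le => //; apply: ncD_le; apply: ncM_le => //.
  by rewrite b1.
apply: le_trans (rem_arith (s := s) (c := `|c|) (P := P) (Q := Q) (Q' := Q')
  (D := D) (D' := D') (X := X) (Y := Y) _ _ _ _ _ _ _ _ _) => //; last 2 first.
- by rewrite s0 s1.
- by rewrite normr_ge0 c1.
apply: ncD_le.
  apply: ncM_le; first by rewrite nc_real ger0_norm.
  apply: ncD_le.
    apply: ncB_le; last exact: ncM_le.
    by apply: ncD_le => //; rewrite ncN; exact: ncM_le.
  apply: ncM_le; first by rewrite sg1.
  by apply: ncD_le; exact: ncM_le.
apply: ncM_le; first by rewrite nc_real.
apply: ncB_le; last exact: ncM_le.
apply: ncD_le; last exact: ncM_le.
apply: ncD_le; last exact: ncM_le.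
apply: ncB_le; last exact: ncM_le.
apply: ncD_le; last exact: ncM_le.
by rewrite ncN; exact: ncM_le.
Qed.

Lemma bk_rem00 sg a s c p : nc sg = 1 -> nc a = 1 -> 0 <= s <= 1 -> `|c| <= 1 ->
  nc p <= 1 -> nc (bk_rem sg a s c p 0 0) <= 100 * nc p.
Proof.
move=> sg1 a1 /andP[s0 s1] c1 p1.
have b1 : nc a^-1 = 1 by rewrite ncV a1 invr1.
have E : bk_rem sg a s c p 0 0 =
  - a^-1 * (s%:C * (ccos (p / 2%:R) - 1) + c%:C * csin (p / 2%:R))
  + a * (sg * (s%:C * (ccos (p / 2%:R) - 1)) + c%:C * csin (p / 2%:R)).
  rewrite /bk_rem /bk_rhs !addr0 !subr0 !mul0r csin0 ccos0; ring.
have P0 := nc_ge0 p.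
have z1 : nc (p / 2%:R) <= nc p / 2 by rewrite nc_half.
have zle : nc (p / 2%:R) <= 1 by lra.
have cB := le_trans (ccos_bound zle) (ler_wpM2l (ler0n _ 16) z1).
have sB := le_trans (csin_bound zle) (ler_wpM2l (ler0n _ 17) z1).
have k1 : nc (s%:C * (ccos (p / 2%:R) - 1)) <= 1 * (16 * (nc p / 2)).
  by apply: ncM_le => //; rewrite nc_real ger0_norm.
have k2 : nc (c%:C * csin (p / 2%:R)) <= 1 * (17 * (nc p / 2)).
  by apply: ncM_le => //; rewrite nc_real.
have k3 : nc (sg * (s%:C * (ccos (p / 2%:R) - 1))) <= 1 * (1 * (16 * (nc p / 2))).
  by apply: ncM_le => //; rewrite sg1.
apply: (@le_trans _ _ (1 * (1 * (16 * (nc p / 2)) + 1 * (17 * (nc p / 2))) +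
  1 * (1 * (1 * (16 * (nc p / 2))) + 1 * (17 * (nc p / 2))))); last by lra.
rewrite E; apply: ncD_le; apply: ncM_le.
- by rewrite ncN b1.
- exact: ncD_le.
- by rewrite a1.
- exact: ncD_le.
Qed.

End NonlinearTerm.

(** * Contractions in the uniform distance and the complex linear equation *)

Section FixedPoint.
Context {R : realType} {J : Type}.
Local Notation nc := (@Normc.normc R).
Implicit Types (u v : J -> R[i]).

Lemma geometric_limit (x : nat -> R) (c : R) :
  (forall n, `|x n.+1 - x n| <= c / 2 ^+ n) ->
  exists l, forall n, `|x n - l| <= 2 * c / 2 ^+ n.
Proof.
move=> H.
have half n : 2 * c / 2 ^+ n.+1 = c / 2 ^+ n.
  by rewrite exprS; field; rewrite expf_neq0.
have two n : 2 * c / 2 ^+ n = c / 2 ^+ n + c / 2 ^+ n by ring.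
pose a n := x n - 2 * c / 2 ^+ n; pose b n := x n + 2 * c / 2 ^+ n.
have c0 : 0 <= c by have := le_trans (normr_ge0 _) (H 0%N); rewrite expr0 divr1.
have p0 n : 0 <= c / 2 ^+ n by rewrite divr_ge0 // exprn_ge0.
have aS n : a n <= a n.+1.
  by rewrite /a half two; have := H n => /ler_normlP[]; lra.
have bS n : b n.+1 <= b n.
  by rewrite /b half two; have := H n => /ler_normlP[]; lra.
have ah : {homo a : n m / (n <= m)%N >-> n <= m}.
  by apply: homo_leq => //; [exact: le_trans].
have bh : {homo b : n m / (n <= m)%N >-> n >= m}.
  by apply: (@homo_leq _ b (fun x y => y <= x)) => // y z t yz ty; exact: le_trans ty yz.
have ab n m : a n <= b m.
  apply: (@le_trans _ _ (a (maxn n m))); first by apply: ah; rewrite leq_maxl.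
  apply: (@le_trans _ _ (b (maxn n m))); last by apply: bh; rewrite leq_maxr.
  by rewrite /a /b; have := p0 (maxn n m); rewrite two; lra.
have hs : has_sup (range a).
  by split; [exists (a 0%N), 0%N|exists (b 0%N) => _ [n _ <-]].
exists (sup (range a)) => n.
have L : a n <= sup (range a) by apply: ub_le_sup; [case: hs|exists n].
have U : sup (range a) <= b n by apply: ge_sup; [case: hs|move=> _ [k _ <-]].
by apply/ler_normlP; rewrite /a in L; rewrite /b in U; split; lra.
Qed.

(** Banach's theorem for a relation instead of a map: the solution operators
    used below are only known through existence and estimates. *)
Lemma contraction_fixpoint (P : (J -> R[i]) -> Prop)
    (rel : (J -> R[i]) -> (J -> R[i]) -> Prop) (u0 : J -> R[i]) (c : R) :
  P u0 -> (forall u, P u -> exists2 v, P v & rel u v) ->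
  (forall u u' v v' (e : R), P u -> P u' -> rel u v -> rel u' v' -> P v -> P v' ->
     (forall j, nc (u j - u' j) <= e) -> forall j, nc (v j - v' j) <= e / 2) ->
  (forall u v, P u -> P v -> forall j, nc (u j - v j) <= c) ->
  (forall (us : nat -> J -> R[i]) u (k : R), (forall n, P (us n)) ->
     (forall n j, nc (us n j - u j) <= k / 2 ^+ n) -> P u) ->
  exists2 u, P u & rel u u.
Proof.
move=> Pu0 tot contr bd closed.
have /choice[f fP] : forall u, exists v, P u -> P v /\ rel u v.
  move=> u; have [Pu|nPu] := pselect (P u).
    by have [v Pv uv] := tot u Pu; exists v.
  by exists u => /nPu.
pose us n := iter n f u0.
have Pus n : P (us n) by elim: n => //= n /fP[].
have dn n j : nc (us n.+1 j - us n j) <= c / 2 ^+ n.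
  elim: n j => [|n IH] j; first by rewrite expr0 divr1; exact: bd.
  have := contr (us n.+1) (us n) (us n.+2) (us n.+1) (c / 2 ^+ n) (Pus _) (Pus _)
    (fP _ (Pus n.+1)).2 (fP _ (Pus n)).2 (Pus _) (Pus _) IH j.
  by rewrite exprS invfM mulrCA mulrC mulrA (mulrC 2^-1) mulrC.
have lim j : exists l, forall n, nc (us n j - l) <= 4 * c / 2 ^+ n.
  have [a aP] := @geometric_limit (fun n => Re (us n j)) c
    (fun n => ltac:(rewrite -ReB; exact: le_trans (nc_Re _) (dn n j))).
  have [b bP] := @geometric_limit (fun n => Im (us n j)) c
    (fun n => ltac:(rewrite -ImB; exact: le_trans (nc_Im _) (dn n j))).
  exists (a +i* b) => n; apply: (le_trans (nc_le_ReIm _)).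
  by rewrite ReB ImB /=; have := aP n; have := bP n; lra.
have [u uP] := choice lim.
have Pu : P u by apply: closed Pus _ => n j; exact: uP j n.
have [v Pv uv] := tot u Pu.
have E : v = u.
  apply/funext => j; apply/eqP; rewrite -subr_eq0; apply/eqP; apply: nc_eq0.
  apply/eqP; rewrite eq_le nc_ge0 andbT; apply/ler_addgt0Pl => e e0; rewrite addr0.
  have c0 : 0 <= c by apply: le_trans (bd _ _ Pu Pu j); exact: nc_ge0.
  have [n Hn] : exists n : nat, 4 * c / e < n%:R.
    by exists (Num.bound (4 * c / e)); apply: archi_boundP; rewrite divr_ge0 ?mulr_ge0 // ltW.
  have H1 := contr _ _ _ _ _ Pu (Pus n) uv (fP _ (Pus n)).2 Pv (Pus n.+1)
    (fun i => ltac:(rewrite -ncN opprB; exact: uP i n)) j.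
  have H2 := uP j n.+1.
  have H3 : 4 * c / 2 ^+ n.+1 = 4 * c / 2 ^+ n / 2 by rewrite exprS; field; rewrite expf_neq0.
  have H4 : 4 * c / 2 ^+ n <= e.
    rewrite ltr_pdivrMr // in Hn; rewrite ler_pdivrMr ?exprn_gt0 //.
    apply: (le_trans (ltW Hn)); rewrite mulrC ler_wpM2l ?(ltW e0) //.
    by rewrite -natrX ler_nat ltnW // ltn_expl.
  rewrite H3 in H2.
  have := ncD (v j - us n.+1 j) (us n.+1 j - u j); rewrite addrA subrK.
  by move: H1 H2 => /=; lra.
by exists u => //; rewrite -{2}E.
Qed.

End FixedPoint.

Section EnergyAbsorption.
Context {R : realType}.

(** Half of the energy [I2] is absorbed on the left-hand side. *)
Lemma energy_absorption (C t A B X I1 I2 : R) : 0 < C -> 0 <= A -> 0 <= B ->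
  X ^+ 2 = I2 -> I1 <= X * A -> 4 * C * (t * I2) <= I2 ->
  I2 <= C * (B ^+ 2 + (I1 + t * I2)) + C * (B ^+ 2 + (I1 + t * I2)) ->
  I2 <= (4 * (C + 1) * (A + B)) ^+ 2.
Proof.
move=> C0 A0 B0 X2 I1X tI H.
have CI := ler_wpM2l (ltW C0) I1X.
have K : I2 <= 4 * C * B ^+ 2 + 4 * C * (X * A) by clear - CI tI H; lra.
have K2 : 4 * C * (X * A) <= X ^+ 2 / 2 + 8 * C ^+ 2 * A ^+ 2.
  by have v := sqr_ge0 (X - 4 * C * A); clear - v; nra.
have K3 : I2 <= 8 * C * B ^+ 2 + 16 * C ^+ 2 * A ^+ 2 by rewrite X2 in K2; clear - K K2; lra.
apply: (le_trans K3).
have C1 : 2^-1 * C <= (C + 1) ^+ 2 by clear - C0; nra.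
have C2 : C ^+ 2 <= (C + 1) ^+ 2 by clear - C0; nra.
have e1 := ler_wpM2r (sqr_ge0 B) C1; have e2 := ler_wpM2r (sqr_ge0 A) C2.
have e3 := mulr_ge0 (sqr_ge0 (C + 1)) (mulr_ge0 A0 B0).
rewrite (_ : (4 * (C + 1) * (A + B)) ^+ 2 = 16 * ((C + 1) ^+ 2 * A ^+ 2) +
  16 * ((C + 1) ^+ 2 * B ^+ 2) + 32 * ((C + 1) ^+ 2 * (A * B))); last by ring.
by clear - e1 e2 e3; lra.
Qed.

End EnergyAbsorption.

Section ComplexLinear.
Context {R : realType} (beta : R) (beta_neq0 : beta != 0).
Local Notation nc := (@Normc.normc R).
Local Notation S := (wsech beta).
Local Notation T := (wtanh beta).
Implicit Types (q f g p : R -> R[i]) (c d : R[i]) (h : R -> R) (m A B : R).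

Lemma ReMreal (x : R) (z : R[i]) : Re (x%:C * z) = x * Re z.
Proof. by rewrite ReM /= mul0r subr0. Qed.

Lemma ImMreal (x : R) (z : R[i]) : Im (x%:C * z) = x * Im z.
Proof. by rewrite ImM /= mul0r addr0. Qed.

Lemma cprimitive_components q c f :
  cprimitive q (fun x => (T x)%:C * q x + (c * (S x)%:C + f x)) <->
  primitive (fun x => Re (q x)) (fun x => T x * Re (q x) + (Re c * S x + Re (f x))) /\
  primitive (fun x => Im (q x)) (fun x => T x * Im (q x) + (Im c * S x + Im (f x))).
Proof.
have ER x : Re ((T x)%:C * q x + (c * (S x)%:C + f x)) = T x * Re (q x) + (Re c * S x + Re (f x)).
  by rewrite !ReD ReMreal (mulrC c) ReMreal (mulrC (S x)).
have EI x : Im ((T x)%:C * q x + (c * (S x)%:C + f x)) = T x * Im (q x) + (Im c * S x + Im (f x)).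
  by rewrite !ImD ImMreal (mulrC c) ImMreal (mulrC (S x)).
by split=> -[a b]; split; [apply: eq_primitive a|apply: eq_primitive b
                          |apply: eq_primitive a|apply: eq_primitive b] => x //.
Qed.

Let cdominated f h m : cmeasurable f -> sq [set: R] h -> 0 <= m ->
  (forall x, nc (f x) <= `|h x| + m) ->
  dominated (fun x => Re (f x)) (n2 [set: R] h + m) /\
  dominated (fun x => Im (f x)) (n2 [set: R] h + m).
Proof.
move=> [mr mi] sh m0 fh; split; split => //; exists h, m; split => // x.
  exact: le_trans (nc_Re _) (fh x).
exact: le_trans (nc_Im _) (fh x).
Qed.

Lemma complex_solution_bound : exists2 C, 0 < C & forall q c f h m B,
  cprimitive q (fun x => (T x)%:C * q x + (c * (S x)%:C + f x)) ->
  (forall x, nc (q x) <= B) -> cmeasurable f -> sq [set: R] h -> 0 <= m ->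
  (forall x, nc (f x) <= `|h x| + m) ->
  nc c <= C * (n2 [set: R] h + m) /\ forall x, nc (q x) <= C * (n2 [set: R] h + m).
Proof.
have [C C0 HC] := bounded_solution_bound beta_neq0.
exists (2 * C); first by rewrite mulr_gt0.
move=> q c f h m B /cprimitive_components[qr qi] qB mf sh m0 fh.
have [dr di] := cdominated mf sh m0 fh.
have [c1 q1] := HC _ _ _ _ _ dr qr (fun x => le_trans (nc_Re _) (qB x)).
have [c2 q2] := HC _ _ _ _ _ di qi (fun x => le_trans (nc_Im _) (qB x)).
split; first by have := nc_le_ReIm c; lra.
by move=> x; have := nc_le_ReIm (q x); have := q1 x; have := q2 x; lra.
Qed.

Lemma complex_solution_exists f h m : cmeasurable f -> sq [set: R] h -> 0 <= m ->
  (forall x, nc (f x) <= `|h x| + m) ->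
  exists q c B, cprimitive q (fun x => (T x)%:C * q x + (c * (S x)%:C + f x)) /\
    forall x, nc (q x) <= B.
Proof.
move=> mf sh m0 fh; have [dr di] := cdominated mf sh m0 fh.
have [q1 [c1 [B1 [p1 b1]]]] := bounded_solution_exists beta_neq0 dr.
have [q2 [c2 [B2 [p2 b2]]]] := bounded_solution_exists beta_neq0 di.
exists (fun x => q1 x +i* q2 x), (c1 +i* c2), (B1 + B2); split.
  by apply/cprimitive_components; split.
by move=> x; apply: (le_trans (nc_le_ReIm _)); exact: (lerD (b1 x) (b2 x)).
Qed.

Lemma complex_energy : exists2 C, 0 < C & exists2 t0, 0 < t0 &
  forall q g h (t : R) A B, cprimitive q (fun x => (T x)%:C * q x + g x) ->
  (forall x, nc (q x) <= B) -> sq [set: R] h -> (forall x, 0 <= h x) ->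
  n2 [set: R] h <= A -> 0 <= t -> t <= t0 ->
  (forall x, nc (g x) <= h x + t * nc (q x)) ->
  csq q /\ cn2 q <= C * (A + B).
Proof.
have [C C0 HC] := energy_estimate beta_neq0.
exists (4 * (C + 1)); first by rewrite mulr_gt0 // addr_gt0.
exists (4 * C)^-1; first by rewrite invr_gt0 mulr_gt0.
move=> q g h t A B qp qB sh h0 hA t0 tC gh.
have B0 : 0 <= B by apply: le_trans (qB 0); exact: nc_ge0.
have A0 : 0 <= A by apply: le_trans hA; exact: n2_ge0.
have cE : cprimitive q (fun x => (T x)%:C * q x + (0 * (S x)%:C + g x)).
  case: qp => a b; split; [apply: eq_primitive a|apply: eq_primitive b] => x //.
    by rewrite mul0r add0r.
  by rewrite mul0r add0r.
have [qr qi] := (cprimitive_components q 0 g).1 cE.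
have mq := cprimitive_measurable qp.
have [cr ci] := (primitive_continuous qp.1, primitive_continuous qp.2).
have cT := continuous_wtanh (beta := beta).
have lr : loc_int (fun x => Re (g x)).
  have := loc_intB qr.1 (loc_int_cont (c_M cT cr)); congr loc_int; apply/funext => x /=.
  by rewrite mul0r add0r; ring.
have li : loc_int (fun x => Im (g x)).
  have := loc_intB qi.1 (loc_int_cont (c_M cT ci)); congr loc_int; apply/funext => x /=.
  by rewrite mul0r add0r; ring.
have qr' : primitive (fun x => Re (q x)) (fun x => T x * Re (q x) + Re (g x)).
  by apply: eq_primitive qr => x //=; rewrite mul0r add0r.
have qi' : primitive (fun x => Im (q x)) (fun x => T x * Im (q x) + Im (g x)).
  by apply: eq_primitive qi => x //=; rewrite mul0r add0r.
have mnq := measurable_nc mq.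
have cn : loc_int (fun x => nc (q x) ^+ 2).
  have E : (fun x => nc (q x) ^+ 2) = (fun x => Re (q x) * Re (q x) + Im (q x) * Im (q x)).
    by apply/funext => x; rewrite ncE !expr2.
  by rewrite E; apply: loc_int_cont; exact: c_D (c_M cr cr) (c_M ci ci).
have mh : measurable_fun [set: R] h by case: sh.
have lh2 : loc_int (fun x => h x ^+ 2).
  by case: sh => _ _ ih2; apply: integrable_loc_int ih2; exact: measurable_funX.
have lqh : loc_int (fun x => nc (q x) * h x).
  apply: loc_int_le (loc_intD cn lh2); first exact: measurable_funM.
  move=> x; rewrite [leRHS]ger0_norm ?addr_ge0 ?sqr_ge0 //.
  rewrite ger0_norm ?mulr_ge0 ?nc_ge0 //.
  by have := nc_ge0 (q x); have := h0 x; nra.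
have bound (n : nat) : iint (- n%:R) n%:R (fun x => nc (q x) ^+ 2) <=
    (4 * (C + 1) * (A + B)) ^+ 2.
  have n0 : (0 : R) <= n%:R by [].
  have nn : - n%:R <= n%:R :> R by lra.
  set I2 := iint _ _ _.
  have I20 : 0 <= I2 by apply: iint_ge0 => x _; exact: sqr_ge0.
  set I1 := iint (- n%:R) n%:R (fun x => nc (q x) * h x).
  have comp (r k : R -> R) : primitive r (fun x => T x * r x + k x) -> loc_int k ->
      (forall x, `|r x| <= nc (q x)) -> (forall x, `|k x| <= nc (g x)) ->
      iint (- n%:R) n%:R (fun x => r x ^+ 2) <= C * (B ^+ 2 + (I1 + t * I2)).
    move=> rp lk rq kg.
    apply: (le_trans (HC _ _ _ rp (fun x => le_trans (rq x) (qB x)) lk n)).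
    rewrite ler_pM2l // lerD2l /I1 /I2 -iintZ // -iintD //; last exact: loc_intZ.
    have lrk : loc_int (fun x => r x * k x).
      by apply: loc_intMc => //; exact: primitive_continuous rp.
    apply: le_iint.
    - apply: loc_int_le lrk; last by move=> x; rewrite !normrM !normr_id.
      by apply: measurable_funM; apply: measurableT_comp => //;
        [exact: continuous_measurable_fun (primitive_continuous rp)|case: lk].
    - by apply: loc_intD => //; exact: loc_intZ.
    - move=> x _; have q0 := nc_ge0 (q x); have g0 := nc_ge0 (g x).
      have := ler_pM (normr_ge0 _) (normr_ge0 _) (rq x) (kg x).
      have := ler_wpM2l q0 (gh x); rewrite expr2; lra.
  have H1 := comp _ _ qr' lr (fun x => nc_Re _) (fun x => nc_Re _).
  have H2 := comp _ _ qi' li (fun x => nc_Im _) (fun x => nc_Im _).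
  have EI : I2 = iint (- n%:R) n%:R (fun x => Re (q x) ^+ 2) +
                 iint (- n%:R) n%:R (fun x => Im (q x) ^+ 2).
    rewrite -iintD; first by apply: eq_iint => x _; rewrite ncE.
      exact: loc_int_cont (c_M cr cr).
    exact: loc_int_cont (c_M ci ci).
  have sI : sq `[- n%:R, n%:R] (fun x => nc (q x)) by split => //; exact: cn.2.
  have [sh' nh'] := @sqS R `[- n%:R, n%:R] setT h (measurable_itv _) (@subsetT _ _) sh.
  have [_ cs] := cauchy_schwarz sI sh'.
  have X2 : n2 `[- n%:R, n%:R] (fun x => nc (q x)) ^+ 2 = I2 by rewrite n2_sqr.
  have I1X : I1 <= n2 `[- n%:R, n%:R] (fun x => nc (q x)) * A.
    apply: (@le_trans _ _ (n2 `[- n%:R, n%:R] (fun x => nc (q x)) * n2 `[- n%:R, n%:R] h)).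
      apply: le_trans cs; rewrite /I1 le_eqVlt; apply/orP; left; apply/eqP.
      by apply: eq_iint => x _; rewrite ger0_norm // mulr_ge0 ?nc_ge0.
    by rewrite ler_wpM2l ?n2_ge0 // (le_trans nh').
  set X := n2 `[- n%:R, n%:R] _ in X2 I1X.
  have Xge0 : 0 <= X := n2_ge0 _ _.
  have tC2 : 4 * C * t <= 1 by move: tC; rewrite -[leRHS]mul1r ler_pdivlMr ?mulr_gt0 // mulrC.
  have tI : 4 * C * (t * I2) <= I2 by rewrite mulrA; apply: ler_piMl.
  apply: (energy_absorption C0 A0 B0 X2 I1X tI).
  by rewrite [leLHS]EI; exact: lerD H1 H2.
have [iq nq] := integrable_line cn (fun x => sqr_ge0 _) bound.
split; first by split => //; split.
apply: n2_le => //.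
by rewrite !mulr_ge0 // ?addr_ge0 // ltW.
Qed.

End ComplexLinear.

(** * Solving the nonlinear equation *)

Section RadiusArithmetic.
Context {R : realType}.

(** The constants of the fixed point argument: [K e] is the radius of the ball
    that is mapped into itself. *)
Lemma radius (La L t0 : R) : 1 <= La -> 0 < L -> 0 < t0 ->
  exists K e0, [/\ 0 < K, 0 < e0 & forall e, 0 <= e -> e <= e0 ->
    [/\ e <= K * e, K * e <= 4^-1,
        La * (e + (200 * e + 400 * (K * e) * (K * e) + 100 * e * (K * e))) <= K * e,
        L * (K * e) <= 4^-1 & 400 * (K * e) <= t0]].
Proof.
move=> La1 L0 t00; have La0 : 0 < La := lt_le_trans ltr01 La1.
have [K KE] : exists K, K = 30 * 30 * La by eexists.
have K1 : 1 <= K by rewrite KE; clear - La1; lra.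
have K0 : 0 < K := lt_le_trans ltr01 K1.
have LaK := mulr_gt0 La0 K0; have LK := mulr_gt0 L0 K0; have Kt := divr_gt0 K0 t00.
have [D0 D0E] : exists D0, D0 = 40 * 40 * (La * K) + 8 * (L * K) + 8 * K + 20 * 20 * (K / t0).
  by eexists.
have D00 : 0 < D0 by rewrite D0E; clear - LaK LK Kt K0; lra.
exists K, D0^-1; split => //; first by rewrite invr_gt0.
move=> e e0 eD.
have eD1 : e * D0 <= 1 by rewrite -ler_pdivlMr // div1r.
have w1 := mulr_ge0 e0 (ltW LaK); have w2 := mulr_ge0 e0 (ltW LK).
have w3 := mulr_ge0 e0 (ltW K0); have w4 := mulr_ge0 e0 (ltW Kt).
rewrite D0E in eD1.
have [f1 f2 f3 f4] : [/\ 40 * 40 * (e * (La * K)) <= 1, 8 * (e * (L * K)) <= 1,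
    8 * (e * K) <= 1 & 20 * 20 * (e * (K / t0)) <= 1].
  by clear - w1 w2 w3 w4 eD1; split; lra.
have f5 : e * La <= e * (La * K) by rewrite ler_wpM2l // ler_peMr // ltW.
split.
- by rewrite ler_peMl.
- by clear - f3; lra.
- have Ke0 : 0 <= K * e by rewrite mulrC.
  have g1 := ler_wpM2r Ke0 f1.
  have g2 := ler_wpM2r Ke0 f5.
  have g3 : 30 * 30 * (La * e) = K * e by rewrite KE mulrA.
  have g4 : 0 <= La * e by rewrite mulr_ge0 // ltW.
  by clear - g1 g2 g3 g4 Ke0; lra.
- by clear - f2; lra.
- have : 20 * 20 * (K * e) / t0 <= 1 by clear - f4; lra.
  by rewrite ler_pdivrMr // mul1r => h; clear - h; lra.
Qed.

Lemma source_ge0 (e r : R) : 0 <= e -> 0 <= r -> 0 <= 200 * e + 400 * r * r + 100 * e * r.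
Proof. by move=> e0 r0; have := mulr_ge0 r0 r0; have := mulr_ge0 e0 r0; lra. Qed.

Lemma self_arith (e r z y w k : R) : 0 <= e -> 0 <= r -> 0 <= k -> k <= 1 ->
  0 <= z -> 0 <= y -> w <= e -> z <= r -> y <= r ->
  200 * w + 100 * r * k * z + 100 * (e + 3 * r) * y <= 200 * e + 400 * r * r + 100 * e * r.
Proof.
move=> e0 r0 k0 k1 z0 y0 we zr yr.
have h1 : r * k * z <= r * r.
  by apply: ler_pM => //; [exact: mulr_ge0|rewrite ler_piMr].
have h2 : (e + 3 * r) * y <= (e + 3 * r) * r by rewrite ler_wpM2l //; lra.
lra.
Qed.

Lemma energy_arith (e r z y w v k s : R) : 0 <= r -> e <= r -> r <= 4^-1 -> 0 <= s -> z <= r ->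
  0 <= y ->
  k * r * s + (v + (200 * w + 100 * r * s * z + 100 * (e + 3 * r) * y)) <=
  v + 200 * w + (k + 100) * r * s + 400 * r * y.
Proof.
move=> r0 er r4 s0 zr y0.
have b1 : r * s * z <= r * s * 1 by rewrite ler_wpM2l ?mulr_ge0 //; lra.
have b2 : (e + 3 * r) * y <= (4 * r) * y by rewrite ler_wpM2r //; lra.
lra.
Qed.

Lemma quarter_double (l y : R) : 0 <= y -> l <= 4^-1 -> l * (y + y) <= y / 2.
Proof. by move=> y0 l4; have := ler_wpM2r y0 l4; lra. Qed.

Lemma lipschitz_arith (C k e z : R) : 0 <= C * (500 * e * z) -> 0 <= k ->
  C * (500 * e * z) <= 500 * C * (1 + k) * e * z /\
  k * (C * (500 * e * z)) <= 500 * C * (1 + k) * e * z.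
Proof. by move=> w0 k0; have := mulr_ge0 k0 w0; split; lra. Qed.

End RadiusArithmetic.

Section NonlinearEquation.
Context {R : realType} (beta : R) (beta_neq0 : beta != 0).
Local Notation nc := (@Normc.normc R).
Local Notation S := (wsech beta).
Local Notation T := (wtanh beta).
Context (sg a : R[i]) (sg1 : nc sg = 1) (a1 : nc a = 1)
  (aE : (a + a^-1) / 2%:R = beta%:C) (slope_neq0 : bk_slope sg a != 0).
Local Notation th := (fun x : R => - tanh (beta * x)).
Implicit Types (p q r : R -> R[i]) (d : R[i]) (x e : R).

(** The equation for the perturbation [q] of the transformed field and [d] of
    the parameter, given the perturbations [p] and [r] of the original field
    and of its time derivative. *)
Definition bk_sol p r q d :=
  cprimitive q (fun x => r x +
    (bk_rhs sg (a + d) (S x) (th x) (p x) (q x) - bk_rhs sg a (S x) (th x) 0 0)).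

Local Notation rem p q d := (fun x => bk_rem sg a (S x) (th x) (p x) (q x) d).
Local Notation kap := (bk_slope sg a).

Lemma bk_rhs_split p q d x :
  bk_rhs sg (a + d) (S x) (th x) (p x) (q x) - bk_rhs sg a (S x) (th x) 0 0 =
  (T x)%:C * q x + (kap * d * (S x)%:C + rem p q d x).
Proof.
rewrite /bk_rem aE.
have -> : beta%:C * (th x)%:C * q x = - ((T x)%:C * q x).
  by rewrite -rmorphM /= mulrN rmorphN mulNr.
set u := bk_rhs _ _ _ _ _ _; set v := bk_rhs _ _ _ _ _ _; ring.
Qed.

Lemma bk_solE p r q d : bk_sol p r q d <->
  cprimitive q (fun x => (T x)%:C * q x + (kap * d * (S x)%:C + (r x + rem p q d x))).
Proof.
rewrite /bk_sol; suff -> : (fun x => r x + (bk_rhs sg (a + d) (S x) (th x) (p x) (q x) -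
    bk_rhs sg a (S x) (th x) 0 0)) =
  (fun x => (T x)%:C * q x + (kap * d * (S x)%:C + (r x + rem p q d x))) by [].
apply/funext => x; rewrite bk_rhs_split.
set u := bk_rem _ _ _ _ _ _ _; ring.
Qed.

Lemma th_le1 x : `|th x| <= 1. Proof. by rewrite normrN tanh_le1. Qed.

Lemma S01 x : 0 <= S x <= 1. Proof. by rewrite wsech_ge0 wsech_le1. Qed.

Lemma cmeasurable_ccos (u : R -> R[i]) : cmeasurable u -> cmeasurable (fun x => ccos (u x)).
Proof.
move=> m; apply: cmeasurableM; last exact: cmeasurable_cst.
have mi : cmeasurable (fun x => (0 +i* 1) * u x).
  by apply: cmeasurableM => //; exact: cmeasurable_cst.
by apply: cmeasurableD; apply: cmeasurable_cexp => //; exact: cmeasurableN.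
Qed.

Lemma cmeasurable_wsech : cmeasurable (fun x => (S x)%:C).
Proof. by apply: cmeasurable_real; apply: continuous_measurable_fun; exact: continuous_wsech. Qed.

Lemma cmeasurable_th : cmeasurable (fun x => (th x)%:C).
Proof.
apply: cmeasurable_real; apply: continuous_measurable_fun.
exact: c_N (c_comp (c_M (c_cst beta) (@c_id R)) continuous_tanh).
Qed.

Lemma cmeasurable_rhs (b : R[i]) p q : cmeasurable p -> cmeasurable q ->
  cmeasurable (fun x => bk_rhs sg b (S x) (th x) (p x) (q x)).
Proof.
move=> mp mq.
have mS := cmeasurable_wsech; have mt := cmeasurable_th.
have C z := @cmeasurable_cst R z.
have mz : cmeasurable (fun x => (p x + q x) / 2%:R).
  by apply: cmeasurableM => //; exact: cmeasurableD.
have mw : cmeasurable (fun x => (p x - q x) / 2%:R).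
  by apply: cmeasurableM => //; exact: cmeasurableB.
have ct z := cmeasurableM mt (cmeasurable_csin z).
have cs z := cmeasurable_ccos z.
exact: (cmeasurableD (cmeasurableM (C _) (cmeasurableD (cmeasurableM mS (cs _ mz)) (ct _ mz)))
  (cmeasurableM (C _) (cmeasurableD (cmeasurableM (cmeasurableM (C _) mS) (cs _ mw)) (ct _ mw)))).
Qed.

Lemma cmeasurable_rem p q d : cmeasurable p -> cmeasurable q -> cmeasurable (rem p q d).
Proof.
move=> mp mq.
have mS := cmeasurable_wsech; have mt := cmeasurable_th.
have C z := @cmeasurable_cst R z.
apply: cmeasurableB; last by apply: cmeasurableM.
apply: cmeasurableD.
  apply: cmeasurableB; first exact: cmeasurable_rhs.
  exact: (@cmeasurable_rhs a (fun=> 0) (fun=> 0) (C 0) (C 0)).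
by apply: cmeasurableM => //; apply: cmeasurableM.
Qed.

Lemma sq0 : sq [set: R] (fun=> 0 : R) /\ n2 [set: R] (fun=> 0 : R) = 0.
Proof.
have [s n] := @sqZ R setT 0 _ (sq_wsech beta_neq0).
have E : (fun x => 0 * S x) = (fun=> 0) by apply/funext => x; rewrite mul0r.
by rewrite E in s n; split => //; rewrite n normr0 mul0r.
Qed.

Lemma nc_kap_gt0 : 0 < nc kap.
Proof.
rewrite lt0r nc_ge0 andbT; apply/eqP => /nc_eq0 E.
by move: slope_neq0; rewrite E eqxx.
Qed.

(** The difference of two solutions solves the linearized equation with a
    source that is small relative to the difference. *)
Lemma bk_difference : exists2 L, 0 < L & forall p r q d q' d' (X Y B e : R),
  cmeasurable p -> cmeasurable q -> cmeasurable q' ->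
  e <= 4^-1 -> (forall x, nc (p x) <= e) -> (forall x, nc (q x) <= e) ->
  (forall x, nc (q' x) <= e) -> nc d <= e -> nc d' <= e ->
  (forall x, nc (q x - q' x) <= X) -> nc (d - d') <= Y ->
  forall v v' c c', (forall x, nc (v x) <= B) -> (forall x, nc (v' x) <= B) ->
  cprimitive v (fun x => (T x)%:C * v x + (kap * c * (S x)%:C + (r x + rem p q d x))) ->
  cprimitive v' (fun x => (T x)%:C * v' x + (kap * c' * (S x)%:C + (r x + rem p q' d' x))) ->
  nc (c - c') <= L * e * (X + Y) /\ forall x, nc (v x - v' x) <= L * e * (X + Y).
Proof.
have [C C0 HC] := complex_solution_bound beta_neq0.
have k0 := nc_kap_gt0.
pose L := 500 * C * (1 + (nc kap)^-1).
have L0 : 0 < L.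
  have : 0 < C * (1 + (nc kap)^-1) by rewrite mulr_gt0 ?addr_gt0 ?invr_gt0.
  by rewrite /L; lra.
exists L => // p r q d q' d' X Y B e mp mq mq' e4 pe qe qe' de de' qX dY
  v v' c c' vB vB' pv pv'.
have e0 : 0 <= e by apply: le_trans (pe 0); exact: nc_ge0.
have X0 : 0 <= X by apply: le_trans (qX 0); exact: nc_ge0.
have Y0 : 0 <= Y by apply: le_trans dY; exact: nc_ge0.
have [s0 n0] := sq0.
pose f := fun x => rem p q d x - rem p q' d' x.
have mf : cmeasurable f by apply: cmeasurableB; exact: cmeasurable_rem.
have fB x : nc (f x) <= `|(fun=> 0 : R) x| + 500 * e * (X + Y).
  rewrite normr0 add0r /f.
  apply: (le_trans (bk_rem_lipschitz sg1 a1 (S01 x) (th_le1 x) _ _ _ _ _));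
    try exact: le_trans e4.
  have h1 : (nc (p x) + nc (q x) + nc (q' x) + nc d + nc d') * nc (q x - q' x) <= 5 * e * X.
    apply: ler_pM => //; rewrite ?nc_ge0 // ?addr_ge0 ?nc_ge0 //.
    by have := pe x; have := qe x; have := qe' x; lra.
  have /andP[S0 S1] := S01 x.
  have h2 : ((nc d + nc d') * S x + nc (p x) + nc (q x)) * nc (d - d') <= 5 * e * Y.
    apply: ler_pM => //; rewrite ?nc_ge0 //.
      by rewrite !addr_ge0 ?mulr_ge0 ?addr_ge0 ?nc_ge0.
    have := ler_piMr (addr_ge0 (nc_ge0 d) (nc_ge0 d')) S1.
    by have := pe x; have := qe x; lra.
  lra.
have m0 : 0 <= 500 * e * (X + Y) by have := mulr_ge0 e0 (addr_ge0 X0 Y0); lra.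
have pD : cprimitive (fun x => v x - v' x)
    (fun x => (T x)%:C * (v x - v' x) + (kap * (c - c') * (S x)%:C + f x)).
  have := cprimitiveB pv pv'; congr cprimitive; apply/funext => x /=.
  rewrite /f; set u := bk_rem _ _ _ _ _ _ _; set w := bk_rem _ _ _ _ _ _ _; ring.
have vv x : nc (v x - v' x) <= B + B := ncB_le (vB x) (vB' x).
have [H1 H2] := HC _ _ _ _ _ (B + B) pD vv mf s0 m0 fB.
rewrite n0 add0r in H1 H2.
have ki : 0 < (nc kap)^-1 by rewrite invr_gt0.
have CM : 0 <= C * (500 * e * (X + Y)) by rewrite mulr_ge0 // ltW.
have [l1 l2] := lipschitz_arith CM (ltW ki).
split=> [|x]; last exact: le_trans (H2 x) l1.
rewrite ncM in H1; apply: le_trans l2.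
by rewrite mulrC ler_pdivlMr // mulrC.
Qed.

(** By [bk_difference], a bound on the difference of two small solutions can be
    halved, hence the difference vanishes. *)
Lemma bk_unique : exists2 e, 0 < e & forall p r q d q' d',
  cmeasurable p -> (forall x, nc (p x) <= e) ->
  (forall x, nc (q x) <= e) -> (forall x, nc (q' x) <= e) -> nc d <= e -> nc d' <= e ->
  bk_sol p r q d -> bk_sol p r q' d' -> d = d' /\ forall x, q x = q' x.
Proof.
have [L L0 HL] := bk_difference.
have [e [e0 e4 eL]] : exists e, [/\ 0 < e, e <= 4^-1 & L * e <= 4^-1].
  exists (4 * (L + 1))^-1; rewrite invr_gt0 mulr_gt0 // ?addr_gt0 //; split => //.
    by rewrite lef_pV2 ?posrE ?mulr_gt0 ?addr_gt0 // ler_peMr //; lra.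
  by rewrite invfM mulrCA ger_pMr // ler_pdivrMr ?mul1r ?addr_gt0 //; lra.
exists e => // p r q d q' d' mp pe qe qe' de de' s s'.
have mq := cprimitive_measurable s; have mq' := cprimitive_measurable s'.
move/bk_solE: s => s; move/bk_solE: s' => s'.
have H n : (forall x, nc (q x - q' x) <= 2 / 2 ^+ n) /\ nc (d - d') <= 2 / 2 ^+ n.
  elim: n => [|n [IH1 IH2]].
    rewrite expr0 divr1; split => [x|].
      by have := ncB_le (qe x) (qe' x); lra.
    by have := ncB_le de de'; lra.
  have [H2 H1] := HL p r q d q' d' _ _ e e mp mq mq' e4 pe qe qe' de de' IH1 IH2
    q q' d d' qe qe' s s'.
  have K : L * e * (2 / 2 ^+ n + 2 / 2 ^+ n) <= 2 / 2 ^+ n.+1.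
    rewrite exprS invfM mulrCA.
    have z0 : 0 <= (2 ^+ n)^-1 :> R by rewrite invr_ge0 exprn_ge0.
    have := ler_wpM2r z0 eL; lra.
  by split => [x|]; [exact: le_trans (H1 x) K|exact: le_trans H2 K].
have Z (z : R[i]) : (forall n, nc z <= 2 / 2 ^+ n) -> z = 0.
  move=> Hz; apply: nc_eq0; apply/eqP; rewrite eq_le nc_ge0 andbT.
  by apply: (@le_geometric _ _ _ 2) => n; rewrite add0r; exact: Hz.
split; first by apply/eqP; rewrite -subr_eq0; apply/eqP; apply: Z => n; exact: (H n).2.
by move=> x; apply/eqP; rewrite -subr_eq0; apply/eqP; apply: Z => n; exact: (H n).1.
Qed.

Lemma cmeasurable_uniform_limit (us : nat -> R -> R[i]) (u : R -> R[i]) (k : R) :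
  (forall n, cmeasurable (us n)) -> (forall n x, nc (us n x - u x) <= k / 2 ^+ n) ->
  cmeasurable u.
Proof.
move=> mus H.
have cv0 : (fun n => k / 2 ^+ n) @ \oo --> (0 : R).
  rewrite -[X in _ --> X](mulr0 k); apply: cvgM; first exact: cvg_cst.
  under eq_fun do rewrite -exprVn; apply: cvg_expr; rewrite ger0_norm; lra.
have lim (v : nat -> R) l : (forall n, `|v n - l| <= k / 2 ^+ n) -> v @ \oo --> l.
  move=> Hv; apply/cvgrPdist_le => e e0.
  move/cvgrPdist_le : cv0 => /(_ e e0); apply: filterS => n.
  rewrite sub0r normrN distrC => h; apply: (le_trans (Hv n)).
  exact: le_trans (ler_norm _) h.
split.
  apply: (measurable_fun_cvg (fun n => (mus n).1)) => x _.
  by apply: lim => n; rewrite -ReB; exact: le_trans (nc_Re _) (H n x).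
apply: (measurable_fun_cvg (fun n => (mus n).2)) => x _.
by apply: lim => n; rewrite -ImB; exact: le_trans (nc_Im _) (H n x).
Qed.

Let lip0 p q d x (e r : R) : e <= 4^-1 -> r <= 4^-1 -> nc (p x) <= e -> nc (q x) <= r ->
  nc d <= r -> nc (rem p q d x) <= 200 * nc (p x) + 100 * r * S x * nc d + 100 * (e + 3 * r) * nc (q x).
Proof.
move=> e4 r4 pe qr dr.
have /andP[S0 S1] := S01 x.
have P0 := nc_ge0 (p x); have Q0 := nc_ge0 (q x); have D0 := nc_ge0 d.
have := bk_rem_lipschitz (q := q x) (q' := 0) (d := d) (d' := 0) sg1 a1 (S01 x) (th_le1 x)
  (le_trans pe e4) (le_trans qr r4) ltac:(by rewrite nc0) (le_trans dr r4) ltac:(by rewrite nc0).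
rewrite !subr0 nc0 !addr0 => H.
have px1 : nc (p x) <= 1 by lra.
have H0 := bk_rem00 sg1 a1 (S01 x) (th_le1 x) px1.
have := ncD (rem p q d x - bk_rem sg a (S x) (th x) (p x) 0 0) (bk_rem sg a (S x) (th x) (p x) 0 0).
rewrite subrK => K.
have h1 : (nc (p x) + nc (q x) + nc d) * nc (q x) <= (e + 2 * r) * nc (q x).
  by rewrite ler_wpM2r //; lra.
have h2 : nc d * S x * nc d <= r * S x * nc d.
  by rewrite ler_wpM2r // ler_wpM2r.
have h3 : nc (p x) * nc d <= nc (p x) * 1 by rewrite ler_wpM2l //; lra.
have h4 : nc (q x) * nc d <= nc (q x) * r by rewrite ler_wpM2l.
lra.
Qed.

(** The contraction acts on the pair of the field and the parameter, encoded as
    a function on [option R] with the parameter at [None], in the uniform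
    distance; the L2 bound is obtained afterwards from the energy estimate, as
    the part of the source that is not square integrable is a small multiple of
    the solution. *)
Lemma bk_exists : exists e0 C, [/\ 0 < e0, 0 < C & forall p r e,
  0 <= e -> e <= e0 -> (forall x, nc (p x) <= e) -> csq p -> cn2 p <= e ->
  csq r -> cn2 r <= e ->
  exists q d, [/\ bk_sol p r q d, forall x, nc (q x) <= C * e, nc d <= C * e,
    csq q & cn2 q <= C * e]].
Proof.
have [C1 C10 HC1] := complex_solution_bound beta_neq0.
have [L L0 HL] := bk_difference.
have [CE CE0 [t0 t00 HCE]] := complex_energy beta_neq0.
have k0 := nc_kap_gt0; have ki : 0 < (nc kap)^-1 by rewrite invr_gt0.
pose La := C1 * (1 + (nc kap)^-1) + 1.
have La1 : 1 <= La by rewrite /La lerDr mulr_ge0 ?(ltW C10) // addr_ge0 // ltW.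
have La0 : 0 < La by lra.
have [K [E0 [K0 E00 small]]] := radius La1 L0 t00.
pose CC := K + CE * (1 + 200 + (nc kap + 100) * K * n2 [set: R] S + K).
have nS := n2_ge0 setT S.
have k100 : 0 <= nc kap + 100 := addr_ge0 (nc_ge0 _) (ler0n _ _).
have kKS := mulr_ge0 (mulr_ge0 k100 (ltW K0)) nS.
have CEp : 0 < CE * (1 + 200 + (nc kap + 100) * K * n2 [set: R] S + K).
  apply: (mulr_gt0 CE0); apply: ltr_wpDl K0.
  exact: addr_ge0 (addr_ge0 ler01 (ler0n _ _)) kKS.
have CC0 : 0 < CC by exact: addr_gt0.
exists E0, CC; split => //.
move=> p r e e0 eD pe sp np sr nr.
pose rr := K * e.
have [er rr4 self Lr tr] := small e e0 eD.
rewrite -/rr in er rr4 self Lr tr.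
have rr0 : 0 <= rr := le_trans e0 er.
have e4 : e <= 4^-1 := le_trans er rr4.
clear small eD.
have [mp _] := sp; have [mr snr] := sr.
pose fd (u : option R -> R[i]) x := u (Some x).
pose P (u : option R -> R[i]) := cmeasurable (fd u) /\ forall j, nc (u j) <= rr.
pose rel (u v : option R -> R[i]) := cprimitive (fd v)
  (fun x => (T x)%:C * fd v x + (kap * v None * (S x)%:C + (r x + rem p (fd u) (u None) x))).
have [u [mu_ ub] uu] : exists2 u, P u & rel u u.
  apply: (@contraction_fixpoint R (option R) P rel (fun=> 0) (rr + rr)).
  - by split=> [|j]; [exact: cmeasurable_cst|rewrite nc0].
  - move=> u [mu_ ub].
    have mrem := cmeasurable_rem (u None) mp mu_.
    have mf : cmeasurable (fun x => r x + rem p (fd u) (u None) x) by exact: cmeasurableD.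
    pose m := 200 * e + 400 * rr * rr + 100 * e * rr.
    have m0 : 0 <= m by exact: source_ge0.
    have fB x : nc (r x + rem p (fd u) (u None) x) <= `|nc (r x)| + m.
      rewrite ger0_norm ?nc_ge0 //; apply: ncD_le => //.
      apply: (le_trans (lip0 e4 rr4 (pe x) (ub (Some x)) (ub None))).
      have /andP[S0 S1] := S01 x.
      by apply: self_arith => //; first [exact: nc_ge0|exact: ub].
    have [q [c [B [qp qB]]]] := complex_solution_exists beta_neq0 mf snr m0 fB.
    have [cb qb] := HC1 _ _ _ _ _ _ qp qB mf snr m0 fB.
    have cE : kap * (c / kap) = c by rewrite mulrC divfK.
    pose A := n2 [set: R] (fun x => nc (r x)) + m.
    have A0 : 0 <= A by rewrite addr_ge0 // n2_ge0.
    have Ab : La * A <= rr.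
      by apply: le_trans self; rewrite ler_wpM2l ?(ltW La0) // lerD2r.
    have CLa : C1 * A <= La * A.
      by rewrite ler_wpM2r // /La mulrDr mulr1 -addrA lerDl addr_ge0 // mulr_ge0 // ltW.
    have CLa' : (nc kap)^-1 * (C1 * A) <= La * A.
      rewrite mulrA ler_wpM2r // /La mulrDr mulr1 (addrC C1) mulrC -addrA lerDl.
      by rewrite addr_ge0 // ltW.
    exists (fun j => if j is Some x then q x else c / kap).
      split; first exact: cprimitive_measurable qp.
      case=> [x|]; first exact: le_trans (qb x) (le_trans CLa Ab).
      rewrite ncM ncV mulrC; apply: le_trans (le_trans CLa' Ab).
      by rewrite ler_wpM2l // ltW.
    by rewrite /rel /fd /= cE.
  - move=> u u' v v' e' [mu_ ub] [mu'_ ub'] uv uv' [_ vb] [_ vb'] ue.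
    have e'0 : 0 <= e' by apply: le_trans (ue None); exact: nc_ge0.
    have [H1 H2] := HL p r (fd u) (u None) (fd u') (u' None) e' e' rr rr mp mu_ mu'_
      rr4 (fun x => le_trans (pe x) er) (fun x => ub (Some x)) (fun x => ub' (Some x))
      (ub None) (ub' None) (fun x => ue (Some x)) (ue None) (fd v) (fd v') (v None) (v' None)
      (fun x => vb (Some x)) (fun x => vb' (Some x)) uv uv'.
    have Z : L * rr * (e' + e') <= e' / 2.
      by exact: quarter_double.
    by case=> [x|]; [exact: le_trans (H2 x) Z|exact: le_trans H1 Z].
  - by move=> u v [_ ub] [_ vb] j; exact: ncB_le.
  - move=> us u k Pus H; split.
      apply: (cmeasurable_uniform_limit (us := fun n => fd (us n)) (k := k)).
        by move=> n; exact: (Pus n).1.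
      by move=> n x; exact: H n (Some x).
    move=> j; apply: (@le_geometric _ _ _ k) => n.
    have := ncB (us n j) (us n j - u j); rewrite opprB addrC subrK => h.
    exact: le_trans h (lerD ((Pus n).2 j) (H n j)).
pose q := fd u; pose d := u None.
have sol : bk_sol p r q d by apply/bk_solE.
exists q, d.
have qb x : nc (q x) <= rr := ub (Some x).
have db : nc d <= rr := ub None.
have KCC : rr <= CC * e by rewrite /rr ler_wpM2r // /CC lerDl ltW.
pose t := 400 * rr.
pose h x := (nc (r x) + 200 * nc (p x)) + ((nc kap + 100) * rr) * S x.
have kr0 : 0 <= (nc kap + 100) * rr := mulr_ge0 k100 rr0.
have [s1 n1] := @sqZ R setT 200 _ sp.2.
have [s2 n2_] := sqD snr s1.
have [s3 n3] := @sqZ R setT ((nc kap + 100) * rr) _ (sq_wsech beta_neq0).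
have [sh nh] := sqD s2 s3.
have h0 x : 0 <= h x.
  exact: addr_ge0 (addr_ge0 (nc_ge0 _) (mulr_ge0 (ler0n R 200) (nc_ge0 _)))
    (mulr_ge0 kr0 (wsech_ge0 beta x)).
pose A := e + 200 * e + (nc kap + 100) * rr * n2 [set: R] S.
have hA : n2 [set: R] h <= A.
  apply: (le_trans nh); rewrite n3 (ger0_norm kr0) /A lerD2r.
  apply: (le_trans n2_); rewrite n1 (ger0_norm (ler0n R 200)).
  exact: lerD nr (ler_wpM2l (ler0n R 200) np).
have qp : cprimitive q (fun x => (T x)%:C * q x + (kap * d * (S x)%:C + (r x + rem p q d x))).
  exact: uu.
have [|||sq_ nq] := HCE q _ h t A rr qp qb sh h0 hA.
- exact: mulr_ge0 (ler0n R 400) rr0.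
- exact: tr.
- move=> x; have /andP[S0 S1] := S01 x.
  have l0 := lip0 e4 rr4 (pe x) (qb x) db.
  have a1' : nc (kap * d * (S x)%:C) <= nc kap * rr * S x.
    rewrite !ncM nc_real (ger0_norm S0) ler_wpM2r // ler_wpM2l //; exact: ltW.
  apply: (le_trans (ncD_le a1' (ncD_le (lexx (nc (r x))) l0))).
  by rewrite /h /t; apply: energy_arith => //; exact: nc_ge0.
split => //.
- by move=> x; exact: le_trans (qb x) KCC.
- exact: le_trans db KCC.
apply: (le_trans nq); rewrite /CC /A /rr.
have Ke : 0 <= K * e by rewrite mulr_ge0 // ltW.
have -> : CE * (e + 200 * e + (nc kap + 100) * (K * e) * n2 [set: R] S + K * e) =
  CE * (1 + 200 + (nc kap + 100) * K * n2 [set: R] S + K) * e by ring.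
by rewrite ler_wpM2r // lerDr ltW.
Qed.

End NonlinearEquation.

(** * Families depending on two shifts *)

Section ShiftFamilies.
Context {R : realType}.
Implicit Types (f g : R -> R -> R -> R) (w : R -> R) (x s t : R).

Definition in_box s t : Prop := `|s| <= 1 /\ `|t| <= 1.

(** Families bounded and Lipschitz in the shifts, both with the weight [w] in
    space. Closure under the algebraic operations takes the place of bounds
    on the second derivatives of the profiles. *)
Definition lipw w f :=
  (forall s t, in_box s t -> continuous (f s t)) /\
  exists2 M, 0 <= M & forall s t s' t' x, in_box s t -> in_box s' t' ->
    `|f s t x| <= M * w x /\
    `|f s t x - f s' t' x| <= M * w x * (`|s - s'| + `|t - t'|).

Lemma lipw_cst (k : R) : lipw (fun=> 1) (fun _ _ _ => k).
Proof.
split; first by move=> s t _; exact: c_cst.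
exists `|k| => // s t s' t' x _ _; rewrite mulr1 subrr normr0 lexx; split => //.
Qed.

Lemma lipwD w f g : (forall x, 0 <= w x) -> lipw w f -> lipw w g ->
  lipw w (fun s t x => f s t x + g s t x).
Proof.
move=> w0 [cf [M M0 HM]] [cg [N N0 HN]]; split.
  by move=> s t b; apply: c_D; [exact: cf|exact: cg].
exists (M + N); first exact: addr_ge0.
move=> s t s' t' x b b'; have [f1 f2] := HM s t s' t' x b b'.
have [g1 g2] := HN s t s' t' x b b'; split.
  by apply: (le_trans (ler_normD _ _)); rewrite mulrDl; exact: lerD.
rewrite opprD addrACA; apply: (le_trans (ler_normD _ _)).
by rewrite 2!mulrDl; exact: lerD.
Qed.

Lemma lipwM w f g : (forall x, 0 <= w x) -> lipw (fun=> 1) f -> lipw w g ->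
  lipw w (fun s t x => f s t x * g s t x).
Proof.
move=> w0 [cf [M M0 HM]] [cg [N N0 HN]]; split.
  by move=> s t b; apply: c_M; [exact: cf|exact: cg].
exists (2 * (M * N)); first by rewrite !mulr_ge0.
move=> s t s' t' x b b'; have [f1 f2] := HM s t s' t' x b b'.
have [g1 g2] := HN s t s' t' x b b'; have [f1' _] := HM s' t' s t x b' b.
rewrite !mulr1 in f1 f2 f1'; set d := `|s - s'| + `|t - t'| in f2 g2 *.
have d0 : 0 <= d by rewrite addr_ge0.
have MN := mulr_ge0 (mulr_ge0 M0 N0) (w0 x).
split.
  rewrite normrM; apply: (le_trans (ler_pM _ _ f1 g1)) => //.
  by rewrite mulrA; lra.
have -> : f s t x * g s t x - f s' t' x * g s' t' x =
  (f s t x - f s' t' x) * g s t x + f s' t' x * (g s t x - g s' t' x) by ring.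
apply: (le_trans (ler_normD _ _)); rewrite !normrM.
have := ler_pM (normr_ge0 _) (normr_ge0 _) f2 g1.
have := ler_pM (normr_ge0 _) (normr_ge0 _) f1' g2.
lra.
Qed.

Lemma lipwZ w (k : R) f : (forall x, 0 <= w x) -> lipw w f ->
  lipw w (fun s t x => k * f s t x).
Proof. by move=> w0; apply: lipwM => //; exact: lipw_cst. Qed.

Lemma lipwV f (m : R) : 0 < m -> (forall s t x, in_box s t -> m <= f s t x) ->
  lipw (fun=> 1) f -> lipw (fun=> 1) (fun s t x => (f s t x)^-1).
Proof.
move=> m0 fm [cf [M M0 HM]].
have fp s t x : in_box s t -> 0 < f s t x by move=> b; exact: lt_le_trans m0 (fm _ _ _ b).
split.
  by move=> s t b; apply: c_V; [move=> x; rewrite gt_eqF ?fp|exact: cf].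
exists (m^-1 + M / m ^+ 2).
  by rewrite addr_ge0 ?invr_ge0 ?(ltW m0) // divr_ge0 // sqr_ge0.
move=> s t s' t' x b b'; have [_ f2] := HM s t s' t' x b b'.
rewrite !mulr1 in f2 *; set d := `|s - s'| + `|t - t'| in f2 *.
have d0 : 0 <= d by rewrite addr_ge0.
have p := fp _ _ x b; have p' := fp _ _ x b'.
have i1 : (f s t x)^-1 <= m^-1 by rewrite lef_pV2 ?posrE //; exact: fm.
have i2 : (f s' t' x)^-1 <= m^-1 by rewrite lef_pV2 ?posrE //; exact: fm.
have q1 : 0 <= (f s t x)^-1 by rewrite invr_ge0 ltW.
have q2 : 0 <= (f s' t' x)^-1 by rewrite invr_ge0 ltW.
have Mm : 0 <= M / m ^+ 2 by rewrite divr_ge0 // sqr_ge0.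
split; first by rewrite ger0_norm //; lra.
have -> : (f s t x)^-1 - (f s' t' x)^-1 =
  - (f s t x - f s' t' x) * ((f s t x)^-1 * (f s' t' x)^-1).
  by field; rewrite !gt_eqF.
rewrite normrM normrN (ger0_norm (mulr_ge0 q1 q2)).
apply: (@le_trans _ _ (M * d * (m^-1 * m^-1))).
  apply: ler_pM => //; first exact: mulr_ge0.
  exact: ler_pM.
have E : M * d * (m^-1 * m^-1) = M / m ^+ 2 * d by field; rewrite gt_eqF.
by rewrite E ler_wpM2r // lerDr invr_ge0 ltW.
Qed.

Lemma lipwW w f : (forall x, w x <= 1) -> lipw w f -> lipw (fun=> 1) f.
Proof.
move=> w1 [cf [M M0 HM]]; split => //; exists M => // s t s' t' x b b'.
have [f1 f2] := HM s t s' t' x b b'.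
have Mw : M * w x <= M * 1 by rewrite ler_wpM2l.
split; first exact: le_trans Mw.
by apply: (le_trans f2); rewrite ler_wpM2r // addr_ge0.
Qed.

Lemma sin_lipschitz (x y : R) : `|sin x - sin y| <= `|x - y|.
Proof.
have [z _ ->] := @MVT_between R sin _ y x (fun z _ => is_derive_sin z).
by rewrite normrM ler_piMl // ler_norml cos_geN1 cos_le1.
Qed.

Lemma cos_lipschitz (x y : R) : `|cos x - cos y| <= `|x - y|.
Proof.
have [z _ ->] := @MVT_between R cos _ y x (fun z _ => is_derive_cos z).
by rewrite normrM ler_piMl // normrN ler_norml sin_geN1 sin_le1.
Qed.

Lemma abs_sin_le1 (x : R) : `|sin x| <= 1.
Proof. by rewrite ler_norml sin_geN1 sin_le1. Qed.

Lemma abs_cos_le1 (x : R) : `|cos x| <= 1.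
Proof. by rewrite ler_norml cos_geN1 cos_le1. Qed.

Lemma lipw_sin (k : R) : 0 <= k <= 1 -> lipw (fun=> 1) (fun s _ _ => sin (k * s)).
Proof.
move=> /andP[k0 k1]; split; first by move=> s t _; exact: c_cst.
exists 1 => // s t s' t' x _ _; rewrite !mulr1 mul1r abs_sin_le1; split => //.
apply: (le_trans (sin_lipschitz _ _)); rewrite -mulrBr normrM (ger0_norm k0).
by have := ler_piMl (normr_ge0 (s - s')) k1; have := normr_ge0 (t - t'); lra.
Qed.

Lemma lipw_cos (k : R) : 0 <= k <= 1 -> lipw (fun=> 1) (fun s _ _ => cos (k * s)).
Proof.
move=> /andP[k0 k1]; split; first by move=> s t _; exact: c_cst.
exists 1 => // s t s' t' x _ _; rewrite !mulr1 mul1r abs_cos_le1; split => //.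
apply: (le_trans (cos_lipschitz _ _)); rewrite -mulrBr normrM (ger0_norm k0).
by have := ler_piMl (normr_ge0 (s - s')) k1; have := normr_ge0 (t - t'); lra.
Qed.

Lemma cos_ge_half (y : R) : `|y| <= 1 -> 2^-1 <= cos y.
Proof.
move=> y1; have -> : cos y = 1 - 2 * sin (y / 2) ^+ 2.
  by have := cosD (y / 2) (y / 2); rewrite -splitr => ->; rewrite -!expr2 cos2sin2; ring.
have := sin_lipschitz (y / 2) 0; rewrite sin0 !subr0 normrM (@ger0_norm _ 2^-1) // => h.
have h2 : `|sin (y / 2)| <= 2^-1 by lra.
have : sin (y / 2) ^+ 2 <= 2^-1 ^+ 2.
  by rewrite -[leLHS]real_normK ?num_real // lerXn2r ?nnegrE.
lra.
Qed.

Lemma between_box s s' t : `|s| <= 1 -> `|s'| <= 1 -> (t - s) * (t - s') <= 0 -> `|t| <= 1.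
Proof.
rewrite !ler_norml => /andP[a b] /andP[c d] H; apply/andP; split.
  rewrite leNgt; apply/negP => h.
  have : 0 < (s - t) * (s' - t) by apply: mulr_gt0; lra.
  nra.
rewrite leNgt; apply/negP => h.
have : 0 < (t - s) * (t - s') by apply: mulr_gt0; lra.
nra.
Qed.

Definition partials f g h :=
  (forall s t x, in_box s t -> is_derive s 1 (fun r => f r t x) (g s t x)) /\
  (forall s t x, in_box s t -> is_derive t 1 (fun r => f s r x) (h s t x)).

Lemma shift_taylor w f g h : (forall x, 0 <= w x) -> partials f g h -> lipw w g -> lipw w h ->
  exists2 M, 0 <= M & forall s t s' t' x, in_box s t -> in_box s' t' ->
    `|f s t x - f s' t' x| <= M * w x * (`|s - s'| + `|t - t'|) /\
    `|f s t x - f s' t' x - (s - s') * g 0 0 x - (t - t') * h 0 0 x| <=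
      M * w x * (`|s| + `|t| + (`|s'| + `|t'|)) * (`|s - s'| + `|t - t'|).
Proof.
move=> w0 [D1 D2] [_ [M M0 HM]] [_ [N N0 HN]].
exists (2 * (M + N)); first by rewrite mulr_ge0 // addr_ge0.
move=> s t s' t' x [b1 b2] [b1' b2'].
have [z z1 E1] := @MVT_between R (fun r => f r t x) (fun r => g r t x) s' s
  (fun z hz => D1 z t x (conj (between_box b1' b1 hz) b2)).
have [y y1 E2] := @MVT_between R (fun r => f s' r x) (fun r => h s' r x) t' t
  (fun z hz => D2 s' z x (conj b1' (between_box b2' b2 hz))).
have zb := between_box b1' b1 z1; have yb := between_box b2' b2 y1.
have z2 := between_norm z1; have y2 := between_norm y1.
have b0 : in_box 0 0 by split; rewrite normr0.
have [g1 g2] := HM z t 0 0 x (conj zb b2) b0.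
have [h1 h2] := HN s' y 0 0 x (conj b1' yb) b0.
rewrite !subr0 in g2 h2.
have E : f s t x - f s' t' x = g z t x * (s - s') + h s' y x * (t - t') by rewrite -E1 -E2; ring.
set a := `|s - s'| in z2 *; set b := `|t - t'| in y2 *.
have a0 : 0 <= a by exact: normr_ge0.
have bb0 : 0 <= b by exact: normr_ge0.
have Mw := mulr_ge0 M0 (w0 x); have Nw := mulr_ge0 N0 (w0 x).
have aE : a <= `|s| + `|s'| by exact: ler_normB.
have bE : b <= `|t| + `|t'| by exact: ler_normB.
have zn : `|z| <= 2 * (`|s| + `|s'|).
  have v := ler_normD (z - s') s'; rewrite subrK in v; have v' := normr_ge0 s.
  by clear - v v' z2 aE; lra.
have yn : `|y| <= 2 * (`|t| + `|t'|).
  have v := ler_normD (y - t') t'; rewrite subrK in v; have v' := normr_ge0 t.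
  by clear - v v' y2 bE; lra.
have pa : `|g z t x * (s - s')| <= M * w x * a by rewrite normrM ler_wpM2r.
have pb : `|h s' y x * (t - t')| <= N * w x * b by rewrite normrM ler_wpM2r.
split.
  rewrite E; apply: (le_trans (ler_normD _ _)); apply: (le_trans (lerD pa pb)).
  have v1 := mulr_ge0 Mw bb0; have v2 := mulr_ge0 Nw a0; have v3 := mulr_ge0 Mw a0.
  by have v4 := mulr_ge0 Nw bb0; clear - v1 v2 v3 v4; lra.
have -> : f s t x - f s' t' x - (s - s') * g 0 0 x - (t - t') * h 0 0 x =
  (g z t x - g 0 0 x) * (s - s') + (h s' y x - h 0 0 x) * (t - t') by rewrite E; ring.
apply: (le_trans (ler_normD _ _)); rewrite !normrM.
set Q := `|s| + `|t| + (`|s'| + `|t'|).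
have Q1 : `|z| + `|t| <= 2 * Q by rewrite /Q; have v1 := normr_ge0 t; have v2 := normr_ge0 t'; clear - zn v1 v2; lra.
have Q2 : `|s'| + `|y| <= 2 * Q by rewrite /Q; have v1 := normr_ge0 s; have v2 := normr_ge0 s'; clear - yn v1 v2; lra.
have Q0 : 0 <= Q by rewrite /Q !addr_ge0.
have e1 : `|g z t x - g 0 0 x| * a <= M * w x * (2 * Q) * a.
  by rewrite ler_wpM2r //; apply: (le_trans g2); rewrite ler_wpM2l.
have e2 : `|h s' y x - h 0 0 x| * b <= N * w x * (2 * Q) * b.
  by rewrite ler_wpM2r //; apply: (le_trans h2); rewrite ler_wpM2l.
apply: (le_trans (lerD e1 e2)).
have k1 := mulr_ge0 (mulr_ge0 Mw Q0) bb0; have k2 := mulr_ge0 (mulr_ge0 Nw Q0) a0.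
by clear - k1 k2; lra.
Qed.

End ShiftFamilies.

Section ShiftedProfiles.
Context {R : realType} (beta : R).
Context (beta_bounds : -1 < beta < 1) (beta_neq0 : beta != 0).
Local Notation al := (alpha beta).
Local Notation S := (wsech beta).
Implicit Types (s t x : R).

Lemma alpha_sqr : al ^+ 2 = 1 - beta ^+ 2.
Proof.
move: beta_bounds => /andP[b1 b2].
by rewrite /alpha sqr_sqrtr //; nra.
Qed.

Lemma alpha_gt0 : 0 < al.
Proof. by move: beta_bounds => /andP[b1 b2]; rewrite /alpha sqrtr_gt0; nra. Qed.

Lemma alpha_le1 : al <= 1.
Proof. by have := alpha_sqr; have := alpha_gt0; have := sqr_ge0 beta; nra. Qed.


Lemma beta_le1 : `|beta| <= 1.
Proof. by move: beta_bounds => /andP[b1 b2]; rewrite ler_norml !ltW. Qed.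

Lemma sech_shift_le (y h : R) : `|h| <= 1 -> sech (y + h) <= 4 * sech y.
Proof.
move=> h1; rewrite /sech -[leLHS]div1r ler_pdivrMr ?cosh_gt0 // mulrAC.
rewrite -[leLHS]mulr1 mulrC ler_pdivlMr ?cosh_gt0 // !mul1r.
have E (z k : R) : `|k| <= 1 -> expR z <= 4 * expR (z + k).
  move=> k1; have -> : expR z = expR (- k) * expR (z + k) by rewrite -expRD; congr expR; ring.
  rewrite ler_wpM2r ?expR_ge0 //; apply: le_trans (@expR1_le4 R); rewrite ler_expR.
  by apply: le_trans k1; rewrite -normrN ler_norm.
have h1' : `|- h| <= 1 by rewrite normrN.
have := E y h h1; have := E (- y) (- h) h1'.
by rewrite /cosh opprD; lra.
Qed.

Lemma lipw_sech : lipw S (fun _ t x => sech (beta * (x + t))).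
Proof.
have L t : continuous (fun x => beta * (x + t)).
  exact: (c_M (c_cst beta) (c_D (@c_id R) (c_cst t))).
split; first by move=> s t _; exact: c_comp (L t) (@continuous_sech R).
have bd t x : `|t| <= 1 -> sech (beta * (x + t)) <= 4 * S x.
  move=> t1; rewrite mulrDr; apply: sech_shift_le; rewrite normrM.
  by have := ler_pM (normr_ge0 _) (normr_ge0 _) beta_le1 t1; rewrite mulr1.
exists 4 => // s t s' t' x [_ b] [_ b']; split.
  by rewrite ger0_norm ?bd // ltW // sech_gt0.
have D (z : R) : is_derive z 1 (fun r => sech (beta * (x + r)))
    (- (tanh (beta * (x + z)) * sech (beta * (x + z))) * beta).
  apply: (d_comp (g := sech)); last exact: d_sech.
  by apply: d_eq (d_Z beta (d_D (d_cst x z) (d_id z))) _; ring.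
have [z zb ->] := @MVT_between R _ _ t' t (fun z _ => D z).
have zn := between_box b' b zb.
rewrite normrM; apply: ler_pM => //; last by rewrite lerDr.
rewrite normrM normrN normrM -[leRHS]mulr1; apply: ler_pM => //; last exact: beta_le1.
rewrite -[leRHS]mul1r; apply: ler_pM => //; first exact: tanh_le1.
by rewrite ger0_norm ?bd // ltW // sech_gt0.
Qed.

Lemma lipw_sech1 : lipw (fun=> 1) (fun _ t x => sech (beta * (x + t))).
Proof. by apply: lipwW lipw_sech => x; exact: wsech_le1. Qed.

Lemma lipw_tanh : lipw (fun=> 1) (fun _ t x => tanh (beta * (x + t))).
Proof.
have L t : continuous (fun x => beta * (x + t)).
  exact: (c_M (c_cst beta) (c_D (@c_id R) (c_cst t))).
split; first by move=> s t _; exact: c_comp (L t) (@continuous_tanh R).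
exists 1 => // s t s' t' x _ _; rewrite !mulr1 mul1r tanh_le1; split => //.
have D (z : R) : is_derive z 1 (fun r => tanh (beta * (x + r))) (sech (beta * (x + z)) ^+ 2 * beta).
  apply: (d_comp (g := tanh)); last exact: d_tanh.
  by apply: d_eq (d_Z beta (d_D (d_cst x z) (d_id z))) _; ring.
have [z _ ->] := @MVT_between R _ _ t' t (fun z _ => D z).
rewrite normrM; apply: (@le_trans _ _ (1 * `|t - t'|)); last by rewrite mul1r lerDr.
rewrite ler_wpM2r // normrM -[leRHS]mulr1; apply: ler_pM => //; last exact: beta_le1.
by rewrite ger0_norm ?sqr_ge0 // expr_le1 ?sech_le1 // ltW // sech_gt0.
Qed.

End ShiftedProfiles.

(** * The breather family *)

Section BreatherFamilies.
Context {R : realType} (beta : R).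
Context (beta_bounds : -1 < beta < 1) (beta_neq0 : beta != 0).
Local Notation al := (alpha beta).
Local Notation S := (wsech beta).
Implicit Types (s t x : R).

Let al0 : 0 < al := alpha_gt0 beta_bounds.
Let aln : al != 0. Proof. by rewrite gt_eqF. Qed.
Let al01 : 0 <= al <= 1. Proof. by rewrite (ltW al0) alpha_le1. Qed.
Let al2 : 0 < al ^+ 2. Proof. by rewrite exprn_gt0. Qed.

Definition shifted_sech (_ t x : R) : R := sech (beta * (x + t)).
Definition shifted_tanh (_ t x : R) : R := tanh (beta * (x + t)).
Definition sin_shift (s _ _ : R) : R := sin (al * s).
Definition cos_shift (s _ _ : R) : R := cos (al * s).
Local Notation Si := shifted_sech.
Local Notation Ta := shifted_tanh.
Local Notation sn := sin_shift.
Local Notation cs := cos_shift.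

Lemma lipw1_sech : lipw (fun=> 1) Si. Proof. exact: lipw_sech1. Qed.
Lemma lipw1_tanh : lipw (fun=> 1) Ta. Proof. exact: lipw_tanh. Qed.
Lemma lipw1_sin : lipw (fun=> 1) sn. Proof. exact: lipw_sin. Qed.
Lemma lipw1_cos : lipw (fun=> 1) cs. Proof. exact: lipw_cos. Qed.
Lemma lipwS_sech : lipw S Si. Proof. exact: lipw_sech. Qed.

Lemma d_sin_shift s t x : is_derive s 1 (fun r => sn r t x) (al * cs s t x).
Proof. by apply: d_eq (d_comp (d_Z al (d_id s)) (is_derive_sin _)) _; rewrite /cs; ring. Qed.

Lemma d_cos_shift s t x : is_derive s 1 (fun r => cs r t x) (- (al * sn s t x)).
Proof. by apply: d_eq (d_comp (d_Z al (d_id s)) (is_derive_cos _)) _; rewrite /sn; ring. Qed.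

Let d_lint t x : is_derive t 1 (fun r => beta * (x + r)) beta.
Proof. by apply: d_eq (d_Z beta (d_D (d_cst x t) (d_id t))) _; ring. Qed.

Lemma d_shifted_sech s t x : is_derive t 1 (fun r => Si s r x) (- (beta * (Ta s t x * Si s t x))).
Proof. by apply: d_eq (d_comp (d_lint t x) (d_sech _)) _; rewrite /Si /Ta; ring. Qed.

(** Up to [cosh^2], the denominator of the breather and of its derivatives. *)
Definition breather_den s t x : R :=
  al ^+ 2 + beta ^+ 2 * (sn s t x * sn s t x * (Si s t x * Si s t x)).
Local Notation E := breather_den.

Lemma breather_den_ge s t x : al ^+ 2 <= E s t x.
Proof. by rewrite /E lerDl mulr_ge0 ?sqr_ge0 // -!expr2 mulr_ge0 ?sqr_ge0. Qed.

Lemma breather_den_neq0 s t x : E s t x != 0.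
Proof. by rewrite gt_eqF // (lt_le_trans al2) // breather_den_ge. Qed.

Let one0 : forall x : R, 0 <= (fun=> 1 : R) x. Proof. by move=> x; exact: ler01. Qed.

Lemma lipw_breather_den : lipw (fun=> 1) E.
Proof.
apply: lipwD => //; first exact: lipw_cst.
apply: lipwZ => //; apply: lipwM => //.
  by apply: lipwM => //; exact: lipw1_sin.
by apply: lipwM => //; exact: lipw1_sech.
Qed.

Lemma lipw_breather_inv : lipw (fun=> 1) (fun s t x => (E s t x)^-1).
Proof. by apply: (lipwV al2) lipw_breather_den => s t x _; exact: breather_den_ge. Qed.

Definition breather_d1 s t x : R :=
  4 * al ^+ 2 * beta * (cs s t x * (E s t x)^-1) * Si s t x.
Definition breather_d2 s t x : R :=
  - (4 * al * beta ^+ 2) * (sn s t x * (Ta s t x * (E s t x)^-1)) * Si s t x.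
Definition breather_t_d1 s t x : R :=
  - (4 * al ^+ 3 * beta) * (sn s t x * ((E s t x + 2 * beta ^+ 2 *
    (cs s t x * cs s t x * (Si s t x * Si s t x))) * ((E s t x)^-1 * (E s t x)^-1))) * Si s t x.
Definition breather_t_d2 s t x : R :=
  4 * al ^+ 2 * beta ^+ 2 * (cs s t x * (Ta s t x * ((beta ^+ 2 *
    (sn s t x * sn s t x * (Si s t x * Si s t x)) + - al ^+ 2) *
     ((E s t x)^-1 * (E s t x)^-1)))) * Si s t x.

Let S0 x : 0 <= S x := wsech_ge0 beta x.

Lemma lipw_breather_d1 : lipw S breather_d1.
Proof.
apply: lipwM lipwS_sech => //; apply: lipwZ => //.
by apply: lipwM lipw_breather_inv => //; exact: lipw1_cos.
Qed.

Lemma lipw_breather_d2 : lipw S breather_d2.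
Proof.
apply: lipwM lipwS_sech => //; apply: lipwZ => //.
apply: lipwM => //; first exact: lipw1_sin.
by apply: lipwM lipw_breather_inv => //; exact: lipw1_tanh.
Qed.

Lemma lipw_breather_t_d1 : lipw S breather_t_d1.
Proof.
apply: lipwM lipwS_sech => //; apply: lipwZ => //.
apply: lipwM => //; first exact: lipw1_sin.
apply: lipwM => //; last by apply: lipwM => //; exact: lipw_breather_inv.
apply: lipwD => //; first exact: lipw_breather_den.
apply: lipwZ => //; apply: lipwM => //.
  by apply: lipwM => //; exact: lipw1_cos.
by apply: lipwM => //; exact: lipw1_sech.
Qed.

Lemma lipw_breather_t_d2 : lipw S breather_t_d2.
Proof.
apply: lipwM lipwS_sech => //; apply: lipwZ => //.
apply: lipwM => //; first exact: lipw1_cos.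
apply: lipwM => //; first exact: lipw1_tanh.
apply: lipwM => //; last by apply: lipwM => //; exact: lipw_breather_inv.
apply: lipwD => //; last exact: lipw_cst.
apply: lipwZ => //; apply: lipwM => //.
  by apply: lipwM => //; exact: lipw1_sin.
by apply: lipwM => //; exact: lipw1_sech.
Qed.

Lemma breather_tE : breather_t beta = breather_d1.
Proof.
apply/funext => s; apply/funext => t; apply/funext => x.
have := breather_den_neq0 s t x; rewrite /breather_t /breather_d1 /E /cs /sn /Si /sech => E0.
have C0 := cosh_neq0 (beta * (x + t)).
move: E0; set c := cosh _ in C0 *; set a := al; set si := sin _ => E0.
have E1 : a ^+ 2 + beta ^+ 2 * (si * si * (c^-1 / c)) =
    (a ^+ 2 * c ^+ 2 + beta ^+ 2 * si ^+ 2) / c ^+ 2 by field.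
have E2 : a ^+ 2 * c ^+ 2 + beta ^+ 2 * si ^+ 2 != 0.
  by move: E0; rewrite E1; apply: contraNneq => ->; rewrite mul0r.
rewrite E1; move: E2; move: (_ + _) => D D0.
by field; rewrite C0 D0.
Qed.

Lemma breatherE s t x : breather beta s t x = 4 * atan (beta / al * (sn s t x * Si s t x)).
Proof. by []. Qed.

Lemma breather_partials : partials (breather beta) breather_d1 breather_d2.
Proof.
have N s t x : 1 + (beta / al * (sn s t x * Si s t x)) ^+ 2 = E s t x / al ^+ 2.
  by rewrite /E; field.
split=> s t x _.
- have D := d_Z (beta / al) (d_M (d_sin_shift s t x) (d_cst (Si s t x) s)).
  apply: d_eq (d_Z 4 (d_comp D (is_derive1_atan _))) _.
  rewrite -/(Si s t x) -/(sn s t x) N /breather_d1.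
  by field; rewrite aln breather_den_neq0.
- have D := d_Z (beta / al) (d_M (d_cst (sn s t x) t) (d_shifted_sech s t x)).
  apply: d_eq (d_Z 4 (d_comp D (is_derive1_atan _))) _.
  rewrite N /breather_d2.
  by field; rewrite aln breather_den_neq0.
Qed.

Lemma breather_t_partials : partials (breather_t beta) breather_t_d1 breather_t_d2.
Proof.
rewrite breather_tE; split=> s t x _.
- have DE : is_derive s 1 (fun r => E r t x) _ := d_D (d_cst (al ^+ 2) s) (d_Z (beta ^+ 2)
     (d_M (d_M (d_sin_shift s t x) (d_sin_shift s t x)) (d_cst (Si s t x * Si s t x) s))).
  have DV := @d_V _ (fun r => E r t x) s _ (breather_den_neq0 s t x) DE.
  apply: d_eq (d_M (d_M (d_cst (4 * al ^+ 2 * beta) s) (d_M (d_cos_shift s t x) DV))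
     (d_cst (Si s t x) s)) _.
  rewrite /breather_t_d1.
  by field; rewrite breather_den_neq0.
- have DE : is_derive t 1 (fun r => E s r x) _ := d_D (d_cst (al ^+ 2) t) (d_Z (beta ^+ 2)
     (d_M (d_cst (sn s t x * sn s t x) t) (d_M (d_shifted_sech s t x) (d_shifted_sech s t x)))).
  have DV := @d_V _ (fun r => E s r x) t _ (breather_den_neq0 s t x) DE.
  apply: d_eq (d_M (d_M (d_cst (4 * al ^+ 2 * beta) t) (d_M (d_cst (cs s t x) t) DV))
     (d_shifted_sech s t x)) _.
  rewrite /breather_t_d2.
  have E0 := breather_den_neq0 s t x.
  have -> : al ^+ 2 = E s t x - beta ^+ 2 * (sn s t x * sn s t x * (Si s t x * Si s t x)).
    by rewrite /E; ring.
  by field.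
Qed.

Lemma shifts0 x : [/\ sn 0 0 x = 0, cs 0 0 x = 1, Si 0 0 x = S x & E 0 0 x = al ^+ 2].
Proof. by rewrite /E /sn /cs /Si !mulr0 sin0 cos0 addr0 !mul0r mulr0 addr0. Qed.

Lemma breather0 x : breather beta 0 0 x = 0.
Proof. by rewrite breatherE; have [-> _ _ _] := shifts0 x; rewrite mul0r mulr0 atan0 mulr0. Qed.

Lemma breather_d10 x : breather_d1 0 0 x = 4 * beta * S x.
Proof. by rewrite /breather_d1; have [_ -> -> ->] := shifts0 x; field. Qed.

Lemma breather_d20 x : breather_d2 0 0 x = 0.
Proof. by rewrite /breather_d2; have [-> _ _ _] := shifts0 x; rewrite !mul0r mulr0 mul0r. Qed.

Lemma breather_t_d10 x : breather_t_d1 0 0 x = 0.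
Proof. by rewrite /breather_t_d1; have [-> _ _ _] := shifts0 x; rewrite !mul0r mulr0 mul0r. Qed.

Lemma breather_t_d20 x : breather_t_d2 0 0 x = - 4 * beta ^+ 2 * tanh (beta * x) * S x.
Proof.
rewrite /breather_t_d2; have [-> -> -> ->] := shifts0 x.
by rewrite /Ta addr0; field.
Qed.

Lemma breather_t0 x : breather_t beta 0 0 x = 4 * beta * S x.
Proof. by rewrite breather_tE breather_d10. Qed.

End BreatherFamilies.

(** * The kink family *)

Section ComplexLogarithm.
Context {R : realType}.
Implicit Types (X Y : R).
Local Notation nc := (@Normc.normc R).

Lemma shift_arith (m n a b w : R) : 0 <= m * w -> 0 <= n * w -> 0 <= a * w -> 0 <= b * w ->
  0 <= w -> m * w + n * w <= (m + n + 2 * (a + b) + 1) * w /\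
  2 * (a * w) + 2 * (b * w) <= (m + n + 2 * (a + b) + 1) * w.
Proof. by move=> *; split; lra. Qed.

Lemma nc_sqr X Y : nc (X +i* Y) ^+ 2 = X ^+ 2 + Y ^+ 2.
Proof. by rewrite /nc sqr_sqrtr // addr_ge0 ?sqr_ge0. Qed.

Lemma nc_off_axis X Y : Y != 0 -> 0 < nc (X +i* Y) /\ 0 < nc (X +i* Y) + X.
Proof.
move=> Y0; have N0 : 0 <= nc (X +i* Y) by exact: nc_ge0.
have := nc_sqr X Y; have Y2 : 0 < Y ^+ 2 by rewrite exprn_even_gt0.
have X2 := sqr_ge0 X.
move=> H; split; first by rewrite lt_neqAle N0 andbT; apply/eqP => h; rewrite -h expr0n /= in H; lra.
have : 0 < (nc (X +i* Y) + X) * (nc (X +i* Y) - X) by rewrite mulrC -subr_sqr H; lra.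
rewrite ltNge => /negP h; rewrite ltNge; apply/negP => h2; apply: h.
by rewrite mulr_le0_ge0 //; lra.
Qed.

Lemma cos_2atan X : cos (2 * atan X) = (1 - X ^+ 2) / (1 + X ^+ 2).
Proof.
have P : 0 < 1 + X ^+ 2 by rewrite ltr_pwDl ?ltr01 ?sqr_ge0.
rewrite mulrC mulr_natr cos_mulr2n cos_atan exprVn sqr_sqrtr ?(ltW P) //.
by rewrite -mulr_natr; field; rewrite gt_eqF.
Qed.

Lemma sin_2atan X : sin (2 * atan X) = 2 * X / (1 + X ^+ 2).
Proof.
have P : 0 < 1 + X ^+ 2 by rewrite ltr_pwDl ?ltr01 ?sqr_ge0.
have -> : sin (2 * atan X) = 2 * (X * cos (atan X)) * cos (atan X).
  have E : X * cos (atan X) = sin (atan X).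
    rewrite -{1}(atanK X) /tan divfK // gt_eqF // cos_gt0_pihalf //.
    by rewrite atan_gtNpi2 atan_ltpi2.
  by rewrite E mulrC mulr_natr sin_mulr2n -mulr_natr; ring.
rewrite cos_atan.
have Q : Num.sqrt (1 + X ^+ 2) ^+ 2 = 1 + X ^+ 2 by rewrite sqr_sqrtr ?(ltW P).
have Q0 : Num.sqrt (1 + X ^+ 2) != 0 by rewrite gt_eqF ?sqrtr_gt0.
by move: Q Q0; move: (Num.sqrt _) => q <- q0; field.
Qed.

Lemma carg_cos_sin X Y : Y != 0 ->
  cos (carg (X +i* Y)) = X / nc (X +i* Y) /\ sin (carg (X +i* Y)) = Y / nc (X +i* Y).
Proof.
move=> Y0; have [N0 NX0] := nc_off_axis X Y0; have N2 := nc_sqr X Y.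
rewrite /carg; move: N0 NX0 N2; set N := nc _ => /= N0 NX0 N2.
have Nn : N != 0 by rewrite gt_eqF.
have NXn : N + X != 0 by rewrite gt_eqF.
have E : 1 + (Y / (N + X)) ^+ 2 = 2 * N / (N + X).
  have -> : 1 + (Y / (N + X)) ^+ 2 = ((N + X) ^+ 2 + Y ^+ 2) / (N + X) ^+ 2 by field.
  have -> : Y ^+ 2 = N ^+ 2 - X ^+ 2 by rewrite N2; ring.
  by field.
rewrite cos_2atan sin_2atan E; split; last by field; rewrite Nn.
have -> : 1 - (Y / (N + X)) ^+ 2 = ((N + X) ^+ 2 - Y ^+ 2) / (N + X) ^+ 2 by field.
have -> : Y ^+ 2 = N ^+ 2 - X ^+ 2 by rewrite N2; ring.
by field; rewrite Nn.
Qed.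

Lemma cargN X Y : carg (X -i* Y) = - carg (X +i* Y).
Proof. by rewrite /carg /= sqrrN mulNr atanN mulrN. Qed.

Section Derivatives.
Variables (f g : R -> R) (s f' g' : R).
Hypotheses (Df : is_derive s 1 f f') (Dg : is_derive s 1 g g') (g0 : g s != 0).
Local Notation N2 := (f s ^+ 2 + g s ^+ 2).

Let N r := nc (f r +i* g r).
Let N0 : 0 < N s. Proof. by case: (nc_off_axis (f s) g0). Qed.
Let NX0 : 0 < N s + f s. Proof. by case: (nc_off_axis (f s) g0). Qed.
Let N2E : N s ^+ 2 = N2. Proof. exact: nc_sqr. Qed.
Let Nn : N s != 0. Proof. by rewrite gt_eqF. Qed.
Let NXn : N s + f s != 0. Proof. by rewrite gt_eqF. Qed.

Let d_nc : is_derive s 1 N ((f s * f' + g s * g') / N s).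
Proof.
have D : is_derive s 1 (fun r => f r * f r + g r * g r) _ := d_D (d_M Df Df) (d_M Dg Dg).
have P : 0 < f s * f s + g s * g s by rewrite -!expr2 -N2E exprn_gt0.
apply: d_ext (_ : (fun r => Num.sqrt (f r * f r + g r * g r)) =1 N) _.
  by move=> r; rewrite -!expr2.
apply: d_eq (d_comp D (is_derive1_sqrt P)) _.
have -> : Num.sqrt (f s * f s + g s * g s) = N s by rewrite -!expr2.
by field.
Qed.

(** Real and imaginary parts of [z' / z]. *)
Lemma d_ln_nc : is_derive s 1 (fun r => ln (nc (f r +i* g r))) ((f s * f' + g s * g') / N2).
Proof.
apply: d_eq (d_comp d_nc (is_derive1_ln N0)) _.
by rewrite -N2E; field.
Qed.

Lemma d_carg : is_derive s 1 (fun r => carg (f r +i* g r)) ((f s * g' - g s * f') / N2).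
Proof.
have DV := @d_V _ (fun r => N r + f r) s _ NXn (d_D d_nc Df).
apply: d_eq (d_Z 2 (d_comp (d_M Dg DV) (is_derive1_atan _))) _.
have E : 1 + (g s / (N s + f s)) ^+ 2 = 2 * N s / (N s + f s).
  have -> : 1 + (g s / (N s + f s)) ^+ 2 = ((N s + f s) ^+ 2 + g s ^+ 2) / (N s + f s) ^+ 2 by field.
  have -> : g s ^+ 2 = N s ^+ 2 - f s ^+ 2 by rewrite N2E; ring.
  by field.
rewrite E -N2E.
transitivity ((g' * (N s + f s) * N s - g s * (f s * f' + g s * g') - g s * f' * N s)
   / (N s ^+ 2 * (N s + f s))); first by field; rewrite Nn NXn.
have -> : g' * (N s + f s) * N s - g s * (f s * f' + g s * g') - g s * f' * N s =
  (N s ^+ 2 - g s ^+ 2 + N s * f s) * g' - (N s + f s) * (g s * f') by ring.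
have -> : N s ^+ 2 - g s ^+ 2 = f s ^+ 2 by rewrite N2E; ring.
by field; rewrite Nn NXn.
Qed.

End Derivatives.

End ComplexLogarithm.

Section KinkFamilies.
Context {R : realType} (beta : R).
Context (beta_bounds : -1 < beta < 1) (beta_neq0 : beta != 0).
Local Notation al := (alpha beta).
Local Notation S := (wsech beta).
Local Notation nc := (@Normc.normc R).
Local Notation I := ((0 : R) +i* 1).
Local Notation Si := (shifted_sech beta).
Local Notation Ta := (shifted_tanh beta).
Local Notation sn := (sin_shift beta).
Local Notation cs := (cos_shift beta).
Implicit Types (s t x : R).

Let al0 : 0 < al := alpha_gt0 beta_bounds.
Let aln : al != 0. Proof. by rewrite gt_eqF. Qed.

Lemma abs_shift_le1 s : `|s| <= 1 -> `|al * s| <= 1.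
Proof.
move=> s1; rewrite normrM (ger0_norm (ltW al0)).
by have := alpha_le1 beta_bounds; have := ler_piMl (normr_ge0 s) (alpha_le1 beta_bounds); lra.
Qed.

Lemma cos_shift_ge s t x : in_box s t -> 2^-1 <= cs s t x.
Proof. by move=> [s1 _]; exact/cos_ge_half/abs_shift_le1. Qed.

Definition kink_den s t x : R := 1 + - (sn s t x * sn s t x * (Si s t x * Si s t x)).

Lemma kink_den_ge s t x : in_box s t -> 4^-1 <= kink_den s t x.
Proof.
move=> b; have c := cos_shift_ge x b; rewrite /kink_den.
have q : sn s t x ^+ 2 = 1 - cs s t x ^+ 2 by rewrite /sn /cs sin2cos2.
have S1 : Si s t x ^+ 2 <= 1 by rewrite expr_le1 ?sech_le1 // ltW // sech_gt0.
have S0 := sqr_ge0 (Si s t x).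
have c2 : 4^-1 <= cs s t x ^+ 2 by move: c; move: (cs s t x) => k; nra.
rewrite -!expr2 q.
by move: c2 S0 S1; move: (cs s t x ^+ 2) (Si s t x ^+ 2) => k m; nra.
Qed.

Lemma kink_den_neq0 s t x : in_box s t -> kink_den s t x != 0.
Proof. by move=> b; rewrite gt_eqF // (lt_le_trans _ (kink_den_ge x b)) // invr_gt0. Qed.

Let one0 : forall x : R, 0 <= (fun=> 1 : R) x. Proof. by move=> x; exact: ler01. Qed.
Let S0 x : 0 <= S x := wsech_ge0 beta x.

Lemma lipw_kink_inv : lipw (fun=> 1) (fun s t x => (kink_den s t x)^-1).
Proof.
apply: (@lipwV _ _ 4^-1); [by rewrite invr_gt0|by move=> *; exact: kink_den_ge|].
apply: lipwD => //; first exact: lipw_cst.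
have H : lipw (fun=> 1) (fun s t x => sn s t x * sn s t x * (Si s t x * Si s t x)).
  apply: lipwM => //; first by apply: lipwM => //; exact: lipw1_sin.
  by apply: lipwM => //; exact: lipw1_sech.
have := @lipwZ _ _ (-1) _ one0 H; congr lipw.
by apply/funext => s; apply/funext => t; apply/funext => x; rewrite mulN1r.
Qed.

(** Real and imaginary parts of [1 / cosh (beta (x + x2) + i alpha x1)]. *)
Definition csech_re s t x : R := cs s t x * (kink_den s t x)^-1 * Si s t x.
Definition csech_im s t x : R := - (Ta s t x * (sn s t x * (kink_den s t x)^-1) * Si s t x).

Lemma lipw_csech_re : lipw S csech_re.
Proof.
apply: lipwM (lipwS_sech beta_bounds) => //; apply: lipwM => //; first exact: lipw1_cos.
exact: lipw_kink_inv.
Qed.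

Lemma lipw_csech_im : lipw S csech_im.
Proof.
have H : lipw S (fun s t x => Ta s t x * (sn s t x * (kink_den s t x)^-1) * Si s t x).
  apply: lipwM (lipwS_sech beta_bounds) => //; apply: lipwM => //; first exact: lipw1_tanh.
  by apply: lipwM lipw_kink_inv => //; exact: lipw1_sin.
have := @lipwZ _ _ (-1) _ S0 H; congr lipw.
by apply/funext => s; apply/funext => t; apply/funext => x; rewrite mulN1r.
Qed.

Definition kink_re s t x : R :=
  2 * (carg ((1 - expR (beta * (x + t)) * sin (al * s)) +i* (expR (beta * (x + t)) * cos (al * s))) -
       carg ((1 + expR (beta * (x + t)) * sin (al * s)) +i* (- (expR (beta * (x + t)) * cos (al * s))))).
Definition kink_im s t x : R :=
  2 * (ln (nc ((1 + expR (beta * (x + t)) * sin (al * s)) +i* (- (expR (beta * (x + t)) * cos (al * s))))) -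
       ln (nc ((1 - expR (beta * (x + t)) * sin (al * s)) +i* (expR (beta * (x + t)) * cos (al * s))))).

Lemma kinkE s t x : kink beta s t x = kink_re s t x +i* kink_im s t x.
Proof.
rewrite /kink /carctan.
have -> : 1 + I * cexp (kink_phase beta s t x) =
  (1 - expR (beta * (x + t)) * sin (al * s)) +i* (expR (beta * (x + t)) * cos (al * s)).
  by rewrite /kink_phase /cexp /=; apply: complex_ext => /=; ring.
have -> : 1 - I * cexp (kink_phase beta s t x) =
  (1 + expR (beta * (x + t)) * sin (al * s)) +i* (- (expR (beta * (x + t)) * cos (al * s))).
  by rewrite /kink_phase /cexp /=; apply: complex_ext => /=; ring.
rewrite /clog /kink_re /kink_im; move: (carg _) (carg _) (ln _) (ln _) => a1 a2 l1 l2.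
have -> : (l2 +i* a2) - (l1 +i* a1) = ((a2 - a1) +i* (l1 - l2)) * I :> R[i].
  by apply: complex_ext => /=; ring.
have -> : (4%:R : R[i]) = 2%:R * 2%:R by rewrite -natrM.
have -> z : 2%:R * 2%:R * (z * I / (2%:R * I)) = 2%:R * z.
  by field; exact: I_neq0.
by apply: complex_ext => /=; ring.
Qed.

Let kink_chain_re (k l e c s : R) : c ^+ 2 = 1 - s ^+ 2 ->
  1 - 2 * e * s + e ^+ 2 != 0 -> 1 + 2 * e * s + e ^+ 2 != 0 ->
  ((1 - e * s) * (k * e * c - l * e * s) + e * c * (k * e * s + l * e * c)) /
    (1 - 2 * e * s + e ^+ 2) -
  (- ((1 + e * s) * (k * e * c - l * e * s)) + e * c * (k * e * s + l * e * c)) /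
    (1 + 2 * e * s + e ^+ 2) =
  (k * c + l * ((e ^+ 2 - 1) / (e ^+ 2 + 1) * s)) * (2 * e / (e ^+ 2 + 1) /
   (1 - s * s * (2 * e / (e ^+ 2 + 1) * (2 * e / (e ^+ 2 + 1))))).
Proof.
move=> c2 D1 D2; have e1 : e ^+ 2 + 1 != 0 by rewrite gt_eqF // ltr_wpDl ?sqr_ge0.
have -> : (1 - e * s) * (k * e * c - l * e * s) + e * c * (k * e * s + l * e * c) =
  k * e * c - l * e * s + l * e ^+ 2 * (s ^+ 2 + c ^+ 2) by ring.
have -> : - ((1 + e * s) * (k * e * c - l * e * s)) + e * c * (k * e * s + l * e * c) =
  - (k * e * c) + l * e * s + l * e ^+ 2 * (s ^+ 2 + c ^+ 2) by ring.
have -> : s ^+ 2 + c ^+ 2 = 1 by rewrite c2; ring.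
have -> : 1 - s * s * (2 * e / (e ^+ 2 + 1) * (2 * e / (e ^+ 2 + 1))) =
  (1 - 2 * e * s + e ^+ 2) * (1 + 2 * e * s + e ^+ 2) / (e ^+ 2 + 1) ^+ 2 by field.
by field; rewrite e1 D1 D2.
Qed.

Let kink_chain_im (k l e c s : R) : c ^+ 2 = 1 - s ^+ 2 ->
  1 - 2 * e * s + e ^+ 2 != 0 -> 1 + 2 * e * s + e ^+ 2 != 0 ->
  ((1 + e * s) * (k * e * s + l * e * c) + e * c * (k * e * c - l * e * s)) /
    (1 + 2 * e * s + e ^+ 2) -
  (- ((1 - e * s) * (k * e * s + l * e * c)) + e * c * (k * e * c - l * e * s)) /
    (1 - 2 * e * s + e ^+ 2) =
  (l * c - k * ((e ^+ 2 - 1) / (e ^+ 2 + 1) * s)) * (2 * e / (e ^+ 2 + 1) /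
   (1 - s * s * (2 * e / (e ^+ 2 + 1) * (2 * e / (e ^+ 2 + 1))))).
Proof.
move=> c2 D1 D2; have e1 : e ^+ 2 + 1 != 0 by rewrite gt_eqF // ltr_wpDl ?sqr_ge0.
have -> : (1 + e * s) * (k * e * s + l * e * c) + e * c * (k * e * c - l * e * s) =
  k * e * s + l * e * c + k * e ^+ 2 * (s ^+ 2 + c ^+ 2) by ring.
have -> : - ((1 - e * s) * (k * e * s + l * e * c)) + e * c * (k * e * c - l * e * s) =
  - (k * e * s + l * e * c) + k * e ^+ 2 * (s ^+ 2 + c ^+ 2) by ring.
have -> : s ^+ 2 + c ^+ 2 = 1 by rewrite c2; ring.
have -> : 1 - s * s * (2 * e / (e ^+ 2 + 1) * (2 * e / (e ^+ 2 + 1))) =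
  (1 - 2 * e * s + e ^+ 2) * (1 + 2 * e * s + e ^+ 2) / (e ^+ 2 + 1) ^+ 2 by field.
by field; rewrite e1 D1 D2.
Qed.

(** The derivative of the kink along a curve of phases [y + i th] is
    [2 (y' + i th') / cosh (y + i th)]; this covers the two shifts and the space
    variable at once. *)
Lemma kink_chain (y th : R -> R) (r k l : R) :
  is_derive r 1 y k -> is_derive r 1 th l -> cos (th r) != 0 ->
  let c := cos (th r) in let s := sin (th r) in
  let F := 1 - s * s * (sech (y r) * sech (y r)) in
  is_derive r 1 (fun q =>
    2 * (carg ((1 - expR (y q) * sin (th q)) +i* (expR (y q) * cos (th q))) -
         carg ((1 + expR (y q) * sin (th q)) +i* (- (expR (y q) * cos (th q))))))
    (2 * ((k * c + l * (tanh (y r) * s)) * (sech (y r) / F))) /\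
  is_derive r 1 (fun q =>
    2 * (ln (nc ((1 + expR (y q) * sin (th q)) +i* (- (expR (y q) * cos (th q))))) -
         ln (nc ((1 - expR (y q) * sin (th q)) +i* (expR (y q) * cos (th q))))))
    (2 * ((l * c - k * (tanh (y r) * s)) * (sech (y r) / F))).
Proof.
move=> Dy Dth c0 c s F.
have De := d_comp Dy (is_derive_expR (y r)).
have Dc := d_comp Dth (is_derive_cos (th r)).
have Ds := d_comp Dth (is_derive_sin (th r)).
have e0 : 0 < expR (y r) by exact: expR_gt0.
have Y1 : expR (y r) * cos (th r) != 0 by rewrite mulf_neq0 // gt_eqF.
have Y2 : - (expR (y r) * cos (th r)) != 0 by rewrite oppr_eq0.
have DX1 : is_derive r 1 (fun q => 1 - expR (y q) * sin (th q)) _ := d_B (d_cst 1 r) (d_M De Ds).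
have DX2 : is_derive r 1 (fun q => 1 + expR (y q) * sin (th q)) _ := d_D (d_cst 1 r) (d_M De Ds).
have DY1 : is_derive r 1 (fun q => expR (y q) * cos (th q)) _ := d_M De Dc.
have DY2 : is_derive r 1 (fun q => - (expR (y q) * cos (th q))) _ := d_N (d_M De Dc).
have sE : sech (y r) = 2 * expR (y r) / (expR (y r) ^+ 2 + 1).
  by rewrite /sech /cosh expRN; field; rewrite gt_eqF //= gt_eqF // ltr_wpDl ?sqr_ge0.
have tE : tanh (y r) = (expR (y r) ^+ 2 - 1) / (expR (y r) ^+ 2 + 1).
  by rewrite /tanh /sinh /cosh expRN; field; rewrite gt_eqF //= gt_eqF // ltr_wpDl ?sqr_ge0.
have c2 : cos (th r) ^+ 2 = 1 - sin (th r) ^+ 2 by rewrite cos2sin2.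
have N1 : 0 < (1 - expR (y r) * sin (th r)) ^+ 2 + (expR (y r) * cos (th r)) ^+ 2.
  by rewrite ltr_wpDl ?sqr_ge0 // exprn_even_gt0.
have N2 : 0 < (1 + expR (y r) * sin (th r)) ^+ 2 + (- (expR (y r) * cos (th r))) ^+ 2.
  by rewrite ltr_wpDl ?sqr_ge0 // exprn_even_gt0.
have N1E : (1 - expR (y r) * sin (th r)) ^+ 2 + (expR (y r) * cos (th r)) ^+ 2 =
   1 - 2 * expR (y r) * sin (th r) + expR (y r) ^+ 2.
  by rewrite [X in _ + X]exprMn c2; ring.
have N2E : (1 + expR (y r) * sin (th r)) ^+ 2 + (- (expR (y r) * cos (th r))) ^+ 2 =
   1 + 2 * expR (y r) * sin (th r) + expR (y r) ^+ 2.
  by rewrite sqrrN [X in _ + X]exprMn c2; ring.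
have A1 := d_carg DX1 DY1 Y1; have A2 := d_carg DX2 DY2 Y2.
have L1 := d_ln_nc DX1 DY1 Y1; have L2 := d_ln_nc DX2 DY2 Y2.
split.
- apply: d_eq (d_Z 2 (d_B A1 A2)) _.
  rewrite N1E N2E sE tE in N1 N2 *; rewrite /F /s /c sE -(kink_chain_re k l c2) ?gt_eqF //.
  by congr (2 * (_ / _ - _ / _)); ring.
- apply: d_eq (d_Z 2 (d_B L2 L1)) _.
  rewrite N1E N2E sE tE in N1 N2 *; rewrite /F /s /c sE -(kink_chain_im k l c2) ?gt_eqF //.
  by congr (2 * (_ / _ - _ / _)); ring.
Qed.

Let d_phase2 t x : is_derive t 1 (fun r => beta * (x + r)) beta.
Proof. by apply: d_eq (d_Z beta (d_D (d_cst x t) (d_id t))) _; ring. Qed.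

Let d_phasex t x : is_derive x 1 (fun r => beta * (r + t)) beta.
Proof. by apply: d_eq (d_Z beta (d_D (d_id x) (d_cst t x))) _; ring. Qed.

Let d_phase1 s : is_derive s 1 (fun r => al * r) al.
Proof. by apply: d_eq (d_Z al (d_id s)) _; ring. Qed.

Let cos_shift_neq0 s t : in_box s t -> cos (al * s) != 0.
Proof. by move=> b; rewrite gt_eqF // (lt_le_trans _ (cos_shift_ge 0 b)) // invr_gt0. Qed.

Lemma kink_re_partials : partials kink_re (fun s t x => - (2 * al) * csech_im s t x)
  (fun s t x => 2 * beta * csech_re s t x).
Proof.
split=> s t x b.
- have [D _] := kink_chain (d_cst (beta * (x + t)) s) (d_phase1 s) (cos_shift_neq0 b).
  by apply: d_eq D _; rewrite /csech_im /kink_den /Si /Ta /sn; ring.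
- have [D _] := kink_chain (d_phase2 t x) (d_cst (al * s) t) (cos_shift_neq0 b).
  by apply: d_eq D _; rewrite /csech_re /kink_den /Si /Ta /sn /cs; ring.
Qed.

Lemma kink_im_partials : partials kink_im (fun s t x => 2 * al * csech_re s t x)
  (fun s t x => 2 * beta * csech_im s t x).
Proof.
split=> s t x b.
- have [_ D] := kink_chain (d_cst (beta * (x + t)) s) (d_phase1 s) (cos_shift_neq0 b).
  by apply: d_eq D _; rewrite /csech_re /kink_den /Si /Ta /sn /cs; ring.
- have [_ D] := kink_chain (d_phase2 t x) (d_cst (al * s) t) (cos_shift_neq0 b).
  by apply: d_eq D _; rewrite /csech_im /kink_den /Si /Ta /sn /cs; ring.
Qed.

Definition kink_x s t x : R[i] := (2 * beta * csech_re s t x) +i* (2 * beta * csech_im s t x).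

Lemma kink_cprimitive s t : in_box s t -> cprimitive (kink beta s t) (kink_x s t).
Proof.
move=> b; have [cr _] := lipw_csech_re; have [ci _] := lipw_csech_im.
split; rewrite /kink_x /=.
- have -> : (fun x => Re (kink beta s t x)) = kink_re s t by apply/funext => x; rewrite kinkE.
  apply: primitive_C1; last by apply: (c_M (c_cst _)); exact: cr.
  move=> x; have [D _] := kink_chain (d_phasex t x) (d_cst (al * s) x) (cos_shift_neq0 b).
  by apply: d_eq D _; rewrite /csech_re /kink_den /Si /Ta /sn /cs; ring.
- have -> : (fun x => Im (kink beta s t x)) = kink_im s t by apply/funext => x; rewrite kinkE.
  apply: primitive_C1; last by apply: (c_M (c_cst _)); exact: ci.
  move=> x; have [_ D] := kink_chain (d_phasex t x) (d_cst (al * s) x) (cos_shift_neq0 b).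
  by apply: d_eq D _; rewrite /csech_im /kink_den /Si /Ta /sn /cs; ring.
Qed.

Let csech_alg (e c s : R) : c ^+ 2 = 1 - s ^+ 2 ->
  1 - s * s * (2 * e / (e ^+ 2 + 1) * (2 * e / (e ^+ 2 + 1))) != 0 ->
  let F := 1 - s * s * (2 * e / (e ^+ 2 + 1) * (2 * e / (e ^+ 2 + 1))) in
  let T := (e ^+ 2 - 1) / (e ^+ 2 + 1) in
  c / F * (2 * e / (e ^+ 2 + 1)) * (1 + e ^+ 2 * (c ^+ 2 - s ^+ 2)) +
  T * (s / F) * (2 * e / (e ^+ 2 + 1)) * (2 * e ^+ 2 * s * c) = 2 * (e * c) /\
  c / F * (2 * e / (e ^+ 2 + 1)) * (2 * e ^+ 2 * s * c) -
  T * (s / F) * (2 * e / (e ^+ 2 + 1)) * (1 + e ^+ 2 * (c ^+ 2 - s ^+ 2)) = 2 * (e * s).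
Proof.
move=> c2; have e1 : e ^+ 2 + 1 != 0 by rewrite gt_eqF // ltr_wpDl ?sqr_ge0.
have -> : 1 - s * s * (2 * e / (e ^+ 2 + 1) * (2 * e / (e ^+ 2 + 1))) =
  ((e ^+ 2 + 1) ^+ 2 - 4 * e ^+ 2 * s ^+ 2) / (e ^+ 2 + 1) ^+ 2 by field.
move=> F0; have D0 : (e ^+ 2 + 1) ^+ 2 - 4 * e ^+ 2 * s ^+ 2 != 0.
  by move: F0; apply: contraNneq => ->; rewrite mul0r.
rewrite /= c2; split.
- by field; rewrite e1 D0.
- have E (u v : R) : c / u * v * (2 * e ^+ 2 * s * c) = c ^+ 2 / u * v * (2 * e ^+ 2 * s) by ring.
  by rewrite E c2; field; rewrite e1 D0.
Qed.

Lemma kink_tE s t x : in_box s t ->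
  kink_t beta s t x = (- (2 * al) * csech_im s t x) +i* (2 * al * csech_re s t x).
Proof.
move=> b; rewrite /kink_t; set w := kink_phase _ _ _ _.
have -> : cexp (2%:R * w) = cexp w * cexp w by rewrite -cexpD; congr cexp; ring.
set E := cexp w.
have EE : E = (expR (beta * (x + t)) * cos (al * s)) +i* (expR (beta * (x + t)) * sin (al * s)) by [].
have E0 : E != 0 by exact: cexp_neq0.
have K : (csech_re s t x +i* csech_im s t x) * (1 + E * E) = 2%:R * E.
  have e0 : 0 < expR (beta * (x + t)) by exact: expR_gt0.
  have sE : Si s t x = 2 * expR (beta * (x + t)) / (expR (beta * (x + t)) ^+ 2 + 1).
    by rewrite /Si /sech /cosh expRN; field; rewrite gt_eqF //= gt_eqF // ltr_wpDl ?sqr_ge0.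
  have tE : Ta s t x = (expR (beta * (x + t)) ^+ 2 - 1) / (expR (beta * (x + t)) ^+ 2 + 1).
    by rewrite /Ta /tanh /sinh /cosh expRN; field; rewrite gt_eqF //= gt_eqF // ltr_wpDl ?sqr_ge0.
  have c2 : cos (al * s) ^+ 2 = 1 - sin (al * s) ^+ 2 by rewrite cos2sin2.
  have F0 := kink_den_neq0 x b; rewrite /kink_den sE /sn in F0.
  have [A1 A2] := csech_alg c2 F0.
  rewrite EE; apply: complex_ext; rewrite /csech_re /csech_im /kink_den /= tE sE /sn /cs.
    transitivity (2 * (expR (beta * (x + t)) * cos (al * s))); last by ring.
    by rewrite -A1 /=; ring.
  transitivity (2 * (expR (beta * (x + t)) * sin (al * s))); last by ring.
  by rewrite -A2 /=; ring.
have D0 : 1 + E * E != 0.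
  by apply: contra_neq E0 => D0; move: K; rewrite D0 mulr0 => /esym/eqP; rewrite mulf_eq0 (negbTE (@two_neq0 R)) => /eqP.
apply: (mulIf D0); rewrite divfK //.
transitivity (2%:R * I * al%:C * (2%:R * E)); first by ring.
rewrite -K; apply: complex_ext => /=; ring.
Qed.

Lemma csech0 x : csech_re 0 0 x = S x /\ csech_im 0 0 x = 0.
Proof.
rewrite /csech_re /csech_im /kink_den; have [-> -> -> _] := shifts0 beta x.
by rewrite !mul0r oppr0 addr0 invr1 !mul1r mulr0 mul0r oppr0.
Qed.

Lemma kink_x0 x : kink_x 0 0 x = (2 * beta * S x)%:C.
Proof. by rewrite /kink_x; have [-> ->] := csech0 x; rewrite mulr0. Qed.

Lemma in_box0 : @in_box R 0 0. Proof. by split; rewrite normr0. Qed.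

Lemma kink_t0 x : kink_t beta 0 0 x = (0 +i* (2 * al * S x)).
Proof. by rewrite kink_tE; [|exact: in_box0]; have [-> ->] := csech0 x; rewrite mulr0. Qed.

Lemma kink0 x : exists k : R, [/\ kink beta 0 0 x = (2 * k)%:C,
  sin k = S x & cos k = - tanh (beta * x)].
Proof.
pose e := expR (beta * x); have e0 : 0 < e by exact: expR_gt0.
have en : e != 0 by rewrite gt_eqF.
exists (carg (1 +i* e) *+ 2); have [C1 C2] := carg_cos_sin 1 en.
have N0 := (nc_off_axis 1 en).1; have N2 := nc_sqr 1 e.
have Nn : nc (1 +i* e) != 0 by rewrite gt_eqF.
have e1 : 1 + e ^+ 2 != 0 by rewrite gt_eqF // ltr_pwDl ?sqr_ge0.
rewrite sin_mulr2n cos_mulr2n C1 C2.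
have e1' : e ^+ 2 + 1 != 0 by rewrite addrC.
have sE : S x = 2 * e / (1 + e ^+ 2).
  by rewrite /wsech /sech /cosh expRN -/e; field; rewrite ?en ?e1 ?e1'.
have tE : tanh (beta * x) = (e ^+ 2 - 1) / (1 + e ^+ 2).
  by rewrite /tanh /sinh /cosh expRN -/e; field; rewrite ?en ?e1 ?e1'.
split.
- rewrite kinkE /kink_re /kink_im mulr0 sin0 cos0 !mulr1 !mulr0 subr0 !addr0 -/e.
  have -> : nc (1 -i* e) = nc (1 +i* e) by rewrite /nc /= sqrrN.
  by rewrite subrr mulr0 cargN; apply: complex_ext => //=; rewrite -mulr_natr; ring.
- rewrite sE; transitivity (2 * e / nc (1 +i* e) ^+ 2); last by rewrite N2 expr1n.
  by rewrite -mulr_natr; field.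
- rewrite tE; transitivity (2 / nc (1 +i* e) ^+ 2 - 1); first by rewrite -mulr_natr; field.
  by rewrite N2 expr1n; field.
Qed.

Lemma kink_shift_bound : exists2 M, 0 < M & forall s t x, in_box s t ->
  [/\ nc (kink beta s t x - kink beta 0 0 x) <= M * S x * (`|s| + `|t|),
      nc (kink_x s t x - kink_x 0 0 x) <= M * S x * (`|s| + `|t|) &
      nc (kink_t beta s t x - kink_t beta 0 0 x) <= M * S x * (`|s| + `|t|)].
Proof.
have [cr [Mr Mr0 HMr]] := lipw_csech_re; have [ci [Mi Mi0 HMi]] := lipw_csech_im.
have Lr k := lipwZ k S0 lipw_csech_re; have Li k := lipwZ k S0 lipw_csech_im.
have [N1 N10 H1] := shift_taylor S0 kink_re_partials (Li _) (Lr _).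
have [N2 N20 H2] := shift_taylor S0 kink_im_partials (Lr _) (Li _).
exists (N1 + N2 + 2 * (Mr + Mi) + 1).
  by rewrite ltr_wpDl // !addr_ge0 // mulr_ge0 // addr_ge0.
move=> s t x b; have b0 := in_box0.
have [h1 _] := H1 s t 0 0 x b b0; have [h2 _] := H2 s t 0 0 x b b0.
have [_ h3] := HMr s t 0 0 x b b0; have [_ h4] := HMi s t 0 0 x b b0.
rewrite !subr0 in h1 h2 h3 h4; set d := `|s| + `|t| in h1 h2 h3 h4 *.
have d0 : 0 <= d by rewrite addr_ge0.
have W : 0 <= S x * d by rewrite mulr_ge0.
have W1 := mulr_ge0 N10 W; have W2 := mulr_ge0 N20 W.
have W3 := mulr_ge0 Mr0 W; have W4 := mulr_ge0 Mi0 W.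
have [g1 g2] := shift_arith W1 W2 W3 W4 W; rewrite -!(mulrA _ (S x) d).
rewrite -(mulrA _ (S x) d) in h1; rewrite -(mulrA _ (S x) d) in h2.
have i3 : 2 * `|csech_re s t x - csech_re 0 0 x| <= 2 * (Mr * (S x * d)).
  by rewrite ler_pM2l ?ltr0n // mulrA.
have i4 : 2 * `|csech_im s t x - csech_im 0 0 x| <= 2 * (Mi * (S x * d)).
  by rewrite ler_pM2l ?ltr0n // mulrA.
have i34 := le_trans (lerD i3 i4) g2; have i43 := i34; rewrite addrC in i43.
have L (a b' : R) : `|a| <= 1 -> `|2 * a * b'| <= 2 * `|b'|.
  move=> a1; rewrite !normrM (@ger0_norm _ 2) // -mulrA ler_pM2l ?ltr0n //.
  by rewrite ler_piMl.
have al1 : `|al| <= 1 by rewrite ger0_norm ?alpha_le1 // ltW.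
have al1' : `|- al| <= 1 by rewrite normrN.
have be1 := beta_le1 beta_bounds.
split.
- rewrite !kinkE; apply: (le_trans (nc_le_ReIm _)) => /=.
  exact: le_trans (lerD h1 h2) g1.
- apply: (le_trans (nc_le_ReIm _)) => /=; rewrite -!mulrBr.
  exact: le_trans (lerD (L _ _ be1) (L _ _ be1)) i34.
- rewrite !kink_tE //; apply: (le_trans (nc_le_ReIm _)) => /=; rewrite -!mulrBr -mulrN.
  exact: le_trans (lerD (L _ _ al1') (L _ _ al1)) i43.
Qed.

End KinkFamilies.

(** * Modulation *)

Section Moments.
Context {R : realType} (beta : R) (beta_neq0 : beta != 0).
Local Notation S := (wsech beta).
Local Notation mu := (@lebesgue_measure R).
Local Notation n2T := (n2 [set: R]).
Local Notation sqT := (sq [set: R]).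
Local Notation msb D := (@measurable _ (measurableTypeR R) D).
Implicit Types (f g : R -> R -> R -> R) (z : R -> R) (s t x : R).

Let S0 x : 0 <= S x := wsech_ge0 beta x.
Let mT : msb [set: R]. Proof. exact: measurableT. Qed.
Let sS : sqT S := sq_wsech beta_neq0.

Lemma lipw_sq g s t : lipw S g -> in_box s t -> sqT (g s t).
Proof.
move=> [cg [N N0 HN]] b; have [s1 _] := sqZ N sS.
apply: (sq_le _ _ s1).1; first exact: continuous_measurable_fun (cg _ _ b).
move=> x _; have [h _] := HN s t s t x b b; apply: (le_trans h).
by rewrite ger0_norm // mulr_ge0.
Qed.

Definition moment z f g s t : R := \int[mu]_x ((z x - (f s t x - f 0 0 x)) * g s t x).

Let linear_arith (A B w d d' x y : R) : 0 <= d -> 0 <= d' -> 0 <= A * w -> 0 <= B * w ->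
  x <= A * w -> y <= B * w -> d * x + d' * y <= (A + B) * w * (d + d').
Proof.
move=> d0 d'0 A0 B0 hx hy.
have := ler_wpM2l d0 hx; have := ler_wpM2l d'0 hy.
have := mulr_ge0 d0 B0; have := mulr_ge0 d'0 A0; lra.
Qed.

Let moment_sum (N C Q d i m n : R) : N * d * i <= N * d * (m * n) -> 0 <= N * n * Q * d ->
  0 <= C * n ^+ 2 * m * d ->
  N * d * i + C * Q * d * n ^+ 2 <= (N * n + C * n ^+ 2) * (m + Q) * d.
Proof. by move=> *; lra. Qed.

Let moment_alg (z zb g0 g g' D D' L N M1 M2 w d Q : R) :
  0 <= N -> 0 <= M1 -> 0 <= M2 -> 0 <= w -> 0 <= d -> 0 <= Q ->
  `|g - g'| <= N * w * d -> `|D'| <= M1 * w * Q -> `|D - D' - L| <= M1 * w * Q * d ->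
  `|g| <= N * w -> `|L| <= M2 * w * d -> `|g - g0| <= N * w * Q ->
  `|(z - D) * g - (z - D') * g' + L * g0| <=
    N * d * `|z * w| + (2 * M1 * N + M2 * N) * Q * d * w ^+ 2.
Proof.
move=> N0 M10 M20 w0 d0 Q0 h1 h2 h3 h4 h5 h6.
have -> : (z - D) * g - (z - D') * g' + L * g0 =
  z * (g - g') - ((D - D' - L) * g + L * (g - g0) + D' * (g - g')) by ring.
apply: (le_trans (ler_normB _ _)).
have a1 : `|z * (g - g')| <= N * d * `|z * w|.
  rewrite !normrM (ger0_norm w0); apply: (le_trans (ler_wpM2l (normr_ge0 z) h1)).
  by rewrite le_eqVlt; apply/orP; left; apply/eqP; ring.
have a2 : `|(D - D' - L) * g| <= M1 * w * Q * d * (N * w) by rewrite normrM; exact: ler_pM.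
have a3 : `|L * (g - g0)| <= M2 * w * d * (N * w * Q) by rewrite normrM; exact: ler_pM.
have a4 : `|D' * (g - g')| <= M1 * w * Q * (N * w * d) by rewrite normrM; exact: ler_pM.
have := ler_normD ((D - D' - L) * g + L * (g - g0)) (D' * (g - g')).
have := ler_normD ((D - D' - L) * g) (L * (g - g0)).
have -> : (2 * M1 * N + M2 * N) * Q * d * w ^+ 2 = M1 * w * Q * d * (N * w) +
   M2 * w * d * (N * w * Q) + M1 * w * Q * (N * w * d) by ring.
by move=> b1 b2; lra.
Qed.

(** The quadratic terms carry [S ^ 2] and the terms linear in [z] carry
    [|z| S]; both are integrable, the latter by Cauchy-Schwarz. *)
Lemma moment_expansion f f1 f2 g : (forall s t, in_box s t -> continuous (f s t)) ->
  partials f f1 f2 -> lipw S f1 -> lipw S f2 -> lipw S g ->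
  exists2 M, 0 <= M & forall z, sqT z ->
  [/\ forall s t, in_box s t -> integrable_on [set: R] (fun x => (z x - (f s t x - f 0 0 x)) * g s t x),
   `|moment z f g 0 0| <= M * n2T z &
  forall s t s' t', in_box s t -> in_box s' t' ->
    `|moment z f g s t - moment z f g s' t' +
      ((s - s') * (\int[mu]_x (f1 0 0 x * g 0 0 x)) + (t - t') * \int[mu]_x (f2 0 0 x * g 0 0 x))| <=
    M * (n2T z + (`|s| + `|t| + (`|s'| + `|t'|))) * (`|s - s'| + `|t - t'|)].
Proof.
move=> cf pf l1 l2 lg; have [M1 M10 H1] := shift_taylor S0 pf l1 l2.
have [_ [N N0 HN]] := lg; have [_ [A A0 HA]] := l1; have [_ [B B0 HB]] := l2.
have nS : 0 <= n2T S by exact: n2_ge0.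
pose C := 2 * M1 * N + (A + B) * N.
have C0 : 0 <= C by rewrite addr_ge0 // !mulr_ge0 // addr_ge0.
have b0 := @in_box0 R.
have sq0 h s t : lipw S h -> in_box s t -> sqT (h s t) by exact: lipw_sq.
exists (N * n2T S + C * n2T S ^+ 2); first by rewrite addr_ge0 // mulr_ge0 // sqr_ge0.
move=> z sz.
have sD s t : in_box s t -> sqT (fun x => z x - (f s t x - f 0 0 x)).
  move=> b; have [s1 _] := sqZ (M1 * (`|s| + `|t|)) sS.
  have s2 : sqT (fun x => f s t x - f 0 0 x).
    apply: (sq_le _ _ s1).1.
      by apply: measurable_funB; apply: continuous_measurable_fun; exact: cf.
    move=> x _; have [h _] := H1 s t 0 0 x b b0; rewrite !subr0 in h.
    rewrite [leRHS]ger0_norm; first by rewrite mulrAC.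
    by rewrite !mulr_ge0 // addr_ge0.
  have [s3 _] := sqZ (-1) s2; have [s4 _] := sqD sz s3.
  by apply: sq_eq s4 => x; rewrite mulN1r.
have iD s t : in_box s t -> integrable_on [set: R] (fun x => (z x - (f s t x - f 0 0 x)) * g s t x).
  by move=> b; have [] := cauchy_schwarz (sD _ _ b) (lipw_sq lg b).
have [izS czS] := cauchy_schwarz sz sS.
have cS2 : n2T S ^+ 2 = \int[mu]_x S x ^+ 2 by exact: n2_sqr.
have nz : 0 <= n2T z by exact: n2_ge0.
split => //.
- have [ig cg] := cauchy_schwarz sz (lipw_sq lg b0).
  have -> : moment z f g 0 0 = \int[mu]_x (z x * g 0 0 x).
    by congr Rintegral; apply/funext => x; rewrite subrr subr0.
  apply: (le_trans (le_normr_Rintegral mT ig)); apply: (le_trans cg).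
  have ng : n2T (g 0 0) <= N * n2T S.
    have [s1 n1] := sqZ N sS; rewrite -[N](ger0_norm N0) -n1.
    apply: (sq_le _ _ s1).2; first by have [] := lipw_sq lg b0.
    move=> x _; have [h _] := HN 0 0 0 0 x b0 b0; apply: (le_trans h).
    by rewrite ger0_norm // mulr_ge0.
  apply: (le_trans (ler_wpM2l nz ng)); rewrite mulrC ler_wpM2r //.
  by rewrite lerDl mulr_ge0 // sqr_ge0.
- move=> s t s' t' b b'.
  have [i1 _] := cauchy_schwarz (lipw_sq l1 b0) (lipw_sq lg b0).
  have [i2 _] := cauchy_schwarz (lipw_sq l2 b0) (lipw_sq lg b0).
  have j1 := integrable_onZ (s - s') mT i1; have j2 := integrable_onZ (t - t') mT i2.
  have j3 := integrable_onB mT (iD _ _ b) (iD _ _ b').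
  have j4 := integrable_onD mT j1 j2; have j5 := integrable_onD mT j3 j4.
  rewrite /moment -RintegralB //; [|exact: iD|exact: iD].
  rewrite -!RintegralZl // -!RintegralD //.
  apply: (le_trans (le_normr_Rintegral mT j5)).
  set d := `|s - s'| + `|t - t'|; set Q := `|s| + `|t| + (`|s'| + `|t'|).
  have d0 : 0 <= d by rewrite addr_ge0.
  have Q0 : 0 <= Q by rewrite !addr_ge0.
  have k1 := integrable_onZ (N * d) mT (integrable_on_norm mT izS).
  have [_ _ iS2] := sS; have k2 := integrable_onZ (C * Q * d) mT iS2.
  apply: (@le_trans _ _ (\int[mu]_x (N * d * `|z x * S x| + C * Q * d * S x ^+ 2))).
    apply: le_Rint => //; [exact: integrable_on_norm|exact: integrable_onD|].
    move=> x _.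
    have [_ h1] := HN s t s' t' x b b'; have [h4 _] := HN s t s' t' x b b'.
    have [_ h6] := HN s t 0 0 x b b0; rewrite !subr0 in h6.
    have [h2 _] := H1 s' t' 0 0 x b' b0; rewrite !subr0 in h2.
    have [_ h3] := H1 s t s' t' x b b'.
    have [e1 _] := HA 0 0 0 0 x b0 b0; have [e2 _] := HB 0 0 0 0 x b0 b0.
    have -> : (s - s') * (f1 0 0 x * g 0 0 x) + (t - t') * (f2 0 0 x * g 0 0 x) =
      ((s - s') * f1 0 0 x + (t - t') * f2 0 0 x) * g 0 0 x by ring.
    have W : 0 <= N * S x by rewrite mulr_ge0.
    have W1 : 0 <= M1 * S x by rewrite mulr_ge0.
    apply: (@moment_alg _ (z x) _ _ _ _ _ _ N M1 (A + B)) => //; first exact: addr_ge0.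
    + by apply: (le_trans h2); rewrite ler_wpM2l // /Q lerDr addr_ge0.
    + apply: le_trans h3; rewrite le_eqVlt; apply/orP; left; apply/eqP; congr `|_|; ring.
    + apply: (le_trans (ler_normD _ _)); rewrite !normrM.
      by apply: linear_arith; rewrite ?mulr_ge0.
    + by apply: (le_trans h6); rewrite ler_wpM2l // /Q lerDl addr_ge0.
  rewrite RintegralD // !RintegralZl //; last exact: integrable_on_norm.
  rewrite -cS2; have u1 := ler_wpM2l (mulr_ge0 N0 d0) czS.
  have v1 : 0 <= N * n2T S * Q * d by rewrite !mulr_ge0.
  have v2 : 0 <= C * n2T S ^+ 2 * n2T z * d by rewrite !mulr_ge0 // sqr_ge0.
  exact: moment_sum.
Qed.

Lemma n2_gt0 (h : R -> R) m : 0 < m -> sqT h -> (forall x, 1 <= x <= 2 -> m <= `|h x|) ->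
  0 < n2T h.
Proof.
move=> m0 sh hm; have [s n] := @sqS R `[1, 2] setT h (measurable_itv _) (@subsetT _ _) sh.
apply: lt_le_trans n.
have n1 : n2 `[(1 : R), 2] (fun=> m) = m.
  rewrite /n2 -/(iint _ _ _) (@eq_iint _ _ _ _ (fun=> m ^+ 2)) => [|y _] //.
  by rewrite iint_cst ?ler1n // (_ : 2 - 1 = 1) ?mulr1 ?sqrtr_sqr ?gtr0_norm //; lra.
rewrite -n1 in m0; apply: (lt_le_trans m0).
apply: (sq_le _ _ s).2 => // x; rewrite /= in_itv /= => /hm.
by rewrite [X in _ -> X <= _]ger0_norm // -n1 ltW.
Qed.

End Moments.

Section TwoMoments.
Context {R : realType}.
Local Notation nc := (@Normc.normc R).

(** Quantitative inverse function theorem with diagonal linear part: the map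
    [(s, t) |-> (s + m1 / G1, t + m2 / G2)], on pairs encoded as complex
    numbers, contracts distances by one half. *)
Lemma two_moments (G1 G2 M : R) : 0 < G1 -> 0 < G2 -> 0 <= M ->
  exists e0 C rho, [/\ 0 < e0, 0 < C, 0 < rho & rho <= 1 /\
  forall (m1 m2 : R -> R -> R) e, 0 <= e -> e <= e0 ->
  `|m1 0 0| <= M * e -> `|m2 0 0| <= M * e ->
  (forall s t s' t', in_box s t -> in_box s' t' ->
    `|m1 s t - m1 s' t' + (s - s') * G1| <=
      M * (e + (`|s| + `|t| + (`|s'| + `|t'|))) * (`|s - s'| + `|t - t'|) /\
    `|m2 s t - m2 s' t' + (t - t') * G2| <=
      M * (e + (`|s| + `|t| + (`|s'| + `|t'|))) * (`|s - s'| + `|t - t'|)) ->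
  exists s t, [/\ `|s| <= C * e, `|t| <= C * e, `|s| < rho /\ `|t| < rho,
    m1 s t = 0 /\ m2 s t = 0 &
    forall s' t', `|s'| < rho -> `|t'| < rho -> m1 s' t' = 0 -> m2 s' t' = 0 -> s' = s /\ t' = t]].
Proof.
move=> G10 G20 M0; pose K := M / G1 + M / G2 + 1.
have p1 : 0 <= M / G1 by rewrite divr_ge0 // ltW.
have p2 : 0 <= M / G2 by rewrite divr_ge0 // ltW.
have K1 : M / G1 <= K by rewrite /K -addrA lerDl addr_ge0.
have K2 : M / G2 <= K by rewrite /K addrAC lerDr addr_ge0.
have K3 : 1 <= K by rewrite /K lerDr addr_ge0.
have K0 : 0 < K := lt_le_trans ltr01 K3.
pose rho := (64 * K)^-1.
have r0 : 0 < rho by rewrite invr_gt0 mulr_gt0.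
have rK : K * rho = 64^-1 by rewrite /rho; field; rewrite gt_eqF.
have r1 : rho <= 64^-1 by rewrite -rK ler_peMl // ltW.
exists (rho / (8 * K)), (4 * K), rho.
have e00 : 0 < rho / (8 * K) by rewrite divr_gt0 // mulr_gt0.
split=> //; first by rewrite mulr_gt0.
have rho1 : rho <= 1 by apply: (le_trans r1); clear; lra.
split=> // m1 m2 e e1 e2 z1 z2 H.
have Ke : 8 * (K * e) <= rho.
  by move: e2; rewrite ler_pdivlMr ?mulr_gt0 // => h; clear - h; lra.
pose T (u : R[i]) : R[i] := (Re u + m1 (Re u) (Im u) / G1) +i* (Im u + m2 (Re u) (Im u) / G2).
pose small (u : R[i]) := `|Re u| < rho /\ `|Im u| < rho.
have small_box u : small u -> in_box (Re u) (Im u) by move=> [a b]; split; exact: le_trans (ltW _) rho1.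
have Tc u u' : small u -> small u' -> nc (T u - T u') <= nc (u - u') / 2.
  move=> su su'; have [h1 h2] := H _ _ _ _ (small_box _ su) (small_box _ su').
  have [a1 a2] := su; have [b1 b2] := su'.
  have dd := nc_Re (u - u'); have dd' := nc_Im (u - u').
  rewrite ReB in dd; rewrite ImB in dd'.
  set d := `|Re u - Re u'| + `|Im u - Im u'| in h1 h2; have d0 : 0 <= d by rewrite addr_ge0.
  have dn : d <= 2 * nc (u - u') by rewrite /d; clear - dd dd'; lra.
  set E := e + (`|Re u| + `|Im u| + (`|Re u'| + `|Im u'|)) in h1 h2; have E0 : 0 <= E by rewrite /E !addr_ge0.
  have EK : K * E <= 8^-1.
    have : K * E <= K * (e + 4 * rho).
      by rewrite ler_wpM2l ?(ltW K0) // /E; clear - a1 a2 b1 b2; lra.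
    by move=> h; clear - h Ke rK r1; lra.
  have F (x x' y y' G : R) : 0 < G -> M / G <= K ->
      `|y - y' + (x - x') * G| <= M * E * d -> `|x + y / G - (x' + y' / G)| <= 8^-1 * d.
    move=> G0 KG h; have -> : x + y / G - (x' + y' / G) = (y - y' + (x - x') * G) / G.
      by field; rewrite gt_eqF.
    rewrite normrM (@gtr0_norm _ G^-1) ?invr_gt0 // ler_pdivrMr //; apply: (le_trans h).
    have -> : M * E * d = M / G * E * d * G by field; rewrite gt_eqF.
    rewrite ler_wpM2r ?(ltW G0) // ler_wpM2r //; apply: le_trans EK.
    by rewrite ler_wpM2r.
  have f1 := F _ _ _ _ _ G10 K1 h1; have f2 := F _ _ _ _ _ G20 K2 h2.
  apply: (le_trans (nc_le_ReIm _)); rewrite ReB ImB /=.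
  by apply: (le_trans (lerD f1 f2)); clear - dn; lra.
have small0 : small 0 by rewrite /small /= normr0.
have T0 : nc (T 0) <= 2 * K * e.
  have F (m G : R) : 0 < G -> M / G <= K -> `|m| <= M * e -> `|0 + m / G| <= K * e.
    move=> G0 KG h; rewrite add0r normrM (@gtr0_norm _ G^-1) ?invr_gt0 // ler_pdivrMr //.
    apply: (le_trans h); have -> : M * e = M / G * e * G by field; rewrite gt_eqF.
    by rewrite ler_wpM2r ?(ltW G0) // ler_wpM2r.
  have f1 := F _ _ G10 K1 z1; have f2 := F _ _ G20 K2 z2.
  apply: (le_trans (nc_le_ReIm _)); apply: (le_trans (lerD f1 f2)).
  by clear; lra.
pose rr := 4 * K * e; have rr0 : 0 <= rr by rewrite /rr !mulr_ge0 // ltW.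
have rrr : rr < rho by rewrite /rr; clear - Ke r0; lra.
have ball_small u : nc u <= rr -> small u.
  by move=> h; split; apply: le_lt_trans (le_trans _ h) rrr; [exact: nc_Re|exact: nc_Im].
have [u Pu fix_] : exists2 u : unit -> R[i], nc (u tt) <= rr & u tt = T (u tt).
  apply: (@contraction_fixpoint R unit (fun u => nc (u tt) <= rr) (fun u v => v tt = T (u tt))
    (fun=> 0) (2 * rr)).
  - by rewrite nc0.
  - move=> u hu; exists (fun=> T (u tt)) => //.
    have h := Tc _ _ (ball_small _ hu) small0; rewrite subr0 in h.
    have h' := ncD (T (u tt) - T 0) (T 0); rewrite subrK /rr in h' hu *.
    by clear - h h' hu T0; lra.
  - move=> u u' v v' k hu hu' Ev Ev' _ _ hk []; rewrite Ev Ev'.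
    have h1 := Tc _ _ (ball_small _ hu) (ball_small _ hu'); have h2 := hk tt.
    by clear - h1 h2; lra.
  - move=> u v hu hv []; have h := ncB_le hu hv; clear - h; lra.
  - move=> us u k Pus hk; apply: (@le_geometric _ _ _ k) => n.
    have := Pus n; have := hk n tt; have := ncB (us n tt) (us n tt - u tt).
    by rewrite opprB addrC subrK => h1 h2 h3; clear - h1 h2 h3; lra.
have su := ball_small _ Pu.
have zero (x y G : R) : 0 < G -> x + y / G = x <-> y = 0.
  move=> G0; split => [h|->]; last by rewrite mul0r addr0.
  have E : y / G = 0 by rewrite -(addKr x (y / G)) h addNr.
  by rewrite -(divfK (negbT (gt_eqF G0)) y) E mul0r.
exists (Re (u tt)), (Im (u tt)); have [s1 s2] := su.
have C1 := nc_Re (u tt); have C2 := nc_Im (u tt).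
rewrite -/rr; split; [exact: le_trans Pu|exact: le_trans Pu|by []| |].
  by rewrite -(zero (Re (u tt)) _ G1) // -(zero (Im (u tt)) _ G2) //; split;
     rewrite [in RHS]fix_.
move=> s' t' hs ht q1 q2.
have E : T (s' +i* t') = s' +i* t' by rewrite /T /= q1 q2 !mul0r !addr0.
have h := Tc (s' +i* t') (u tt) (conj hs ht) su; rewrite E -fix_ in h.
have /eqP : (s' +i* t') - u tt = 0 by apply: nc_eq0; have h0 := nc_ge0 ((s' +i* t') - u tt); clear - h h0; lra.
by rewrite subr_eq0 => /eqP <-.
Qed.

End TwoMoments.

Section Modulation.
Context {R : realType} (beta : R).
Context (beta_bounds : -1 < beta < 1) (beta_neq0 : beta != 0).
Local Notation al := (alpha beta).
Local Notation S := (wsech beta).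
Local Notation mu := (@lebesgue_measure R).
Local Notation n2T := (n2 [set: R]).
Local Notation sqT := (sq [set: R]).
Local Notation msb D := (@measurable _ (measurableTypeR R) D).
Local Notation B := (breather beta).
Local Notation Bt := (breather_t beta).
Local Notation B1 := (breather_d1 beta).
Local Notation B2 := (breather_d2 beta).
Local Notation Bt1 := (breather_t_d1 beta).
Local Notation Bt2 := (breather_t_d2 beta).

Let mT : msb [set: R]. Proof. exact: measurableT. Qed.
Let S0 x : 0 <= S x := wsech_ge0 beta x.

Lemma breather_continuous s t : in_box s t -> continuous (B s t).
Proof.
move=> b; have c1 : continuous (fun x => 4 * atan (beta / al * (sin_shift beta s t x * shifted_sech beta s t x))).
  apply: (c_M (c_cst 4)); apply: c_comp (@continuous_atan R).
  apply: (c_M (c_cst _)); apply: (c_M (c_cst _)).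
  by have [cs _] := lipwS_sech beta_bounds; exact: cs.
exact: c1.
Qed.

Lemma breather_t_continuous s t : in_box s t -> continuous (Bt s t).
Proof. by move=> b; rewrite breather_tE //; have [c _] := lipw_breather_d1 beta_bounds; exact: c. Qed.

Lemma shifts_derive1 (f g h : R -> R -> R -> R) (s t x : R) : partials f g h -> in_box s t ->
  derive1 (fun r => f r t x) s = g s t x /\ derive1 (fun r => f s r x) t = h s t x.
Proof.
move=> [D1 D2] b; have d1 := D1 s t x b; have d2 := D2 s t x b.
by rewrite !derive1E !derive_val.
Qed.



Lemma modulation_shiftE phi0 phi1 rho s t : rho <= 1 ->
  let z := rem0 beta phi0 0 0 in let w := rem1 beta phi1 0 0 in
  sqT z -> sqT w ->
  modulation_shift beta phi0 phi1 rho s t <->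
  [/\ `|s| < rho, `|t| < rho, moment z B B1 s t + moment w Bt Bt1 s t = 0 &
      moment z B B2 s t + moment w Bt Bt2 s t = 0].
Proof.
move=> r1 z w sz sw.
have pB := breather_partials beta_bounds; have pBt := breather_t_partials beta_bounds.
have [L1 L2] := (lipw_breather_d1 beta_bounds, lipw_breather_d2 beta_bounds).
have [K1 K2] := (lipw_breather_t_d1 beta_bounds, lipw_breather_t_d2 beta_bounds).
have cB := breather_continuous; have cBt := breather_t_continuous.
have [M1 _ /(_ _ sz)[i1 _ _]] := moment_expansion beta_neq0 cB pB L1 L2 L1.
have [M2 _ /(_ _ sz)[i2 _ _]] := moment_expansion beta_neq0 cB pB L1 L2 L2.
have [M3 _ /(_ _ sw)[i3 _ _]] := moment_expansion beta_neq0 cBt pBt K1 K2 K1.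
have [M4 _ /(_ _ sw)[i4 _ _]] := moment_expansion beta_neq0 cBt pBt K1 K2 K2.
have E : `|s| < rho -> `|t| < rho ->
   \int[mu]_x (rem0 beta phi0 s t x * derive1 (fun r => B r t x) s +
     rem1 beta phi1 s t x * derive1 (fun r => Bt r t x) s) =
   moment z B B1 s t + moment w Bt Bt1 s t /\
   \int[mu]_x (rem0 beta phi0 s t x * derive1 (fun r => B s r x) t +
     rem1 beta phi1 s t x * derive1 (fun r => Bt s r x) t) =
   moment z B B2 s t + moment w Bt Bt2 s t.
  move=> hs ht; have b : in_box s t by split; lra.
  rewrite /moment -!RintegralD //; [|exact: i2|exact: i4|exact: i1|exact: i3].
  split; congr Rintegral; apply/funext => x; have [E1 E2] := shifts_derive1 x pB b;
    have [E3 E4] := shifts_derive1 x pBt b; rewrite ?E1 ?E2 ?E3 ?E4;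
    by rewrite /z /w /rem0 /rem1; congr (_ * _ + _ * _); ring.
split=> [[a b c d]|[a b c d]]; have [E1 E2] := E a b.
  by split; [exact: a|exact: b|exact: etrans (esym E1) c|exact: etrans (esym E2) d].
by split; [exact: a|exact: b|exact: etrans E1 c|exact: etrans E2 d].
Qed.

Let sum13_le (a b c d : R) : 0 <= b -> 0 <= d -> a + c <= a + b + c + d.
Proof. by move=> b0 d0; lra. Qed.

Let sum24_le (a b c d : R) : 0 <= a -> 0 <= c -> b + d <= a + b + c + d.
Proof. by move=> b0 d0; lra. Qed.

Lemma modulation : exists e0 C rho, [/\ 0 < e0, 0 < C, 0 < rho & rho <= 1 /\
  forall phi0 phi1 e, 0 <= e -> e <= e0 ->
  sqT (rem0 beta phi0 0 0) -> sqT (rem1 beta phi1 0 0) ->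
  n2T (rem0 beta phi0 0 0) <= e -> n2T (rem1 beta phi1 0 0) <= e ->
  exists x1 x2, [/\ modulation_shift beta phi0 phi1 rho x1 x2, `|x1| <= C * e, `|x2| <= C * e &
    forall y1 y2, modulation_shift beta phi0 phi1 rho y1 y2 -> y1 = x1 /\ y2 = x2]].
Proof.
have pB := breather_partials beta_bounds; have pBt := breather_t_partials beta_bounds.
have [L1 L2] := (lipw_breather_d1 beta_bounds, lipw_breather_d2 beta_bounds).
have [K1 K2] := (lipw_breather_t_d1 beta_bounds, lipw_breather_t_d2 beta_bounds).
have cB := breather_continuous; have cBt := breather_t_continuous.
have [M1 M10 H1] := moment_expansion beta_neq0 cB pB L1 L2 L1.
have [M2 M20 H2] := moment_expansion beta_neq0 cB pB L1 L2 L2.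
have [M3 M30 H3] := moment_expansion beta_neq0 cBt pBt K1 K2 K1.
have [M4 M40 H4] := moment_expansion beta_neq0 cBt pBt K1 K2 K2.
have b0 := @in_box0 R.
have G10 : 0 < \int[mu]_x (B1 0 0 x * B1 0 0 x).
  have s1 := lipw_sq beta_neq0 L1 b0.
  under eq_Rintegral do rewrite -expr2.
  rewrite -n2_sqr exprn_gt0 //.
  have m0 : 0 < `|4 * beta| * S 2 by rewrite mulr_gt0 ?wsech_gt0 // normr_gt0 mulf_neq0.
  apply: n2_gt0 m0 s1 _ => x /andP[x1 x2].
  rewrite breather_d10 // (normrM _ (S x)) (ger0_norm (S0 x)) ler_wpM2l //.
  by apply: wsech_homo; rewrite !ger0_norm //; lra.
have G20 : 0 < \int[mu]_x (Bt2 0 0 x * Bt2 0 0 x).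
  have s1 := lipw_sq beta_neq0 K2 b0.
  under eq_Rintegral do rewrite -expr2.
  rewrite -n2_sqr exprn_gt0 //.
  have m0 : 0 < `|- 4 * beta ^+ 2| * tanh `|beta| * S 2.
    by rewrite mulr_gt0 ?wsech_gt0 // mulr_gt0 ?tanh_gt0 ?normr_gt0 // mulf_neq0 ?sqrf_eq0 // oppr_eq0.
  apply: n2_gt0 m0 s1 _ => x /andP[x1 x2].
  rewrite breather_t_d20 // (normrM _ (S x)) (ger0_norm (S0 x)) (normrM (- 4 * beta ^+ 2) (tanh _)).
  have h1 : tanh `|beta| <= `|tanh (beta * x)|.
    rewrite tanh_norm; apply: tanh_homo; rewrite normrM (@ger0_norm _ x); last lra.
    by rewrite ler_peMr.
  apply: ler_pM => //; first by rewrite mulr_ge0 ?tanh_ge0.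
    by rewrite ler_wpM2l.
  by apply: wsech_homo; rewrite !ger0_norm //; lra.
have Z h : (forall x, h x = 0) -> \int[mu]_x h x = 0.
  by move=> h0; have -> : h = (fun=> 0) by [apply/funext]; rewrite Rintegral_cst // mul0r.
have Z1 : \int[mu]_x (B2 0 0 x * B1 0 0 x) = 0 by apply: Z => x; rewrite breather_d20 mul0r.
have Z2 : \int[mu]_x (B1 0 0 x * B2 0 0 x) = 0 by apply: Z => x; rewrite breather_d20 mulr0.
have Z3 : \int[mu]_x (B2 0 0 x * B2 0 0 x) = 0 by apply: Z => x; rewrite breather_d20 mul0r.
have Z4 : \int[mu]_x (Bt1 0 0 x * Bt1 0 0 x) = 0 by apply: Z => x; rewrite breather_t_d10 mul0r.
have Z5 : \int[mu]_x (Bt2 0 0 x * Bt1 0 0 x) = 0 by apply: Z => x; rewrite breather_t_d10 mulr0.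
have Z6 : \int[mu]_x (Bt1 0 0 x * Bt2 0 0 x) = 0 by apply: Z => x; rewrite breather_t_d10 mul0r.
pose M := M1 + M2 + M3 + M4; have M0 : 0 <= M by rewrite !addr_ge0.
have M13 : M1 + M3 <= M by exact: sum13_le.
have M24 : M2 + M4 <= M by exact: sum24_le.
have [e0 [C [rho [e00 C0 r0 [r1 H]]]]] := two_moments G10 G20 M0.
exists e0, C, rho; split => //; split => // phi0 phi1 e ee0 ee1 sz sw nz nw.
have [_ a1 f1] := H1 _ sz; have [_ a2 f2] := H2 _ sz.
have [_ a3 f3] := H3 _ sw; have [_ a4 f4] := H4 _ sw.
have [|||s [t [c1 c2 [c3 c4] [c5 c6] uniq]]] := H
  (fun s t => moment (rem0 beta phi0 0 0) B B1 s t + moment (rem1 beta phi1 0 0) Bt Bt1 s t)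
  (fun s t => moment (rem0 beta phi0 0 0) B B2 s t + moment (rem1 beta phi1 0 0) Bt Bt2 s t)
  e ee0 ee1.
- apply: (le_trans (ler_normD _ _)); apply: (le_trans (lerD a1 a3)).
  apply: (le_trans (lerD (ler_wpM2l M10 nz) (ler_wpM2l M30 nw))).
  by rewrite -mulrDl ler_wpM2r // M13.
- apply: (le_trans (ler_normD _ _)); apply: (le_trans (lerD a2 a4)).
  apply: (le_trans (lerD (ler_wpM2l M20 nz) (ler_wpM2l M40 nw))).
  by rewrite -mulrDl ler_wpM2r // M24.
- move=> s t s' t' b b'.
  have g1 := f1 s t s' t' b b'; have g2 := f2 s t s' t' b b'.
  have g3 := f3 s t s' t' b b'; have g4 := f4 s t s' t' b b'.
  rewrite Z1 mulr0 addr0 in g1; rewrite Z2 Z3 !mulr0 !addr0 in g2.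
  rewrite Z4 Z5 !mulr0 !addr0 in g3; rewrite Z6 mulr0 add0r in g4.
  set Q := `|s| + `|t| + (`|s'| + `|t'|) in g1 g2 g3 g4 *.
  set d := `|s - s'| + `|t - t'| in g1 g2 g3 g4 *.
  have Q0 : 0 <= Q by rewrite /Q !addr_ge0.
  have d0 : 0 <= d by rewrite /d addr_ge0.
  have W k n (k0 : 0 <= k) (ne : n <= e) : k * (n + Q) * d <= k * (e + Q) * d.
    by rewrite ler_wpM2r // ler_wpM2l // lerD2r.
  have W0 k (k0 : 0 <= k) : 0 <= k * (e + Q) * d by rewrite !mulr_ge0 // addr_ge0.
  have P (x y v : R) k l n n' : 0 <= k -> 0 <= l -> k + l <= M -> n <= e -> n' <= e ->
      `|x + v| <= k * (n + Q) * d -> `|y| <= l * (n' + Q) * d ->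
      `|x + y + v| <= M * (e + Q) * d.
    move=> k0 l0 kl ne ne' hx hy; rewrite addrAC; apply: (le_trans (ler_normD _ _)).
    apply: (le_trans (lerD (le_trans hx (W _ _ k0 ne)) (le_trans hy (W _ _ l0 ne')))).
    by rewrite -!mulrDl ler_wpM2r // ler_wpM2r // addr_ge0.
  have P' (x y v : R) k l n n' : 0 <= k -> 0 <= l -> k + l <= M -> n <= e -> n' <= e ->
      `|x| <= k * (n + Q) * d -> `|y + v| <= l * (n' + Q) * d ->
      `|x + y + v| <= M * (e + Q) * d.
    move=> k0 l0 kl ne ne' hx hy; rewrite -addrA; apply: (le_trans (ler_normD _ _)).
    apply: (le_trans (lerD (le_trans hx (W _ _ k0 ne)) (le_trans hy (W _ _ l0 ne')))).
    by rewrite -!mulrDl ler_wpM2r // ler_wpM2r // addr_ge0.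
  split.
  + by rewrite opprD addrACA; exact: (P _ _ _ _ _ _ _ M10 M30 M13 nz nw g1 g3).
  + by rewrite opprD addrACA; exact: (P' _ _ _ _ _ _ _ M20 M40 M24 nz nw g2 g4).
exists s, t; split => //; first exact/modulation_shiftE.
by move=> y1 y2 /modulation_shiftE-/(_ r1 sz sw)[y11 y12 y13 y14]; exact: uniq.
Qed.

End Modulation.

(** * The superposition formula *)

Section Permutability.
Context {R : realType}.
Local Notation nc := (@Normc.normc R).
Implicit Types (q x y c : R) (a : R[i]).

Lemma csinE x y : csin (x +i* y) = (sin x * cosh y) +i* (cos x * sinh y).
Proof.
rewrite /csin; have E : (2%:R * (0 +i* 1) : R[i]) != 0 by rewrite mulf_neq0 ?two_neq0 ?I_neq0.
apply: (mulIf E); rewrite divfK //.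
have -> : (0 +i* 1) * (x +i* y) = (- y) +i* x :> R[i] by apply: complex_ext => /=; ring.
by rewrite /cexp /cosh /sinh /=; apply: complex_ext => /=; rewrite ?opprK ?cosN ?sinN; field.
Qed.

(** With [c = Re a / Im a] and [q] the imaginary part of the intermediate field,
    this is what the transformations of parameters [a] and [conj a] together
    subtract from a real solution: the classical superposition formula for two
    conjugate parameters. *)
Definition superposition c q : R := 4 * atan (c * tanh (q / 2)).
Definition superposition' c q : R :=
  2 * c * sech (q / 2) ^+ 2 / (1 + (c * tanh (q / 2)) ^+ 2).

Let half_d q : is_derive q 1 (fun s => s / 2) 2^-1.
Proof. by apply: d_eq (d_M (d_id q) (d_cst 2^-1 q)) _; ring. Qed.

Let den_gt0 c q : 0 < 1 + (c * tanh (q / 2)) ^+ 2.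
Proof. by rewrite ltr_pwDl ?ltr01 ?sqr_ge0. Qed.

Lemma d_superposition c q : is_derive q 1 (superposition c) (superposition' c q).
Proof.
have D := d_Z c (d_comp (half_d q) (d_tanh _)).
apply: d_eq (d_Z 4 (d_comp D (is_derive1_atan _))) _.
by rewrite /superposition'; field; rewrite gt_eqF.
Qed.

Let den_inv c q : 0 <= (1 + (c * tanh (q / 2)) ^+ 2)^-1 <= 1.
Proof.
have := den_gt0 c q; move=> d0; rewrite invr_ge0 (ltW d0) /=.
by rewrite invf_le1 // lerDl sqr_ge0.
Qed.

Let sech_sqr q : 0 <= sech (q / 2) ^+ 2 <= 1.
Proof. by rewrite sqr_ge0 expr_le1 ?sech_le1 // ltW // sech_gt0. Qed.

Lemma superposition'_bound c q : `|superposition' c q| <= 2 * `|c|.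
Proof.
have /andP[s0 s1] := sech_sqr q; have /andP[d0 d1] := den_inv c q.
rewrite /superposition' normrM (ger0_norm d0) normrM (ger0_norm s0) normrM (@ger0_norm _ 2) //.
by rewrite -mulrA ler_piMr ?mulr_ge0 // mulr_ile1.
Qed.

Lemma superposition'_lipschitz c q q' :
  `|superposition' c q - superposition' c q'| <= 2 * `|c| * (1 + c ^+ 2) * `|q - q'|.
Proof.
pose T (z : R) := tanh (z / 2); pose s (z : R) := sech (z / 2).
pose D (z : R) := 1 + (c * T z) ^+ 2.
have dT (z : R) : is_derive z 1 T (s z ^+ 2 / 2) by apply: d_eq (d_comp (half_d z) (d_tanh _)) _.
have ds (z : R) : is_derive z 1 s (- (T z * s z) / 2).
  by apply: d_eq (d_comp (half_d z) (d_sech _)) _.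
have D0 (z : R) : D z != 0 by rewrite gt_eqF // den_gt0.
have dD (z : R) : is_derive z 1 D (c ^+ 2 * (T z * s z ^+ 2)).
  have d : is_derive z 1 D _ := d_D (d_cst 1 z) (d_M (d_Z c (dT z)) (d_Z c (dT z))).
  by apply: d_eq d _; field.
have dF (z : R) : is_derive z 1 (superposition' c)
    (2 * c * (- (T z * (s z ^+ 2 * (D z)^-1)) - c ^+ 2 * (T z * ((s z ^+ 2 * (D z)^-1) ^+ 2)))).
  have DV := @d_V _ D z _ (D0 z) (dD z).
  have d : is_derive z 1 (superposition' c) _ :=
    d_M (d_M (d_cst (2 * c) z) (d_M (ds z) (ds z))) DV.
  by apply: d_eq d _; have := D0 z; rewrite -/(D z); move: (D z) (T z) (s z) => d1 t1 s1 d10; field.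
have [z _ ->] := @MVT_between R _ _ q' q (fun z _ => dF z).
rewrite normrM ler_wpM2r // normrM normrM (@ger0_norm _ 2) // ler_wpM2l ?mulr_ge0 //.
have /andP[s0 s1] := sech_sqr z; have /andP[d0 d1] := den_inv c z.
have k0 : 0 <= s z ^+ 2 * (D z)^-1 by exact: mulr_ge0.
have k1 : s z ^+ 2 * (D z)^-1 <= 1 by exact: mulr_ile1.
have t1 : `|T z| <= 1 by exact: tanh_le1.
apply: (le_trans (ler_normB _ _)); rewrite normrN; apply: lerD.
  by rewrite normrM (ger0_norm k0) mulr_ile1.
rewrite normrM (ger0_norm (sqr_ge0 c)) ler_piMr ?sqr_ge0 //.
by rewrite normrM (ger0_norm (sqr_ge0 _)) mulr_ile1 ?sqr_ge0 ?expr_le1.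
Qed.

Lemma superposition0 c : superposition c 0 = 0.
Proof. by rewrite /superposition mul0r tanh0 mulr0 atan0 mulr0. Qed.

Lemma superposition_bound c q : `|superposition c q| <= 2 * `|c| * `|q|.
Proof.
have [z _ E] := @MVT_between R _ _ 0 q (fun z _ => d_superposition c z).
rewrite superposition0 !subr0 in E; rewrite E normrM ler_wpM2r //.
exact: superposition'_bound.
Qed.

(** With [t] the tangent of a quarter of the superposition, the first expression
    is a multiple of [p sh - k ch t], which vanishes by the choice of [t]. *)
Let superposition_alg (p k sX cX ch sh sg cg t : R) : k != 0 -> ch != 0 ->
  ch ^+ 2 - sh ^+ 2 = 1 -> t = p / k * (sh / ch) ->
  cg = (1 - t ^+ 2) / (1 + t ^+ 2) -> sg = 2 * t / (1 + t ^+ 2) ->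
  let s' := sX * cg - cX * sg in let c' := cX * cg + sX * sg in
  p * (cX * sh) - k * (sX * ch) + (p * (c' * sh) + k * (s' * ch)) = 0 /\
  p * (sX * ch) + k * (cX * sh) + (p * (s' * ch) - k * (c' * sh)) =
   - (2 * (p / k) * (ch^-1) ^+ 2 / (1 + t ^+ 2)) * (p * (cX * sh) - k * (sX * ch)).
Proof.
move=> k0 ch0 csh tE -> -> s' c'.
have t1 : 1 + t ^+ 2 != 0 by rewrite gt_eqF // ltr_pwDl ?sqr_ge0.
have pE : p * sh = k * ch * t by rewrite tE; field; rewrite k0 ch0.
split; rewrite /s' /c'.
- have -> : p * (cX * sh) - k * (sX * ch) + (p * ((cX * ((1 - t ^+ 2) / (1 + t ^+ 2)) + sX * (2 * t / (1 + t ^+ 2))) * sh) +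
    k * ((sX * ((1 - t ^+ 2) / (1 + t ^+ 2)) - cX * (2 * t / (1 + t ^+ 2))) * ch)) =
    2 / (1 + t ^+ 2) * (cX + sX * t) * (p * sh - k * ch * t) by field.
  by rewrite pE subrr mulr0.
- have -> : p * (sX * ch) + k * (cX * sh) + (p * ((sX * ((1 - t ^+ 2) / (1 + t ^+ 2)) - cX * (2 * t / (1 + t ^+ 2))) * ch) -
    k * ((cX * ((1 - t ^+ 2) / (1 + t ^+ 2)) + sX * (2 * t / (1 + t ^+ 2))) * sh)) =
    2 / (1 + t ^+ 2) * (sX - cX * t) * (p * ch - k * sh * t) by field.
  have -> : p * (cX * sh) - k * (sX * ch) = cX * (p * sh) - k * sX * ch by ring.
  have -> : p * ch - k * sh * t = p * (ch ^+ 2 - sh ^+ 2) / ch by rewrite tE; field; rewrite k0 ch0.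
  by rewrite pE csh; field; rewrite t1 k0 ch0.
Qed.

Let superposition_real (p k X q : R) : k != 0 ->
  let c := p / k in let g := superposition c q / 2 in
  (p -i* k) * csin (X +i* (q / 2)) + (p +i* k) * csin ((X - g) +i* (q / 2)) =
  (- superposition' c q * Im ((p -i* k) * csin (X +i* (q / 2))))%:C.
Proof.
move=> k0 c g; pose t := c * tanh (q / 2).
have gE : g = 2 * atan t by rewrite /g /superposition; field.
have cg : cos g = (1 - t ^+ 2) / (1 + t ^+ 2) by rewrite gE cos_2atan.
have sg : sin g = 2 * t / (1 + t ^+ 2) by rewrite gE sin_2atan.
have tE : t = p / k * (sinh (q / 2) / cosh (q / 2)) by [].
have [E1 E2] := superposition_alg (sin X) (cos X) k0 (cosh_neq0 (q / 2)) (cosh2Bsinh2 (q / 2)) tE cg sg.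
rewrite !csinE sinB cosB; apply: complex_ext => /=.
- rewrite /superposition' -/t; transitivity (p * (sin X * cosh (q / 2)) + k * (cos X * sinh (q / 2)) +
    (p * ((sin X * cos g - cos X * sin g) * cosh (q / 2)) -
     k * ((cos X * cos g + sin X * sin g) * sinh (q / 2)))); first by ring.
  by rewrite E2 /sech -/c mulNr; ring.
- by rewrite -[RHS]E1; ring.
Qed.

(** The combinations of the two Backlund transformations that enter the equation
    are real; their values sum to the derivative of [superposition] along the
    intermediate field. *)
Lemma superposition_plus a (phi : R) (psi : R[i]) : Im a != 0 ->
  let c := Re a / Im a in let y := phi - superposition c (Im psi) in
  a^-1 * csin ((phi%:C + psi) / 2%:R) + (a^*%C)^-1 * csin ((psi + y%:C) / 2%:R) =
  (- superposition' c (Im psi) * Im (a^-1 * csin ((phi%:C + psi) / 2%:R)))%:C.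
Proof.
case: a psi => p k [P q] k0 c y; cbn [Re Im] in k0, c, y |- *.
have -> : ((p +i* k)^* )%C = p -i* k by [].
have N0 : p ^+ 2 + k ^+ 2 != 0.
  by rewrite gt_eqF // ltr_wpDl ?sqr_ge0 // exprn_even_gt0.
pose N := (p ^+ 2 + k ^+ 2)^-1; pose X := (phi + P) / 2.
have aV : (p +i* k)^-1 = N%:C * (p -i* k).
  have a0 : (p +i* k) != 0 :> R[i] by apply: contraNneq k0 => /eqP; rewrite eq_complex /= => /andP[].
  by apply: (mulfI a0); rewrite divff //; apply: complex_ext => /=; rewrite /N; field.
have bV : (p -i* k)^-1 = N%:C * (p +i* k).
  have a0 : (p -i* k) != 0 :> R[i].
    by apply: contraNneq k0 => /eqP; rewrite eq_complex /= oppr_eq0 => /andP[].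
  by apply: (mulfI a0); rewrite divff //; apply: complex_ext => /=; rewrite /N; field.
have -> : (phi%:C + (P +i* q)) / 2%:R = X +i* (q / 2) :> R[i].
  by apply: (mulIf (@two_neq0 R)); rewrite divfK ?two_neq0 //; apply: complex_ext => /=; rewrite /X; field.
have -> : ((P +i* q) + y%:C) / 2%:R = (X - superposition c q / 2) +i* (q / 2) :> R[i].
  by apply: (mulIf (@two_neq0 R)); rewrite divfK ?two_neq0 //; apply: complex_ext => /=; rewrite /X /y; field.
have E := superposition_real p X q k0; cbv zeta in E; rewrite -/c in E.
rewrite aV bV -!(mulrA N%:C) -mulrDr E; move: (_ * csin _) => [W1 W2].
by apply: complex_ext => /=; ring.
Qed.

Lemma superposition_minus a (phi : R) (psi : R[i]) : Im a != 0 ->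
  let c := Re a / Im a in let y := phi - superposition c (Im psi) in
  a * csin ((phi%:C - psi) / 2%:R) - a^*%C * csin ((psi - y%:C) / 2%:R) =
  (superposition' c (Im psi) * Im (a * csin ((phi%:C - psi) / 2%:R)))%:C.
Proof.
case: a psi => p k [P q] k0 c y; cbn [Re Im] in k0, c, y |- *.
have -> : ((p +i* k)^* )%C = p -i* k by [].
pose X := (phi - P) / 2.
have -> : (phi%:C - (P +i* q)) / 2%:R = X +i* (- q / 2) :> R[i].
  by apply: (mulIf (@two_neq0 R)); rewrite divfK ?two_neq0 //; apply: complex_ext => /=; rewrite /X; field.
have -> : ((P +i* q) - y%:C) / 2%:R = - ((X - superposition c q / 2) +i* (- q / 2)) :> R[i].
  by apply: (mulIf (@two_neq0 R)); rewrite divfK ?two_neq0 //; apply: complex_ext => /=; rewrite /X /y; field.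
have k0' : - k != 0 by rewrite oppr_eq0.
have := superposition_real p X (- q) k0'; cbv zeta; rewrite opprK.
have -> : p / - k = - c by rewrite invrN mulrN.
have -> : superposition (- c) (- q) = superposition c q.
  by rewrite /superposition !mulNr tanhN mulrN opprK.
have -> : superposition' (- c) (- q) = - superposition' c q.
  by rewrite /superposition' !mulNr tanhN sechN !mulrN !opprK !mulNr.
by rewrite csinN mulrN opprK !opprK => ->.
Qed.

End Permutability.

(** * One Backlund step *)

Section Increment.
Context {R : realType} (beta : R) (beta_neq0 : beta != 0) (beta1 : `|beta| <= 1).
Local Notation nc := (@Normc.normc R).
Local Notation S := (wsech beta).
Local Notation th := (fun x : R => - tanh (beta * x)).
Local Notation n2S := (n2 [set: R] S).
Context (sg a : R[i]) (sg1 : nc sg = 1) (a1 : nc a = 1) (aE : (a + a^-1) / 2%:R = beta%:C).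
Implicit Types (p q : R -> R[i]) (d : R[i]) (x e : R).

Definition bk_incr p q d x : R[i] :=
  bk_rhs sg (a + d) (S x) (th x) (p x) (q x) - bk_rhs sg a (S x) (th x) 0 0.

Lemma bk_incr_bound p q d x : nc (p x) <= 4^-1 -> nc (q x) <= 4^-1 -> nc d <= 4^-1 ->
  nc (bk_incr p q d x) <= 300 * (nc (p x) + nc (q x) + nc d * S x).
Proof.
move=> p4 q4 d4; have S01 : 0 <= S x <= 1 by rewrite wsech_ge0 wsech_le1.
have /andP[S0 S1] := S01.
have th1 : `|- tanh (beta * x)| <= 1 by rewrite normrN tanh_le1.
have P0 := nc_ge0 (p x); have Q0 := nc_ge0 (q x); have D0 := nc_ge0 d.
have n04 : nc (0 : R[i]) <= 4^-1 by rewrite nc0; lra.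
have := bk_rem_lipschitz sg1 a1 S01 th1 p4 q4 n04 d4 n04.
rewrite !subr0 nc0 !addr0 => H.
have px1 : nc (p x) <= 1 by lra.
have H0 := bk_rem00 sg1 a1 S01 th1 px1.
rewrite /bk_incr (bk_rhs_split _ aE).
set r0 := bk_rem _ _ _ _ _ 0 0 in H H0; set r1 := bk_rem _ _ _ _ _ _ _ in H *.
have K := ncD (r1 - r0) r0; rewrite subrK in K.
have kap2 : nc (bk_slope sg a) <= 2.
  rewrite /bk_slope; apply: (le_trans (ncD _ _)); rewrite sg1 expr2 ncM ncV a1 invr1; lra.
have T1 : nc (wtanh beta x)%:C <= 1.
  by rewrite nc_real /wtanh normrM mulr_ile1 ?tanh_le1.
have t1 : nc ((wtanh beta x)%:C * q x) <= 1 * nc (q x) by rewrite ncM ler_wpM2r.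
have t2 : nc (bk_slope sg a * d * (S x)%:C) <= 2 * nc d * S x.
  by rewrite ncM nc_real (ger0_norm S0) ncM ler_wpM2r // ler_wpM2r.
have := ncD ((wtanh beta x)%:C * q x) (bk_slope sg a * d * (S x)%:C + r1).
have := ncD (bk_slope sg a * d * (S x)%:C) r1.
have h1 : (nc (p x) + nc (q x) + nc d) * nc (q x) <= 1 * nc (q x) by rewrite ler_wpM2r //; lra.
have h2 : nc d * S x * nc d <= nc d * S x * 1 by rewrite ler_wpM2l ?mulr_ge0 //; lra.
have h3 : (nc (p x) + nc (q x)) * nc d <= (nc (p x) + nc (q x)) * 1 by rewrite ler_wpM2l ?addr_ge0 //; lra.
have := mulr_ge0 D0 S0.
by lra.
Qed.

Lemma bk_incr_csq p q d e : csq p -> csq q -> (forall x, nc (p x) <= 4^-1) ->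
  (forall x, nc (q x) <= 4^-1) -> nc d <= 4^-1 ->
  cn2 p <= e -> cn2 q <= e -> nc d <= e ->
  csq (bk_incr p q d) /\ cn2 (bk_incr p q d) <= 300 * (2 + n2S) * e.
Proof.
move=> sp sq_ p4 q4 d4 pe qe de.
have sS := sq_wsech beta_neq0; have nS : 0 <= n2S by exact: n2_ge0.
have [s1 m1] := sqD sp.2 sq_.2; have [s2 m2] := sqZ (nc d) sS.
have [s3 m3] := sqD s1 s2; have [s4 m4] := sqZ 300 s3.
apply: (csq_bound _ s4).
- by apply: cmeasurableB; [apply: cmeasurable_rhs; [exact: sp.1|exact: sq_.1]
    |apply: cmeasurable_rhs; exact: cmeasurable_cst].
- rewrite m4 (@ger0_norm _ 300); last by exact: ler0n.
  rewrite -mulrA ler_wpM2l ?ler0n //.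
  apply: (le_trans m3); rewrite m2 (ger0_norm (nc_ge0 _)) mulrDl.
  apply: lerD; last by rewrite mulrC ler_wpM2l.
  by apply: (le_trans m1); rewrite mulr_natl; exact: lerD.
- by move=> x; exact: bk_incr_bound.
Qed.

End Increment.

Section Representative.
Context {R : realType}.
Local Notation nc := (@Normc.normc R).
Local Notation mu := (@lebesgue_measure R).

Lemma inH1_representative (u : R -> R[i]) : inH1 u -> exists v,
  [/\ cprimitive v (wderiv u), aeq u v, csq v, csq (wderiv u) &
      cn2 v = L2norm u /\ cn2 (wderiv u) = L2norm (wderiv u) /\
      forall x, nc (v x) <= 2 * (L2norm u + L2norm (wderiv u))].
Proof.
move=> /inH1_csq[su sw e1 e2 W]; have [v vp uv] := has_wderiv_primitive W.
have [sv nv] := csq_ae (cprimitive_measurable vp) uv su.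
exists v; split => //; rewrite e1 e2 -nv; split=> //; split => // x.
exact: csup_le_cn2.
Qed.

Lemma wderivD_profile (K K' u : R -> R[i]) : cprimitive K K' -> inH1 u ->
  aeq (wderiv (K \+ u)) (fun x => K' x + wderiv u x).
Proof.
move=> KK /inH1_csq[_ _ _ _ W]; apply: wderiv_aeq.
have := has_wderivD W KK; congr has_wderiv; apply/funext => x; exact: addrC.
Qed.

End Representative.

Section BacklundStep.
Context {R : realType} (beta : R) (beta_neq0 : beta != 0) (beta1 : `|beta| <= 1).
Local Notation nc := (@Normc.normc R).
Local Notation mu := (@lebesgue_measure R).
Local Notation S := (wsech beta).
Local Notation th := (fun x : R => - tanh (beta * x)).
Local Notation n2S := (n2 [set: R] S).
Context (sg a : R[i]) (sg1 : nc sg = 1) (a1 : nc a = 1)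
  (aE : (a + a^-1) / 2%:R = beta%:C) (slope_neq0 : bk_slope sg a != 0).
Implicit Types (Phi Phit Psi Psit Th Thx Tht K Kx Kt p r rt q u s : R -> R[i]) (b d : R[i]) (e : R).

(** The shape common to the two steps: the known field is an explicit one
    perturbed by [p], with derivatives perturbed by [r] and [rt], and the
    unknown field is [Th] (with derivatives [Thx] and [Tht]) up to a
    perturbation. Expanding the first component exchanges the roles of known
    and unknown field and the sign [sg]. *)
Definition backlund_base Phi Phit Th Thx Tht p r rt : Prop :=
  forall Psi Psit b,
  {ae mu, forall x, backlund2 Phi Phit Psi Psit b x = Thx x + r x - wderiv Psi x +
    (bk_rhs sg b (S x) (th x) (p x) (Psi x - Th x) - bk_rhs sg a (S x) (th x) 0 0)} /\
  {ae mu, forall x, backlund1 Phi Phit Psi Psit b x = rt x - (Psit x - Tht x) +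
    (bk_rhs (- sg) b (S x) (th x) (Psi x - Th x) (p x) - bk_rhs (- sg) a (S x) (th x) 0 0)}.

Lemma backlund_bk_sol Phi Phit Th Thx Tht K Kx Kt p r rt u s d :
  backlund_base Phi Phit Th Thx Tht p r rt -> cprimitive K Kx -> cprimitive Th Thx ->
  cmeasurable p -> cmeasurable r -> inH1 u ->
  backlund_zero Phi Phit (K \+ u) (Kt \+ s) (a + d) ->
  exists v, [/\ aeq u v, bk_sol beta sg a p r (fun x => v x + (K x - Th x)) d &
    forall x, nc (v x) <= 2 * (L2norm u + L2norm (wderiv u))].
Proof.
move=> base KK TT mp mr hu [_ z2].
have [v [vp uv sv sw [_ [_ vb]]]] := inH1_representative hu.
exists v; split => //.
have P := cprimitiveD vp (cprimitiveB KK TT).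
apply: (cprimitive_ae P).
  apply: (cmeasurableD mr); apply: cmeasurableB; apply: cmeasurable_rhs;
    by [exact: mp|exact: cprimitive_measurable P|exact: cmeasurable_cst].
have [b2 _] := base (K \+ u) (Kt \+ s) (a + d).
have W := wderivD_profile KK hu.
have A := ae_imply2 (fun x (h1 : _ = _) (h2 : _ = _) => etrans (esym h1) h2) b2 z2.
have B := ae_imply2 (fun x (h1 : wderiv (K \+ u) x = _) (h2 : u x = v x) => conj h1 h2) W uv.
apply: ae_imply2 A B => x h [h1 h2]; move: h; rewrite h1 /= h2.
have -> : K x + v x - Th x = v x + (K x - Th x) by ring.
move=> h; apply/eqP; rewrite -subr_eq0; apply/eqP.
rewrite -[RHS]oppr0 -[in RHS]h; ring.
Qed.

Lemma bk_sol_deriv p r q d e : csq p -> csq r -> csq q -> (forall x, nc (p x) <= 4^-1) ->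
  (forall x, nc (q x) <= 4^-1) -> nc d <= 4^-1 ->
  cn2 p <= e -> cn2 r <= e -> cn2 q <= e -> nc d <= e ->
  bk_sol beta sg a p r q d ->
  let h := fun x => r x + bk_incr beta sg a p q d x in
  [/\ cprimitive q h, csq h & cn2 h <= (1 + 300 * (2 + n2S)) * e].
Proof.
move=> sp sr sq_ p4 q4 d4 pe re qe de sol h.
have [si ni] := bk_incr_csq beta_neq0 beta1 sg1 a1 aE sp sq_ p4 q4 d4 pe qe de.
have [sh nh] := csqD sr si; split => //.
by apply: (le_trans nh); rewrite mulrDl mul1r; exact: lerD.
Qed.

Definition step_constant : R := 7 + 600 * (2 + n2S).

Let affine_gt0 (n : R) : 0 <= n -> 0 < 7 + 600 * (2 + n).
Proof. by move=> n0; lra. Qed.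

Lemma step_constant_gt0 : 0 < step_constant.
Proof. exact: affine_gt0 (n2_ge0 _ _). Qed.

Let CC := step_constant.
Let nS : 0 <= n2S. Proof. exact: n2_ge0. Qed.

Let total e : 0 <= e -> 2 * e + ((1 + 300 * (2 + n2S)) * e + e) +
   (2 * e + 300 * (2 + n2S) * e) + e = CC * e.
Proof. by move=> e0; rewrite /CC /step_constant; ring. Qed.

Let second_bound e : 0 <= e -> 0 <= n2S * e -> e + e + 300 * (2 + n2S) * e <=
  2 * e + ((1 + 300 * (2 + n2S)) * e + e) + (2 * e + 300 * (2 + n2S) * e) + e.
Proof. by move=> e0 h; lra. Qed.

Let eighth_le (x : R) : 0 < x -> x / 8 <= x.
Proof. by move=> x0; lra. Qed.

Let sup_arith (l m n k e rad eps eu : R) : 0 < eu -> l <= n -> m <= n -> 0 <= k -> n + k <= rad ->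
  rad <= eps -> eps <= eu / 8 -> e <= eps -> 2 * (l + m) + e <= eu.
Proof. by move=> *; lra. Qed.

Let param_arith (n k rad eps eu : R) : 0 < eu -> 0 <= n -> n + k <= rad ->
  rad <= eps -> eps <= eu / 8 -> k <= eu.
Proof. by move=> *; lra. Qed.

(** The unknown perturbation is measured from the shifted profile [K] in the
    statement, but from [Th] in the equation. A competitor in the small ball has
    a continuous representative that is small in the sup norm, so it coincides
    with the given solution of the equation; its time derivative is then
    determined by the first component. *)
Lemma backlund_step : exists2 eps, 0 < eps &
  forall Phi Phit Th Thx Tht K Kx Kt p r rt q d e, 0 <= e -> e <= eps ->
  backlund_base Phi Phit Th Thx Tht p r rt -> cprimitive K Kx -> cprimitive Th Thx ->
  [/\ csq p, cn2 p <= e & forall x, nc (p x) <= e] ->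
  [/\ csq r, cn2 r <= e, csq rt & cn2 rt <= e] ->
  [/\ csq (fun x => K x - Th x), cn2 (fun x => K x - Th x) <= e & forall x, nc (K x - Th x) <= e] ->
  csq (fun x => Kx x - Thx x) /\ cn2 (fun x => Kx x - Thx x) <= e ->
  csq (fun x => Kt x - Tht x) /\ cn2 (fun x => Kt x - Tht x) <= e ->
  [/\ bk_sol beta sg a p r q d, csq q, cn2 q <= e & forall x, nc (q x) <= e] -> nc d <= e ->
  let u := fun x => q x - (K x - Th x) in
  let s := fun x => rt x - (Kt x - Tht x) + bk_incr beta (- sg) a q p d x in
  (csq s /\ cn2 s <= CC * e) /\
  forall rad, rad <= eps -> CC * e < rad ->
  small_unique_solution (fun u' s' d' => backlund_zero Phi Phit (K \+ u') (Kt \+ s') (a + d'))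
    (CC * e) rad u s d.
Proof.
have [eu eu0 uniq] := bk_unique beta_neq0 sg1 a1 aE slope_neq0.
pose eps := Num.min 4^-1 (eu / 8).
have e80 : 0 < eps by rewrite lt_min; apply/andP; split; lra.
have eps4 : eps <= 4^-1 by rewrite ge_min lexx.
have epsu : eps <= eu / 8 by rewrite ge_min lexx orbT.
exists eps => // Phi Phit Th Thx Tht K Kx Kt p r rt q d e e0 ee base KK TT [sp pe p_e]
  [sr re sr1 rte] [sD De D_e] [sD' D'e] [sDt Dte] [sol sq_ qe q_e] de u s.
have e4 : e <= 4^-1 by exact: le_trans eps4.
have p4 x : nc (p x) <= 4^-1 by exact: le_trans (p_e x) e4.
have q4 x : nc (q x) <= 4^-1 by exact: le_trans (q_e x) e4.
have d4 := le_trans de e4.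
have [qh sh nh] := bk_sol_deriv sp sr sq_ p4 q4 d4 pe re qe de sol.
have sgN1 : nc (- sg) = 1 by rewrite ncN.
have [si ni] := bk_incr_csq beta_neq0 beta1 sgN1 a1 aE sq_ sp q4 p4 d4 qe pe de.
have DD := cprimitiveB KK TT.
have [su nu] := csqB sq_ sD; have [sw nw] := csqB sh sD'.
have [ss1 ns1] := csqB sr1 sDt; have [ss ns] := csqD ss1 si.
have up := cprimitiveB qh DD; have [hu Lw] := cprimitive_inH1 up su sw.
have nsC : cn2 s <= CC * e.
  apply: (le_trans ns); apply: (le_trans (lerD (le_trans ns1 (lerD rte Dte)) ni)).
  rewrite -total //; exact: (second_bound e0 (mulr_ge0 nS e0)).
split=> // rad rade Crad.
have hs : inL2 s by exact/inL2_csq.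
have N : H1L2Cnorm u s d <= CC * e.
  rewrite /H1L2Cnorm -total //; apply: lerD de; apply: (le_trans (H1L2norm_le _ _)).
  rewrite Lw !L2normE //; apply: lerD; first apply: lerD.
  - by apply: (le_trans nu); rewrite mulr_natl; exact: lerD.
  - by apply: (le_trans nw); exact: lerD.
  - by apply: (le_trans ns); apply: lerD ni; apply: (le_trans ns1); rewrite mulr_natl; exact: lerD.
have Ku x : (K \+ u) x - Th x = q x by rewrite /= /u; ring.
have KuW : aeq (wderiv (K \+ u)) (fun x => Thx x + (r x + bk_incr beta sg a p q d x)).
  apply: wderiv_aeq; apply: cprimitive_has_wderiv.
  have := cprimitiveD TT qh; congr cprimitive; apply/funext => x.
  by rewrite /= /u; ring.
split=> //; first exact: le_lt_trans Crad.
- have [b2 b1] := base (K \+ u) (Kt \+ s) (a + d); split.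
    apply: ae_imply b1 => x ->; rewrite Ku /= /s /bk_incr; ring.
  apply: ae_imply2 b2 KuW => x -> ->; rewrite Ku /bk_incr; ring.
move=> u' s' d' [hu' hs'] n' eq'.
have [v [uv sol' vb]] := backlund_bk_sol base KK TT sp.1 sr.1 hu' eq'.
have [g1 g2 g3] := H1L2norm_ge u' s'.
have ge := nc_ge0 d'; have L1 := L2norm_ge0 u'; have L2 := L2norm_ge0 s'.
rewrite /H1L2Cnorm in n'.
have hv x : nc (v x + (K x - Th x)) <= eu.
  apply: (le_trans (ncD_le (vb x) (D_e x))).
  exact: (sup_arith eu0 g1 g2 ge (ltW n') rade epsu ee).
have eeu : e <= eu by apply: (le_trans ee); apply: (le_trans epsu); exact: eighth_le.
have deu : nc d' <= eu by exact: (param_arith eu0 (le_trans L1 g1) (ltW n') rade epsu).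
have [dE qE] := uniq p r q d (fun x => v x + (K x - Th x)) d' sp.1
  (fun x => le_trans (p_e x) eeu) (fun x => le_trans (q_e x) eeu) hv
  (le_trans de eeu) deu sol sol'.
have uu : aeq u' u.
  by apply: ae_imply uv => x ->; rewrite /u qE; ring.
split => //.
have [_ b1] := base (K \+ u') (Kt \+ s') (a + d').
have A := ae_imply2 (fun x (h1 : _ = _) (h2 : _ = _) => etrans (esym h1) h2) b1 eq'.1.
apply: ae_imply2 A uu => x h h2; move: h; rewrite /= h2 -dE.
have -> : K x + u x - Th x = q x by exact: Ku.
rewrite -/(bk_incr beta (- sg) a q p d x) /s => h.
apply/eqP; rewrite -subr_eq0; apply/eqP; rewrite -[RHS]oppr0 -[in RHS]h; ring.
Qed.

End BacklundStep.

(** * The two steps *)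

Section TwoSteps.
Context {R : realType} (beta : R).
Context (beta_bounds : -1 < beta < 1) (beta_neq0 : beta != 0).
Local Notation al := (alpha beta).
Local Notation nc := (@Normc.normc R).
Local Notation mu := (@lebesgue_measure R).
Local Notation S := (wsech beta).
Local Notation th x := (- tanh (beta * x)).
Local Notation n2S := (n2 [set: R] S).
Local Notation K0 := (kink beta 0 0).
Local Notation K0x := (kink_x beta 0 0).
Local Notation K0t := (kink_t beta 0 0).
Local Notation a0 := (beta +i* al).
Local Notation b0 := (beta -i* al).
Implicit Types (x : R) (a b p q d : R[i]).

Let al0 : 0 < al := alpha_gt0 beta_bounds.
Let beta1 : `|beta| <= 1 := beta_le1 beta_bounds.

Lemma nc_a0 : nc a0 = 1 /\ nc b0 = 1.
Proof.
have H : beta ^+ 2 + al ^+ 2 = 1 by rewrite alpha_sqr // addrC subrK.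
by split; rewrite /nc ?sqrrN H sqrtr1.
Qed.

Lemma a0V : a0^-1 = b0 /\ b0^-1 = a0.
Proof.
have H : a0 * b0 = 1 :> R[i].
  by apply: complex_ext => /=; [rewrite mulrN opprK -!expr2 alpha_sqr //; ring|ring].
have n0 : a0 != 0 :> R[i] by apply/eqP => E; move: H; rewrite E mul0r => /eqP; rewrite eq_sym oner_eq0.
have V : a0^-1 = b0 by apply: (mulfI n0); rewrite divff.
by rewrite -V invrK.
Qed.

Lemma a0E : (a0 + a0^-1) / 2%:R = beta%:C /\ (b0 + b0^-1) / 2%:R = beta%:C.
Proof.
have [-> ->] := a0V; have H : a0 + b0 = 2%:R * beta%:C :> R[i].
  by apply: complex_ext => /=; ring.
by rewrite (addrC b0) H mulrC mulKf ?two_neq0.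
Qed.

Lemma slope_neq0 : bk_slope (-1) a0 != 0 /\ bk_slope 1 b0 != 0.
Proof.
have ab : 2 * (al * beta) != 0 by rewrite mulf_neq0 // mulf_neq0 // gt_eqF.
rewrite /bk_slope; have [-> ->] := a0V; split; apply/eqP => /(congr1 (@Im R)) /= E; move: ab.
  by move/negP; apply; apply/eqP; lra.
by move/negP; apply; apply/eqP; lra.
Qed.

Lemma ccosN a : ccos (- a) = ccos a.
Proof. by rewrite /ccos mulrN opprK addrC. Qed.

Lemma csin_half_shift (k : R) a :
  csin (((2 * k)%:C + a) / 2%:R) = (sin k)%:C * ccos (a / 2%:R) + (cos k)%:C * csin (a / 2%:R).
Proof.
rewrite -csin_real -ccos_real -csinD; congr csin.
have -> : (2 * k)%:C = k%:C * 2%:R by apply: complex_ext => /=; ring.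
by rewrite mulrDl mulfK ?two_neq0.
Qed.

Lemma bk_rhs_kink x a p q :
  [/\ bk_rhs (-1) a (S x) (th x) p q =
        - a^-1 * csin ((p + (K0 x + q)) / 2%:R) + a * csin ((p - (K0 x + q)) / 2%:R),
      bk_rhs 1 a (S x) (th x) q p =
        - a^-1 * csin ((p + (K0 x + q)) / 2%:R) - a * csin ((p - (K0 x + q)) / 2%:R),
      bk_rhs 1 a (S x) (th x) p q =
        - a^-1 * csin (((K0 x + p) + q) / 2%:R) + a * csin (((K0 x + p) - q) / 2%:R) &
      bk_rhs (-1) a (S x) (th x) q p =
        - a^-1 * csin (((K0 x + p) + q) / 2%:R) - a * csin (((K0 x + p) - q) / 2%:R)].
Proof.
have [k [-> sE cE]] := kink0 beta x.
have Ep : csin (((2 * k)%:C + (p + q)) / 2%:R) = (S x)%:C * ccos ((p + q) / 2%:R) + (th x)%:C * csin ((p + q) / 2%:R).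
  by rewrite csin_half_shift sE cE.
have Em : csin (((2 * k)%:C + (p - q)) / 2%:R) = (S x)%:C * ccos ((p - q) / 2%:R) + (th x)%:C * csin ((p - q) / 2%:R).
  by rewrite csin_half_shift sE cE.
have Em' : csin (((2 * k)%:C + (q - p)) / 2%:R) = (S x)%:C * ccos ((p - q) / 2%:R) - (th x)%:C * csin ((p - q) / 2%:R).
  by rewrite csin_half_shift sE cE -(opprB p q) mulNr ccosN csinN mulrN.
have -> : p + ((2 * k)%:C + q) = (2 * k)%:C + (p + q) by ring.
have -> : p - ((2 * k)%:C + q) = - ((2 * k)%:C + (q - p)) by ring.
have -> : (2 * k)%:C + p + q = (2 * k)%:C + (p + q) by ring.
have -> : (2 * k)%:C + p - q = (2 * k)%:C + (p - q) by ring.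
have Ns (v : R[i]) : csin (- v / 2%:R) = - csin (v / 2%:R) by rewrite mulNr csinN.
have Nc (v : R[i]) : ccos (- v / 2%:R) = ccos (v / 2%:R) by rewrite mulNr ccosN.
rewrite Ns Ep Em Em' /bk_rhs (addrC q p) -(opprB p q) Nc Ns.
move: (csin _) (csin _) (ccos _) (ccos _) => s1 s2 c1 c2.
by split; ring.
Qed.

Lemma bk_rhs_base x : [/\ bk_rhs (-1) a0 (S x) (th x) 0 0 = - (2 * beta * S x)%:C,
  bk_rhs (-1) b0 (S x) (th x) 0 0 = - (2 * beta * S x)%:C,
  bk_rhs 1 a0 (S x) (th x) 0 0 = (0 +i* (2 * al * S x)) &
  bk_rhs 1 b0 (S x) (th x) 0 0 = - (0 +i* (2 * al * S x))].
Proof.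
rewrite /bk_rhs; have [-> ->] := a0V.
rewrite addr0 subr0 mul0r csin0 ccos0 !mulr1 !mulr0 !addr0 mul1r mulN1r.
by split; apply: complex_ext => /=; ring.
Qed.

Lemma base_first (phi0 phi1 z w : R -> R) :
  aeq (toC phi0) (toC z) -> (forall x, phi1 x = 4 * beta * S x + w x) ->
  backlund_base beta (-1) a0 (toC phi0) (toC phi1) K0 K0x K0t (toC z) (toC w) (wderiv (toC phi0)).
Proof.
move=> pz pw Psi Psit b; rewrite opprK.
have E x : K0 x + (Psi x - K0 x) = Psi x by ring.
split; apply: ae_imply pz => x h.
- rewrite /backlund2 h; have [-> _ _ _] := bk_rhs_kink x b (toC z x) (Psi x - K0 x).
  rewrite E; have [-> _ _ _] := bk_rhs_base x; rewrite kink_x0 /toC pw.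
  have -> : (4 * beta * S x + w x)%:C = (2 * beta * S x)%:C + (2 * beta * S x)%:C + (w x)%:C.
    by apply: complex_ext => /=; ring.
  by move: (csin _) (csin _) => c1 c2; ring.
- rewrite /backlund1 h; have [_ -> _ _] := bk_rhs_kink x b (toC z x) (Psi x - K0 x).
  rewrite E; have [_ _ -> _] := bk_rhs_base x; rewrite kink_t0 //.
  by move: (csin _) (csin _) => c1 c2; ring.
Qed.

Lemma base_second (Phi Phit p r : R -> R[i]) :
  (forall x, Phi x = K0 x + p x) -> (forall x, Phit x = K0t x + r x) ->
  backlund_base beta 1 b0 Phi Phit (fun=> 0) (fun=> 0) (fun=> 0) p r
    (fun x => wderiv Phi x - K0x x).
Proof.
move=> Pp Pr Psi Psit b; split; apply: ae_all => x.
- rewrite /backlund2 Pp Pr; have [_ _ -> _] := bk_rhs_kink x b (p x) (Psi x - 0).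
  rewrite !subr0; have [_ _ _ ->] := bk_rhs_base x; rewrite kink_t0 //.
  by move: (csin _) (csin _) => c1 c2; ring.
- rewrite /backlund1 Pp; have [_ _ _ ->] := bk_rhs_kink x b (p x) (Psi x - 0).
  rewrite !subr0; have [_ -> _ _] := bk_rhs_base x; rewrite kink_x0.
  by move: (csin _) (csin _) => c1 c2; ring.
Qed.

(** The chain rule reduces the equation to the pointwise identities
    [superposition_plus] and [superposition_minus]; the same identities make the
    imaginary part of the time derivative cancel. *)
Lemma superposition_bk_sol (z g : R -> R) (w : R -> R) (U : R -> R[i]) (W : R -> R[i]) d :
  primitive z g -> aeq W (toC g) -> Im (a0 + d) != 0 ->
  bk_sol beta (-1) a0 (toC z) (toC w) U d ->
  let c := Re (a0 + d) / Im (a0 + d) in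
  let y := fun x => z x - superposition c (Im (U x)) in
  let h := fun x => toC w x + bk_incr beta (-1) a0 (toC z) U d x in
  cmeasurable W ->
  bk_sol beta 1 b0 U (fun x => W x + bk_incr beta 1 a0 U (toC z) d x) (toC y) (d^*)%C /\
  {ae mu, forall x, Im (h x + bk_incr beta (-1) b0 (toC y) U (d^*)%C x) = 0}.
Proof.
move=> zg Wg; set a := a0 + d => a_im sol c y h mW.
have conj_a : b0 + (d^*)%C = (a^*)%C.
  by rewrite /a; case: (d) => d1 d2; apply: complex_ext => /=; ring.
have hE x : Im (h x) = - Im (a^-1 * csin (((z x)%:C + (K0 x + U x)) / 2%:R)) +
    Im (a * csin (((z x)%:C - (K0 x + U x)) / 2%:R)).
  rewrite /h /bk_incr; have [-> _ _ _] := bk_rhs_kink x a (toC z x) (U x).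
  have [-> _ _ _] := bk_rhs_base x; rewrite /toC !ImD !ImN mulNr ImN /=; ring.
have ImK x : Im (K0 x + U x) = Im (U x).
  by have [k [-> _ _]] := kink0 beta x; rewrite ImD /= add0r.
have SP x := superposition_plus (z x) (K0 x + U x) a_im.
have SM x := superposition_minus (z x) (K0 x + U x) a_im.
split.
- have hy : primitive y (fun x => g x - superposition' c (Im (U x)) * Im (h x)).
    apply: primitiveB zg _; apply: (primitive_comp (C := 2 * `|c| * (1 + c ^+ 2))).
    + by move=> q; exact: d_superposition.
    + by move=> q q'; exact: superposition'_lipschitz.
    + exact: sol.2.
  have mU := cprimitive_measurable sol.
  have mz : cmeasurable (toC z) := cprimitive_measurable (cprimitive_real zg).
  have my : cmeasurable (toC y) := cprimitive_measurable (cprimitive_real hy).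
  have mc := @cmeasurable_cst R 0.
  apply: (cprimitive_ae (cprimitive_real hy)).
    apply: cmeasurableD; [apply: (cmeasurableD mW)|]; apply: cmeasurableB; exact: cmeasurable_rhs.
  apply: ae_imply Wg => x ->.
  have := SP x; have := SM x; cbv zeta; rewrite ImK -/c -/(y x) => sm sp.
  rewrite /bk_incr -/a; have [_ -> _ _] := bk_rhs_kink x a (toC z x) (U x).
  rewrite conj_a; have [_ _ -> _] := bk_rhs_kink x (a^*)%C (U x) (toC y x).
  have [_ _ -> ->] := bk_rhs_base x.
  rewrite {1}/toC hE /toC.
  set i1 := Im (a^-1 * _) in sp *; set i2 := Im (a * _) in sm *.
  have -> : (g x - superposition' c (Im (U x)) * (- i1 + i2))%:C =
    (g x)%:C - (- superposition' c (Im (U x)) * i1)%:C - (superposition' c (Im (U x)) * i2)%:C.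
    by apply: complex_ext => /=; ring.
  rewrite -sp -sm; move: (csin _) (csin _) (csin _) (csin _) => s1 s2 s3 s4; ring.
- apply: ae_all => x; rewrite ImD hE /bk_incr conj_a.
  have [_ _ _ ->] := bk_rhs_kink x (a^*)%C (U x) (toC y x); have [_ -> _ _] := bk_rhs_base x.
  have := SP x; have := SM x; cbv zeta; rewrite ImK -/c -/(y x) => /(congr1 (@Im R)) sm /(congr1 (@Im R)) sp.
  move: sp sm; rewrite /toC; move: (csin _) (csin _) (csin _) (csin _) => s1 s2 s3 s4.
  rewrite !mulNr !(ImD, ImN) /=; lra.
Qed.

End TwoSteps.

Section Assembly.
Context {R : realType} (beta : R).
Context (beta_bounds : -1 < beta < 1) (beta_neq0 : beta != 0).
Local Notation al := (alpha beta).
Local Notation nc := (@Normc.normc R).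
Local Notation mu := (@lebesgue_measure R).
Local Notation S := (wsech beta).
Local Notation n2S := (n2 [set: R] S).
Local Notation a0 := (beta +i* al).
Local Notation b0 := (beta -i* al).
Implicit Types (x e : R).

Let al0 : 0 < al := alpha_gt0 beta_bounds.
Let beta1 : `|beta| <= 1 := beta_le1 beta_bounds.
Let nS : 0 <= n2S. Proof. exact: n2_ge0. Qed.
Let S0 x : 0 <= S x := wsech_ge0 beta x.

Lemma wsech_csq (f : R -> R[i]) k : cmeasurable f -> 0 <= k -> (forall x, nc (f x) <= k * S x) ->
  csq f /\ cn2 f <= k * n2S.
Proof.
move=> mf k0 fk; have [s n] := sqZ k (sq_wsech beta_neq0).
by apply: (csq_bound mf s) fk; rewrite n ger0_norm.
Qed.

Lemma kink_t_measurable s t : in_box s t -> cmeasurable (kink_t beta s t).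
Proof.
move=> b; have [cr _] := lipw_csech_re beta_bounds; have [ci _] := lipw_csech_im beta_bounds.
have -> : kink_t beta s t = fun x => (- (2 * al) * csech_im beta s t x) +i* (2 * al * csech_re beta s t x).
  by apply/funext => x; rewrite kink_tE.
by split => /=; apply: continuous_measurable_fun; apply: (c_M (c_cst _)); [exact: ci|exact: cr].
Qed.

Lemma cprimitive0 : cprimitive (fun=> 0 : R[i]) (fun=> 0).
Proof.
have P : primitive (fun=> 0 : R) (fun=> 0).
  by split => [|a b ab]; [exact: loc_int_cst|rewrite iint_cst // mul0r subrr].
exact: cprimitive_real P.
Qed.

Lemma real_representative (phi : R -> R) : inH1 (toC phi) -> exists z g,
  [/\ primitive z g, aeq (toC phi) (toC z), aeq (wderiv (toC phi)) (toC g),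
      csq (toC z) /\ cn2 (toC z) = L2norm (toC phi) &
      forall x, nc (toC z x) <= 2 * (L2norm (toC phi) + L2norm (wderiv (toC phi)))].
Proof.
move=> hphi; have [su sw e1 e2 W] := inH1_csq hphi.
have [v [vp pv sv _ [n1 [_ vb]]]] := inH1_representative hphi.
exists (fun x => Re (v x)), (fun x => Re (wderiv (toC phi) x)).
have zg := vp.1; have P := cprimitive_real zg.
have pz : aeq (toC phi) (toC (fun x => Re (v x))) by apply: ae_imply pv => x; rewrite /toC => <-.
split => //.
- have W2 : has_wderiv (toC phi) (toC (fun x => Re (wderiv (toC phi) x))).
    by split; [exact: W.1|exact: primitive_has_wderivR P.2].
  exact: has_wderiv_unique W W2.
- have [s n] := csq_ae (cprimitive_measurable P) pz su; split => //.
  by rewrite n e1.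
- move=> x; apply: le_trans (vb x); rewrite /toC nc_real; exact: nc_Re.
Qed.

Let sizes (M C0 : R) : 0 < M -> 0 < C0 -> exists k1 k2,
  [/\ 4 <= k1, k1 <= k2, 2 * M <= k1 /\ 2 * M * n2S <= k1, 4 * C0 <= k1 &
      (2 + 300 * (2 + n2S) + 8 / al) * k1 <= k2].
Proof.
move=> M0 C00; pose k1 := 4 + 2 * M * (1 + n2S) + 4 * C0.
have MS := mulr_ge0 (ltW M0) nS.
have k4 : 4 <= k1 by rewrite /k1; lra.
exists k1, ((2 + 300 * (2 + n2S) + 8 / al) * k1); split => //.
- have d0 : 0 <= 8 / al by rewrite divr_ge0 ?ler0n // ltW.
  rewrite ler_peMl //; first exact: le_trans k4.
  by move: nS d0; move: (n2S) (8 / al) => n v n0 v0; lra.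
- by rewrite /k1; split; lra.
- by rewrite /k1; lra.
Qed.

Let threshold (e1 e2 e3 k1 k2 : R) : 0 < e1 -> 0 < e2 -> 0 < e3 -> 4 <= k1 -> k1 <= k2 ->
  exists2 m, 0 < m & [/\ m <= e1, m <= e2 &
    forall e, 0 <= e -> e <= m -> [/\ k1 * e <= e1, k2 * e <= e2, 4 * e <= e3, k1 * e <= al / 2 & k1 * e <= 4^-1]].
Proof.
move=> e10 e20 e30 k14 k12; have k20 : 0 < k2 by lra.
have al20 : 0 < al / 2 by rewrite divr_gt0.
pose n := Num.min e1 (Num.min e2 (Num.min e3 (Num.min (al / 2) 4^-1))).
have n0 : 0 < n by rewrite /n !lt_min e10 e20 e30 al20 invr_gt0 ltr0n.
have n1 : n <= e1 by rewrite /n ge_min lexx.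
have n2_ : n <= e2 by rewrite /n !ge_min lexx !orbT.
have n3 : n <= e3 by rewrite /n !ge_min lexx !orbT.
have n4 : n <= al / 2 by rewrite /n !ge_min lexx !orbT.
have n5 : n <= 4^-1 by rewrite /n !ge_min lexx !orbT.
have kn : n / k2 <= n by rewrite ler_pdivrMr // ler_peMr ?(ltW n0) //; lra.
exists (n / k2); first exact: divr_gt0.
split; [exact: le_trans n1|exact: le_trans n2_|].
move=> e ee; rewrite ler_pdivlMr // => en.
have k2e : k2 * e <= n by rewrite mulrC.
have k1e : k1 * e <= n by apply: le_trans k2e; rewrite ler_wpM2r.
have e4 : 4 * e <= n by apply: le_trans k1e; rewrite ler_wpM2r.
by split; [exact: le_trans n1|exact: le_trans n2_|exact: le_trans n3|exact: le_trans n4|exact: le_trans n5].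
Qed.

Let ratio_bound (d : R[i]) : nc d <= al / 2 -> Im (a0 + d) != 0 /\
  2 * `|Re (a0 + d) / Im (a0 + d)| <= 8 / al.
Proof.
move=> dal; have := le_trans (nc_Re d) dal; have := le_trans (nc_Im d) dal.
case: d {dal} => d1 d2 /= h2 h1.
have D : al / 2 <= al + d2 by move: (ler_norm (- d2)); rewrite normrN; lra.
have D0 : 0 < al + d2 by move: al0 D; lra.
have al1 := alpha_le1 beta_bounds.
split; first by rewrite gt_eqF.
have N : `|beta + d1| <= 2 by have := ler_normD beta d1; move: beta1 h1 al1; lra.
rewrite normrM normfV (gtr0_norm D0) mulrA ler_pdivrMr //.
have E : 8 / al * (al / 2) = 4 by field; rewrite gt_eqF.
have : 8 / al * (al / 2) <= 8 / al * (al + d2) by rewrite ler_wpM2l // divr_ge0 ?ler0n // ltW.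
by rewrite E; move: N; lra.
Qed.

Let low_incr (v n : R) : 0 <= v -> 1 + 300 * (2 + n) <= 2 + 300 * (2 + n) + v.
Proof. by move=> v0; lra. Qed.

Let low_ratio (v n : R) : 0 <= n -> 1 + v <= 2 + 300 * (2 + n) + v.
Proof. by move=> n0; lra. Qed.

(** Unlike in the first step, the solution of the second one is explicit, so
    only uniqueness is drawn from the analysis of the equation. *)
Lemma two_steps : exists eps C, [/\ 0 < eps, 0 < C &
  forall (phi0 phi1 : R -> R) x1 x2 e, 0 <= e -> e <= eps -> in_box x1 x2 ->
  `|x1| <= e -> `|x2| <= e -> inH1 (toC phi0) ->
  L2norm (toC phi0) <= e -> L2norm (wderiv (toC phi0)) <= e ->
  let w := fun x => phi1 x - 4 * beta * S x in csq (toC w) -> cn2 (toC w) <= e ->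
  let K := kink beta x1 x2 in let Kt := kink_t beta x1 x2 in
  exists u0 s0 delta y0 v0 deltat, forall rad, rad <= eps -> C * e < rad ->
  [/\ small_unique_solution (fun u s d =>
        backlund_zero (toC phi0) (toC phi1) (K \+ u) (Kt \+ s) (a0 + d))
        (C * e) rad u0 s0 delta,
      small_unique_solution (fun y v d =>
        backlund_zero (K \+ u0) (Kt \+ s0) y v (b0 + d))
        (C * e) rad y0 v0 deltat,
      {ae mu, forall x, Im (y0 x) = 0} &
      {ae mu, forall x, Im (v0 x) = 0}]].
Proof.
have [na nb] := nc_a0 beta_bounds; have [aE bE] := a0E beta_bounds.
have [sl1 sl2] := slope_neq0 beta_bounds beta_neq0.
have nm1 : nc (-1) = 1 by rewrite ncN nc1.
have [e1 e10 H1] := backlund_step beta_neq0 beta1 nm1 na aE sl1.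
have [e2 e20 H2] := backlund_step beta_neq0 beta1 (@nc1 R) nb bE sl2.
have [e3 [C0 [e30 C00 H3]]] := bk_exists beta_neq0 nm1 na aE sl1.
have [M M0 HM] := kink_shift_bound beta_bounds.
have [k1 [k2 [k14 k12 [kM kMS] kC k2k]]] := sizes M0 C00.
(* [k1 e] bounds the perturbations of the first step, [k2 e] those of the second. *)
have [eps eps0 [eps1 eps2 small]] := threshold e10 e20 e30 k14 k12.
have k10 : 0 < k1 by apply: lt_le_trans k14.
have k20 : 0 < k2 by apply: lt_le_trans k12.
have CC0 := step_constant_gt0 beta; set CC := step_constant beta in CC0 H1 H2.
exists eps, (CC * k2); split => //; first exact: mulr_gt0.
move=> phi0 phi1 x1 x2 e ee ee1 box x1e x2e hphi n1 n2_ w sw nw K Kt.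
have [k1e k2e e4 k1al k14e] := small e ee ee1.
have ke1 : 0 <= k1 * e by rewrite mulr_ge0 // ltW.
have ke2 : 0 <= k2 * e by rewrite mulr_ge0 // ltW.
have ek1 : 4 * e <= k1 * e by rewrite ler_wpM2r.
have e1k : e <= k1 * e by apply: le_trans ek1; rewrite ler_peMl // ler1n.
have e14 : e <= 4 * e by rewrite ler_peMl // ler1n.
have [z [g [zg pz Wg [sz nz] zsup]]] := real_representative hphi.
have zs x : nc (toC z x) <= 4 * e.
  apply: (le_trans (zsup x)); rewrite (_ : 4 * e = 2 * (e + e)); last by ring.
  by rewrite ler_pM2l ?ltr0n //; exact: lerD n1 n2_.
rewrite -nz in n1.
(* [z] is the continuous representative of [phi0]; its sup norm is at most [4 e]. *)
have [U [d [sol Usup de sU nU]]] := H3 (toC z) (toC w) (4 * e) (le_trans ee e14) e4 zs sz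
  (le_trans n1 e14) sw (le_trans nw e14).
have C0k : C0 * (4 * e) <= k1 * e by rewrite mulrA (mulrC C0) ler_wpM2r.
have KK := kink_cprimitive beta_bounds box.
have KK0 := kink_cprimitive beta_bounds (@in_box0 R).
have KB := cprimitiveB KK KK0.
have hM k x : k <= M * S x * (`|x1| + `|x2|) -> k <= 2 * M * e * S x.
  move=> h; apply: (le_trans h); have -> : 2 * M * e * S x = M * S x * (e + e) by ring.
  by rewrite ler_wpM2l ?mulr_ge0 ?(ltW M0) // lerD.
have Me0 : 0 <= 2 * M * e by rewrite !mulr_ge0 // ltW.
have hD x := let: And3 a b c := HM x1 x2 x box in conj (hM _ _ a) (conj (hM _ _ b) (hM _ _ c)).
have MSe : 2 * M * e * n2S <= k1 * e by rewrite mulrAC ler_wpM2r.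
have [sD nD] := wsech_csq (cprimitive_measurable KB) Me0 (fun x => (hD x).1).
have [sDx nDx] := wsech_csq (cprimitive_measurable_deriv KB) Me0 (fun x => (hD x).2.1).
have mKt := cmeasurableB (kink_t_measurable box) (kink_t_measurable (@in_box0 R)).
have [sDt nDt] := wsech_csq mKt Me0 (fun x => (hD x).2.2).
have Dsup x : nc (K x - kink beta 0 0 x) <= k1 * e.
  apply: (le_trans (hD x).1); apply: (@le_trans _ _ (2 * M * e)).
    by rewrite ler_piMr // wsech_le1.
  by rewrite ler_wpM2r.
have hw x : phi1 x = 4 * beta * S x + w x by rewrite /w; ring.
have base1 := base_first beta_bounds pz hw.
have [sphi sdphi L1 L2 Wphi] := inH1_csq hphi.
rewrite L2 in n2_.
have := H1 _ _ _ _ _ K _ Kt _ _ _ U d (k1 * e) ke1 k1e base1 KK KK0.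
have dk := le_trans de C0k; have nUk := le_trans nU C0k.
have Uk x := le_trans (Usup x) C0k.
have zk x := le_trans (zs x) ek1.
move=> /(_ (And3 sz (le_trans n1 e1k) zk)).
move=> /(_ (And4 sw (le_trans nw e1k) sdphi (le_trans n2_ e1k))).
move=> /(_ (And3 sD (le_trans nD MSe) Dsup) (conj sDx (le_trans nDx MSe)) (conj sDt (le_trans nDt MSe))).
move=> /(_ (And4 sol sU nUk Uk) dk) /=; rewrite opprK.
pose u0 x := U x - (K x - kink beta 0 0 x).
pose s0 x := wderiv (toC phi0) x - (Kt x - kink_t beta 0 0 x) + bk_incr beta 1 a0 U (toC z) d x.
rewrite -/u0 -/s0 => -[_ first_].
pose W := wderiv (toC phi0); pose r2 x := W x + bk_incr beta 1 a0 U (toC z) d x.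
have Phi2 x : (K \+ u0) x = kink beta 0 0 x + U x by rewrite /= /u0; ring.
have Phit2 x : (Kt \+ s0) x = kink_t beta 0 0 x + r2 x by rewrite /= /s0 /r2 /W; ring.
(* The known field of the second step is the kink at zero shifts perturbed by [U]. *)
have base2 := base_second beta_bounds Phi2 Phit2.
have [im_a ratio] := ratio_bound (le_trans dk k1al).
have [sol2 imv] := superposition_bk_sol beta_bounds zg Wg im_a sol sdphi.1.
set c := Re (a0 + d) / Im (a0 + d) in sol2 imv ratio.
(* The field that permutability predicts for the parameter [conj (a0 + d)]. *)
pose y x := z x - superposition c (Im (U x)).
have z4 x := le_trans (zk x) k14e; have U4 x := le_trans (Uk x) k14e.
have d4 := le_trans dk k14e; have nzk := le_trans n1 e1k.
have [Uh sh nh] := bk_sol_deriv beta_neq0 beta1 nm1 na aE sz sw sU z4 U4 d4 nzk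
  (le_trans nw e1k) nUk dk sol.
set h := (fun x => _) in Uh sh nh imv.
have kk (t : R) : t <= 2 + 300 * (2 + n2S) + 8 / al -> t * (k1 * e) <= k2 * e.
  by move=> ht; rewrite mulrA ler_wpM2r //; apply: le_trans k2k; rewrite ler_wpM2r // ltW.
have al8 : 0 <= 8 / al by rewrite divr_ge0 ?ler0n // ltW.
have kk1 : (1 + 300 * (2 + n2S)) * (k1 * e) <= k2 * e.
  exact: kk (low_incr _ al8).
have kk2 : (1 + 8 / al) * (k1 * e) <= k2 * e.
  exact: kk (low_ratio _ nS).
have k1k2 : k1 * e <= k2 * e by rewrite ler_wpM2r.
have hW : aeq h (fun x => wderiv (K \+ u0) x - kink_x beta 0 0 x).
  have P := cprimitiveD KK0 Uh.
  have E : (fun x => kink beta 0 0 x + U x) = K \+ u0 by apply/funext => x; rewrite Phi2.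
  rewrite E in P; have := wderiv_aeq (cprimitive_has_wderiv P).
  by apply: ae_imply => x ->; ring.
have mW : cmeasurable (fun x => wderiv (K \+ u0) x - kink_x beta 0 0 x).
  apply: cmeasurableB; last exact: cprimitive_measurable_deriv KK0.
  have P := cprimitiveD KK0 Uh.
  have E : (fun x => kink beta 0 0 x + U x) = K \+ u0 by apply/funext => x; rewrite Phi2.
  rewrite E in P; exact: has_wderiv_measurable (has_wderiv_wderiv (cprimitive_has_wderiv P)).
have [srt nrt] := csq_ae mW hW sh; rewrite -nrt in nh.
have [si ni] := bk_incr_csq beta_neq0 beta1 (@nc1 R) na aE sU sz U4 z4 d4 nUk nzk dk.
have [sr2 nr2] := csqD sdphi si.
have nr2k : cn2 r2 <= k2 * e.
  apply: le_trans kk1; apply: (le_trans nr2); rewrite mulrDl mul1r.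
  by apply: lerD ni; exact: le_trans n2_ e1k.
have yb x : nc (toC y x) <= nc (toC z x) + 8 / al * nc (U x).
  rewrite /toC !nc_real /y; apply: (le_trans (ler_normB _ _)); rewrite lerD2l.
  apply: (le_trans (superposition_bound _ _)).
  by apply: ler_pM => //; exact: nc_Im.
have my : cmeasurable (toC y) := cprimitive_measurable sol2.
have ysup x : nc (toC y x) <= k2 * e.
  apply: (le_trans (yb x)); apply: le_trans kk2; rewrite [leRHS]mulrDl [X in _ <= X + _]mul1r.
  exact: lerD (zk x) (ler_wpM2l al8 (Uk x)).
have [sf1 nf1] := sqZ (8 / al) sU.2; have [sf2 nf2] := sqD sz.2 sf1.
have [sy ny] : csq (toC y) /\ cn2 (toC y) <= k2 * e.
  apply: (csq_bound my sf2 _ yb); apply: (le_trans nf2); rewrite nf1 (ger0_norm al8).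
  apply: le_trans kk2; rewrite [leRHS]mulrDl [X in _ <= X + _]mul1r.
  exact: lerD nzk (ler_wpM2l al8 nUk).
have dck : nc (d^*)%C <= k2 * e by rewrite nc_conj; exact: le_trans k1k2.
(* The unknown field of the second step is a perturbation of zero, whose shifted
   profile is also zero. *)
have [s00 n00] : csq (fun x : R => (0 : R[i]) - 0) /\ cn2 (fun x : R => (0 : R[i]) - 0) <= k2 * e.
  have [s n] := @wsech_csq (fun x : R => (0 : R[i]) - 0) 0
    (cmeasurableB (@cmeasurable_cst R 0) (@cmeasurable_cst R 0)) (lexx _)
    (fun x => ltac:(by rewrite subr0 nc0 mul0r)).
  by split; [exact: s|apply: (le_trans n); rewrite mul0r].
have z00 (x : R) : nc ((0 : R[i]) - 0) <= k2 * e by rewrite subr0 nc0.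
have := H2 _ _ _ _ _ (fun=> 0) _ (fun=> 0) _ _ _ (toC y) (d^*)%C (k2 * e) ke2 k2e base2
  cprimitive0 cprimitive0.
move=> /(_ (And3 sU (le_trans nUk k1k2) (fun x => le_trans (Uk x) k1k2))).
move=> /(_ (And4 sr2 nr2k srt (le_trans nh kk1)) (And3 s00 n00 z00) (conj s00 n00) (conj s00 n00)).
move=> /(_ (And4 sol2 sy ny ysup) dck) /= -[_ second_].
exists u0, s0, d, (fun x => toC y x - (0 - 0)),
  (fun x => wderiv (K \+ u0) x - kink_x beta 0 0 x - (0 - 0) +
     bk_incr beta (- 1) b0 (toC y) U (d^*)%C x), (d^*)%C => rad rade Crad.
have CCe : CC * (k1 * e) <= CC * k2 * e by rewrite -mulrA ler_pM2l.
split.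
- have [f1 f2 f3 f4 f5] := first_ rad (le_trans rade eps1) (le_lt_trans CCe Crad).
  by split => //; exact: le_trans CCe.
- have := second_ rad (le_trans rade eps2).
  rewrite mulrA => /(_ Crad).
  have -> // : (fun (u' s' : R -> R[i]) d' => backlund_zero (K \+ u0) (Kt \+ s0)
     ((fun=> 0) \+ u') ((fun=> 0) \+ s') (b0 + d')) =
    (fun u' s' d' => backlund_zero (K \+ u0) (Kt \+ s0) u' s' (b0 + d')).
  apply/funext => u'; apply/funext => s'; apply/funext => d'.
  have zeroD (f : R -> R[i]) : (fun=> 0) \+ f = f by apply/funext => x; exact: add0r.
  by rewrite !zeroD.
- by apply: (@ae_all R (fun x => Im (toC y x - (0 - 0)) = 0)) => x; rewrite !subr0.
- by apply: ae_imply2 imv hW => x + <-; rewrite !subr0.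
Qed.

End Assembly.

(** * The theorem *)

Section Admissibility.
Context {R : realType} (beta : R) (beta_bounds : -1 < beta < 1).

Lemma small_kink_admissible (s : R) : `|s| < 1 -> kink_admissible beta s.
Proof.
move=> s1 k E; have a0 := alpha_gt0 beta_bounds.
have H : `|alpha beta * s| < 1.
  rewrite normrM (gtr0_norm a0); apply: le_lt_trans s1.
  by rewrite ler_piMl // alpha_le1.
have E2 : alpha beta * s = pi * (1 / 2 + k%:~R) by rewrite E; field; rewrite gt_eqF.
have k2 : 2^-1 <= `|1 / 2 + k%:~R| :> R.
  have [k0|k0] := leP 0 k.
    have : (0 : R) <= k%:~R by rewrite ler0z.
    by move=> h; rewrite ger0_norm; lra.
  have : (k%:~R : R) <= (-1)%:~R by rewrite ler_int -ltzD1 addNr.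
  rewrite mulrN1z.
  by move=> h; rewrite ler0_norm; lra.
have := pi_ge2 R; rewrite E2 normrM (gtr0_norm (pi_gt0 R)) in H.
by move=> p2; have := ler_pM (ler0n R 2) _ p2 k2; rewrite divff ?pnatr_eq0 //; lra.
Qed.

End Admissibility.

Theorem theorem1p3 (R : realType) (beta : R)
    (beta_bounds : -1 < beta < 1) (beta_neq0 : beta != 0) :
  exists eta0 C rho r : R, [/\ 0 < eta0, 0 < C, 0 < rho, 0 < r &
  forall eta : R, 0 < eta -> eta < eta0 ->
  forall phi0 phi1 : R -> R,
    inH1L2 (toC (rem0 beta phi0 0 0)) (toC (rem1 beta phi1 0 0)) ->
    H1L2norm (toC (rem0 beta phi0 0 0)) (toC (rem1 beta phi1 0 0)) < eta ->
  exists x1 x2 : R,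
    [/\ modulation_shift beta phi0 phi1 rho x1 x2,
        (forall x1' x2' : R, modulation_shift beta phi0 phi1 rho x1' x2' ->
           x1' = x1 /\ x2' = x2),
        `|x1| <= C * eta /\ `|x2| <= C * eta,
        kink_admissible beta x1 &
        let B := toC (breather beta x1 x2) in
        let Bt := toC (breather_t beta x1 x2) in
        let K := kink beta x1 x2 in
        let Kt := kink_t beta x1 x2 in
        let z0 := toC (rem0 beta phi0 x1 x2) in
        let w0 := toC (rem1 beta phi1 x1 x2) in
        exists (u0 s0 : R -> R[i]) (delta : R[i])
               (y0 v0 : R -> R[i]) (deltat : R[i]),
          [/\ small_unique_solution (fun u s d =>
                backlund_zero (B \+ z0) (Bt \+ w0) (K \+ u) (Kt \+ s)
                  (beta +i* alpha beta + d))
                (C * eta) r u0 s0 delta,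
              small_unique_solution (fun y v d =>
                backlund_zero (K \+ u0) (Kt \+ s0) y v
                  (beta -i* alpha beta + d))
                (C * eta) r y0 v0 deltat,
              {ae @lebesgue_measure R, forall x, Im (y0 x) = 0} &
              {ae @lebesgue_measure R, forall x, Im (v0 x) = 0}]]].
Proof.
have [em [Cm [rho [em0 Cm0 rho0 [rho1 Hmod]]]]] := modulation beta_bounds beta_neq0.
have [eps [C [eps0 C0 Hsteps]]] := two_steps beta_bounds beta_neq0.
pose k := 1 + Cm; have k0 : 0 < k by rewrite addr_gt0.
have Ck : Cm <= k by rewrite lerDr.
have k1 : 1 <= k by rewrite lerDl ltW.
pose m := Num.min em (Num.min 1 eps).
have m0 : 0 < m by rewrite !lt_min em0 ltr01 eps0.
have me : m <= em by rewrite ge_min lexx.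
have m1 : m <= 1 by rewrite !ge_min lexx orbT.
have meps : m <= eps by rewrite !ge_min lexx !orbT.
have Ck0 := mulr_gt0 C0 k0.
(* [D eta < m] implies every smallness condition; [k eta] bounds the distance of
   the data to the breather as well as the shifts. *)
pose D := 1 + k + C * k / eps; have D0 : 0 < D by rewrite /D !addr_gt0 // divr_gt0.
have q0 : 0 <= C * k / eps by rewrite divr_ge0 // ltW.
have D1 : 1 <= D by rewrite /D -addrA lerDl addr_ge0 // ltW.
have Dk : k <= D by rewrite /D addrAC lerDr addr_ge0.
have DC : C * k / eps <= D by rewrite /D lerDr addr_ge0 // ltW.
exists (m / D), (k + C * k), rho, eps; split => //; first exact: divr_gt0.
  exact: addr_gt0.
move=> eta eta0; rewrite ltr_pdivlMr // => etaD phi0 phi1 [hz hw] heta.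
have R0 : rem0 beta phi0 0 0 = phi0.
  by apply/funext => x; rewrite /rem0 breather0 subr0.
have R1 : rem1 beta phi1 0 0 = fun x => phi1 x - 4 * beta * wsech beta x.
  by apply/funext => x; rewrite /rem1 breather_t0.
have [sz _ nz _ _] := inH1_csq hz; have sw := (inL2_csq _).1 hw; have nw := L2normE sw.
have [h1 h2 h3] := H1L2norm_ge (toC (rem0 beta phi0 0 0)) (toC (rem1 beta phi1 0 0)).
have g1 := le_trans h1 (ltW heta); have g2 := le_trans h2 (ltW heta).
have g3 := le_trans h3 (ltW heta).
have ee := ltW eta0.
have De (t : R) : t <= D -> t * eta <= m.
  by move=> tD; apply: le_trans (ltW etaD); rewrite mulrC ler_wpM2l.
have e1 : eta <= m by rewrite -[eta]mul1r; exact: De.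
have e2 : k * eta <= m by exact: De.
have e3 : C * (k * eta) < eps.
  have E : C * (k * eta) = eps * (C * k / eps * eta) by field; rewrite gt_eqF.
  rewrite E -[ltRHS]mulr1 ltr_pM2l //; apply: lt_le_trans m1; apply: le_lt_trans etaD.
  by rewrite mulrC ler_wpM2l.
have [x1 [x2 [shift b1 b2 uniq]]] := Hmod phi0 phi1 eta ee (le_trans e1 me)
  ((csq_real _).1 sz) ((csq_real _).1 sw)
  ltac:(by rewrite -cn2_real -nz) ltac:(by rewrite -cn2_real -nw).
have [s1 s2 _ _] := shift.
have ke0 : 0 <= k * eta by rewrite mulr_ge0 // ltW.
have ek : eta <= k * eta by rewrite ler_peMl.
have Cke : Cm * eta <= k * eta by rewrite ler_wpM2r.
have box : in_box x1 x2.
  by split; [exact: le_trans (ltW s1) rho1|exact: le_trans (ltW s2) rho1].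
have total : k * eta <= (k + C * k) * eta.
  by rewrite ler_wpM2r // lerDl mulr_ge0 // ltW.
have totalC : C * (k * eta) <= (k + C * k) * eta by rewrite mulrA ler_wpM2r // lerDr ltW.
exists x1, x2; split => //.
- by split; [exact: le_trans (le_trans b1 Cke) total|exact: le_trans (le_trans b2 Cke) total].
- exact: small_kink_admissible beta_bounds _ (lt_le_trans s1 rho1).
cbv zeta; rewrite R0 in hz g1 g2 nz; rewrite R1 in sw nw g3.
have [u0 [s0 [d [y0 [v0 [dt H]]]]]] := Hsteps phi0 phi1 x1 x2 (k * eta) ke0 (le_trans e2 meps)
  box (le_trans b1 Cke) (le_trans b2 Cke) hz (le_trans g1 ek) (le_trans g2 ek) sw
  ltac:(by rewrite -nw; exact: le_trans g3 ek).
have [[f1 f2 f3 f4 f5] [f1' f2' f3' f4' f5'] r1 r2] := H eps (lexx _) e3.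
have EB : toC (breather beta x1 x2) \+ toC (rem0 beta phi0 x1 x2) = toC phi0.
  apply/funext => x; rewrite /= /toC /rem0; apply: complex_ext => /=; ring.
have EBt : toC (breather_t beta x1 x2) \+ toC (rem1 beta phi1 x1 x2) = toC phi1.
  apply/funext => x; rewrite /= /toC /rem1; apply: complex_ext => /=; ring.
exists u0, s0, d, y0, v0, dt; rewrite EB EBt.
by split => //; split => //; [exact: le_trans totalC|exact: le_trans totalC].
Qed.
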